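(* There are absolute positive constants $c_0,c_1,c_2,c_3$ such that the following holds in the Gaussian linear model. Assume that there exists $k\in\{1,\dots,p\}$ such that $N\le\kappa_{DM}\,d_*(\Sigma_{k+1:p}^{-1/2}B_2^p)$ and $R_N(\Sigma_{1:k}^{1/2}B_2^p)\le\ell_*(\Sigma_{k+1:p}^{1/2}B_2^p)\sqrt{\kappa_{DM}/N}$. Then for every such $k$: with probability at least $$1-c_0\exp\Big(-c_1\Big(|J_1|+N\frac{\sum_{j\in J_2}\sigma_j}{\mathrm{Tr}(\Sigma_{k+1:p})}\Big)\Big),$$ $$\|\Sigma^{1/2}(\hat\beta-\beta^* )\|_2\le\square+\sigma_\xi\frac{c_2\sqrt{N\,\mathrm{Tr}(\Sigma_{k+1:p}^2)}}{\mathrm{Tr}(\Sigma_{k+1:p})}+c_3\|\Sigma_{k+1:p}^{1/2}\beta^*_{k+1:p}\|_2$$ in each of the following two cases: i) if $\sigma_1N<\kappa_{DM}\ell_*^2(\Sigma_{k+1:p}^{1/2}B_2^p)$ and $\mathrm{Tr}(\Sigma_{1:k})\le N\sigma_1$, with $$\square=c_3\max\Big\{\sigma_\xi\sqrt{\frac{\mathrm{Tr}(\Sigma_{1:k})}{\mathrm{Tr}(\Sigma_{k+1:p})}},\ \sqrt{\frac{N\sigma_1}{\mathrm{Tr}(\Sigma_{k+1:p})}}\,\|\Sigma_{k+1:p}^{1/2}\beta^*_{k+1:p}\|_2,\ \|\beta^*_{1:k}\|_2\sqrt{\frac{\mathrm{Tr}(\Sigma_{k+1:p})}{N}}\Big\};$$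 ii) if $\sigma_1N\ge\kappa_{DM}\ell_*^2(\Sigma_{k+1:p}^{1/2}B_2^p)$ and $\sum_{j\in J_2}\sigma_j\le\kappa_{DM}\ell_*^2(\Sigma_{k+1:p}^{1/2}B_2^p)\big(1-|J_1|/N\big)$, with $$\square=c_3\max\Big\{\sigma_\xi\sqrt{\frac{|J_1|}{N}},\ \sigma_\xi\sqrt{\frac{\sum_{j\in J_2}\sigma_j}{\mathrm{Tr}(\Sigma_{k+1:p})}},\ \|\Sigma_{k+1:p}^{1/2}\beta^*_{k+1:p}\|_2,\ \|\Sigma_{1,thres}^{-1/2}\beta^*_{1:k}\|_2\frac{\mathrm{Tr}(\Sigma_{k+1:p})}{N}\Big\}.$$
   Context: Gaussian linear model: $N\in\mathbb N$, $p\in\mathbb N\cup\{\infty\}$ (for $p=\infty$ read $\mathbb R^p$ as $\ell_2$ and $\Sigma$ as trace class); $\Sigma$ is a $p\times p$ covariance matrix with eigenvalues $\sigma_1\ge\cdots\ge\sigma_p>0$ and orthonormal eigenvectors $u_1,\dots,u_p$. $y=\mathbb X\beta^*+\xi$, where the rows of the $N\times p$ matrix $\mathbb X$ are i.i.d. $\mathcal N(0,\Sigma)$, $\xi\sim\mathcal N(0,\sigma_\xi^2I_N)$ is independent of $\mathbb X$, and $\beta^*\in\mathbb R^p$. $\hat\beta\in\mathrm{argmin}\{\|\beta\|_2:\mathbb X\beta=y\}$. $\Sigma_{1:k}=\sum_{j\le k}\sigma_ju_ju_j^\top$, $\Sigma_{k+1:p}=\sum_{j>k}\sigma_ju_ju_j^\top$;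 $v_{1:k},v_{k+1:p}$ are the orthogonal projections of $v$ onto $\mathrm{span}(u_j:j\le k)$ and $\mathrm{span}(u_j:j>k)$. $B_2^p$ is the Euclidean unit ball. For a set $T\subset\mathbb R^p$, $\ell^*(T)=\ell_*(T)=\mathbb E\sup_{x\in T}\langle x,g\rangle$, $g$ standard Gaussian; thus $\ell_*(\Sigma_{k+1:p}^{1/2}B_2^p)=\mathbb E\|\Sigma_{k+1:p}^{1/2}g\|_2$. $d_*(\Sigma_{k+1:p}^{-1/2}B_2^p)=\ell_*^2(\Sigma_{k+1:p}^{1/2}B_2^p)/\sigma_{k+1}$. For a positive semi-definite $\Gamma$, $R_N(\Gamma^{1/2}B_2^p)=\inf\{R>0:\ell^*((\Gamma^{1/2}B_2^p)\cap(RB_2^p))\le\kappa_{RIP}R\sqrt N\}$, where $\kappa_{RIP}\in(0,1)$ is an absolute constant such that, for some absolute $c>0$, for every positive semi-definite $\Gamma$ and $N\times p$ standard Gaussian matrix $G$, with probability at least $1-\exp(-cN)$, $\frac12\|\Gamma^{1/2}v\|_2^2\le\frac1N\|G\Gamma^{1/2}v\|_2^2\le\frac32\|\Gamma^{1/2}v\|_2^2$ for all $v$ with $R_N(\Gamma^{1/2}B_2^p)\|v\|_2\le\|\Gamma^{1/2}v\|_2$. $J_1=\{j\in\{1,\dots,k\}:\sigma_j\ge\kappa_{DM}\ell_*^2(\Sigma_{k+1:p}^{1/2}B_2^p)/N\}$, $J_2=\{1,\dots,k\}\setminus J_1$, and $\Sigma_{1,thres}^{-1/2}=\sum_{j\le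 k}\big(\sigma_j\vee\frac{\kappa_{DM}\ell_*^2(\Sigma_{k+1:p}^{1/2}B_2^p)}{N}\big)^{-1/2}u_ju_j^\top$. $\kappa_{DM}\in(0,1]$ is an absolute constant for which the Gaussian Dvoretzky–Milman theorem holds: there is an absolute $c>0$ such that, for every norm $|||\cdot|||$ with unit ball $B$ and dual unit ball $B^*$, with $d_*(B)=(\ell^*(B^* )/\sup_{x\in B^*}\|x\|_2)^2$, if $N\le\kappa_{DM}d_*(B)$ then with probability at least $1-\exp(-c\,d_*(B))$, for all $\lambda\in\mathbb R^N$, $\frac1{\sqrt2}\|\lambda\|_2\ell^*(B^* )\le|||G^\top\lambda|||\le\sqrt{3/2}\|\lambda\|_2\ell^*(B^* )$. *)

(* Defs.v *)
From HB Require Import structures.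
From mathcomp Require Import all_boot all_order all_algebra.
From mathcomp Require Import finmap.
From mathcomp Require Import all_classical all_reals all_analysis.
Set Implicit Arguments.
Unset Strict Implicit.
Unset Printing Implicit Defensive.
Import Order.TTheory GRing.Theory Num.Theory.
Import numFieldNormedType.Exports.
Local Open Scope classical_set_scope.
Local Open Scope ring_scope.

(* Coordinates, eigenvalues and eigenvectors are indexed from 0, so the
   mathematical index j in {1, ..., p} is the natural number j - 1. *)
Inductive xdim := Fin of nat | Infty.

Definition in_dim (p : xdim) (j : nat) : bool :=
  if p is Fin n then (j < n)%N else true.

(* R^p is the set of square-summable sequences vanishing outside the first p
   coordinates: R^n when p = Fin n, l_2 when p = Infty. *)
Definition Rp {R : realType} (p : xdim) : set R^nat :=
  [set x : R^nat | (forall j, ~~ in_dim p j -> x j = 0) /\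
           cvgn (series (fun j => x j ^+ 2))].

Definition dot {R : realType} (x y : R^nat) : R :=
  limn (series (fun j => x j * y j)).

Definition norm2 {R : realType} (x : R^nat) : R := Num.sqrt (dot x x).

Definition ball2 {R : realType} (p : xdim) (r : R) : set R^nat :=
  [set x : R^nat | Rp p x /\ norm2 x <= r].

Definition basis_vec {R : realType} (i : nat) : R^nat := fun j => (j == i)%:R.

Definition diag_entry {R : realType} (p : xdim) (A : R^nat -> R^nat) : R^nat :=
  fun i => if in_dim p i then A (basis_vec i) i else 0.

Definition tr {R : realType} (p : xdim) (A : R^nat -> R^nat) : R :=
  limn (series (diag_entry p A)).

(* Only the values of an operator on R^p are meaningful.  Boundedness for
   p = Infty follows from symmetry (Hellinger-Toeplitz). *)
Definition psd_op {R : realType} (p : xdim) (A : R^nat -> R^nat) : Prop :=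
  [/\ forall x, Rp p x -> Rp p (A x),
      forall a x y, Rp p x -> Rp p y ->
        A ((a \*o x) \+ y) = (a \*o A x) \+ A y,
      forall x y, Rp p x -> Rp p y -> dot (A x) y = dot x (A y) &
      forall x, Rp p x -> 0 <= dot x (A x)].

(* For p = Fin n the trace condition holds automatically. *)
Definition covariance_op {R : realType} (p : xdim) (A : R^nat -> R^nat) : Prop :=
  psd_op p A /\ cvgn (series (diag_entry p A)).

Definition is_sqrt_op {R : realType} (p : xdim) (A S : R^nat -> R^nat) : Prop :=
  psd_op p S /\ forall x, Rp p x -> S (S x) = A x.

(* sigma 0 >= sigma 1 >= ... > 0 are all the eigenvalues of Sigma, and u is an
   orthonormal basis of R^p of eigenvectors.  Both are 0 outside the range, so
   the "eigenvalue of index p + 1" is 0. *)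
Record eigen_system {R : realType} (p : xdim) (Sigma : R^nat -> R^nat)
    (sigma : R^nat) (u : nat -> R^nat) : Prop := {
  eigen_val_out : forall j, ~~ in_dim p j -> sigma j = 0;
  eigen_vec_out : forall j, ~~ in_dim p j -> u j = cst 0;
  eigen_val_gt0 : forall j, in_dim p j -> 0 < sigma j;
  eigen_val_noninc : forall i j, (i <= j)%N -> in_dim p j ->
    sigma j <= sigma i;
  eigen_vec_in : forall j, in_dim p j -> Rp p (u j);
  eigen_orthonormal : forall i j, in_dim p i -> in_dim p j ->
    dot (u i) (u j) = (i == j)%:R;
  eigen_complete : forall x, Rp p x ->
    (forall j, in_dim p j -> dot (u j) x = 0) -> x = cst 0;
  eigen_eq : forall j, in_dim p j -> Sigma (u j) = sigma j \*o u j }.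

(* sum_j a_j u_j u_j^T *)
Definition spec_op {R : realType} (u : nat -> R^nat) (a : R^nat)
    (v : R^nat) : R^nat :=
  fun i => limn (series (fun j => a j * dot (u j) v * u j i)).

(* Restriction to the indices 1..k, resp. k+1..p, of the 1-based numbering. *)
Definition low_part {R : realType} (k : nat) (a : R^nat) : R^nat :=
  fun j => if (j < k)%N then a j else 0.

Definition high_part {R : realType} (k : nat) (a : R^nat) : R^nat :=
  fun j => if (k <= j)%N then a j else 0.

Definition sqrt_seq {R : realType} (a : R^nat) : R^nat :=
  fun j => Num.sqrt (a j).

(* For events that are not known to be measurable, the probability is the inner
   one. *)
Definition with_prob_ge {R : realType} (d : measure_display)
    (T : measurableType d) (P : probability T R) (q : R) (E : set T) : Prop :=
  exists A : set T, [/\ measurable A, A `<=` E & (q%:E <= P A)%E].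

Definition sigma_of {R : realType} (T I : Type) (Y : I -> T -> R) :
    set (set T) :=
  <<s [set A | exists i, exists2 B : set R, measurable B & A = Y i @^-1` B] >>.

Definition mutual_indep {R : realType} (d : measure_display)
    (T : measurableType d) (P : probability T R) (I : choiceType) (D : set I)
    (F : I -> set (set T)) : Prop :=
  forall (J : {fset I}) (A : I -> set T),
    (forall i, i \in J -> D i /\ F i (A i)) ->
    P (\bigcap_(i in [set` J]) A i) = (\prod_(i <- J) fine (P (A i)))%:E.

Definition indep_systems {R : realType} (d : measure_display)
    (T : measurableType d) (P : probability T R) (F G : set (set T)) : Prop :=
  forall A B, F A -> G B -> P (A `&` B) = (P A * P B)%E.

(* N(0, s^2); the library's [normal_prob] is not the Dirac mass when s = 0. *)
Definition normal_law {R : realType} (s : R) : set R -> \bar R :=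
  if s == 0 then dirac (0 : R) else normal_prob 0 s.

Definition has_law {R : realType} (d : measure_display) (T : measurableType d)
    (P : probability T R) (Y : T -> R) (mu : set R -> \bar R) : Prop :=
  forall B : set R, measurable B -> P (Y @^-1` B) = mu B.

(* A random vector of R^p with law N(0, A): <v, Y> ~ N(0, <v, A v>) for all v. *)
Definition gaussian_vec {R : realType} (d : measure_display)
    (T : measurableType d) (P : probability T R) (p : xdim) (Y : T -> R^nat)
    (A : R^nat -> R^nat) : Prop :=
  [/\ forall w, Rp p (Y w),
      forall j, measurable_fun setT (fun w => Y w j) &
      forall v, Rp p v ->
        has_law P (fun w => dot v (Y w)) (normal_law (Num.sqrt (dot v (A v))))].

Definition std_gaussian_family {R : realType} (d : measure_display)
    (T : measurableType d) (P : probability T R) (I : choiceType) (D : set I)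
    (Z : I -> T -> R) : Prop :=
  [/\ forall i, measurable_fun setT (Z i),
      forall i, ~ D i -> Z i = cst 0,
      forall i, D i -> has_law P (Z i) (normal_law 1) &
      mutual_indep P D (fun i => sigma_of (fun _ : unit => Z i))].

(* When p = Infty, g is almost surely not in l_2. *)
Definition std_gaussian_vec {R : realType} (d : measure_display)
    (T : measurableType d) (P : probability T R) (p : xdim) (g : T -> R^nat) :=
  std_gaussian_family P [set j | in_dim p j] (fun j w => g w j).

Definition std_gaussian_mx {R : realType} (d : measure_display)
    (T : measurableType d) (P : probability T R) (N : nat) (p : xdim)
    (G : 'I_N -> T -> R^nat) :=
  std_gaussian_family P [set ij : 'I_N * nat | in_dim p ij.2]
    (fun ij w => G ij.1 w ij.2).

(* The sets S below contain 0, so the integrand is nonnegative.  For p = Infty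
   they lie in the image of the unit ball under a Hilbert-Schmidt operator, so
   almost surely [dot x (g w)] converges for all x in S simultaneously.
   The width depends only on the law of g, hence not on the choice of a standard
   Gaussian vector g of R^p on (T, P). *)
Definition ell_star {R : realType} (d : measure_display)
    (T : measurableType d) (P : probability T R) (g : T -> R^nat)
    (S : set R^nat) : \bar R :=
  (\int[P]_w ereal_sup [set (dot x (g w))%:E | x in S])%E.

Definition R_N {R : realType} (d : measure_display) (T : measurableType d)
    (P : probability T R) (g : T -> R^nat) (kappa : R) (N : nat) (p : xdim)
    (S : set R^nat) : R :=
  inf [set r | 0 < r /\
    (ell_star P g (S `&` ball2 p r) <= (kappa * r * Num.sqrt N%:R)%:E)%E].

Definition RIP_constant {R : realType} (kappa : R) : Prop :=
  (0 < kappa < 1) /\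
  exists2 c : R, 0 < c &
  forall (N : nat) (p : xdim) (Gamma S : R^nat -> R^nat)
    (d0 : measure_display) (T0 : measurableType d0) (P0 : probability T0 R)
    (g : T0 -> R^nat)
    (d : measure_display) (T : measurableType d) (P : probability T R)
    (G : 'I_N -> T -> R^nat),
  (0 < N)%N -> covariance_op p Gamma -> is_sqrt_op p Gamma S ->
  std_gaussian_vec P0 p g -> std_gaussian_mx P p G ->
  with_prob_ge P (1 - expR (- (c * N%:R)))
    [set w | forall v, Rp p v ->
      R_N P0 g kappa N p (S @` ball2 p 1) * norm2 v <= norm2 (S v) ->
      let q := N%:R^-1 * \sum_(i < N) dot (G i w) (S v) ^+ 2 in
      2^-1 * norm2 (S v) ^+ 2 <= q <= 3 / 2 * norm2 (S v) ^+ 2].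

Definition is_norm {R : realType} (p : xdim) (nrm : R^nat -> R) : Prop :=
  [/\ forall x y, Rp p x -> Rp p y -> nrm (x \+ y) <= nrm x + nrm y,
      forall a x, Rp p x -> nrm (a \*o x) = `|a| * nrm x &
      forall x, Rp p x -> nrm x = 0 -> x = cst 0].

Definition dual_ball {R : realType} (p : xdim) (nrm : R^nat -> R) : set R^nat :=
  [set y : R^nat | Rp p y /\ forall x, Rp p x -> nrm x <= 1 -> dot x y <= 1].

(* G^T lambda *)
Definition mx_tr_apply {R : realType} (N : nat) (G : 'I_N -> R^nat)
    (lambda : R^nat) : R^nat :=
  fun j => \sum_(i < N) lambda i * G i j.

(* The Dvoretzky-Milman theorem is a finite-dimensional statement: for
   p = Infty, G^T lambda is not in l_2, where the norm is defined. *)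
Definition DM_constant {R : realType} (kappa : R) : Prop :=
  (0 < kappa <= 1) /\
  exists2 c : R, 0 < c &
  forall (N n : nat) (nrm : R^nat -> R)
    (d0 : measure_display) (T0 : measurableType d0) (P0 : probability T0 R)
    (g : T0 -> R^nat)
    (d : measure_display) (T : measurableType d) (P : probability T R)
    (G : 'I_N -> T -> R^nat),
  (0 < N)%N -> is_norm (Fin n) nrm ->
  std_gaussian_vec P0 (Fin n) g -> std_gaussian_mx P (Fin n) G ->
  let ell := fine (ell_star P0 g (dual_ball (Fin n) nrm)) in
  let dstar := (ell / sup [set norm2 x | x in dual_ball (Fin n) nrm]) ^+ 2 in
  N%:R <= kappa * dstar ->
  with_prob_ge P (1 - expR (- (c * dstar)))
    [set w | forall lambda, Rp (Fin N) lambda ->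
      (Num.sqrt 2)^-1 * norm2 lambda * ell
        <= nrm (mx_tr_apply (fun i => G i w) lambda)
        <= Num.sqrt (3 / 2) * norm2 lambda * ell].

Definition response {R : realType} (N : nat) (X : 'I_N -> R^nat)
    (beta xi : R^nat) : 'I_N -> R :=
  fun i => dot (X i) beta + xi i.

Definition min_norm_interpolant {R : realType} (N : nat) (p : xdim)
    (X : 'I_N -> R^nat) (y : 'I_N -> R) (b : R^nat) : Prop :=
  [/\ Rp p b, forall i, dot (X i) b = y i &
      forall b', Rp p b' -> (forall i, dot (X i) b' = y i) ->
        norm2 b <= norm2 b'].

(* X i w is the i-th row of the design matrix.  The interpolant exists only
   almost surely, since the design may have rank less than N on a null set. *)
Record gaussian_linear_model {R : realType} (N : nat) (p : xdim)
    (Sigma : R^nat -> R^nat) (sigma : R^nat) (u : nat -> R^nat)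
    (beta : R^nat) (sigma_xi : R)
    (d : measure_display) (T : measurableType d) (P : probability T R)
    (X : 'I_N -> T -> R^nat) (xi betahat : T -> R^nat) : Prop := {
  model_cov : covariance_op p Sigma;
  model_eigen : eigen_system p Sigma sigma u;
  model_beta : Rp p beta;
  model_noise_level : 0 <= sigma_xi;
  model_rows : forall i, gaussian_vec P p (X i) Sigma;
  model_rows_indep :
    mutual_indep P setT (fun i : 'I_N => sigma_of (fun j w => X i w j));
  model_noise : gaussian_vec P (Fin N) xi (fun v => (sigma_xi ^+ 2) \*o v);
  model_noise_indep :
    indep_systems P (sigma_of (fun (ij : 'I_N * nat) w => X ij.1 w ij.2))
                    (sigma_of (fun j w => xi w j));
  model_estimator : {ae P, forall w,
    min_norm_interpolant p (fun i => X i w)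
      (response (fun i => X i w) beta (xi w)) (betahat w)} }.

(* Main.v *)
(* In the basis (u_j) the design has entries sqrt(sigma_j) Z_ij with Z standard Gaussian.  Write
   A = X_t X_t^T for the Gram matrix of the tail of the design (coordinates j > k), Delta for
   betahat - beta on the first k coordinates, ell^2 for ell_*^2(Sigma_t^(1/2) B_2), and
   D_j = max(sigma_j, thres) with thres = kappa_DM ell^2 / N.
   The minimum norm interpolant is betahat = X^T lambda, hence
     A lambda = X_t beta_t + xi - X_h Delta   and   <lambda, X_h Delta> = <beta_h, Delta> + |Delta|^2,
   so that, with z = X_h Delta,
     <A^-1 z, z> + |Delta|^2 = <A^-1 (X_t beta_t + xi), z> - <beta_h, Delta>.
   Dvoretzky-Milman gives A ~ ell^2 Id and the restricted isometry gives
   |D^(1/2) Delta|^2 <= (2/N) |z|^2 + 2 thres |Delta|^2, so the left-hand side dominates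
   (N / ell^2) |D^(1/2) Delta|^2 up to constants, while the right-hand side is at most
   |D^(1/2) Delta| |D^(-1/2) (X_h^T A^-1 (X_t beta_t + xi) - beta_h)|.  This bounds Delta, and then
   the tail of betahat - beta through lambda.
   The rate comes from the noise terms, which are Gaussian quadratic forms: if 0 <= B <= 1/2 is
   independent of the standard Gaussian vector z, then <B z, z> / 2 <= 2 Tr B + t outside an event of
   probability exp(-t).  It is used with t = |J_1| + N sum_{J_2} sigma / Tr(Sigma_t) <= N. *)
Require Import Defs.
From HB Require Import structures.
From mathcomp Require Import all_boot all_order all_algebra.
From mathcomp Require Import finmap.
From mathcomp Require Import all_classical all_reals all_analysis.
From mathcomp Require Import measurable_realfun normal_distribution ring lra.
Set Implicit Arguments.
Unset Strict Implicit.
Unset Printing Implicit Defensive.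
Import Order.TTheory GRing.Theory Num.Theory.
Import numFieldNormedType.Exports.
Local Open Scope classical_set_scope.
Local Open Scope ring_scope.
Import HBNNSimple.

(** What shapes the proof is the case where [p] is infinite. The vector g is not in l_2 and
    Dvoretzky-Milman is a finite-dimensional statement, so joint laws in the eigenbasis are
    identified by characteristic functions, the tail is read through windows of finitely many
    coordinates, and a bound that holds on each window with the same probability is passed to the
    limit through the limsup of the window events. The hypotheses speak of ell^2 and the conclusion
    of Tr(Sigma_t). Both are comparable, E|Z| sqrt(Tr) <= ell <= sqrt(Tr), and (E|Z|)^(-2) enters
    all constants. Dvoretzky-Milman is used twice: for the tail, and for the norm of D^(-1/2) X_h^T,
    whose weights sigma_j / D_j are completed by tail weights up to the required dimension. The two
    cases of the theorem differ only in the way these weights are written as rho * gam with gam <= 1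
    and sum gam <= N: rho = sigma_1 / thres in the first case, rho = 1 in the second. The quadratic
    forms in the noise have random coefficients, which depend on the tail of the design. The chaos
    bound is therefore proved conditionally on a history. *)

Ltac mfun1 := first [ by [] | exact: measurable_cst | exact: measurable_id
  | exact: measurable_funX | exact: measurable_indic
  | apply: measurable_funD | apply: measurable_funB | apply: measurable_funM
  | apply: measurable_funN | apply: measurable_funX
  | apply: (measurableT_comp (@measurable_expR _))
  | apply: (measurableT_comp (continuous_measurable_fun (@continuous_cos _)))
  | apply: (measurableT_comp (continuous_measurable_fun (@continuous_sin _)))
  | apply: (measurableT_comp (@normr_measurable _ setT)) ].
Ltac mfun := repeat mfun1.

(** * The standard normal law *)

Section normal.
Context {R : realType}.
Local Notation mu := (@lebesgue_measure R).
Local Notation phi := (@normal_pdf R 0 1).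

(** For indicators this is the definition of [normal_prob]; simple functions follow by linearity,
    and monotone convergence along [g] on both sides gives the general case. *)
Lemma ge0_integral_normal (m s : R) (f : measurableTypeR R -> \bar R) :
  measurable_fun setT f -> (forall x, (0 <= f x)%E) ->
  (\int[normal_prob m s]_x f x = \int[mu]_x (f x * (normal_pdf m s x)%:E))%E.
Proof.
move=> mf f0; pose g := nnsfun_approx measurableT mf.
have mpdf := @measurable_normal_pdf R m s.
have pdf0 := @normal_pdf_ge0 R m s.
have gE n : (\int[normal_prob m s]_x (g n x)%:E =
    \int[mu]_x ((g n x)%:E * (normal_pdf m s x)%:E))%E.
  have -> := integralT_nnsfun (normal_prob m s) (g n); rewrite sintegralE.
  under [RHS]eq_integral => x _.
    rewrite fimfunE -fsumEFin// ge0_mule_fsuml; last first.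
      by move=> r; rewrite EFinM; exact: nnfun_muleindic_ge0.
    over.
  rewrite ge0_integral_fsum//; last 2 first.
    move=> r; apply: emeasurable_funM; last exact/measurable_EFinP.
    by apply/measurable_EFinP/measurable_funM => //; exact: measurable_indic.
    move=> r x _; apply: mule_ge0; last by rewrite lee_fin.
    by rewrite EFinM; exact: nnfun_muleindic_ge0.
  apply: eq_fsbigr => r; rewrite inE => -[y _ gyr].
  have r0 : 0 <= r by rewrite -gyr.
  under eq_integral => x _ do rewrite EFinM -muleA.
  rewrite ge0_integralZl//; last 2 first.
    apply: emeasurable_funM; last exact/measurable_EFinP.
    by apply/measurable_EFinP; exact: measurable_indic.
    by move=> x _; rewrite mule_ge0 ?lee_fin.
  congr (_ * _)%E; rewrite /normal_prob /= [LHS]integral_mkcond /=.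
  apply: eq_integral => x _; rewrite patchE indicE.
  by case: ifP => _; rewrite ?mul1e ?mul0e.
have h1 := @cvg_monotone_convergence _ _ R (normal_prob m s) _ measurableT
  (fun n => EFin \o g n).
have h2 := @cvg_monotone_convergence _ _ R mu _ measurableT
  (fun n x => ((g n x)%:E * (normal_pdf m s x)%:E)%E).
have gf x : limn (EFin \o g^~ x) = f x.
  by apply/cvg_lim => //; exact: cvg_nnsfun_approx.
have e1 : (\int[normal_prob m s]_x f x =
   \int[normal_prob m s]_x limn (fun n => (EFin \o g n) x))%E.
  by apply: eq_integral => x _; rewrite -gf.
have e2 : (\int[mu]_x (f x * (normal_pdf m s x)%:E) =
   \int[mu]_x limn (fun n => (g n x)%:E * (normal_pdf m s x)%:E))%E.
  apply: eq_integral => x _; apply/esym/cvg_lim => //.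
  apply: cvgeZr => //; exact: cvg_nnsfun_approx.
rewrite e1 e2; have {}h2 := h2 _ _ _; have {}h1 := h1 _ _ _.
rewrite -(cvg_lim _ (h1 _ _ _)) //; first rewrite -(cvg_lim _ (h2 _ _ _)) //.
- by congr (lim (_ @ \oo)); apply/funext => n; exact: gE.
- by move=> n; apply: emeasurable_funM; exact/measurable_EFinP.
- by move=> n x _; rewrite mule_ge0 ?lee_fin.
- move=> x _ a b ab; rewrite lee_wpmul2r ?lee_fin//.
  by have /lefP := nd_nnsfun_approx measurableT mf ab; apply.
- by move=> n; exact/measurable_EFinP.
- by move=> n x _; rewrite lee_fin.
- move=> x _ a b ab; rewrite lee_fin.
  by have /lefP := nd_nnsfun_approx measurableT mf ab; apply.
Qed.

(** Completing the square turns integrand times density into a constant times the normal density of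
    mean s / (1 - b) and variance 1 / (1 - b). With b = 1/2 and s = 0 it gives an integrable
    dominating function; the general case integrates out one coordinate of a Gaussian chaos. *)
Lemma integral_normal_expR (b s : R) : b < 1 ->
  (\int[normal_prob 0 1]_x (expR (b * x ^+ 2 / 2 + s * x))%:E =
   ((Num.sqrt (1 - b))^-1 * expR (s ^+ 2 / (2 * (1 - b))))%:E)%E.
Proof.
move=> b1; have c0 : 0 < 1 - b by rewrite subr_gt0.
have mexp : measurable_fun setT (fun x : R => expR (b * x ^+ 2 / 2 + s * x)).
  by mfun.
rewrite ge0_integral_normal; last 2 first.
  exact/measurable_EFinP.
  by move=> x; rewrite lee_fin expR_ge0.
set C := _ * _; pose v := (Num.sqrt (1 - b))^-1.
have v0 : 0 < v by rewrite invr_gt0 sqrtr_gt0.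
have v2 : v ^+ 2 = (1 - b)^-1 by rewrite exprVn sqr_sqrtr ?ltW.
transitivity (\int[mu]_x (C%:E * (normal_pdf (s / (1 - b)) v x)%:E))%E; last first.
  rewrite integralZl ?integral_normal_pdf ?mule1//; exact: integrable_normal_pdf.
apply: eq_integral => x _; rewrite -!EFinM; congr (_%:E).
rewrite !normal_pdfE ?gt_eqF// /C /normal_fun /normal_peak v2 expr1n subr0.
have -> : (Num.sqrt ((1 - b)^-1 * pi *+ 2))^-1 = v^-1 * (Num.sqrt (1 * pi *+ 2))^-1 :> R.
  rewrite -invfM; congr (_^-1); rewrite mul1r -mulrnAr sqrtrM ?invr_ge0 ?ltW//.
  by rewrite sqrtrV ?ltW.
rewrite -/v; set w := (Num.sqrt (1 * pi *+ 2))^-1.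
transitivity (w * (v * v^-1) * (expR (s ^+ 2 / (2 * (1 - b))) *
   expR (- (x - s / (1 - b)) ^+ 2 / ((1 - b)^-1 *+ 2)))); last by ring.
rewrite mulfV ?gt_eqF// mulr1 [LHS]mulrCA -!expRD.
congr (_ * expR _); field; rewrite gt_eqF// andbT; lra.
Qed.
Lemma integral_normal (m s : R) (f : measurableTypeR R -> \bar R) :
  measurable_fun setT f ->
  (\int[normal_prob m s]_x f x = \int[mu]_x (f x * (normal_pdf m s x)%:E))%E.
Proof.
move=> mf; have pdf0 := @normal_pdf_ge0 R m s.
rewrite integralE [RHS]integralE; congr (_ - _)%E.
  rewrite ge0_integral_normal//; last exact: measurable_funepos.
  apply: eq_integral => x _; rewrite !funeposE maxe_pMl ?mul0e ?lee_fin//.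
rewrite ge0_integral_normal//; last exact: measurable_funeneg.
by apply: eq_integral => x _; rewrite !funenegE maxe_pMl ?mul0e ?lee_fin// mulNe.
Qed.

(** The fundamental theorem of calculus on [-(n+1), n+1] leaves boundary terms that vanish in the
    limit, and dominated convergence identifies the limit of the truncated integrals. *)
Lemma integral_derive_eq0 (F f : R -> R) :
  (forall x : R, is_derive x 1 F (f x)) -> continuous f ->
  mu.-integrable setT (EFin \o f) ->
  F n%:R @[n --> \oo] --> 0 -> F (- n%:R) @[n --> \oo] --> 0 ->
  (\int[mu]_x (f x)%:E = 0)%E.
Proof.
move=> dF cf intf F1 F2.
have cF : continuous F.
  move=> x; apply: differentiable_continuous; apply/derivable1_diffP.
  by have [] := dF x.
pose I n : set R := [set` `[- n.+1%:R, n.+1%:R]].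
have FTC n : (\int[mu]_(x in I n) (f x)%:E
    = (F n.+1%:R - F (- n.+1%:R))%R%:E)%E.
  rewrite EFinB; apply: continuous_FTC2.
  - by rewrite gtrN.
  - exact: continuous_subspaceT.
  - split.
    + by move=> x _; have [] := dF x.
    + by apply: cvg_at_right_filter; exact: cF.
    + by apply: cvg_at_left_filter; exact: cF.
  - by move=> x _; rewrite derive1E; have [_ ->] := dF x.
have h1 : (\int[mu]_(x in I n) (f x)%:E)%E @[n --> \oo] -->
    (\int[mu]_x (f x)%:E)%E.
  under eq_fun do rewrite integral_mkcond.
  apply: (@dominated_cvg _ _ _ _ _ _ _ _ (fun x : measurableTypeR R => `|(f x)%:E|%E)) => //.
  - move=> n; apply/(measurable_restrictT _ _).1 => //.
    by rewrite /I; exact: measurable_itv.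
    apply: measurable_funTS; exact: measurable_int intf.
  - move=> x _; apply: cvg_near_cst.
    near=> n; rewrite patchE ifT// mem_setE /I/= in_itv/= -ler_norml.
    have /ltW h := truncnS_gt `|x|; apply: (le_trans h).
    rewrite ler_nat ltnS; near: n; exact: nbhs_infty_ge.
  - exact: integrable_abse.
  - by move=> n x _; rewrite patchE; case: ifPn => _; rewrite ?abse0.
have h2 : (\int[mu]_(x in I n) (f x)%:E)%E @[n --> \oo] --> 0%E.
  under eq_fun do rewrite FTC.
  apply: cvg_EFin; first exact: nearW.
  rewrite -[X in _ --> X](subr0 0); apply: cvgB.
    by rewrite (cvg_shiftS (fun n => F n%:R)).
  by rewrite (cvg_shiftS (fun n => F (- n%:R))).
exact: cvg_unique h1 h2.
Unshelve. all: by end_near. Qed.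

Local Notation gamma := (@normal_prob R 0 1).

Lemma sqr_le_expR4 (x : R) : x ^+ 2 <= 4 * expR (x ^+ 2 / 4).
Proof. by have := expR_ge1Dx (x ^+ 2 / 4); lra. Qed.

Lemma normal_integrable (f : measurableTypeR R -> R) (C : R) :
  measurable_fun setT f -> (forall x : R, `|f x| <= C * expR (x ^+ 2 / 4)) ->
  gamma.-integrable setT (EFin \o f).
Proof.
move=> mf fC.
have mexp : measurable_fun setT (fun x : R => expR (2^-1 * x ^+ 2 / 2 + 0 * x)).
  by mfun.
have ie : gamma.-integrable setT
    (EFin \o (fun x : measurableTypeR R => expR (2^-1 * x ^+ 2 / 2 + 0 * x))).
  apply/integrableP; split; first exact/measurable_EFinP.
  under eq_integral do rewrite /= ger0_norm ?expR_ge0//.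
  by rewrite integral_normal_expR ?ltry//; lra.
have C0 : 0 <= C.
  by have := le_trans (normr_ge0 _) (fC 0); rewrite pmulr_lge0 ?expR_gt0.
apply: (le_integrable measurableT _ _ (integrableZl measurableT C ie)).
  exact/measurable_EFinP.
move=> x _ /=; rewrite lee_fin (le_trans (fC x))//.
rewrite ger0_norm ?mulr_ge0 ?expR_ge0// le_eqVlt; apply/orP; left; apply/eqP.
by congr (_ * expR _); field.
Qed.

(** Since phi' = - x phi, the integrand times the density is the derivative of h phi. The mean, the
    variance and the characteristic function of the normal law are all read off this identity. *)
Lemma normal_Stein (h h' : R -> R) (C : R) :
  (forall x : R, is_derive x 1 h (h' x)) -> continuous h' ->
  (forall x, `|h x| <= C * (1 + `|x|)) -> (forall x, `|h' x| <= C) ->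
  (\int[gamma]_x (h' x - x * h x)%:E = 0)%E.
Proof.
move=> dh ch' hC h'C.
have ch : continuous h.
  move=> x; apply: differentiable_continuous; apply/derivable1_diffP.
  by have [] := dh x.
have C0 : 0 <= C by exact: le_trans (normr_ge0 _) (h'C 0).
have mf : measurable_fun setT (fun x : R => h' x - x * h x).
  apply: measurable_funB; first exact: continuous_measurable_fun.
  by apply: measurable_funM => //; exact: continuous_measurable_fun.
have fC (x : R) : `|h' x - x * h x| <= (10 * C) * expR (x ^+ 2 / 4).
  have e4 := sqr_le_expR4 x.
  have e1 : 1 <= expR (x ^+ 2 / 4).
    by rewrite -expR0 ler_expR divr_ge0 ?sqr_ge0.
  apply: (@le_trans _ _ (C * (1 + `|x| + x ^+ 2))).
    rewrite (le_trans (ler_normB _ _))// normrM -(real_normK (num_real x)).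
    have := ler_wpM2l (normr_ge0 x) (hC x); have := h'C x.
    nra.
  rewrite [leRHS]mulrAC [leRHS]mulrC ler_wpM2l//.
  have : `|x| <= 1 + x ^+ 2.
    by rewrite -(real_normK (num_real x)); have := sqr_ge0 (`|x| - 2^-1); nra.
  nra.
have intf : gamma.-integrable setT (EFin \o (fun x : R => h' x - x * h x)).
  exact: normal_integrable fC.
rewrite integral_normal//; last exact/measurable_EFinP.
pose F x := h x * phi x.
have phiE x : phi x = normal_peak 1 * expR (- (x ^+ 2 / 2)).
  by rewrite normal_pdfE ?oner_eq0// /normal_fun expr1n subr0 mulNr.
have dphi (x : R) : is_derive x (1 : R) (phi : R -> R) (- x * phi x).
  rewrite (_ : (phi : R -> R) = fun x => normal_peak 1 * expR (- (x ^+ 2 / 2))); last first.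
    exact/funext.
  apply: is_derive_eq.
  by rewrite /GRing.scale/=; field.
(* As 1 + x^2 / 2 <= exp(x^2 / 2), linear growth of [h] still leaves a decay in 1 / (1 + |x|), which
   kills the boundary terms. *)
have Fn (x : R) : `|F x| <= 4 * C * normal_peak 1 / (1 + `|x|).
  have p0 := @normal_peak_ge0 R 1.
  rewrite /F normrM phiE normrM (ger0_norm p0) (ger0_norm (expR_ge0 _)).
  rewrite ler_pdivlMr ?ltr_pwDl// expRN.
  have e1 := expR_ge1Dx (x ^+ 2 / 2); have e0 := expR_gt0 (x ^+ 2 / 2).
  rewrite mulrA mulrAC ler_pdivrMr//.
  have x2 := real_normK (num_real x); have ax := normr_ge0 x.
  have h1 := hC x; have h0 := normr_ge0 (h x).
  set E := expR _ in e1 e0 *; set a := `|x| in ax x2 h1 *; set H := `|h x| in h0 h1 *.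
  apply: (@le_trans _ _ (normal_peak 1 * C * (1 + a) ^+ 2)).
    have pa : 0 <= normal_peak 1 * (1 + a) by rewrite mulr_ge0// addr_ge0.
    by have := ler_wpM2r pa h1; lra.
  rewrite [leRHS](_ : _ = normal_peak 1 * C * (4 * E)); last by ring.
  rewrite ler_wpM2l ?mulr_ge0//; nra.
have Fcv (u : nat -> R) : (forall n, `|u n| = n%:R) -> F (u n) @[n --> \oo] --> 0.
  move=> un; apply: norm_cvg0; apply: (@squeeze_cvgr _ _ _ _ (cst 0)
      (fun n => 4 * C * normal_peak 1 * n.+1%:R^-1)).
  - apply: nearW => n; apply/andP; split; first exact: normr_ge0.
    by rewrite (le_trans (Fn _))// un nat1r.
  - exact: cvg_cst.
  - rewrite -[X in _ --> X](mulr0 (4 * C * normal_peak 1)).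
    by apply: cvgM; [exact: cvg_cst|exact: cvg_harmonic].
transitivity (\int[mu]_x ((h' x - x * h x) * phi x)%:E)%E; first exact: eq_integral.
apply: (@integral_derive_eq0 F).
- move=> x; apply: is_derive_eq; rewrite /GRing.scale/=; ring.
- move=> x; apply: cvgM; last exact: continuous_normal_pdf.
  by apply: cvgB; [exact: ch'|apply: cvgM => //; exact: ch].
- apply/integrableP; split.
    apply/measurable_EFinP/measurable_funM => //; exact: measurable_normal_pdf.
  have /integrableP[_] := intf; rewrite integral_normal//; last first.
    by apply/measurableT_comp => //; exact/measurable_EFinP.
  congr (_ < _)%E; apply: eq_integral => x _ /=.
  by rewrite normrM EFinM (ger0_norm (normal_pdf_ge0 _ _ _)).
- by apply: Fcv => n; rewrite normr_nat.
- by apply: Fcv => n; rewrite normrN normr_nat.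
Unshelve. all: by end_near. Qed.

Lemma normal_id_integrable : gamma.-integrable setT (EFin \o (fun x : measurableTypeR R => x)).
Proof.
apply: (@normal_integrable _ 5) => // x; have := sqr_le_expR4 x.
have : 1 <= expR (x ^+ 2 / 4) by rewrite -expR0 ler_expR divr_ge0 ?sqr_ge0.
have : `|x| <= 1 + x ^+ 2.
  by rewrite -(real_normK (num_real x)); have := sqr_ge0 (`|x| - 2^-1); nra.
nra.
Qed.

Lemma normal_mean : (\int[gamma]_x x%:E = 0)%E.
Proof.
have := @normal_Stein (cst (-1)) (cst 0) 1.
move=> /(_ _ _ _ _)/=; under eq_integral do rewrite sub0r mulrN1 opprK.
apply => //.
- by move=> x; exact: cst_continuous.
- by move=> x; rewrite normrN1 mul1r lerDl.
- by move=> x; rewrite normr0.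
Qed.

Lemma normal_sqr_integrable :
  gamma.-integrable setT (EFin \o (fun x : measurableTypeR R => x ^+ 2)).
Proof.
apply: (@normal_integrable _ 4); first exact: exprn_measurable.
by move=> x; rewrite ger0_norm ?sqr_ge0// sqr_le_expR4.
Qed.

Lemma normal_var : (\int[gamma]_x (x ^+ 2)%:E = 1)%E.
Proof.
have : (\int[gamma]_x (1 - x * x)%:E = 0)%E.
  apply: (@normal_Stein id (cst 1) 1) => //.
  - by move=> x; exact: cst_continuous.
  - by move=> x; rewrite mul1r lerDr.
  - by move=> x; rewrite normr1.
under eq_integral do rewrite EFinB.
rewrite integralB_EFin//; last 2 first.
- exact: finite_measure_integrable_cst.
- exact: normal_sqr_integrable.
rewrite integral_cst// [X in (1 * X)%E]probability_setT mule1.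
have h : (\int[gamma]_x (x ^+ 2)%:E)%E \is a fin_num.
  exact: integrable_fin_num normal_sqr_integrable.
rewrite -(fineK h) => /eqP; rewrite -EFinB eqe subr_eq0 => /eqP <-.
by [].
Qed.

(** Differentiating under the integral, F'(s) = - E[x sin(s x)] = - s F(s) by Stein's identity for
    sin(s x). Hence F(s) exp(s^2 / 2) is constant, equal to F(0) = 1. *)
Lemma normal_cos (s : R) : (\int[gamma]_x (cos (s * x))%:E = (expR (- (s ^+ 2 / 2)))%:E)%E.
Proof.
pose F (s : R) : R := \int[gamma]_(x in setT) cos (s * x).
have intcos r : gamma.-integrable setT (EFin \o (fun x : measurableTypeR R => cos (r * x))).
  apply: (@normal_integrable _ 1); first by mfun.
  move=> x; rewrite mul1r (le_trans (cos_max _))//.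
  by rewrite -expR0 ler_expR divr_ge0 ?sqr_ge0.
have dcos (r x : R) : is_derive r (1 : R) (fun r : R => cos (r * x)) (- (x * sin (r * x))).
  apply: is_derive_eq; rewrite /GRing.scale/=; ring.
have intxs r : gamma.-integrable setT
    (EFin \o (fun x : measurableTypeR R => x * sin (r * x))).
  apply: (le_integrable measurableT _ _ normal_id_integrable).
    by apply/measurable_EFinP; mfun.
  by move=> x _ /=; rewrite lee_fin normrM ler_piMr// sin_max.
have stein r : \int[gamma]_(x in setT) (x * sin (r * x)) = r * F r.
  have : (\int[gamma]_x (r * cos (r * x) - x * sin (r * x))%:E = 0)%E.
    apply: (@normal_Stein (fun x => sin (r * x)) _ (`|r| + 1)).
    - by move=> x; apply: is_derive_eq; rewrite /GRing.scale/=; ring.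
    - move=> x; apply: cvgM; first exact: cvg_cst.
      apply: continuous_comp; last exact: continuous_cos.
      by apply: cvgM; [exact: cvg_cst|exact: cvg_id].
    - move=> x; rewrite (le_trans (sin_max _))//.
      by have := normr_ge0 x; have := normr_ge0 r; nra.
    - move=> x; rewrite normrM; have := cos_max (r * x); have := normr_ge0 r; nra.
  under eq_integral do rewrite EFinB.
  rewrite integralB_EFin//; last exact: integrableZl (intcos r).
  have -> : (\int[gamma]_x (r * cos (r * x))%:E =
     r%:E * \int[gamma]_x (cos (r * x))%:E)%E.
    by rewrite -integralZl//; exact: intcos.
  rewrite -(fineK (integrable_fin_num _ (intcos r)))//.
  rewrite -(fineK (integrable_fin_num _ (intxs r)))// -EFinM -EFinB => -[/eqP].
  by rewrite subr_eq0 => /eqP.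
have dF (r : R) : is_derive r (1 : R) F (- r * F r).
  have hu (u : R) : [set` `](r - 1), (r + 1)[] u -> True by [].
  have G_ub (u x : R) : [set` `](r - 1), (r + 1)[] u -> setT x ->
      `|partial1of2 (fun (u : R) (x : measurableTypeR R) => cos (u * x)) u x| <= `|x|.
    move=> _ _; rewrite partial1of2E; have [_ ->] := dcos u x.
    by rewrite normrN normrM ler_piMr// sin_max.
  have I : [set` `](r - 1), (r + 1)[] r by rewrite /= in_itv/=; lra.
  have der (u : R) (x : measurableTypeR R) : [set` `](r - 1), (r + 1)[] u -> setT x ->
     derivable (fun u : R => cos (u * x)) u (1 : R) by move=> _ _; have [] := dcos u x.
  have iabs : gamma.-integrable setT (EFin \o (fun x : measurableTypeR R => `|x|)).
    exact: (integrable_norm normal_id_integrable).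
  have h1 := @derivable_under_integral _ _ _ gamma _ _ measurableT r _ _ I
    (fun x _ => intcos x) der _ (fun y => normr_ge0 y) iabs G_ub.
  have h2 := @differentiation_under_integral _ _ _ gamma _ _ measurableT r _ _ I
    (fun x _ => intcos x) der _ (fun y => normr_ge0 y) iabs G_ub.
  split=> //; rewrite -derive1E h2.
  rewrite mulNr -stein -mulN1r -RintegralZl//.
  apply: eq_Rintegral => x _; rewrite partial1of2E; have [_ ->] := dcos r x.
  by rewrite mulN1r.
have E : F s * expR (s ^+ 2 / 2) = F 0 * expR (0 ^+ 2 / 2).
  apply: (@is_derive_0_is_cst _ (fun s => F s * expR (s ^+ 2 / 2))) => x.
  by apply: is_derive_eq; rewrite /GRing.scale/=; field.
have F0 : F 0 = 1.
  rewrite /F; under eq_Rintegral do rewrite mul0r cos0.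
  by rewrite /Rintegral integral_cst// [X in (1 * X)%E]probability_setT mule1.
rewrite -(fineK (integrable_fin_num _ (intcos s)))//; congr EFin.
move: E; rewrite F0 expr0n/= mul0r expR0 mulr1 => E.
apply: (mulIf (lt0r_neq0 (expR_gt0 (s ^+ 2 / 2)))).
by rewrite -expRD addNr expR0.
Qed.

End normal.

(** * Characteristic functions determine laws *)

Section char.
Context {R : realType}.
Local Notation mu := (@lebesgue_measure R).
Local Notation gamma := (@normal_prob R 0 1).

Lemma bounded_integrable d (T : measurableType d) (P : {measure set T -> \bar R})
    (f : T -> R) (M : R) : (P setT < +oo)%E ->
  measurable_fun setT f -> (forall x, `|f x| <= M) -> P.-integrable setT (EFin \o f).
Proof.
move=> PT mf fM; apply: measurable_bounded_integrable => //.
- exists M; split; first exact: num_real.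
  by move=> y My x _; exact: le_trans (fM x) (ltW My).
Qed.

Lemma prob_lty d (T : measurableType d) (P : probability T R) : (P setT < +oo)%E.
Proof. by rewrite probability_setT ltry. Qed.

Lemma prob2_lty d1 d2 (T1 : measurableType d1) (T2 : measurableType d2)
  (P1 : probability T1 R) (P2 : probability T2 R) : ((P1 \x P2) setT < +oo)%E.
Proof. have -> : ((P1 \x P2) setT = P1 setT * P2 setT)%E by rewrite -setXTT product_measure1E.
by rewrite !probability_setT mule1 ltry. Qed.

Lemma bounded_cvg_integral d (T : measurableType d) (P : {measure set T -> \bar R})
    (f_ : nat -> T -> R) (f : T -> R) (M : R) : (P setT < +oo)%E ->
  (forall n, measurable_fun setT (f_ n)) -> (forall n x, `|f_ n x| <= M) ->
  (forall x, f_ n x @[n --> \oo] --> f x) ->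
  (\int[P]_x (f_ n x)%:E)%E @[n --> \oo] --> (\int[P]_x (f x)%:E)%E.
Proof.
move=> PT mf fM ff.
apply: (@dominated_cvg _ _ _ P _ measurableT _ _ (cst M%:E)) => //.
- by move=> n; exact/measurable_EFinP.
- move=> x _; apply: cvg_EFin; [exact: nearW|exact: ff].
- by apply: (@bounded_integrable _ _ P (cst M) `|M|).
- by move=> n x _; rewrite lee_fin.
Qed.

Lemma eq_cvg_lim_eq (u v : nat -> \bar R) (a b : \bar R) :
  u n @[n --> \oo] --> a -> v n @[n --> \oo] --> b -> u =1 v -> a = b.
Proof. by move=> ua vb /funext uv; rewrite uv in ua; exact: cvg_unique ua vb. Qed.

Lemma gauss_fourier (y : R) :
  (\int[gamma]_s (cos (s * y))%:E = (expR (- (y ^+ 2 / 2)))%:E)%E.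
Proof. by rewrite -normal_cos; apply: eq_integral => x _; rewrite mulrC. Qed.

Section one_side.
Context d (T : measurableType d) (P : probability T R) (W Y : T -> R) (M : R).
Hypotheses (mW : measurable_fun setT W) (mY : measurable_fun setT Y)
  (WM : forall w, `|W w| <= M).

(** The Gaussian kernel is an average of cosines by [gauss_fourier], and Fubini applies because the
    weight and the cosine are bounded. *)
Lemma integral_weight_gauss (x e : R) :
  (\int[P]_w (W w * expR (- (((x - Y w) / e) ^+ 2 / 2)))%:E =
   \int[gamma]_s \int[P]_w (W w * cos (s * ((x - Y w) / e)))%:E)%E.
Proof.
pose f (z : T * measurableTypeR R) : \bar R :=
  (W z.1 * cos (z.2 * ((x - Y z.1) / e)))%:E.
have mf : measurable_fun setT (fun z : T * measurableTypeR R =>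
    W z.1 * cos (z.2 * ((x - Y z.1) / e))).
  have m1 : measurable_fun setT (fun z : T * measurableTypeR R => W z.1).
    exact: measurableT_comp mW measurable_fst.
  have m2 : measurable_fun setT (fun z : T * measurableTypeR R => Y z.1).
    exact: measurableT_comp mY measurable_fst.
  have m3 : measurable_fun setT (fun z : T * measurableTypeR R => z.2).
    exact: measurable_snd.
  by mfun.
have intf : (P \x gamma)%E.-integrable setT f.
  apply: (@bounded_integrable _ _ (P \x gamma)%E _ M) => //; first exact: prob2_lty.
  move=> z; rewrite normrM (le_trans _ (WM z.1))// ler_piMr// cos_max.
  by [].
rewrite -(Fubini intf); apply: eq_integral => w _.
rewrite /f/=; under [RHS]eq_integral do rewrite EFinM.
rewrite integralZl//; first by rewrite gauss_fourier.
apply: (@bounded_integrable _ _ gamma _ 1); [exact: prob_lty|by mfun|].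
by move=> u; rewrite cos_max.
Qed.

(** The variable y + e u, u standard normal, has density [normal_pdf y e]; after Fubini [psi] is
    integrated against a Gaussian kernel in x - Y, itself a mixture of cosines of Y. The right-hand
    side thus sees (P, W, Y) only through the integrals of W cos(s Y + t). *)
Lemma integral_weight_smooth (psi : R -> R) (B : R) (e : R) :
  0 < e -> continuous psi -> (forall x, 0 <= psi x <= B) ->
  (\int[P]_w (W w * \int[gamma]_(u in setT) psi (Y w + e * u))%:E =
   \int[mu]_x ((psi x * normal_peak e)%:E *
     \int[gamma]_s \int[P]_w (W w * cos (s * ((x - Y w) / e)))%:E))%E.
Proof.
move=> e0 cpsi psiB.
have enz : e != 0 by rewrite gt_eqF.
have psi0 x : 0 <= psi x by have /andP[] := psiB x.
have psiM x : psi x <= B by have /andP[] := psiB x.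
have mpsi : measurable_fun setT psi by exact: continuous_measurable_fun.
have subst y : (\int[gamma]_u (psi (y + e * u))%:E =
    \int[mu]_x (psi x * normal_pdf y e x)%:E)%E.
  pose F u := y + e * u.
  have dF (u : R) : is_derive u (1 : R) (F : R -> R) e.
    by apply: is_derive_eq; rewrite /GRing.scale/=; ring.
  have F'E : derive1 F = cst e.
    by apply/funext => u; rewrite derive1E; have [_ ->] := dF u.
  rewrite (@increasing_ge0_integration_by_substitutionT _ F
      (fun x => psi x * normal_pdf y e x)).
  - rewrite ge0_integral_normal; last 2 first.
    + apply/measurable_EFinP; apply: measurableT_comp => //; by mfun.
    + by move=> u; rewrite lee_fin.
    apply: eq_integral => u _; rewrite F'E /= -EFinM; congr EFin.
    rewrite /F /= -mulrA; congr (_ * _).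
    rewrite !normal_pdfE ?oner_eq0// /normal_fun /normal_peak.
    rewrite !fctE/= [RHS]mulrAC; congr (_ * expR _); last by field.
    rewrite expr1n mul1r -mulrnAr sqrtrM ?sqr_ge0// sqrtr_sqr gtr0_norm//.
    by rewrite invfM mulrAC mulVf ?mul1r.
  - by move=> a b ab; rewrite /F ltrD2l ltr_pM2l.
  - by rewrite F'E => u; exact: cst_continuous.
  - by rewrite F'E; exact: is_cvg_cst.
  - by rewrite F'E; exact: is_cvg_cst.
  - by move=> u; have [] := dF u.
  - exact: cvg_comp (gt0_cvgMrNy e0 cvg_id) (@cvg_addrl_Ny _ y).
  - exact: cvg_comp (gt0_cvgMry e0 cvg_id) (@cvg_addrl _ y).
  - by move=> u; apply: cvgM; [exact: cpsi|exact: continuous_normal_pdf].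
  - by move=> u; rewrite mulr_ge0// normal_pdf_ge0.
have M0 : 0 <= M by exact: le_trans (normr_ge0 _) (WM point).
have B0 : 0 <= B by exact: le_trans (psi0 0) (psiM 0).
pose k (z : T * measurableTypeR R) : R := W z.1 * psi z.2 * normal_pdf (Y z.1) e z.2.
have pdfE y x : normal_pdf y e x = normal_peak e * expR (- (((x - y) / e) ^+ 2 / 2)).
  rewrite normal_pdfE// /normal_fun; congr (_ * expR _); by field.
have mk : measurable_fun setT k.
  have m1 : measurable_fun setT (fun z : T * measurableTypeR R => W z.1).
    exact: measurableT_comp mW measurable_fst.
  have m2 : measurable_fun setT (fun z : T * measurableTypeR R => Y z.1).
    exact: measurableT_comp mY measurable_fst.
  have m3 : measurable_fun setT (fun z : T * measurableTypeR R => z.2 : R).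
    exact: measurable_snd.
  have m4 : measurable_fun setT (fun z : T * measurableTypeR R => psi z.2).
    exact: measurableT_comp mpsi measurable_snd.
  apply: measurable_funM; first exact: measurable_funM.
  under eq_fun do rewrite pdfE.
  by mfun.
have intk : (P \x mu)%E.-integrable setT (EFin \o k).
  apply/integrable12ltyP; first exact/measurable_EFinP.
  apply: (@le_lt_trans _ _ (\int[P]_w (M * B)%:E)%E); last first.
    rewrite integral_cst//= probability_setT mule1 ltry//.
  apply: ge0_le_integral => //.
  - by move=> w _; exact: integral_ge0.
  - apply: (@measurable_fun_fubini_tonelli_F _ _ _ _ _ mu (fun z => `|(k z)%:E|%E)).
      by apply/measurableT_comp => //; exact/measurable_EFinP.
    by move=> z; exact: abse_ge0.
  - move=> w _; rewrite -[leRHS]mule1 -(integral_normal_pdf (Y w) e) -integralZl//; last first.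
      exact: integrable_normal_pdf.
    apply: ge0_le_integral => //.
    + apply/measurableT_comp => //; apply/measurable_EFinP.
      exact: (measurableT_comp mk (pair1_measurable w)).
    + apply: emeasurable_funM => //; apply/measurable_EFinP; exact: measurable_normal_pdf.
    + move=> x _; rewrite -EFinM lee_fin /k/= normrM (ger0_norm (normal_pdf_ge0 _ _ _)).
      rewrite ler_wpM2r ?normal_pdf_ge0// normrM ler_pM// ger0_norm//.
transitivity (\int[P]_w \int[mu]_x (k (w, x))%:E)%E.
  apply: eq_integral => w _; rewrite EFinM /Rintegral fineK; last first.
    apply: (@integrable_fin_num _ _ _ gamma) => //.
    apply: (@bounded_integrable _ _ gamma _ B); [exact: prob_lty| |].
      by apply: (measurableT_comp mpsi); mfun.
    by move=> u; rewrite ger0_norm.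
  rewrite subst -integralZl//.
    by apply: eq_integral => x _; rewrite -EFinM /k mulrA.
  have := integrable_normal_pdf (Y w) e => h.
  apply: (le_integrable measurableT _ _ (integrableZl measurableT B h)).
    apply/measurable_EFinP/measurable_funM => //; exact: measurable_normal_pdf.
  move=> x _ /=; rewrite lee_fin !normrM ler_wpM2r// !ger0_norm//.
rewrite (Fubini intk); apply: eq_integral => x _.
rewrite -(integral_weight_gauss x e) -integralZl//; last first.
  apply: (@bounded_integrable _ _ P _ M); first exact: prob_lty.
    by mfun.
  move=> w; rewrite normrM (le_trans _ (WM w))// ler_piMr// ger0_norm ?expR_ge0//.
  by rewrite -expR0 ler_expR oppr_le0 divr_ge0// sqr_ge0.
apply: eq_integral => w _; rewrite -EFinM /k/= pdfE; congr EFin; ring.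
Qed.

Lemma integral_weight_smooth_cvg (psi : R -> R) (B : R) :
  continuous psi -> (forall x, 0 <= psi x <= B) ->
  (\int[P]_w (W w * \int[gamma]_(u in setT) psi (Y w + n.+1%:R^-1 * u))%:E)%E
    @[n --> \oo] --> (\int[P]_w (W w * psi (Y w))%:E)%E.
Proof.
move=> cpsi psiB.
have psi0 x : 0 <= psi x by have /andP[] := psiB x.
have psiM x : psi x <= B by have /andP[] := psiB x.
have mpsi : measurable_fun setT psi by exact: continuous_measurable_fun.
have ipsi (a e : R) : gamma.-integrable setT
    (EFin \o (fun u : measurableTypeR R => psi (a + e * u))).
  apply: (@bounded_integrable _ _ gamma _ B); [exact: prob_lty| |].
    by apply: (measurableT_comp mpsi); mfun.
  by move=> u; rewrite ger0_norm.
have mint (e : R) : measurable_fun setT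
    (fun w => \int[gamma]_(u in setT) psi (Y w + e * u)).
  apply: measurableT_comp => //.
  apply: (@measurable_fun_fubini_tonelli_F _ _ _ _ _ gamma
    (fun z : T * measurableTypeR R => (psi (Y z.1 + e * z.2))%:E)).
    apply/measurable_EFinP; apply: (measurableT_comp mpsi).
    apply: measurable_funD; first exact: measurableT_comp mY measurable_fst.
    by apply: measurable_funM => //; exact: measurable_snd.
  by move=> z; rewrite lee_fin.
have bint (a e : R) : `|\int[gamma]_(u in setT) psi (a + e * u)| <= B.
  rewrite (le_trans (le_normr_Rintegral _ _))//.
  have -> : B = \int[gamma]_(u in setT) (B : R).
    by rewrite /Rintegral integral_cst// [X in (_ * X)%E]probability_setT mule1.
  apply: le_Rintegral => //.
  - exact: integrable_norm.
  - apply: (@bounded_integrable _ _ gamma _ `|B|); [exact: prob_lty|by []|by []].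
  - by move=> u _; rewrite ger0_norm.
apply: (@bounded_cvg_integral _ _ P _ _ (M * B)); first exact: prob_lty.
- by move=> n; exact: measurable_funM.
- by move=> n w; rewrite normrM ler_pM.
- move=> w; apply: cvgM; first exact: cvg_cst.
  have h : (\int[gamma]_u (psi (Y w + n.+1%:R^-1 * u))%:E)%E @[n --> \oo] -->
      (\int[gamma]_u (psi (Y w))%:E)%E.
    apply: (@bounded_cvg_integral _ _ gamma _ _ B); first exact: prob_lty.
    - by move=> n; apply: (measurableT_comp mpsi); mfun.
    - by move=> n u; rewrite ger0_norm.
    - move=> u; apply: (continuous_cvg _ (cpsi _)).
      rewrite -[X in _ --> X]addr0; apply: cvgD; first exact: cvg_cst.
      by rewrite -[X in _ --> X](mul0r u); apply: cvgM; [exact: cvg_harmonic|exact: cvg_cst].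
  apply: fine_cvg; move: h.
  by rewrite integral_cst// [X in (_ * X)%E]probability_setT mule1.
Qed.

(** Continuous ramps increase to the indicator of an open half-line. These half-lines are the
    generating pi-system of the Dynkin argument below. *)
Lemma integral_weight_halfline (b : R) :
  (\int[P]_w (W w * Num.min 1 (n%:R * Num.max 0 (b - Y w)))%:E)%E @[n --> \oo] -->
  (\int[P]_w (W w * \1_`]-oo, b[ (Y w))%:E)%E.
Proof.
apply: (@bounded_cvg_integral _ _ P _ _ M); first exact: prob_lty.
- move=> n; apply: measurable_funM => //.
  apply: measurable_minr => //; apply: measurable_funM => //.
  by apply: measurable_maxr => //; mfun.
- move=> n w; rewrite normrM (le_trans _ (WM w))// ler_piMr// ger0_norm.
    by rewrite ge_min lexx.
  by rewrite le_min ler01/= mulr_ge0// le_max lexx.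
move=> w; apply: cvgM; first exact: cvg_cst.
rewrite indicE; have [Yb|Yb] := ltP (Y w) b.
  rewrite mem_set/=; last by rewrite in_itv.
  apply: cvg_near_cst; near=> n.
  apply/min_idPl; rewrite (max_idPr _); last by rewrite subr_ge0 ltW.
  rewrite -ler_pdivrMr ?subr_gt0// mul1r.
  near: n; exact: nbhs_infty_ger.
rewrite memNset/=; last by rewrite in_itv/= ltNge Yb.
apply: cvg_near_cst; apply: nearW => n.
by rewrite (max_idPl _) ?subr_le0// mulr0; apply/min_idPr; exact: ler01.
Unshelve. all: by end_near. Qed.

Lemma integral_weight_setC (A : set R) : measurable A ->
  (\int[P]_w (W w * \1_(~` A) (Y w))%:E =
   \int[P]_w (W w)%:E - \int[P]_w (W w * \1_A (Y w))%:E)%E.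
Proof.
move=> mA; have mI : measurable_fun setT (fun w => \1_A (Y w) : R).
  by apply: measurableT_comp => //; exact: measurable_indic.
rewrite -integralB_EFin//; last 2 first.
- by apply: (@bounded_integrable _ _ P _ M); first exact: prob_lty.
- apply: (@bounded_integrable _ _ P _ M); first exact: prob_lty.
    exact: measurable_funM.
  move=> w; rewrite normrM (le_trans _ (WM w))// ler_piMr// indicE.
  by case: (_ \in _); rewrite ?normr0 ?normr1.
apply: eq_integral => w _; rewrite -EFinB; congr EFin.
by rewrite !indicE in_setC; case: (_ \in _); rewrite /= ?mulr1 ?mulr0 ?subrr ?subr0.
Qed.

Lemma integral_weight_bigcup (F : (set R)^nat) : (forall n, measurable (F n)) ->
  trivIset setT F ->
  (\sum_(k < n) \int[P]_w (W w * \1_(F k) (Y w))%:E)%E @[n --> \oo] -->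
  (\int[P]_w (W w * \1_(\bigcup_k F k) (Y w))%:E)%E.
Proof.
move=> mF tF.
have mI (A : set R) : measurable A -> measurable_fun setT (fun w => \1_A (Y w) : R).
  by move=> mA; apply: measurableT_comp => //; exact: measurable_indic.
have iI (A : set R) : measurable A -> P.-integrable setT
    (EFin \o (fun w => W w * \1_A (Y w))).
  move=> mA; apply: (@bounded_integrable _ _ P _ M); first exact: prob_lty.
    by apply: measurable_funM => //; exact: mI.
  move=> w; rewrite normrM (le_trans _ (WM w))// ler_piMr// indicE.
  by case: (_ \in _); rewrite ?normr0 ?normr1.
have E n : (\sum_(k < n) \int[P]_w (W w * \1_(F k) (Y w))%:E =
    \int[P]_w (W w * \1_(\big[setU/set0]_(k < n) F k) (Y w))%:E)%E.
  elim: n => [|n IH].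
    rewrite !big_ord0; apply/esym; under eq_integral do rewrite indic0 mulr0.
    exact: integral0.
  rewrite !big_ord_recr/= IH -integralD//; last 2 first.
  - by apply: iI; exact: bigsetU_measurable.
  - exact: iI.
  apply: eq_integral => w _; rewrite -EFinD -mulrDr; congr (_ * _)%:E.
  rewrite [in RHS]indicE in_setU !indicE.
  have [h1|h1] := boolP (Y w \in F n); last by rewrite orbF addr0.
  rewrite orbT (_ : (Y w \in _) = false) ?add0r//.
  apply/negbTE/negP => /set_mem; rewrite -bigcup_mkord => -[k /= kn Fk].
  have := tF k n I I; move/set_mem in h1 => /(_ _)/eqP; rewrite (ltn_eqF kn) => h.
  by apply/notF/h; exists (Y w).
under eq_fun do rewrite E.
apply: (@bounded_cvg_integral _ _ P _ _ M); first exact: prob_lty.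
- by move=> n; apply: measurable_funM => //; apply: mI; exact: bigsetU_measurable.
- move=> n w; rewrite normrM (le_trans _ (WM w))// ler_piMr// indicE.
  by case: (_ \in _); rewrite ?normr0 ?normr1.
move=> w; apply: cvgM; first exact: cvg_cst.
rewrite !indicE; have [[k _ Fk]|h] := pselect ((\bigcup_k F k) (Y w)).
  rewrite mem_set; last by exists k.
  apply: cvg_near_cst; near=> n; rewrite indicE mem_set// -bigcup_mkord.
  by exists k => //=; near: n; exact: nbhs_infty_gt.
rewrite memNset//; apply: cvg_near_cst; apply: nearW => n.
rewrite indicE memNset// -bigcup_mkord => -[k _ Fk]; apply: h; by exists k.
Unshelve. all: by end_near. Qed.

End one_side.

Section uniqueness.
Context d1 (T1 : measurableType d1) (P1 : probability T1 R) (W1 Y1 : T1 -> R) (M1 : R).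
Context d2 (T2 : measurableType d2) (P2 : probability T2 R) (W2 Y2 : T2 -> R) (M2 : R).
Hypotheses (mW1 : measurable_fun setT W1) (mY1 : measurable_fun setT Y1)
  (WM1 : forall w, `|W1 w| <= M1).
Hypotheses (mW2 : measurable_fun setT W2) (mY2 : measurable_fun setT Y2)
  (WM2 : forall w, `|W2 w| <= M2).
Hypothesis cos12 : forall s t : R,
  (\int[P1]_w (W1 w * cos (s * Y1 w + t))%:E = \int[P2]_w (W2 w * cos (s * Y2 w + t))%:E)%E.

(** Uniqueness of characteristic functions for the signed measure with density W, pushed forward by
    Y. The weight makes the statement usable by induction on coordinates, since it carries the
    factors already treated. Cosines determine Gaussian smoothings, these determine the integrals of
    bounded continuous functions, then half-lines by ramps, then Borel sets by Dynkin's lemma. *)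
Lemma weighted_law_unique (B : set R) : measurable B ->
  (\int[P1]_w (W1 w * \1_B (Y1 w))%:E = \int[P2]_w (W2 w * \1_B (Y2 w))%:E)%E.
Proof.
have smooth (psi : R -> R) (C : R) : continuous psi -> (forall x, 0 <= psi x <= C) ->
    (\int[P1]_w (W1 w * psi (Y1 w))%:E = \int[P2]_w (W2 w * psi (Y2 w))%:E)%E.
  move=> cpsi psiC.
  have h1 := @integral_weight_smooth_cvg _ _ P1 _ _ _ mW1 mY1 WM1 _ _ cpsi psiC.
  have h2 := @integral_weight_smooth_cvg _ _ P2 _ _ _ mW2 mY2 WM2 _ _ cpsi psiC.
  apply: (eq_cvg_lim_eq h1 h2) => n.
  have e0 : 0 < n.+1%:R^-1 :> R by rewrite invr_gt0.
  apply: (etrans (@integral_weight_smooth _ _ P1 _ _ _ mW1 mY1 WM1 _ _ _ e0 cpsi psiC)).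
  apply: (etrans _ (esym (@integral_weight_smooth _ _ P2 _ _ _ mW2 mY2 WM2 _ _ _ e0 cpsi psiC))).
  apply: eq_integral => x _; congr (_ * _)%E; apply: eq_integral => s _.
  (* The kernel is centred at x, which becomes a phase: this is why all phases t appear in
     [cos12]. *)
  have E (a b y : R) : a * ((x - y) / b) = - (a / b) * y + a * x / b by ring.
  by under eq_integral do rewrite E; rewrite cos12; under eq_integral do rewrite -E.
have half (b : R) : (\int[P1]_w (W1 w * \1_`]-oo, b[ (Y1 w))%:E =
    \int[P2]_w (W2 w * \1_`]-oo, b[ (Y2 w))%:E)%E.
  have h1 := @integral_weight_halfline _ _ P1 _ _ _ mW1 mY1 WM1 b.
  have h2 := @integral_weight_halfline _ _ P2 _ _ _ mW2 mY2 WM2 b.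
  apply: (eq_cvg_lim_eq h1 h2) => n.
  apply: (smooth (fun y => Num.min 1 (n%:R * Num.max 0 (b - y))) 1).
    pose f1 (y : R) := n%:R * Num.max 0 (b - y); pose f2 (y : R) := b - y.
    have c2 : continuous f2 by move=> y; apply: cvgB; [exact: cvg_cst|exact: cvg_id].
    have c1 : continuous f1.
      move=> y; apply: cvgM; first exact: cvg_cst.
      by apply: (@continuous_max _ _ (cst 0) f2); [exact: cst_continuous|exact: c2].
    by move=> y; apply: (@continuous_min _ _ (cst 1) f1); [exact: cst_continuous|exact: c1].
  move=> x; rewrite ge_min lexx andbT le_min ler01/= mulr_ge0// le_max lexx//.
have total : (\int[P1]_w (W1 w)%:E = \int[P2]_w (W2 w)%:E)%E.
  have := cos12 0 0; under eq_integral do rewrite mul0r addr0 cos0 mulr1.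
  by under [in RHS]eq_integral do rewrite mul0r addr0 cos0 mulr1.
pose Q (S : set (measurableTypeR R)) :=
  (\int[P1]_w (W1 w * \1_S (Y1 w))%:E = \int[P2]_w (W2 w * \1_S (Y2 w))%:E)%E.
move=> mB; have mE : @measurable _ (measurableTypeR R) = <<s @RGenInftyO.G R >>.
  exact: RGenInftyO.measurableE.
suff : forall S, <<s @RGenInftyO.G R >> S -> Q S by apply; rewrite -mE.
apply: (dynkin_induction mE).
- move=> _ _ [x ->] [y ->]; exists (Num.min x y); apply/seteqP; split => z /=;
    rewrite !in_itv/= lt_min; [by move=> [-> ->]|by move=> /andP[-> ->]].
- by rewrite /Q; under eq_integral do rewrite indicT mulr1;
    under [RHS]eq_integral do rewrite indicT mulr1.
- by move=> _ [x ->]; exact: half.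
- move=> S mS; rewrite /Q => QS; rewrite (@integral_weight_setC _ _ P1 _ _ _ mW1 mY1 WM1 _ mS) QS total;
    by rewrite (@integral_weight_setC _ _ P2 _ _ _ mW2 mY2 WM2 _ mS).
- move=> F mF tF QF.
  have h1 := @integral_weight_bigcup _ _ P1 _ _ _ mW1 mY1 WM1 _ mF tF.
  have h2 := @integral_weight_bigcup _ _ P2 _ _ _ mW2 mY2 WM2 _ mF tF.
  apply: (eq_cvg_lim_eq h1 h2) => n.
  by apply: eq_bigr => k _; exact: QF.
Qed.
End uniqueness.
End char.

Section gauss_cos.
Context {R : realType}.
Local Notation mu := (@lebesgue_measure R).
Local Notation gamma := (@normal_prob R 0 1).

(** Odd integrand against an even density. Adding 1 keeps the integrand nonnegative, so that the
    reflection x -> -x is done on integrals of nonnegative functions. *)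
Lemma normal_sin (s : R) : (\int[gamma]_x (sin (s * x))%:E = 0)%E.
Proof.
have msin : measurable_fun setT (fun x : R => sin (s * x)) by mfun.
have isin : gamma.-integrable setT (EFin \o (fun x : measurableTypeR R => sin (s * x))).
  apply: (@bounded_integrable _ _ _ gamma _ 1) => //; first exact: prob_lty.
  by move=> x; exact: sin_max.
have h (a : R) : (\int[gamma]_x (1 + sin (a * x))%:E =
    \int[mu]_x ((1 + sin (a * x)) * normal_pdf 0 1 x)%:E)%E.
  rewrite ge0_integral_normal//.
  by apply/measurable_EFinP; mfun.
have mf (a : R) : measurable_fun setT (fun x : measurableTypeR R =>
   ((1 + sin (a * x)) * normal_pdf 0 1 x)%:E).
  apply/measurable_EFinP; apply: measurable_funM; first by mfun.
  exact: measurable_normal_pdf.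
have sym : (\int[gamma]_x (1 + sin (s * x))%:E = \int[gamma]_x (1 + sin (- s * x))%:E)%E.
  rewrite !h.
  have m0 : measurable_fun setT (-%R : measurableTypeR R -> measurableTypeR R).
    exact: oppr_measurable.
  have nn : {in [set: measurableTypeR R], forall x,
      (0 <= ((1 + sin (- s * x)) * normal_pdf 0 1 x)%:E)%E}.
    move=> x _; rewrite lee_fin mulr_ge0 ?normal_pdf_ge0//.
  have e := @ge0_integral_pushforward _ _ _ _ R _ m0 mu setT _ measurableT (mf (- s)) nn.
  rewrite preimage_setT in e.
  transitivity (\int[pushforward mu (-%R : measurableTypeR R -> measurableTypeR R)]_x
      ((1 + sin (- s * x)) * normal_pdf 0 1 x)%:E)%E; last first.
    by apply: eq_measure_integral => A mA _; exact: lebesgue_measureN.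
  rewrite e; apply: eq_integral => x _ /=; rewrite mulNr mulrN opprK; congr (_ * _)%:E.
  by rewrite !normal_pdfE ?oner_eq0// /normal_fun !subr0 sqrrN.
have split (a : R) : (\int[gamma]_x (1 + sin (a * x))%:E =
    1 + \int[gamma]_x (sin (a * x))%:E)%E.
  have ia : gamma.-integrable setT (EFin \o (fun x : measurableTypeR R => sin (a * x))).
    apply: (@bounded_integrable _ _ _ gamma _ 1) => //; first exact: prob_lty.
      by mfun.
    by move=> x; exact: sin_max.
  under eq_integral do rewrite EFinD.
  rewrite integralD//; last exact: finite_measure_integrable_cst.
  by rewrite integral_cst// [X in (_ * X)%E]probability_setT mule1.
move: sym; rewrite !split.
have -> : (\int[gamma]_x (sin (- s * x))%:E = - \int[gamma]_x (sin (s * x))%:E)%E.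
  rewrite -integralN//; last exact: integrable_add_def.
  by apply: eq_integral => x _; rewrite mulNr sinN.
rewrite -(fineK (integrable_fin_num _ isin))// -!EFinN -!EFinD => -[] e.
by congr EFin; move: e; set v := fine _; lra.
Qed.

Lemma normal_cosD (s t : R) :
  (\int[gamma]_x (cos (s * x + t))%:E = (expR (- (s ^+ 2 / 2)) * cos t)%:E)%E.
Proof.
have i1 : gamma.-integrable setT (EFin \o (fun x : measurableTypeR R => cos (s * x))).
  apply: (@bounded_integrable _ _ _ gamma _ 1) => //; [exact: prob_lty|by mfun|].
  by move=> x; exact: cos_max.
have i2 : gamma.-integrable setT (EFin \o (fun x : measurableTypeR R => sin (s * x))).
  apply: (@bounded_integrable _ _ _ gamma _ 1) => //; [exact: prob_lty|by mfun|].
  by move=> x; exact: sin_max.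
under eq_integral do rewrite cosD EFinB !EFinM.
rewrite integralB//; [|exact: integrableZr|exact: integrableZr].
by rewrite !integralZr// normal_cos normal_sin mul0e sube0.
Qed.
End gauss_cos.

(** * Independence and the Cramer-Wold device *)

Section independence.
Context {R : realType} d (T : measurableType d) (P : probability T R).

(** The joint law of (U, Y) agrees with the product of the law of U by [nu] on rectangles, hence
    everywhere, and Tonelli concludes. This is the only form of conditioning in the proof: U is the
    past and Y the fresh variable. *)
Lemma freeze d1 (T1 : measurableType d1) d2 (T2 : measurableType d2)
    (nu : probability T2 R) (U : T -> T1) (Y : T -> T2) (f : T1 * T2 -> \bar R) :
  measurable_fun setT U -> measurable_fun setT Y ->
  (forall A B, measurable A -> measurable B ->
     P (U @^-1` A `&` Y @^-1` B) = (P (U @^-1` A) * nu B)%E) ->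
  measurable_fun setT f -> (forall z, (0 <= f z)%E) ->
  (\int[P]_w f (U w, Y w) = \int[P]_w \int[nu]_y f (U w, y))%E.
Proof.
move=> mU mY indep mf f0.
have mUY : measurable_fun setT (fun w => (U w, Y w)) by exact/measurable_fun_pair.
pose Um : {mfun T >-> T1} := HB.pack U (isMeasurableFun.Build _ _ _ _ _ mU).
pose UYm : {mfun T >-> (T1 * T2)%type} :=
  HB.pack (fun w => (U w, Y w)) (isMeasurableFun.Build _ _ _ _ _ mUY).
have E X : measurable X -> (distribution P Um \x nu)%E X = distribution P UYm X.
  move=> mX; exact: product_measure_unique.
rewrite -[LHS](@ge0_integral_distribution _ _ _ _ _ P UYm f)//.
rewrite (eq_measure_integral (distribution P Um \x nu)%E); last by move=> A mA _; first [exact: E|exact/esym/E].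
rewrite fubini_tonelli1//.
rewrite (@ge0_integral_distribution _ _ _ _ _ P Um)//.
- exact: measurable_fun_fubini_tonelli_F.
- by move=> x; exact: integral_ge0.
Qed.

(** The finite measures A -> P(A n B) and A -> P(A) P(B) agree on the pi-system [G] of finite
    intersections of events of the families indexed by J, hence on the sigma-algebra these
    generate. *)
Lemma mutual_indep_group (I : choiceType) (D J : set I) (F : I -> set (set T)) (j : I) :
  mutual_indep P D F -> (forall i, D i -> F i `<=` measurable) ->
  (forall i, D i -> F i setT) -> (forall i, D i -> setI_closed (F i)) ->
  J `<=` D -> D j -> ~ J j ->
  forall A B, <<s [set A | exists2 i, J i & F i A] >> A -> F j B ->
    P (A `&` B) = (P A * P B)%E.
Proof.
move=> mi mF FT FI JD Dj Jj A B sA FB.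
pose G : set (set T) := [set X | exists (K : {fset I}) (E : I -> set T),
   [/\ forall i, i \in K -> J i, forall i, J i -> F i (E i) &
    X = \bigcap_(i in [set` K]) E i]].
have GF (E : I -> set T) (i : I) : D i -> F i (E i) -> measurable (E i).
  by move=> Di; exact: mF.
have sub : <<s [set A | exists2 i, J i & F i A] >> `<=` <<s G >>.
  apply: smallest_sub; first exact: smallest_sigma_algebra.
  move=> X [i Ji FX]; apply: sub_sigma_algebra.
  exists [fset i]%fset, (fun k => if k == i then X else setT); split.
  - by move=> k; rewrite inE => /eqP ->.
  - by move=> k Jk; case: eqP => [->//|_]; apply: FT; exact: JD.
  - apply/seteqP; split => [x Xx k/=|x /(_ i)/=]; first by rewrite inE => ->.
    by rewrite inE eqxx; apply.
have mB : measurable B by exact: mF FB.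
have mG : G `<=` measurable.
  move=> X [K [E [KJ FE ->]]]; apply: fin_bigcap_measurable => //.
  by move=> i /= iK; apply: (GF E); [apply: JD; exact: KJ|apply: FE; exact: KJ].
have IG : setI_closed G.
  move=> _ _ [K1 [E1 [KJ1 FE1 ->]]] [K2 [E2 [KJ2 FE2 ->]]].
  exists (K1 `|` K2)%fset, (fun i => (if i \in K1 then E1 i else setT) `&`
     (if i \in K2 then E2 i else setT)); split.
  - by move=> i; rewrite inE => /orP[/KJ1|/KJ2].
  - move=> i Ji; have Di := JD _ Ji; apply: FI => //.
      by case: ifP => _; [exact: FE1|exact: FT].
    by case: ifP => _; [exact: FE2|exact: FT].
  - apply/seteqP; split => [x [h1 h2] i/= iK|x h].
      by split; case: ifPn => //= ?; [exact: h1|exact: h2].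
    split => i /= iK; have /= := h i; rewrite inE iK ?orbT => /(_ isT) [];
      by [].
pose p : {nonneg R} := NngNum (fine_ge0 (measure_ge0 P B)).
have PBE : (fine (P B))%:E = P B by rewrite fineK// fin_num_measure.
have PE X : measurable X -> (fine (P X))%:E = P X.
  by move=> mX; rewrite fineK// fin_num_measure.
have m12 X : G X -> mrestr P mB X = mscale p P X.
  move=> GX; have mX := mG _ GX; case: GX => K [E [KJ FE EX]].
  have jK : j \notin K by apply/negP => /KJ.
  rewrite /mrestr /mscale/=.
  have h1 := mi K E (fun i iK => conj (JD _ (KJ _ iK)) (FE _ (KJ _ iK))).
  have h2 := mi (j |` K)%fset (fun i => if i == j then B else E i).
  subst X; rewrite h1 {h1}.
  have -> : \bigcap_(i in [set` K]) E i `&` B =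
      \bigcap_(i in [set` (j |` K)%fset]) (if i == j then B else E i).
    apply/seteqP; split => [x [h hB] i/=|x h].
      rewrite !inE => /orP[/eqP->|iK]; first by rewrite eqxx.
      by case: eqP => // _; exact: h.
    split; last by have /= := h j; rewrite !inE eqxx/=; apply.
    move=> i /= iK; have /= := h i; rewrite !inE iK orbT => /(_ isT).
    by case: eqP => // ij; move: jK; rewrite -ij iK.
  rewrite h2.
    rewrite big_fsetU1//= eqxx EFinM PBE; congr (_ * _)%E; congr EFin.
    rewrite big_seq [RHS]big_seq; apply: eq_bigr => i iK.
    by case: eqP => // ij; move: jK; rewrite -ij iK.
  move=> i; rewrite !inE => /orP[/eqP->|iK]; first by rewrite eqxx.
  case: eqP => [->//|_]; split; [apply: JD; exact: KJ|apply: FE; exact: KJ].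
have h : mrestr P mB A = mscale p P A.
  apply: (g_sigma_algebra_measure_unique G mG (fun=> setT)) => //.
  - move=> _; exists fset0, (fun=> setT); split => //.
      by move=> i Ji; apply: FT; exact: JD.
    by apply/seteqP; split => // x _ i; rewrite /= inE.
  - by rewrite bigcup_const.
  - by move=> _; rewrite /= /mrestr setTI -PBE ltry.
  - exact: sub.
by move: h; rewrite /mrestr /mscale/= PBE muleC.
Qed.

Section cramer_wold.
Variables (I : choiceType) (D : set I) (V : I -> T -> R).
Hypothesis mV : forall i, measurable_fun setT (V i).
Hypothesis cosV : forall (s : seq I) (c : I -> R) (t : R), uniq s ->
  (forall i, i \in s -> D i) ->
  (\int[P]_w (cos (\sum_(i <- s) c i * V i w + t))%:E =
   (expR (- ((\sum_(i <- s) c i ^+ 2) / 2)) * cos t)%:E)%E.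

(** Coordinates move one at a time from the cosine to the indicators. The product formula for
    cosines splits W1 cos(s V_i + r) into two instances of the induction hypothesis, where V_i has
    joined the linear form; their sum is K cos(s V_i + r) integrated. Uniqueness of weighted laws
    then replaces the weight W1 by the constant K in front of the indicator of B_i. *)
Lemma indic_prod_cos (B : I -> set R) (s1 s2 : seq I) (c : I -> R) (t : R) :
  (forall i, measurable (B i)) -> uniq (s1 ++ s2) -> (forall i, i \in s1 ++ s2 -> D i) ->
  (\int[P]_w ((\prod_(i <- s1) \1_(B i) (V i w)) *
      cos (\sum_(i <- s2) c i * V i w + t))%:E =
   ((\prod_(i <- s1) fine (P (V i @^-1` B i))) *
    (expR (- ((\sum_(i <- s2) c i ^+ 2) / 2)) * cos t))%:E)%E.
Proof.
move=> mB; elim: s1 s2 c t => [|i s1 IH] s2 c t us Ds.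
  under eq_integral do rewrite big_nil mul1r.
  by rewrite big_nil mul1r; exact: cosV.
have mI (j : I) : measurable_fun setT (fun w => \1_(B j) (V j w) : R).
  by apply: measurableT_comp => //; exact: measurable_indic.
have mprod s : measurable_fun setT (fun w => \prod_(j <- s) \1_(B j) (V j w) : R).
  exact: measurable_prod.
have msum s (c' : I -> R) : measurable_fun setT (fun w => \sum_(j <- s) c' j * V j w).
  by apply: measurable_sum => j; exact: measurable_funM.
have bprod s w : `|\prod_(j <- s) \1_(B j) (V j w)| <= 1 :> R.
  elim: s => [|j s IHs]; first by rewrite big_nil normr1.
  rewrite big_cons normrM mulr_ile1 ?normr_ge0// indicE.
  by case: (_ \in _); rewrite ?normr0 ?normr1.
pose W1 w : R := (\prod_(j <- s1) \1_(B j) (V j w)) * cos (\sum_(j <- s2) c j * V j w + t).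
pose K : R := (\prod_(j <- s1) fine (P (V j @^-1` B j))) *
    (expR (- ((\sum_(j <- s2) c j ^+ 2) / 2)) * cos t).
have mW1 : measurable_fun setT W1 by apply: measurable_funM => //; mfun.
have W1b w : `|W1 w| <= 1 by rewrite normrM mulr_ile1 ?normr_ge0// cos_max.
have /and3P[inot us1 us2] : [&& i \notin s1 ++ s2, uniq (s1 ++ s2) & true].
  by move: us => /= /andP[-> ->].
have i1 : i \notin s1 by move: inot; rewrite mem_cat negb_or => /andP[].
have i2 : i \notin s2 by move: inot; rewrite mem_cat negb_or => /andP[].
have Di : D i by apply: Ds; rewrite inE eqxx.
have D12 j : j \in s1 ++ s2 -> D j by move=> h; apply: Ds; rewrite inE h orbT.
have uis : uniq (s1 ++ i :: s2).
  by rewrite uniq_catC/= mem_cat orbC -mem_cat inot uniq_catC.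
have Dis j : j \in s1 ++ i :: s2 -> D j.
  by rewrite mem_cat inE orbCA -mem_cat => h; exact: Ds.
(* The scalar e will be 1 or -1, the sign of the remaining linear form in the two terms of the
   product formula. *)
have sumE (s e : R) w : \sum_(j <- i :: s2) (if j == i then s else e * c j) * V j w =
    s * V i w + e * \sum_(j <- s2) c j * V j w.
  rewrite big_cons eqxx big_seq [in RHS]big_seq; congr (_ + _).
  rewrite mulr_sumr; apply: eq_bigr => j js.
  by case: eqP => [ji|_]; [move: i2; rewrite -ji js|rewrite mulrA].
have sqE (s e : R) : e ^+ 2 = 1 -> \sum_(j <- i :: s2) (if j == i then s else e * c j) ^+ 2 =
    s ^+ 2 + \sum_(j <- s2) c j ^+ 2.
  move=> e1; rewrite big_cons eqxx big_seq [in RHS]big_seq; congr (_ + _).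
  apply: eq_bigr => j js.
  by case: eqP => [ji|_]; [move: i2; rewrite -ji js|rewrite exprMn e1 mul1r].
have cos12 (s r : R) : (\int[P]_w (W1 w * cos (s * V i w + r))%:E =
    \int[P]_w (K * cos (s * V i w + r))%:E)%E.
  have E w : W1 w * cos (s * V i w + r) = 2^-1 *
      ((\prod_(j <- s1) \1_(B j) (V j w)) *
         cos (\sum_(j <- i :: s2) (if j == i then s else 1 * c j) * V j w + (t + r)))
    + 2^-1 * ((\prod_(j <- s1) \1_(B j) (V j w)) *
         cos (\sum_(j <- i :: s2) (if j == i then s else (-1) * c j) * V j w + (r - t))).
    rewrite !sumE /W1; set S := \sum_(j <- s2) _; set a := s * V i w.
    have -> : a + 1 * S + (t + r) = (S + t) + (a + r) by ring.
    have -> : a + -1 * S + (r - t) = (a + r) - (S + t) by ring.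
    by move: (S + t) (a + r) => x y; rewrite cosB cosD; field.
  have intb (s' : seq I) c' (r' : R) : P.-integrable setT (EFin \o (fun w =>
     2^-1 * ((\prod_(j <- s1) \1_(B j) (V j w)) * cos (\sum_(j <- s') c' j * V j w + r')))).
    apply: (@bounded_integrable _ _ _ P _ 1); first exact: prob_lty.
      apply: measurable_funM => //; apply: measurable_funM => //.
      have hm := msum s' c'; by mfun.
    move=> w; rewrite normrM mulr_ile1 ?normr_ge0//.
      by rewrite ger0_norm ?invr_ge0// invf_le1// ler1n.
    by rewrite normrM mulr_ile1 ?normr_ge0// cos_max.
  under eq_integral do rewrite E EFinD.
  rewrite integralD//; [|exact: intb|exact: intb].
  have intb' (s' : seq I) c' (r' : R) : P.-integrable setT (EFin \o (fun w =>
     ((\prod_(j <- s1) \1_(B j) (V j w)) * cos (\sum_(j <- s') c' j * V j w + r')))).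
    apply: (@bounded_integrable _ _ _ P _ 1); first exact: prob_lty.
      apply: measurable_funM => //.
      have hm := msum s' c'; by mfun.
    by move=> w; rewrite normrM mulr_ile1 ?normr_ge0// cos_max.
  under eq_integral do rewrite EFinM.
  rewrite integralZl//; last exact: intb'.
  under [X in (_ + X)%E]eq_integral do rewrite EFinM.
  rewrite integralZl//; last exact: intb'.
  rewrite !IH// !sqE ?sqrrN ?expr1n//.
  have h := @cosV [:: i] (fun=> s) r isT _.
  under [RHS]eq_integral do rewrite EFinM.
  rewrite integralZl//; last first.
    apply: (@bounded_integrable _ _ _ P _ 1); first exact: prob_lty.
      have hm := mV i; by mfun.
    by move=> w; exact: cos_max.
  under [X in (_ = _ * X)%E]eq_integral => w _.
    rewrite (_ : s * V i w + r = \sum_(j <- [:: i]) s * V j w + r); last by rewrite big_seq1.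
    over.
  rewrite h; last by move=> j; rewrite inE => /eqP ->.
  rewrite big_seq1 -!EFinM -EFinD; congr EFin; rewrite /K.
  by rewrite mulrDl opprD expRD cosD cosB; field.
have U := @weighted_law_unique _ _ _ P W1 (V i) 1 _ _ P (cst K) (V i) `|K|
  mW1 (mV i) W1b (measurable_cst _) (mV i) (fun=> lexx _) cos12 _ (mB i).
transitivity (\int[P]_w (W1 w * \1_(B i) (V i w))%:E)%E.
  by apply: eq_integral => w _; rewrite big_cons /W1; congr EFin; ring.
rewrite U; transitivity (\int[P]_w (K%:E * (\1_(V i @^-1` B i) w)%:E))%E.
  by apply: eq_integral => w _; rewrite -EFinM.
have mVB : measurable (V i @^-1` B i) by rewrite -[X in measurable X]setTI; exact: mV.
rewrite integralZl//; last exact: integrable_indic.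
rewrite integral_indic// setIT -[X in (_ * X)%E]fineK ?fin_num_measure// -EFinM.
by rewrite big_cons /K; congr EFin; ring.
Qed.

Lemma sigma_of_preimage (Y : T -> R) (A : set T) :
  sigma_of (fun _ : unit => Y) A -> exists2 B : set R, measurable B & A = Y @^-1` B.
Proof.
have : sigma_of (fun _ : unit => Y) `<=` preimage_set_system setT Y measurable.
  apply: smallest_sub.
    by apply: sigma_algebra_preimage; exact: sigma_algebra_measurable.
  by move=> _ [_ [B mB ->]]; exists B => //; rewrite setTI.
by move=> /[apply] -[B mB <-]; exists B => //; rewrite setTI.
Qed.

Lemma cos_law i : D i -> has_law P (V i) (normal_law 1).
Proof.
move=> Di B mB; rewrite /normal_law oner_eq0.
have mVB : measurable (V i @^-1` B) by rewrite -[X in measurable X]setTI; exact: mV.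
have cos12 (s r : R) : (\int[P]_w (1 * cos (s * V i w + r))%:E =
    \int[normal_prob 0 1]_x (1 * cos (s * x + r))%:E)%E.
  under eq_integral do rewrite mul1r; under [RHS]eq_integral do rewrite mul1r.
  rewrite normal_cosD.
  have := @cosV [:: i] (fun=> s) r isT; rewrite big_seq1.
  move=> <-; first by apply: eq_integral => w _; rewrite big_seq1.
  by move=> j; rewrite inE => /eqP ->.
have n1 (S : Type) (x : S) : `|cst (1 : R) x| <= 1 by rewrite normr1.
have := @weighted_law_unique _ _ _ P (cst 1) (V i) 1 _ _ (@normal_prob R 0 1) (cst 1) id 1
  (measurable_cst _) (mV i) (@n1 _) (measurable_cst _) (@measurable_id _ _ _) (@n1 _) cos12 _ mB.
move=> h; transitivity (\int[P]_w (\1_(V i @^-1` B) w)%:E)%E.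
  by rewrite integral_indic// setIT.
transitivity (\int[P]_w (cst 1 w * \1_B (V i w))%:E)%E.
  by apply: eq_integral => w _; rewrite mul1r.
rewrite h -[in RHS](setIT B) -integral_indic//.
by apply: eq_integral => w _; rewrite mul1r.
Qed.

(** The case of an empty linear form in [indic_prod_cos]: each event is a preimage of a Borel set B
    i, and the product of the indicators is the indicator of the intersection. *)
Lemma cos_mutual_indep : mutual_indep P D (fun i => sigma_of (fun _ : unit => V i)).
Proof.
move=> J A JA.
have /choice[B BP] : forall i, exists B : set R, measurable B /\ (i \in J -> A i = V i @^-1` B).
  move=> i; have [iJ|iJ] := boolP (i \in J); last by exists setT.
  by have [_ /sigma_of_preimage[B mB ->]] := JA _ iJ; exists B.
have mB i : measurable (B i) by have [] := BP i.
have := @indic_prod_cos B (enum_fset J) [::] (fun=> 0) 0 mB.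
rewrite cats0 => /(_ (fset_uniq _)) H.
have {}H : (\int[P]_w (\prod_(i <- J) \1_(B i) (V i w))%:E =
    (\prod_(i <- J) fine (P (V i @^-1` B i)))%:E)%E.
  rewrite big_nil mul0r oppr0 expR0 cos0 !mulr1 in H.
  rewrite -H; first by apply: eq_integral => w _; rewrite big_nil addr0 cos0 mulr1.
  by move=> i iJ; have [] := JA _ iJ.
transitivity (\int[P]_w (\1_(\bigcap_(i in [set` J]) A i) w)%:E)%E.
  rewrite integral_indic ?setIT//; apply: fin_bigcap_measurable => // i /= iJ.
  have [_ ->] := BP i; rewrite // -[X in measurable X]setTI; exact: mV.
transitivity (\int[P]_w (\prod_(i <- J) \1_(B i) (V i w))%:E)%E; last first.
  rewrite H; congr EFin; rewrite big_seq [RHS]big_seq; apply: eq_bigr => i iJ.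
  by have [_ ->] := BP i.
apply: eq_integral => w _; congr EFin; rewrite indicE.
have [Aw|Aw] := pselect ((\bigcap_(i in [set` J]) A i) w).
  rewrite mem_set// big_seq big1// => i iJ; rewrite indicE mem_set//.
  by have := Aw i iJ; have [_ ->] := BP i.
rewrite memNset//; apply/esym/eqP; rewrite prodf_seq_eq0.
apply: contra_notT Aw => /hasPn/= h i /= iJ; have := h i iJ.
rewrite indicE; case: (boolP (_ \in _)) => [/set_mem ? _|]; last by rewrite eqxx.
by have [_ ->] := BP i.
Qed.

End cramer_wold.

End independence.

Lemma measurable_invr {R : realType} : measurable_fun setT (fun x : R => x^-1).
Proof.
rewrite -(setUv [set (0 : R)]); apply/measurable_funU => //; first exact: measurableC.
split; first exact: measurable_fun_set1.
apply: open_continuous_measurable_fun.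
  by rewrite openC; exact: closed_eq.
by move=> x /set_mem/= /eqP x0; exact: inv_continuous.
Qed.

(** * Gaussian chaos conditionally on a history *)

Section history.
Context {R : realType} d (T : measurableType d) (P : probability T R).
Context (I : choiceType) (V : I -> T -> R).

Definition hist_gen (J : set I) : set (set T) :=
  [set A | exists2 i, J i & sigma_of (fun _ : unit => V i) A].

(* T with the sigma-algebra generated by the V i, i in J: measurability with respect to the past. *)
Definition hist (J : set I) := g_sigma_algebraType (hist_gen J).

Lemma hist_measurable (J : set I) i : J i ->
  measurable_fun setT (V i : hist J -> R).
Proof.
move=> Ji _ B mB; rewrite setTI; apply: sub_sigma_algebra; exists i => //.
by apply: sub_sigma_algebra; exists tt, B.
Qed.

Hypothesis mV : forall i, measurable_fun setT (V i).

Lemma sigma_of_measurable i : sigma_of (fun _ : unit => V i) `<=` measurable.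
Proof.
apply: smallest_sub; first exact: sigma_algebra_measurable.
by move=> _ [_ [B mB ->]]; rewrite -[X in measurable X]setTI; exact: mV.
Qed.

Lemma hist_id_measurable (J : set I) : measurable_fun setT (id : T -> hist J).
Proof.
move=> _ A sA; rewrite setTI preimage_id; move: A sA.
apply: smallest_sub; first exact: sigma_algebra_measurable.
by move=> A [i _] /sigma_of_measurable.
Qed.

Lemma hist_sub (J K : set I) (h : T -> R) : J `<=` K ->
  measurable_fun setT (h : hist J -> R) -> measurable_fun setT (h : hist K -> R).
Proof.
move=> JK mh _ B mB; have := mh measurableT B mB; move: (_ `&` _).
apply: smallest_sub; first exact: smallest_sigma_algebra.
by move=> A [i Ji ?]; apply: sub_sigma_algebra; exists i => //; exact: JK.
Qed.

Lemma hist_meas d2 (T2 : measurableType d2) (J : set I) (h : T -> T2) :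
  measurable_fun setT (h : hist J -> T2) -> measurable_fun setT h.
Proof. by move=> mh; exact: (measurableT_comp mh (@hist_id_measurable J)). Qed.

Hypothesis (D : set I) (mi : mutual_indep P D (fun i => sigma_of (fun _ : unit => V i))).
Hypothesis lawV : forall i, D i -> has_law P (V i) (normal_law 1).

(** This is [freeze] with U the identity map into [hist J]: any functional of the past is held fixed
    while V i, outside J, is integrated against the normal law. *)
Lemma hist_freeze (J : set I) (i : I) (f : hist J * measurableTypeR R -> \bar R) :
  J `<=` D -> D i -> ~ J i -> measurable_fun setT f -> (forall z, (0 <= f z)%E) ->
  (\int[P]_w f (w, V i w) = \int[P]_w \int[normal_prob 0 1]_y f (w, y))%E.
Proof.
move=> JD Di Ji mf f0.
apply: (@freeze _ _ _ P _ (hist J) _ (measurableTypeR R) (@normal_prob R 0 1) (id : T -> hist J) (V i) f) => //.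
- exact: hist_id_measurable.
- exact: mV.
- move=> A B mA mB; rewrite preimage_id.
  transitivity (P A * P (V i @^-1` B))%E; last first.
    by congr (_ * _)%E; have := lawV Di mB; rewrite /normal_law oner_eq0.
  apply: (mutual_indep_group mi) JD Di Ji _ _ mA _.
  + by move=> k _; exact: sigma_of_measurable.
  + by move=> k _; apply: sub_sigma_algebra; exists tt, setT.
  + move=> k _ X Y /sigma_of_preimage[BX mBX ->] /sigma_of_preimage[BY mBY ->].
    rewrite -preimage_setI; apply: sub_sigma_algebra.
    by exists tt, (BX `&` BY) => //; exact: measurableI.
  + by apply: sub_sigma_algebra; exists tt, B.
Qed.

End history.

Section qform.
Context {R : realType}.

Definition qf (m : nat) (B : nat -> nat -> R) (x : nat -> R) : R :=
  \sum_(a < m) \sum_(b < m) B a b * x a * x b.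

Lemma qfS m B x : (forall a b, B a b = B b a) ->
  qf m.+1 B x = qf m B x + 2 * x m * (\sum_(a < m) B a m * x a) + B m m * x m ^+ 2.
Proof.
move=> sB; rewrite /qf big_ord_recr/=.
under eq_bigr do rewrite big_ord_recr/=.
rewrite big_split/= big_ord_recr/= -!addrA; congr (_ + _); rewrite expr2 !addrA.
congr (_ + _); last by rewrite mulrA.
rewrite [X in X + _](eq_bigr (fun a : 'I_m => x m * (B a m * x a))) => [|a _]; last ring.
rewrite [X in _ + X = _](eq_bigr (fun a : 'I_m => x m * (B a m * x a))) => [|a _]; last first.
  by rewrite (sB m a); ring.
by rewrite -mulr_sumr; ring.
Qed.

(** With b = B m m and S = sum_a B a m x_a, integrating exp(b y^2 / 2 + S y) over y produces exp(S^2
    / (2 (1 - b))), hence the rank-one correction. In matrix terms, Id - [schur] is the Schur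
    complement of the last diagonal entry in Id - B. *)
Definition schur (m : nat) (B : nat -> nat -> R) : nat -> nat -> R :=
  fun a b => B a b + B a m * B b m / (1 - B m m).

Lemma qf_schur m B x :
  qf m (schur m B) x = qf m B x + (\sum_(a < m) B a m * x a) ^+ 2 / (1 - B m m).
Proof.
rewrite /qf expr2 mulr_suml mulr_suml -big_split; apply: eq_bigr => a _ /=.
rewrite mulr_sumr mulr_suml -big_split; apply: eq_bigr => b _ /=.
by rewrite /schur; ring.
Qed.

Definition half_psd (m : nat) (B : nat -> nat -> R) : Prop :=
  (forall a b, B a b = B b a) /\
  forall x, 0 <= qf m B x <= 2^-1 * \sum_(a < m) x a ^+ 2.

Lemma half_psd_diag m B : half_psd m.+1 B -> 0 <= B m m <= 2^-1.
Proof.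
move=> [sB /(_ (fun a => (a == m)%:R))].
rewrite qfS// /qf eqxx big1 => [|a _]; last first.
  by rewrite big1// => b _; rewrite (ltn_eqF (ltn_ord a)) mulr0 mul0r.
rewrite big1 => [|a _]; last by rewrite (ltn_eqF (ltn_ord a)) mulr0.
rewrite big_ord_recr/= eqxx big1 => [|a _]; last first.
  by rewrite (ltn_eqF (ltn_ord a)) expr0n.
by rewrite mulr0 expr1n !add0r !mulr1.
Qed.

(** The last diagonal entry of B^2 <= B / 2, obtained without a square root of B: the lower bound is
    tested on e_m - 2 B e_m and the upper bound on B e_m. *)
Lemma half_psd_col m B : half_psd m.+1 B ->
  \sum_(a < m) B a m ^+ 2 <= 2^-1 * B m m - B m m ^+ 2.
Proof.
move=> [sB pB]; set b := B m m; set c := \sum_(a < m) _.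
have /andP[_] := pB (fun a => B a m); rewrite qfS// big_ord_recr/= -/b.
have /andP[+ _] := pB (fun a => if a == m then 1 - 2 * b else -2 * B a m).
rewrite qfS// eqxx -/b.
have -> : \sum_(a < m) B a m * (if nat_of_ord a == m then 1 - 2 * b else -2 * B a m) =
    - 2 * c.
  rewrite mulr_sumr; apply: eq_bigr => a _.
  by rewrite (ltn_eqF (ltn_ord a)) expr2; ring.
have -> : qf m B (fun a => if a == m then 1 - 2 * b else -2 * B a m) =
    4 * qf m B (fun a => B a m).
  rewrite /qf mulr_sumr; apply: eq_bigr => a _; rewrite mulr_sumr; apply: eq_bigr => e _.
  by rewrite !(ltn_eqF (ltn_ord _)); ring.
have -> : \sum_(a < m) B a m * B a m = c by apply: eq_bigr => a _; rewrite expr2.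
by rewrite -/c; set q := qf _ _ _; nra.
Qed.

Lemma half_psd_schur m B : half_psd m.+1 B -> half_psd m (schur m B).
Proof.
move=> hB; have /andP[b0 b1] := half_psd_diag hB.
have nb : 1 - B m m != 0 by rewrite gt_eqF//; lra.
have ib : 0 < (1 - B m m)^-1 by rewrite invr_gt0; lra.
case: hB => sB pB; split; first by move=> a b; rewrite /schur sB mulrAC [B b m * _]mulrC mulrAC.
move=> x; rewrite qf_schur; set s := \sum_(a < m) _.
apply/andP; split.
  rewrite addr_ge0//; last by rewrite mulr_ge0 ?sqr_ge0// ltW.
  have /andP[+ _] := pB (fun a => if a == m then 0 else x a).
  rewrite qfS// eqxx mulr0 mul0r expr0n/= mulr0 !addr0 /qf.
  congr (_ <= _); apply: eq_bigr => a _; apply: eq_bigr => e _.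
  by rewrite !(ltn_eqF (ltn_ord _)).
(* The last coordinate s / (1 - b) maximizes 2 s y - (1 - b) y^2, and the maximum s^2 / (1 - b) is
   the term added by [schur]. *)
have /andP[_] := pB (fun a => if a == m then s / (1 - B m m) else x a).
rewrite qfS// eqxx big_ord_recr/= eqxx.
have -> : qf m B (fun a => if a == m then s / (1 - B m m) else x a) = qf m B x.
  by apply: eq_bigr => a _; apply: eq_bigr => e _; rewrite !(ltn_eqF (ltn_ord _)).
rewrite [X in 2 * _ * X](eq_bigr (fun a : 'I_m => B a m * x a)) => [|a _]; last first.
  by rewrite (ltn_eqF (ltn_ord a)).
rewrite [X in 2^-1 * (X + _)](eq_bigr (fun a : 'I_m => x a ^+ 2)) => [|a _]; last first.
  by rewrite (ltn_eqF (ltn_ord a)).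
rewrite -/s; set q := qf _ _ _; set n := \sum_(_ < _) _.
have -> : q + 2 * (s / (1 - B m m)) * s + B m m * (s / (1 - B m m)) ^+ 2 =
   q + s ^+ 2 / (1 - B m m) + (s / (1 - B m m)) ^+ 2 by field.
have := sqr_ge0 (s / (1 - B m m)); lra.
Qed.

End qform.

Section gauss_chaos.
Context {R : realType} d (T : measurableType d) (P : probability T R).
Context (I : choiceType) (V : I -> T -> R) (D J : set I).
Hypothesis mV : forall i, measurable_fun setT (V i).
Hypothesis (mi : mutual_indep P D (fun i => sigma_of (fun _ : unit => V i))).
Hypothesis lawV : forall i, D i -> has_law P (V i) (normal_law 1).
Hypothesis JD : J `<=` D.

(** Induction from the last coordinate to the first. Removing coordinate m releases 2 b from twice
    the trace, b = B m m: one b pays for the normalization (1 - b)^(-1/2) <= exp(b), the other for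
    the increase c / (1 - b) of the trace under [schur], since 2 c / (1 - b) <= b by
    [half_psd_col]. *)
Lemma integral_chaos (z : nat -> I) (m : nat) (B : nat -> nat -> T -> R) :
  (forall a, (a < m)%N -> D (z a) /\ ~ J (z a)) ->
  (forall a b, (a < m)%N -> (b < m)%N -> z a = z b -> a = b) ->
  (forall a b, measurable_fun setT (B a b : hist V J -> R)) ->
  (forall w, half_psd m (fun a b => B a b w)) ->
  (\int[P]_w (expR (2^-1 * qf m (fun a b => B a b w) (fun a => V (z a) w)
     - 2 * \sum_(a < m) B a a w))%:E <= 1)%E.
Proof.
elim: m B => [|m IH] B zJ zi mB pB.
  under eq_integral do rewrite /qf !big_ord0 !mulr0 subrr expR0.
  by rewrite integral_cst// mul1e; exact: probability_le1.
(* While coordinate z m is integrated, the past consists of J and of the coordinates z a with a <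
   m. *)
pose J' : set I := [set i | J i \/ exists2 a, (a < m)%N & i = z a].
have J'D : J' `<=` D.
  by move=> i [/JD//|[a am ->]]; have [] := zJ a (ltnW am).
have J'm : ~ J' (z m).
  move=> [h|[a am e]]; first by have [_] := zJ m (ltnSn m).
  by have := zi m a (ltnSn m) (ltnW am) e => e'; move: am; rewrite e' ltnn.
have mBJ a b : measurable_fun setT (B a b : hist V J' -> R).
  by apply: hist_sub (mB a b) => i; left.
have mVJ a : (a < m)%N -> measurable_fun setT (V (z a) : hist V J' -> R).
  by move=> am; apply: hist_measurable; right; exists a.
pose Q w := qf m (fun a b => B a b w) (fun a => V (z a) w).
pose S w := \sum_(a < m) B a m w * V (z a) w.
pose tr w := \sum_(a < m) B a a w.
have mQ : measurable_fun setT (Q : hist V J' -> R).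
  apply: measurable_sum => a; apply: measurable_sum => b.
  by apply: measurable_funM; [apply: measurable_funM => //|]; exact: mVJ.
have mS : measurable_fun setT (S : hist V J' -> R).
  by apply: measurable_sum => a; apply: measurable_funM => //; exact: mVJ.
have mtr : measurable_fun setT (tr : hist V J' -> R).
  by apply: measurable_sum => a.
pose f (p : hist V J' * measurableTypeR R) : \bar R :=
  (expR (2^-1 * Q p.1 - 2 * (tr p.1 + B m m p.1)) *
   expR (B m m p.1 * p.2 ^+ 2 / 2 + S p.1 * p.2))%:E.
have mf : measurable_fun setT f.
  have m1 (h : hist V J' -> R) : measurable_fun setT h ->
      measurable_fun setT (fun p : hist V J' * measurableTypeR R => h p.1).
    by move=> mh; exact: measurableT_comp mh measurable_fst.
  have mQ1 := m1 _ mQ; have mS1 := m1 _ mS; have mt1 := m1 _ mtr.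
  have mB1 := m1 _ (mBJ m m).
  have m2 : measurable_fun setT (fun p : hist V J' * measurableTypeR R => p.2 : R).
    exact: measurable_snd.
  by apply/measurable_EFinP; mfun.
have f0 p : (0 <= f p)%E by rewrite lee_fin mulr_ge0// expR_ge0.
have [Dzm _] := zJ m (ltnSn m).
have e1 : (\int[P]_w (expR (2^-1 * qf m.+1 (fun a b => B a b w) (fun a => V (z a) w)
     - 2 * \sum_(a < m.+1) B a a w))%:E = \int[P]_w f (w, V (z m) w))%E.
  apply: eq_integral => w _; rewrite /f/= -expRD; congr ((expR _)%:E).
  have [sB _] := pB w; rewrite qfS// big_ord_recr/= -/(Q w) -/(S w) -/(tr w).
  by field.
have msch a b : measurable_fun setT
    ((fun w => schur m (fun a b => B a b w) a b) : hist V J -> R).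
  rewrite /schur; apply: measurable_funD => //.
  apply: measurable_funM; first exact: measurable_funM.
  by apply: (measurableT_comp (@measurable_invr _)); exact: measurable_funB.
rewrite e1 (hist_freeze mV mi lawV J'D Dzm J'm mf f0).
apply: le_trans (IH (fun a b w => schur m (fun a b => B a b w) a b) _ _ _ _); last first.
- by move=> w; exact: half_psd_schur.
- exact: msch.
- by move=> a b am bm; apply: zi; exact: ltnW.
- by move=> a am; apply: zJ; exact: ltnW.
apply: ge0_le_integral => //.
- by move=> w _; exact: integral_ge0.
- apply: (hist_meas mV (J := J')).
  exact: (@measurable_fun_fubini_tonelli_F _ _ _ _ _ (@normal_prob R 0 1) f mf f0).
- have mschT a b := hist_meas mV (msch a b).
  apply/measurable_EFinP; apply: (measurableT_comp (@measurable_expR _)).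
  apply: measurable_funB; apply: measurable_funM => //.
    apply: measurable_sum => a; apply: measurable_sum => b.
    by apply: measurable_funM => //; exact: measurable_funM.
  exact: measurable_sum.
move=> w _; have /andP[b0 b1] := half_psd_diag (pB w).
have bc := half_psd_col (pB w); set b := B m m w in b0 b1 bc.
rewrite /f/=; under eq_integral do rewrite EFinM.
rewrite ge0_integralZl//; last by apply/measurable_EFinP; mfun.
rewrite integral_normal_expR; last by rewrite -/b; lra.
rewrite qf_schur -/(Q w) -/(S w) -/b -EFinM lee_fin.
have b1' : 0 < 1 - b by lra.
set c := \sum_(_ < m) _ in bc.
have -> : \sum_(a < m) schur m (fun a b => B a b w) a a = tr w + c / (1 - b).
  by rewrite /schur big_split/= -/b mulr_suml; congr (_ + _); apply: eq_bigr => a _; rewrite expr2.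
(* Comes from exp(b) >= 1 + b and (1 - b)(1 + b)^2 >= 1, valid for 0 <= b <= 1/2. *)
have h1 : (Num.sqrt (1 - b))^-1 <= expR b.
  rewrite -[leRHS]invrK -expRN lef_pV2 ?posrE ?sqrtr_gt0 ?expR_gt0//.
  rewrite -(@ler_sqr R) ?nnegrE ?expR_ge0 ?sqrtr_ge0// sqr_sqrtr; last exact: ltW.
  rewrite expRN exprVn -[leLHS]mul1r ler_pdivrMr ?exprn_gt0 ?expR_gt0//.
  have e1b : (1 + b) ^+ 2 <= expR b ^+ 2.
    by rewrite ler_sqr ?nnegrE ?expR_ge0 ?expR_ge1Dx//; lra.
  by have := ler_wpM2l (ltW b1') e1b; nra.
apply: (@le_trans _ _ (expR (2^-1 * Q w - 2 * (tr w + b)) *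
   (expR b * expR (S w ^+ 2 / (2 * (1 - b)))))).
  by rewrite ler_wpM2l ?expR_ge0// ler_wpM2r ?expR_ge0.
rewrite -!expRD ler_expR.
have : 2 * (c / (1 - b)) <= b.
  by rewrite mulrA ler_pdivrMr//; nra.
have -> : S w ^+ 2 / (2 * (1 - b)) = 2^-1 * (S w ^+ 2 / (1 - b)).
  by field; rewrite gt_eqF.
lra.
Qed.

(* E exp(<B z, z> / 2 - 2 Tr B) <= 1: integrating out the last coordinate replaces B by its [schur]
   complement, which is again between 0 and 1/2. *)
Lemma chaos_tail (z : nat -> I) (m : nat) (B : nat -> nat -> T -> R) (t : R) :
  (forall a, (a < m)%N -> D (z a) /\ ~ J (z a)) ->
  (forall a b, (a < m)%N -> (b < m)%N -> z a = z b -> a = b) ->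
  (forall a b, measurable_fun setT (B a b : hist V J -> R)) ->
  (forall w, half_psd m (fun a b => B a b w)) ->
  exists A : set T, [/\ measurable A, ((1 - expR (- t))%:E <= P A)%E &
    forall w, A w -> 2^-1 * qf m (fun a b => B a b w) (fun a => V (z a) w) <=
      2 * \sum_(a < m) B a a w + t].
Proof.
move=> zJ zi mB pB.
pose X w := 2^-1 * qf m (fun a b => B a b w) (fun a => V (z a) w) - 2 * \sum_(a < m) B a a w.
have mBT a b := hist_meas mV (mB a b).
have mX : measurable_fun setT X.
  apply: measurable_funB; apply: measurable_funM => //.
    apply: measurable_sum => a; apply: measurable_sum => b.
    by apply: measurable_funM => //; exact: measurable_funM.
  exact: measurable_sum.
have mA : measurable [set w | X w <= t].
  rewrite -[X in measurable X]setTI; have := mX measurableT `]-oo, t]%classic (measurable_itv _).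
  by congr (measurable (_ `&` _)); apply/seteqP; split => w /=; rewrite in_itv.
exists [set w | X w <= t]; split => //; last by move=> w; rewrite /= /X lerBlDl.
have mC := measurableC mA.
(* Markov's inequality for exp(X), whose expectation is at most 1. *)
have h : (P (~` [set w | (X w <= t)%R]) <= (expR (- t))%:E)%E.
  have := integral_chaos zJ zi mB pB => h.
  rewrite -[leRHS]mule1 -[leLHS]mul1e -[in leLHS](@expR0 R) -(addNr t) expRD EFinM -muleA.
  rewrite lee_wpmul2l ?lee_fin ?expR_ge0//; apply: le_trans h.
  rewrite -[X in P X]setIT -integral_indic// -ge0_integralZl//; last exact/measurable_EFinP/measurable_indic.
  apply: ge0_le_integral => //.
  - by apply: measurable_funeM; exact/measurable_EFinP/measurable_indic.
  - by apply/measurable_EFinP; exact: (measurableT_comp (@measurable_expR _)).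
  - move=> w _; rewrite -EFinM lee_fin indicE.
    case: (boolP (_ \in _)) => [/set_mem/= /negP|_]; last by rewrite mulr0 expR_ge0.
    by rewrite -ltNge mulr1 ler_expR => /ltW.
rewrite -[X in P X]setCK probability_setC//.
by rewrite EFinB leeB.
Qed.

End gauss_chaos.

(** * Square-summable sequences and the eigenbasis *)

Section l2.
Context {R : realType}.
Implicit Types x y z : R^nat.

(* An inductive type rather than a definition, so that unification does not unfold it. *)
Variant l2 x : Prop := L2 of cvgn (series (fun j => x j ^+ 2)).

Lemma l2_cvg x : l2 x -> cvgn (series (fun j => x j ^+ 2)). Proof. by case. Qed.

Lemma nneg_cvg_series (u : R^nat) (M : R) : (forall j, 0 <= u j) ->
  (forall n, \sum_(j < n) u j <= M) -> cvgn (series u).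
Proof.
move=> u0 uM; apply: nondecreasing_is_cvgn.
  apply/nondecreasing_seqP => n; rewrite /series/= big_nat_recr//= lerDl//.
by exists M => _ [n _ <-]; rewrite /series/= big_mkord.
Qed.

Lemma nneg_sum_le_lim (u : R^nat) n : (forall j, 0 <= u j) -> cvgn (series u) ->
  \sum_(j < n) u j <= limn (series u).
Proof.
move=> u0 cu; rewrite -(big_mkord xpredT u).
apply: (nondecreasing_cvgn_le _ cu); apply/nondecreasing_seqP => m.
by rewrite /series/= big_nat_recr//= lerDl.
Qed.

Lemma limn_series_le (u : R^nat) (M : R) : cvgn (series u) ->
  (forall n, \sum_(j < n) u j <= M) -> limn (series u) <= M.
Proof.
move=> cu uM; apply: limr_le => //; apply: nearW => n.
by rewrite /series/= big_mkord.
Qed.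

Lemma l2_mul_abs x y : l2 x -> l2 y -> cvgn (series (fun j => `|x j * y j|)).
Proof.
move=> [lx] [ly]; apply: (@nneg_cvg_series _ (limn (series (fun j => x j ^+ 2)) +
   limn (series (fun j => y j ^+ 2)))) => [j|n]; first exact: normr_ge0.
apply: (@le_trans _ _ (\sum_(j < n) (x j ^+ 2 + y j ^+ 2))).
  apply: ler_sum => j _; rewrite normrM -[x j ^+ 2]real_normK ?num_real//.
  rewrite -[y j ^+ 2]real_normK ?num_real//.
  have := sqr_ge0 (`|x j| - `|y j|); have := normr_ge0 (x j); have := normr_ge0 (y j); nra.
rewrite big_split; apply: lerD.
  by apply: (@nneg_sum_le_lim (fun j => x j ^+ 2)) => // j; exact: sqr_ge0.
by apply: (@nneg_sum_le_lim (fun j => y j ^+ 2)) => // j; exact: sqr_ge0.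
Qed.

Lemma l2_mul x y : l2 x -> l2 y -> cvgn (series (fun j => x j * y j)).
Proof. by move=> lx ly; apply: normed_cvg; exact: l2_mul_abs. Qed.

Lemma dot_cvg x y : l2 x -> l2 y ->
  \sum_(j < n) x j * y j @[n --> \oo] --> dot x y.
Proof.
move=> lx ly; have := l2_mul lx ly; rewrite /dot /series/=.
by under eq_fun do rewrite big_mkord; under [in X in _ -> X]eq_fun do [].
Qed.

Lemma l2_bound x (M : R) : (forall n, \sum_(j < n) x j ^+ 2 <= M) -> l2 x.
Proof. by move=> h; constructor; apply: (nneg_cvg_series _ h) => j; exact: sqr_ge0. Qed.

Lemma sum_sqr_le_dot x n : l2 x -> \sum_(j < n) x j ^+ 2 <= dot x x.
Proof.
move=> [lx]; have -> : dot x x = limn (series (fun j => x j ^+ 2)) by [].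
by apply: (@nneg_sum_le_lim (fun j => x j ^+ 2)) => // j; exact: sqr_ge0.
Qed.

Lemma dot_le x (M : R) : (forall n, \sum_(j < n) x j ^+ 2 <= M) -> dot x x <= M.
Proof.
move=> xM; have -> : dot x x = limn (series (fun j => x j ^+ 2)) by [].
by apply: limn_series_le => //; exact/l2_cvg/(l2_bound xM).
Qed.

Lemma l2D x y : l2 x -> l2 y -> l2 (x \+ y).
Proof.
move=> lx ly; apply: (@l2_bound _ (2 * dot x x + 2 * dot y y)) => n.
apply: (@le_trans _ _ (2 * (\sum_(j < n) x j ^+ 2) + 2 * (\sum_(j < n) y j ^+ 2))).
  rewrite !mulr_sumr -big_split; apply: ler_sum => j _ /=.
  have := sqr_ge0 (x j - y j); nra.
by rewrite lerD// ler_wpM2l// sum_sqr_le_dot.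
Qed.

Lemma l2Z a x : l2 x -> l2 (a \*o x).
Proof.
move=> lx; apply: (@l2_bound _ (a ^+ 2 * dot x x)) => n.
under eq_bigr do rewrite /= exprMn; rewrite -mulr_sumr.
by rewrite ler_wpM2l ?sqr_ge0// sum_sqr_le_dot.
Qed.

Lemma l2_le x y (M : R) : l2 x -> (forall j, `|y j| <= M * `|x j|) -> l2 y.
Proof.
move=> lx yM; apply: (@l2_bound _ (M ^+ 2 * dot x x)) => n.
apply: (@le_trans _ _ (\sum_(j < n) M ^+ 2 * x j ^+ 2)).
  apply: ler_sum => j _; rewrite -exprMn -[leLHS]real_normK ?num_real//.
  rewrite -[leRHS]real_normK ?num_real// ler_sqr ?nnegrE//.
  by rewrite normrM (le_trans (yM j))// ler_wpM2r// ler_norm.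
by rewrite -mulr_sumr ler_wpM2l ?sqr_ge0// sum_sqr_le_dot.
Qed.

Lemma dotC x y : dot x y = dot y x.
Proof. by rewrite /dot; congr (limn (series _)); apply/funext => j; rewrite mulrC. Qed.

Lemma dotDl x y z : l2 x -> l2 y -> l2 z -> dot (x \+ y) z = dot x z + dot y z.
Proof.
move=> lx ly lz; apply: cvg_lim => //.
rewrite (_ : series _ = (fun n => \sum_(j < n) x j * z j) \+ (fun n => \sum_(j < n) y j * z j)).
  by apply: cvgD; exact: dot_cvg.
apply/funext => n; rewrite /series/= big_mkord -big_split.
by apply: eq_bigr => j _; rewrite /= mulrDl.
Qed.

Lemma dotZl a x y : l2 x -> l2 y -> dot (a \*o x) y = a * dot x y.
Proof.
move=> lx ly; apply: cvg_lim => //.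
rewrite (_ : series _ = (fun n => a * \sum_(j < n) x j * y j)).
  by apply: cvgM; [exact: cvg_cst|exact: dot_cvg].
apply/funext => n; rewrite /series/= big_mkord/= mulr_sumr.
by apply: eq_bigr => j _; rewrite /= mulrA.
Qed.

Lemma dot_ge0 x : 0 <= dot x x.
Proof.
have [lx|nx] := pselect (l2 x); last first.
  have {}nx : ~ cvgn (series (fun j => x j ^+ 2)) by move=> h; apply: nx.
  (* A divergent series has limit 0 by convention, so the inner product with itself is nonnegative
     for every sequence. *)
  by rewrite /dot (_ : series _ = series (fun j => x j ^+ 2))// dvgP.
by have := sum_sqr_le_dot 0 lx; rewrite big_ord0.
Qed.

Lemma dot_eq0 x : l2 x -> dot x x = 0 -> x = cst 0.
Proof.
move=> lx x0; apply/funext => j; apply/eqP; rewrite -sqrf_eq0 eq_le sqr_ge0 andbT.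
rewrite -x0 (le_trans _ (sum_sqr_le_dot j.+1 lx))// big_ord_recr/= lerDr.
by apply: sumr_ge0 => i _; exact: sqr_ge0.
Qed.

Lemma dot_CS x y : l2 x -> l2 y -> dot x y ^+ 2 <= dot x x * dot y y.
Proof.
move=> lx ly; have [y0|y0] := eqVneq (dot y y) 0.
  rewrite y0 mulr0 (_ : dot x y = 0) ?expr0n//.
  rewrite (dot_eq0 ly y0); apply: cvg_lim => //.
  rewrite (_ : series _ = cst 0); first exact: cvg_cst.
  by apply/funext => n; rewrite /series/= big1// => j _; rewrite mulr0.
have yp : 0 < dot y y by rewrite lt_neqAle eq_sym y0 dot_ge0.
pose a := - (dot x y / dot y y).
have := dot_ge0 (x \+ (a \*o y)).
have lz : l2 (a \*o y) by exact: l2Z.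
have e1 : dot x (a \*o y) = a * dot x y by rewrite dotC dotZl// dotC.
have e2 : dot (a \*o y) (a \*o y) = a * (a * dot y y).
  by rewrite dotZl// dotC dotZl.
have e3 : dot (a \*o y) x = a * dot x y by rewrite dotC.
rewrite dotDl//; last exact: l2D.
rewrite (dotC x (x \+ _)) (dotC (a \*o y) (x \+ _)) !dotDl// e1 e2 e3.
rewrite -(ler_pM2r yp) mul0r => h.
have : a * dot y y = - dot x y by rewrite /a mulNr divfK.
move: h; set X := dot x x; set Y := dot y y in yp *; set Z := dot x y; nra.
Qed.

Lemma l2N x : l2 x -> l2 (\- x).
Proof. by move=> lx; apply: (@l2_le x _ 1) => // j; rewrite normrN mul1r. Qed.

Lemma l2B x y : l2 x -> l2 y -> l2 (x \- y).
Proof. by move=> lx ly; apply: l2D => //; exact: l2N. Qed.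

Lemma dotBl x y z : l2 x -> l2 y -> l2 z -> dot (x \- y) z = dot x z - dot y z.
Proof.
move=> lx ly lz; rewrite (_ : x \- y = x \+ ((-1) \*o y)); last first.
  by apply/funext => j; rewrite /= mulN1r.
by rewrite dotDl ?dotZl ?mulN1r//; exact: l2Z.
Qed.

Lemma norm2_ge0 x : 0 <= norm2 x. Proof. exact: sqrtr_ge0. Qed.

Lemma norm2_sqr x : norm2 x ^+ 2 = dot x x.
Proof. by rewrite sqr_sqrtr ?dot_ge0. Qed.

Lemma dot_le_norm x y : l2 x -> l2 y -> `|dot x y| <= norm2 x * norm2 y.
Proof.
move=> lx ly; rewrite -(@ler_sqr R) ?nnegrE ?mulr_ge0 ?norm2_ge0//.
by rewrite real_normK ?num_real// exprMn !norm2_sqr dot_CS.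
Qed.

Lemma norm2D x y : l2 x -> l2 y -> norm2 (x \+ y) <= norm2 x + norm2 y.
Proof.
move=> lx ly; rewrite -(@ler_sqr R) ?nnegrE ?addr_ge0 ?norm2_ge0// norm2_sqr.
rewrite dotDl//; last exact: l2D.
rewrite ![dot _ (_ \+ _)]dotC !dotDl// (dotC y x) -!norm2_sqr.
by have := dot_le_norm lx ly; rewrite ler_norml => /andP[_]; nra.
Qed.

Lemma norm2Z a x : l2 x -> norm2 (a \*o x) = `|a| * norm2 x.
Proof.
move=> lx; rewrite /norm2 dotZl//; last exact: l2Z.
rewrite dotC dotZl// mulrA -expr2 sqrtrM ?sqr_ge0// sqrtr_sqr//.
Qed.

Lemma norm2_le_sqr x y : dot x x <= dot y y -> norm2 x <= norm2 y.
Proof. by move=> h; rewrite /norm2 ler_wsqrtr. Qed.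

Lemma l2_cst0 : l2 (cst 0).
Proof. by apply: (@l2_bound _ 0) => n; rewrite big1// => j _; rewrite expr0n. Qed.

Lemma sum_trunc (f : R^nat) (m n : nat) : (m <= n)%N ->
  \sum_(j < n) (if (j < m)%N then f j else 0) = \sum_(j < m) f j.
Proof.
move=> mn; rewrite -(big_mkord xpredT (fun j => if (j < m)%N then f j else 0)).
rewrite (big_cat_nat (n := m))//= [X in _ + X]big1_seq ?addr0; last first.
  by move=> j /andP[_]; rewrite mem_index_iota => /andP[mj _]; rewrite ltnNge mj.
by rewrite big_mkord; apply: eq_bigr => j _; rewrite ltn_ord.
Qed.

Lemma dot_basis_vec x i : dot x (basis_vec i) = x i.
Proof.
apply: cvg_lim => //; apply: cvg_near_cst; near=> n.
rewrite /series/= big_mkord.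
have ni : (i < n)%N by near: n; exact: nbhs_infty_gt.
rewrite (bigD1 (Ordinal ni))//= /basis_vec eqxx mulr1 big1 ?addr0// => j ji.
by rewrite -val_eqE in ji; rewrite (negbTE ji) mulr0.
Unshelve. all: by end_near. Qed.

Lemma l2_basis_vec i : l2 (basis_vec i : R^nat).
Proof.
apply: (@l2_bound _ 1) => n; apply: (@le_trans _ _ (\sum_(j < n) (if (j == i :> nat) then 1 else 0))).
  by apply: ler_sum => j _; rewrite /basis_vec; case: eqP => _; rewrite ?expr1n ?expr0n.
rewrite -big_mkcond/=; have [ni|ni] := ltnP i n.
  by rewrite (big_pred1 (Ordinal ni)) => // j; rewrite -val_eqE.
by rewrite big1// => j /eqP ji; move: (ltn_ord j); rewrite ji ltnNge ni.
Qed.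

End l2.

Section basis.
Context {R : realType} (p : xdim) (Sigma : R^nat -> R^nat) (sigma : R^nat) (u : nat -> R^nat).
Hypothesis es : eigen_system p Sigma sigma u.

Definition ucoord (x : R^nat) : R^nat := fun j => dot (u j) x.
(** The inverse of [ucoord] on R^p. The sum of the a_j u_j is taken coordinate by coordinate in the
    canonical basis; its l_2 bound is proved afterwards. *)
Definition syn (a : R^nat) : R^nat := fun i => limn (series (fun j => a j * u j i)).

Lemma Rp_l2 (x : R^nat) : Rp p x -> l2 x. Proof. by case. Qed.

Lemma RpI (x : R^nat) : (forall j, ~~ in_dim p j -> x j = 0) -> l2 x -> Rp p x.
Proof. by move=> ? []. Qed.

Lemma l2_u j : l2 (u j).
Proof.
have [pj|pj] := boolP (in_dim p j); first exact: Rp_l2 (eigen_vec_in es pj).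
by rewrite (eigen_vec_out es pj); exact: l2_cst0.
Qed.

Lemma u_out j i : ~~ in_dim p i -> u j i = 0.
Proof.
move=> pi; have [pj|pj] := boolP (in_dim p j); first by have [h _] := eigen_vec_in es pj; exact: h.
by rewrite (eigen_vec_out es pj).
Qed.

Lemma coord_out x j : ~~ in_dim p j -> ucoord x j = 0.
Proof.
move=> pj; rewrite /ucoord (eigen_vec_out es pj); apply: cvg_lim => //.
rewrite (_ : series _ = cst 0); first exact: cvg_cst.
by apply/funext => n; rewrite /series/= big1// => i _; rewrite mul0r.
Qed.

Lemma fin_combS (a : R^nat) n : (fun i => \sum_(j < n.+1) a j * u j i) =
  (fun i => \sum_(j < n) a j * u j i) \+ (a n \*o u n).
Proof. by apply/funext => i; rewrite big_ord_recr. Qed.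

Lemma fin_comb0 (a : R^nat) : (fun i => \sum_(j < 0) a j * u j i) = 0 \*o u 0%N.
Proof. by apply/funext => i; rewrite big_ord0/= mul0r. Qed.

Lemma fin_comb_l2 (a : R^nat) n : l2 (fun i => \sum_(j < n) a j * u j i).
Proof.
elim: n => [|n IH]; first by rewrite fin_comb0; exact: l2Z (l2_u 0).
by rewrite fin_combS; apply: l2D => //; exact: l2Z (l2_u n).
Qed.

Lemma dot_u_fin (a : R^nat) (n l : nat) : (forall j, ~~ in_dim p j -> a j = 0) ->
  dot (u l) (fun i => \sum_(j < n) a j * u j i) = if (l < n)%N then a l else 0.
Proof.
move=> a0; have lu := l2_u; have lf := fin_comb_l2 a.
elim: n => [|n IH]; first by rewrite fin_comb0 dotC dotZl// mul0r.
have lz : l2 (a n \*o u n) by exact: l2Z.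
rewrite dotC fin_combS dotDl// dotC IH dotZl//.
have [pn|pn] := boolP (in_dim p n); last first.
  rewrite (a0 n)// mul0r addr0; case: (ltngtP l n) => [ln|nl|->].
  - by rewrite ltnS ltnW.
  - by rewrite ltnS leqNgt nl.
  - by rewrite ltnSn a0.
have [pl|pl] := boolP (in_dim p l); last first.
  have e0 : dot (u n) (u l) = 0 by rewrite dotC; exact: coord_out.
  by rewrite (a0 l)// !if_same e0 mulr0 addr0.
rewrite (eigen_orthonormal es pn pl); case: (ltngtP l n) => [ln|nl|->].
- by rewrite ltnS ltnW// mulr0 addr0.
- by rewrite ltnS leqNgt nl mulr0 addr0.
- by rewrite ltnSn mulr1 add0r.
Qed.

Lemma dot_fin_comb (a x : R^nat) (n : nat) : l2 x ->
  dot (fun i => \sum_(j < n) a j * u j i) x = \sum_(j < n) a j * ucoord x j.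
Proof.
move=> lx; have lu := l2_u; have lf := fin_comb_l2 a.
elim: n => [|n IH]; first by rewrite fin_comb0 dotZl// mul0r big_ord0.
have lz : l2 (a n \*o u n) by exact: l2Z.
by rewrite fin_combS dotDl// dotZl// IH big_ord_recr.
Qed.

Lemma dot_fin (a : R^nat) (n : nat) : (forall j, ~~ in_dim p j -> a j = 0) ->
  dot (fun i => \sum_(j < n) a j * u j i) (fun i => \sum_(j < n) a j * u j i) =
  \sum_(j < n) a j ^+ 2.
Proof.
move=> a0; rewrite dot_fin_comb; last exact: fin_comb_l2.
by apply: eq_bigr => j _; rewrite /ucoord dot_u_fin// ltn_ord expr2.
Qed.

Lemma bessel (x : R^nat) (n : nat) : l2 x -> \sum_(j < n) ucoord x j ^+ 2 <= dot x x.
Proof.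
move=> lx; pose s i := \sum_(j < n) ucoord x j * u j i.
have ls : l2 s by exact: fin_comb_l2.
have sx : dot s x = \sum_(j < n) ucoord x j ^+ 2.
  by rewrite dot_fin_comb//; apply: eq_bigr => j _; rewrite expr2.
have ss : dot s s = \sum_(j < n) ucoord x j ^+ 2 by apply: dot_fin; exact: coord_out.
have := dot_ge0 (x \- s).
have lxs : l2 (x \- s) by exact: l2B.
by rewrite dotBl// (dotC x) (dotC s) !dotBl// (dotC x s) sx ss; lra.
Qed.

Lemma coord_l2 (x : R^nat) : l2 x -> l2 (ucoord x).
Proof. by move=> lx; apply: (@l2_bound _ _ (dot x x)) => n; exact: bessel. Qed.

Lemma coord_Rp (x : R^nat) : Rp p x -> Rp p (ucoord x).
Proof. by move=> px; apply: RpI; [exact: coord_out|exact/coord_l2/Rp_l2]. Qed.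

Lemma coord_basis_vec i j : ucoord (basis_vec i) j = u j i.
Proof. by rewrite /ucoord dot_basis_vec. Qed.

(** For fixed i, the numbers u j i are the coordinates of the canonical vector e_i in the
    eigenbasis, so Bessel's inequality bounds them. *)
Lemma l2_col i : l2 (fun j => u j i).
Proof.
have := coord_l2 (l2_basis_vec (R := R) i); congr l2.
by apply/funext => j; exact: coord_basis_vec.
Qed.

Lemma syn_cvg (a : R^nat) i : l2 a -> \sum_(j < n) a j * u j i @[n --> \oo] --> syn a i.
Proof. by move=> la; exact: (dot_cvg la (l2_col i)). Qed.

Lemma syn_sum_le (a : R^nat) (n : nat) : Rp p a -> \sum_(i < n) syn a i ^+ 2 <= dot a a.
Proof.
move=> pa; have [a0 _] := pa; have la := Rp_l2 pa.
have h : \sum_(i < n) (\sum_(j < m) a j * u j i) ^+ 2 @[m --> \oo] --> \sum_(i < n) syn a i ^+ 2.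
  elim: n => [|n IH]; first by rewrite big_ord0; under eq_fun do rewrite big_ord0; exact: cvg_cst.
  rewrite big_ord_recr/=; under eq_fun do rewrite big_ord_recr/=.
  by apply: cvgD => //; apply: cvgM; exact: syn_cvg.
rewrite -(cvg_lim _ h)//; apply: limr_le; first by apply/cvg_ex; eexists; exact: h.
apply: nearW => m; apply: le_trans (sum_sqr_le_dot n (fin_comb_l2 a m)) _.
by rewrite dot_fin// sum_sqr_le_dot.
Qed.

Lemma syn_Rp (a : R^nat) : Rp p a -> Rp p (syn a).
Proof.
move=> pa; apply: RpI; last by apply: l2_bound => n; exact: syn_sum_le.
move=> i pi; apply: cvg_lim => //.
rewrite (_ : series _ = cst 0); first exact: cvg_cst.
by apply/funext => n; rewrite /series/= big1// => j _; rewrite u_out ?mulr0.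
Qed.

Lemma syn_dot_le (a : R^nat) : Rp p a -> dot (syn a) (syn a) <= dot a a.
Proof. by move=> pa; apply: dot_le => n; exact: syn_sum_le. Qed.

Definition tail (m : nat) (a : R^nat) : R^nat := fun j => if (j < m)%N then 0 else a j.

Lemma tail_Rp m a : Rp p a -> Rp p (tail m a).
Proof.
move=> pa; have [a0 _] := pa; have la := Rp_l2 pa.
apply: RpI; first by move=> j pj; rewrite /tail a0// if_same.
by apply: (@l2_le _ a _ 1) => // j; rewrite /tail mul1r; case: ifP => _; rewrite ?normr0.
Qed.

Lemma dot_tail m a : l2 a -> dot (tail m a) (tail m a) <= dot a a - \sum_(j < m) a j ^+ 2.
Proof.
move=> la; apply: dot_le => n; rewrite lerBrDr.
apply: le_trans (sum_sqr_le_dot (n + m) la).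
rewrite -[X in X + _](sum_trunc (fun j => tail m a j ^+ 2) (leq_addr m n)).
rewrite -[X in _ + X](sum_trunc (fun j => a j ^+ 2) (leq_addl n m)) -big_split.
apply: ler_sum => j _ /=; rewrite /tail.
by do 2 case: ifP => _; rewrite ?expr0n/= ?addr0 ?add0r ?sqr_ge0.
Qed.

Lemma tail_cvg0 a : l2 a -> dot (tail m a) (tail m a) @[m --> \oo] --> 0.
Proof.
move=> la; apply: (@squeeze_cvgr _ _ _ _ (cst 0) (fun m => dot a a - \sum_(j < m) a j ^+ 2)).
- by apply: nearW => m; rewrite dot_ge0 dot_tail.
- exact: cvg_cst.
- rewrite -[X in _ --> X](subrr (dot a a)); apply: cvgB; first exact: cvg_cst.
  by under eq_fun => m do under eq_bigr do rewrite expr2; exact: dot_cvg.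
Qed.

Lemma syn_tail (a : R^nat) m : l2 a ->
  syn a = (fun i => \sum_(j < m) a j * u j i) \+ syn (tail m a).
Proof.
move=> la; apply/funext => i; apply: cvg_lim => //=.
have lt : l2 (tail m a).
  by apply: (@l2_le _ a _ 1) => // j; rewrite /tail mul1r; case: ifP => _; rewrite ?normr0.
have h : \sum_(j < m) a j * u j i + \sum_(j < n) tail m a j * u j i @[n --> \oo] -->
   \sum_(j < m) a j * u j i + syn (tail m a) i.
  by apply: cvgD; [exact: cvg_cst|exact: syn_cvg].
apply: cvg_trans h; apply: near_eq_cvg; near=> n.
have mn : (m <= n)%N by near: n; exact: nbhs_infty_ge.
rewrite /series/= big_mkord -(sum_trunc (fun j => a j * u j i) mn) -big_split.
apply: eq_bigr => j _ /=; rewrite /tail.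
by case: ifP => _; rewrite ?mul0r ?addr0 ?add0r.
Unshelve. all: by end_near. Qed.

(** Splitting after m > l terms, orthonormality treats the finite part exactly and the remainder is
    at most |u_l| |tail m a|, which tends to 0. *)
Lemma coord_syn (a : R^nat) : Rp p a -> ucoord (syn a) = a.
Proof.
move=> pa; have [a0 _] := pa; have la := Rp_l2 pa; apply/funext => l.
have h m : (l < m)%N -> `|ucoord (syn a) l - a l| <= norm2 (u l) * norm2 (tail m a).
  move=> lm; rewrite /ucoord (syn_tail m la) dotC dotDl; last 3 first.
  - exact: fin_comb_l2.
  - exact: Rp_l2 (syn_Rp (tail_Rp m pa)).
  - exact: l2_u.
  rewrite dotC dot_u_fin// lm addrC addKr dotC.
  apply: le_trans (dot_le_norm (l2_u l) (Rp_l2 (syn_Rp (tail_Rp m pa)))) _.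
  by rewrite ler_wpM2l ?norm2_ge0// norm2_le_sqr// syn_dot_le//; exact: tail_Rp.
have c0 : norm2 (u l) * norm2 (tail m a) @[m --> \oo] --> 0.
  rewrite -[X in _ --> X](mulr0 (norm2 (u l))); apply: cvgM; first exact: cvg_cst.
  rewrite -[X in _ --> X](@sqrtr0 R); apply: continuous_cvg; first exact: sqrt_continuous.
  exact: tail_cvg0.
apply/eqP; rewrite -subr_eq0 -normr_le0; apply/ler_addgt0Pr => e e0; rewrite add0r.
have /cvgrPdist_lt/(_ e e0) [m _ hm] := c0.
have := hm (maxn m l.+1) (leq_maxl _ _).
rewrite /= sub0r normrN => hm'.
by rewrite (le_trans (h _ (leq_maxr m l.+1)))// (le_trans (ler_norm _))// ltW.
Qed.

(** The difference of both sides is orthogonal to every eigenvector, hence 0 by completeness. *)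
Lemma syn_coord (x : R^nat) : Rp p x -> syn (ucoord x) = x.
Proof.
move=> px; have pc := coord_Rp px; have ps := syn_Rp pc.
have pB : Rp p (syn (ucoord x) \- x).
  apply: RpI; last by apply: l2B; exact: Rp_l2.
  by move=> j pj; have [h1 _] := px; have [h2 _] := ps; rewrite /= h1// h2// subrr.
have := eigen_complete es pB => H.
suff : syn (ucoord x) \- x = cst 0.
  by move=> /(congr1 (fun f i => f i + x i)) E; apply/funext => i; have := congr1 (@^~ i) E; rewrite /= subrK add0r.
apply: H => j pj; rewrite dotC dotBl; [|exact: Rp_l2|exact: Rp_l2|exact: l2_u].
by rewrite !(dotC _ (u j)) -!/(ucoord _ _) coord_syn// subrr.
Qed.

Lemma parseval_norm (x : R^nat) : Rp p x -> dot (ucoord x) (ucoord x) = dot x x.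
Proof.
move=> px; apply/eqP; rewrite eq_le; apply/andP; split.
  by apply: dot_le => n; apply: bessel; exact: Rp_l2.
by rewrite -[in leLHS](syn_coord px) syn_dot_le//; exact: coord_Rp.
Qed.

Lemma coordD x y : l2 x -> l2 y -> ucoord (x \+ y) = ucoord x \+ ucoord y.
Proof.
move=> lx ly; apply/funext => j; have lu := l2_u j.
by rewrite /ucoord dotC dotDl//= !(dotC _ (u j)).
Qed.

Lemma coordB x y : l2 x -> l2 y -> ucoord (x \- y) = ucoord x \- ucoord y.
Proof.
move=> lx ly; apply/funext => j; have lu := l2_u j.
by rewrite /ucoord dotC dotBl//= !(dotC _ (u j)).
Qed.

Lemma RpD (x y : R^nat) : Rp p x -> Rp p y -> Rp p (x \+ y).
Proof.
move=> px py; have [x0 _] := px; have [y0 _] := py; apply: RpI.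
  by move=> j pj; rewrite /= x0// y0// addr0.
by apply: l2D; exact: Rp_l2.
Qed.

Lemma RpZ a (x : R^nat) : Rp p x -> Rp p (a \*o x).
Proof.
move=> px; have [x0 _] := px; apply: RpI; first by move=> j pj; rewrite /= x0// mulr0.
exact/l2Z/Rp_l2.
Qed.

Lemma parseval (x y : R^nat) : Rp p x -> Rp p y -> dot (ucoord x) (ucoord y) = dot x y.
Proof.
move=> px py; have lx := Rp_l2 px; have ly := Rp_l2 py.
have lcx := coord_l2 lx; have lcy := coord_l2 ly.
have := parseval_norm (RpD px py); rewrite coordD//.
have lxy := l2D lx ly; have lcxy := l2D lcx lcy.
rewrite !dotDl// !(dotC _ (_ \+ _)) !dotDl// !parseval_norm//.
by rewrite (dotC y x) (dotC (ucoord y)); lra.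
Qed.

Lemma spec_opE (a v : R^nat) : spec_op u a v = syn (fun j => a j * ucoord v j).
Proof. by []. Qed.

Lemma mul_Rp (a v : R^nat) (M : R) : (forall j, `|a j| <= M) -> Rp p v ->
  Rp p (fun j => a j * v j).
Proof.
move=> aM pv; have [v0 _] := pv; have lv := Rp_l2 pv.
apply: RpI; first by move=> j pj; rewrite v0// mulr0.
by apply: (@l2_le _ v _ M) => // j; rewrite normrM ler_wpM2r.
Qed.

Lemma spec_op_Rp (a v : R^nat) (M : R) : (forall j, `|a j| <= M) -> Rp p v ->
  Rp p (spec_op u a v).
Proof.
by move=> aM pv; rewrite spec_opE; apply/syn_Rp/(mul_Rp aM); exact: coord_Rp.
Qed.

Lemma coord_spec_op (a v : R^nat) (M : R) : (forall j, `|a j| <= M) -> Rp p v ->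
  ucoord (spec_op u a v) = (fun j => a j * ucoord v j).
Proof.
by move=> aM pv; rewrite spec_opE coord_syn//; apply/(mul_Rp aM); exact: coord_Rp.
Qed.

Lemma norm2_coord x : Rp p x -> norm2 x = norm2 (ucoord x).
Proof. by move=> px; rewrite /norm2 parseval_norm. Qed.

End basis.

(** * The Dvoretzky-Milman theorem for weighted Euclidean norms *)

Section subfamily.
Context {R : realType} d (T : measurableType d) (P : probability T R).

Lemma std_subfamily (I I' : choiceType) (D : set I) (D' : set I') (V : I -> T -> R)
    (f : I' -> I) :
  std_gaussian_family P D V -> (forall i, D' i -> D (f i)) ->
  (forall i j, D' i -> D' j -> f i = f j -> i = j) ->
  std_gaussian_family P D' (fun i => if pselect (D' i) then V (f i) else cst 0).
Proof.
move=> [mV V0 lV mi] fD fi; split.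
- by move=> i; case: pselect => //= Di; exact: measurable_cst.
- by move=> i Di; case: pselect.
- by move=> i Di; case: pselect => // ?; apply: lV; exact: fD.
move=> J A JA.
have finj : {in J &, injective f}.
  by move=> i j iJ jJ; apply: fi; [have [] := JA i iJ|have [] := JA j jJ].
(* The event attached to i is an intersection over its preimages in J. There is at most one by
   injectivity, so no inverse of [f] has to be chosen. *)
pose A2 (i : I) := \bigcap_(i' in [set i' | i' \in J /\ f i' = i]) A i'.
have A2E i' : i' \in J -> A2 (f i') = A i'.
  move=> iJ; apply/seteqP; split => [w|w Aw k /= [kJ fk]]; first exact.
  by have -> // : k = i' by exact: finj.
have SA i' : i' \in J -> sigma_of (fun _ : unit => V (f i')) (A i').
  by move=> iJ; have [Di] := JA i' iJ; case: pselect.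
have := mi [fset f x | x in J]%fset A2.
rewrite big_imfset//= => h; transitivity (P (\bigcap_(i in [set` [fset f x | x in J]%fset]) A2 i)).
  congr (P _); apply/seteqP; split => [w Aw i /= /imfsetP[/= i' iJ ->]|w Aw i' /= iJ].
    by rewrite A2E//; exact: Aw.
  by rewrite -A2E//; apply: Aw => /=; apply/imfsetP; exists i'.
rewrite h; last first.
  move=> i /imfsetP[/= i' iJ ->]; rewrite A2E//; split; last exact: SA.
  by apply: fD; have [] := JA i' iJ.
by congr EFin; rewrite big_seq [RHS]big_seq; apply: eq_bigr => i' iJ; rewrite A2E.
Qed.
End subfamily.

Section wnorm.
Context {R : realType}.

Definition wvec (n : nat) (om x : R^nat) : R^nat :=
  fun j => if (j < n)%N then Num.sqrt (om j) * x j else 0.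

Definition wnorm (n : nat) (om x : R^nat) : R := norm2 (wvec n om x).

Lemma dot_supp (n : nat) (x y : R^nat) : (forall j, (n <= j)%N -> x j = 0) ->
  dot x y = \sum_(j < n) x j * y j.
Proof.
move=> x0; apply: cvg_lim => //; apply: cvg_near_cst; near=> m.
have nm : (n <= m)%N by near: m; exact: nbhs_infty_ge.
rewrite /series/= big_mkord -(sum_trunc (fun j => x j * y j) nm); apply: eq_bigr => j _.
by case: ltnP => // nj; rewrite x0// mul0r.
Unshelve. all: by end_near. Qed.

Lemma l2_supp (n : nat) (x : R^nat) : (forall j, (n <= j)%N -> x j = 0) -> l2 x.
Proof.
move=> x0; apply: (@l2_bound _ _ (\sum_(j < n) x j ^+ 2)) => m.
rewrite -[leRHS](sum_trunc (fun j => x j ^+ 2) (leq_addr m n)).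
rewrite -[leLHS](sum_trunc (fun j => x j ^+ 2) (leq_addl n m)).
apply: ler_sum => j _; case: ifP => _; first by case: ltnP => // nj; rewrite x0// expr0n.
by case: ifP => // _; exact: sqr_ge0.
Qed.

Lemma Rp_FinP (n : nat) (x : R^nat) : Rp (Fin n) x <-> forall j, (n <= j)%N -> x j = 0.
Proof.
split=> [[x0 _] j nj|x0]; first by apply: x0; rewrite /= -leqNgt.
by apply: RpI; [move=> j /=; rewrite -leqNgt; exact: x0|exact: l2_supp x0].
Qed.

Lemma wvec_supp n om x j : (n <= j)%N -> wvec n om x j = 0.
Proof. by rewrite /wvec leqNgt => /negbTE ->. Qed.

Lemma wvec_l2 n om x : l2 (wvec n om x). Proof. exact: l2_supp (@wvec_supp n om x). Qed.

Variables (n : nat) (om : R^nat).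
Hypothesis om0 : forall j, (j < n)%N -> 0 < om j.

Lemma wnorm_sqr x : wnorm n om x ^+ 2 = \sum_(j < n) om j * x j ^+ 2.
Proof.
rewrite /wnorm norm2_sqr (dot_supp _ (@wvec_supp n om x)); apply: eq_bigr => j _.
rewrite /wvec ltn_ord mulrACA -!expr2 sqr_sqrtr//; apply: ltW; exact: om0.
Qed.

Lemma wnorm_ge0 x : 0 <= wnorm n om x. Proof. exact: norm2_ge0. Qed.

Lemma wnorm_is_norm : is_norm (Fin n) (wnorm n om).
Proof.
split.
- move=> x y _ _; rewrite /wnorm (_ : wvec n om (x \+ y) = wvec n om x \+ wvec n om y).
    by apply: norm2D; exact: wvec_l2.
  by apply/funext => j; rewrite /wvec /=; case: ifP => _; rewrite ?mulrDr ?addr0.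
- move=> a x _; rewrite /wnorm (_ : wvec n om (a \*o x) = a \*o wvec n om x).
    by apply: norm2Z; exact: wvec_l2.
  by apply/funext => j; rewrite /wvec /=; case: ifP => _; rewrite ?mulr0// mulrCA.
- move=> x /Rp_FinP x0 wx0; apply/funext => j.
  have [nj|jn] := leqP n j; first by rewrite x0.
  have := wnorm_sqr x; rewrite wx0 expr0n/= => /esym/eqP.
  rewrite psumr_eq0 => [/allP/(_ (Ordinal jn))|i _]; last first.
    by rewrite mulr_ge0 ?sqr_ge0// ltW// om0.
  rewrite mem_index_enum => /(_ isT)/=.
  by rewrite mulf_eq0 gt_eqF ?om0//= sqrf_eq0 => /eqP.
Qed.

Lemma wnorm_dual (x y : R^nat) : Rp (Fin n) x -> dual_ball (Fin n) (wnorm n om) y ->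
  dot x y <= wnorm n om x.
Proof.
move=> px [py yB]; have [_ nZ n0] := wnorm_is_norm.
have [wx0|wx0] := eqVneq (wnorm n om x) 0.
  rewrite wx0 (n0 x px wx0) (@dot_supp 0)// big_ord0//.
have wp : 0 < wnorm n om x by rewrite lt_neqAle eq_sym wx0 wnorm_ge0.
have h := yB ((wnorm n om x)^-1 \*o x) (RpZ _ px).
rewrite nZ// ger0_norm ?invr_ge0 ?wnorm_ge0// mulVf// in h.
have := h (lexx _); rewrite dotZl; [|exact: Rp_l2 px|exact: Rp_l2 py].
by rewrite ler_pdivrMl// mulr1.
Qed.

Lemma dual_ballP (y : R^nat) : Rp (Fin n) y -> \sum_(j < n) y j ^+ 2 / om j <= 1 ->
  dual_ball (Fin n) (wnorm n om) y.
Proof.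
move=> py y1; split => // x px wx1; have /Rp_FinP x0 := px.
have -> : dot x y = dot (wvec n om x) (wvec n (fun j => (om j)^-1) y).
  rewrite (dot_supp _ x0) (dot_supp _ (@wvec_supp n om x)); apply: eq_bigr => j _.
  rewrite /wvec ltn_ord mulrACA -sqrtrM ?ltW ?om0// divff ?gt_eqF ?om0//.
  by rewrite sqrtr1 mul1r.
apply: le_trans (ler_norm _) _.
apply: le_trans (dot_le_norm (wvec_l2 _ _ _) (wvec_l2 _ _ _)) _.
rewrite mulr_ile1 ?norm2_ge0//.
rewrite -[leRHS]sqrtr1 ler_wsqrtr// (dot_supp _ (@wvec_supp n _ y)).
apply: le_trans y1; apply: ler_sum => j _.
rewrite /wvec ltn_ord mulrACA -!expr2 sqr_sqrtr; last by rewrite invr_ge0 ltW// om0.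
by rewrite mulrC.
Qed.

(** Attained at om x / |x|, the gradient of the norm. If |x| = 0 the quotient is 0 by convention and
    the same witness works. *)
Lemma sup_dual_wnorm (x : R^nat) : Rp (Fin n) x ->
  ereal_sup [set (dot y x)%:E | y in dual_ball (Fin n) (wnorm n om)] = (wnorm n om x)%:E.
Proof.
move=> px; have /Rp_FinP x0 := px; apply/eqP; rewrite eq_le; apply/andP; split.
  by apply: ge_ereal_sup => _ [y yB <-]; rewrite lee_fin dotC wnorm_dual.
apply: ereal_sup_ubound; exists (fun j => om j * x j / wnorm n om x).
  have py : Rp (Fin n) (fun j => om j * x j / wnorm n om x).
    by apply/Rp_FinP => j nj; rewrite x0// mulr0 mul0r.
  apply: dual_ballP => //; have [w0|w0] := eqVneq (wnorm n om x) 0.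
    by rewrite big1// => j _; rewrite w0 invr0 mulr0 expr0n mul0r.
  rewrite (eq_bigr (fun j : 'I_n => (wnorm n om x ^+ 2)^-1 * (om j * x j ^+ 2))).
    by rewrite -mulr_sumr -wnorm_sqr mulVf// sqrf_eq0.
  by move=> j _; field; rewrite w0 gt_eqF// om0.
congr EFin; rewrite (@dot_supp n); last by move=> j nj; rewrite x0// mulr0 mul0r.
rewrite (eq_bigr (fun j : 'I_n => (wnorm n om x)^-1 * (om j * x j ^+ 2))); last first.
  by move=> j _; ring.
rewrite -mulr_sumr -wnorm_sqr; have [->|w0] := eqVneq (wnorm n om x) 0.
  by rewrite expr0n mulr0.
by rewrite expr2 mulKf.
Qed.

(** The dual ball is the ellipsoid q = sum_j y_j^2 / om_j <= 1: pairing y with y / om gives q <=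
    sqrt(q). Its semi-axes are the sqrt(om_j). *)
Lemma dual_norm2_le (m : R) (y : R^nat) : (forall j, (j < n)%N -> om j <= m) ->
  dual_ball (Fin n) (wnorm n om) y -> norm2 y <= Num.sqrt m.
Proof.
move=> omm yB; have [py _] := yB; have /Rp_FinP y0 := py.
have [n0|np] := posnP n.
  rewrite /norm2 (@dot_supp 0%N); last by move=> j _; apply: y0; rewrite n0.
  by rewrite big_ord0 sqrtr0 sqrtr_ge0.
have m0 : 0 < m by exact: lt_le_trans (om0 np) (omm _ np).
have pyo : Rp (Fin n) (fun j => y j / om j).
  by apply/Rp_FinP => j nj; rewrite y0// mul0r.
set q := \sum_(j < n) y j ^+ 2 / om j.
have q0 : 0 <= q.
  by apply: sumr_ge0 => j _; rewrite mulr_ge0 ?sqr_ge0// invr_ge0 ltW// om0.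
have h := wnorm_dual pyo yB.
have e1 : dot (fun j => y j / om j) y = q.
  rewrite (@dot_supp n); last by move=> j nj; rewrite y0// mul0r.
  by apply: eq_bigr => j _; rewrite mulrAC expr2.
have e2 : wnorm n om (fun j => y j / om j) ^+ 2 = q.
  rewrite wnorm_sqr; apply: eq_bigr => j _.
  by field; rewrite gt_eqF// om0.
rewrite e1 in h.
have q1 : q <= 1 by have := wnorm_ge0 (fun j => y j / om j); nra.
apply: ler_wsqrtr; rewrite (dot_supp _ y0).
apply: (@le_trans _ _ (m * q)).
  rewrite /q mulr_sumr; apply: ler_sum => j _.
  rewrite mulrCA -expr2 ler_peMr ?sqr_ge0// ler_pdivlMr ?om0//.
  by rewrite mul1r omm.
by rewrite ger_pMr.
Qed.

End wnorm.

(** * Expected weighted norms of Gaussian vectors *)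

Section gauss_norm.
Context {R : realType} d (T : measurableType d) (P : probability T R).

Lemma has_law_integral (Y : T -> R) (f : measurableTypeR R -> \bar R) : measurable_fun setT Y ->
  has_law P Y (normal_law 1) -> measurable_fun setT f -> (forall x, (0 <= f x)%E) ->
  (\int[P]_w f (Y w) = \int[normal_prob 0 1]_x f x)%E.
Proof.
move=> mY lY mf f0.
have mY' : measurable_fun setT (Y : T -> measurableTypeR R) := mY.
pose Ym : {mfun T >-> measurableTypeR R} := HB.pack (Y : T -> measurableTypeR R)
  (isMeasurableFun.Build _ _ _ _ _ mY').
rewrite -[LHS](@ge0_integral_distribution _ _ _ _ _ P Ym f)//.
apply: eq_measure_integral => A mA _.
by have := lY A mA; rewrite /normal_law oner_eq0.
Qed.

Lemma measurable_wnorm n om (g : T -> R^nat) : (forall j, measurable_fun setT (fun w => g w j)) ->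
  (forall j, (j < n)%N -> 0 < om j) -> measurable_fun setT (fun w => wnorm n om (g w)).
Proof.
move=> mg om0; rewrite (_ : (fun w => _) = fun w => Num.sqrt (\sum_(j < n) om j * g w j ^+ 2)).
  apply: (measurableT_comp (continuous_measurable_fun (@sqrt_continuous R))).
  by apply: measurable_sum => j; apply: measurable_funM => //; exact: measurable_funX.
by apply/funext => w; rewrite -wnorm_sqr// sqrtr_sqr ger0_norm// wnorm_ge0.
Qed.

(** E|Z| = sqrt(2 / pi) for Z standard normal. It is the constant in the lower comparison of an
    expected weighted norm with the square root of the total weight. *)
Definition absmean : R := fine (\int[normal_prob 0 1]_x `|x|%:E)%E.

Lemma absmean_fin : (\int[normal_prob 0 1]_x `|x|%:E)%E = (absmean%:E : \bar R).
Proof.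
rewrite fineK// fin_numE; have := @normal_id_integrable R => /integrableP[_ h].
rewrite gt_eqF/=; last by rewrite (lt_le_trans (ltNyr 0))// integral_ge0.
by rewrite lt_eqF.
Qed.

Lemma integral_eq0_sub d' (T' : measurableType d') (mu : {measure set T' -> \bar R})
    (f h : T' -> \bar R) : measurable_fun setT f -> measurable_fun setT h ->
  (forall x, 0 <= f x)%E -> (forall x, 0 <= h x)%E -> (forall x, f x = 0 -> h x = 0)%E ->
  (\int[mu]_x f x = 0)%E -> (\int[mu]_x h x = 0)%E.
Proof.
move=> mf mh f0 h0 fh if0.
have : ae_eq mu setT f (cst 0%E).
  apply/ae_eq_integral_abs => //; rewrite -[RHS]if0; apply: eq_integral => x _.
  by rewrite gee0_abs.
move=> [N [mN N0 hN]].
rewrite (@ae_eq_integral _ _ _ mu setT (cst 0%E) h) ?integral0//.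
exists N; split => // x /= hx; apply: hN => /= fx; apply: hx => _; apply: fh; exact: fx.
Qed.

Lemma absmean_gt0 : 0 < absmean.
Proof.
rewrite -lte_fin -absmean_fin lt_neqAle integral_ge0 ?andbT//; apply/eqP => h.
have : (\int[normal_prob 0 1]_(x in [set: measurableTypeR R]) (x ^+ 2)%:E = 0 :> \bar R)%E.
  apply: (@integral_eq0_sub _ (measurableTypeR R) (normal_prob 0 1) (fun x => `|x|%:E)) => //.
  - by apply/measurable_EFinP; exact: normr_measurable.
  - by apply/measurable_EFinP; exact: measurable_funX.
  - by move=> x; rewrite lee_fin sqr_ge0.
  - by move=> x [/eqP]; rewrite normr_eq0 => /eqP ->; rewrite expr0n.
rewrite normal_var => -[] /eqP; by rewrite oner_eq0.
Qed.

Section expect_wnorm.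
Variables (n : nat) (om : R^nat) (g : T -> R^nat).
Hypothesis mg : forall j, measurable_fun setT (fun w => g w j).
Hypothesis om0 : forall j, (j < n)%N -> 0 < om j.
Hypothesis lawg : forall j, (j < n)%N -> has_law P (fun w => g w j) (normal_law 1).

Lemma expect_wnorm_sqr : (\int[P]_w (wnorm n om (g w) ^+ 2)%:E = (\sum_(j < n) om j)%:E)%E.
Proof.
under eq_integral do rewrite wnorm_sqr// -sumEFin.
rewrite ge0_integral_sum//=; last 2 first.
- move=> j; apply/measurable_EFinP; apply: measurable_funM => //; exact: measurable_funX.
- by move=> j w _; rewrite lee_fin mulr_ge0 ?sqr_ge0// ltW// om0.
rewrite -sumEFin; apply: eq_bigr => j _.
under eq_integral do rewrite EFinM.
rewrite ge0_integralZl//; last 3 first.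
- by apply/measurable_EFinP; exact: measurable_funX.
- by move=> w _; rewrite lee_fin sqr_ge0.
- by rewrite lee_fin ltW// om0.
rewrite (@has_law_integral (fun w => g w j) (fun x => (x ^+ 2)%:E))//.
- by rewrite normal_var mule1.
- exact: lawg.
- by apply/measurable_EFinP; exact: measurable_funX.
- by move=> x; rewrite lee_fin sqr_ge0.
Qed.

Lemma expect_wnorm_le : (\int[P]_w (wnorm n om (g w))%:E <= (Num.sqrt (\sum_(j < n) om j))%:E)%E.
Proof.
set t := \sum_(j < n) om j.
have mw := measurable_wnorm mg om0.
have t0 : 0 <= t by apply: sumr_ge0 => j _; rewrite ltW// om0.
have [t1|t1] := eqVneq t 0.
  rewrite (@integral_eq0_sub _ _ P (fun w => (wnorm n om (g w) ^+ 2)%:E)) ?lee_fin ?sqrtr_ge0//.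
  - by apply/measurable_EFinP; exact: measurable_funX.
  - exact/measurable_EFinP.
  - by move=> w; rewrite lee_fin sqr_ge0.
  - by move=> w; rewrite lee_fin wnorm_ge0.
  - by move=> w [/eqP]; rewrite sqrf_eq0 => /eqP ->.
  - by rewrite expect_wnorm_sqr -/t t1.
have s0 : 0 < Num.sqrt t by rewrite sqrtr_gt0 lt_neqAle eq_sym t1.
have s2 : Num.sqrt t ^+ 2 = t by rewrite sqr_sqrtr.
(* Jensen's inequality by means of x <= x^2 / (2 s) + s / 2 with s = sqrt(t). *)
apply: (@le_trans _ _ (\int[P]_w ((2 * Num.sqrt t)^-1 * (wnorm n om (g w) ^+ 2) + Num.sqrt t / 2)%:E)%E).
  apply: ge0_le_integral => //.
  - by move=> w _; rewrite lee_fin wnorm_ge0.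
  - exact/measurable_EFinP.
  - by apply/measurable_EFinP; apply: measurable_funD => //; apply: measurable_funM => //; exact: measurable_funX.
  move=> w _; rewrite lee_fin -subr_ge0.
  rewrite [leRHS](_ : _ = (2 * Num.sqrt t)^-1 * (wnorm n om (g w) - Num.sqrt t) ^+ 2).
    by rewrite mulr_ge0 ?sqr_ge0// invr_ge0 mulr_ge0// ltW.
  by field; rewrite gt_eqF.
under eq_integral do rewrite EFinD EFinM.
rewrite ge0_integralD//=; last 2 first.
- by move=> w _; rewrite lee_fin mulr_ge0 ?sqr_ge0// invr_ge0 mulr_ge0// ltW.
- by apply/measurable_EFinP; apply: measurable_funM => //; exact: measurable_funX.
rewrite ge0_integralZl//; last 2 first.
- by apply/measurable_EFinP; exact: measurable_funX.
- by move=> w _; rewrite lee_fin sqr_ge0.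
rewrite expect_wnorm_sqr integral_cst// [X in (_ + _ * X)%E]probability_setT mule1 -/t -EFinM -EFinD lee_fin.
rewrite le_eqVlt; apply/orP; left; apply/eqP.
move: s0 s2; move: (Num.sqrt t) => s s0 <-; by field; rewrite gt_eqF.
Qed.

(** Cauchy-Schwarz against the constant vector gives sqrt(t) |g| >= sum_j om_j |g_j|, where t is the
    total weight, and the right-hand side has mean t E|Z|. The constant depends neither on the
    dimension nor on the weights. *)
Lemma expect_wnorm_ge :
  ((absmean * Num.sqrt (\sum_(j < n) om j))%:E <= \int[P]_w (wnorm n om (g w))%:E)%E.
Proof.
set t := \sum_(j < n) om j.
have mw := measurable_wnorm mg om0.
have t0 : 0 <= t by apply: sumr_ge0 => j _; rewrite ltW// om0.
have [t1|t1] := eqVneq t 0.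
  by rewrite t1 sqrtr0 mulr0 integral_ge0// => w _; rewrite lee_fin wnorm_ge0.
have s0 : 0 < Num.sqrt t by rewrite sqrtr_gt0 lt_neqAle eq_sym t1.
have s2 : Num.sqrt t ^+ 2 = t by rewrite sqr_sqrtr.
apply: (@le_trans _ _ (\int[P]_w ((Num.sqrt t)^-1 * \sum_(j < n) om j * `|g w j|)%:E)%E); last first.
  apply: ge0_le_integral => //.
  - move=> w _; rewrite lee_fin mulr_ge0 ?invr_ge0 ?(ltW s0)//.
    by apply: sumr_ge0 => j _; rewrite mulr_ge0// ltW// om0.
  - apply/measurable_EFinP; apply: measurable_funM => //; apply: measurable_sum => j.
    by apply: measurable_funM => //; exact: measurableT_comp.
  - exact/measurable_EFinP.
  move=> w _; rewrite lee_fin ler_pdivrMl//.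
  have := dot_le_norm (wvec_l2 n om (cst 1)) (wvec_l2 n om (fun j => `|g w j|)).
  move/(le_trans (ler_norm _)); rewrite (dot_supp _ (@wvec_supp _ n om _)).
  rewrite (eq_bigr (fun j : 'I_n => om j * `|g w j|)); last first.
    move=> j _; rewrite /wvec ltn_ord /= mulr1 mulrA -expr2 sqr_sqrtr//.
    by rewrite ltW// om0.
  move/le_trans; apply; apply: ler_pM; rewrite ?norm2_ge0//.
    rewrite -[norm2 _]/(wnorm n om (cst 1)) -[leLHS]ger0_norm ?wnorm_ge0// -sqrtr_sqr wnorm_sqr//.
    by under eq_bigr do rewrite expr1n mulr1.
  rewrite -[norm2 _]/(wnorm n om (fun j => `|g w j|)).
  rewrite -[leLHS]ger0_norm ?wnorm_ge0// -[leRHS]ger0_norm ?wnorm_ge0// -!sqrtr_sqr !wnorm_sqr//.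
  by under eq_bigr do rewrite real_normK ?num_real//.
under eq_integral do rewrite EFinM.
rewrite ge0_integralZl//; last 2 first.
- by apply/measurable_EFinP; apply: measurable_sum => j; apply: measurable_funM => //; exact: measurableT_comp.
- by move=> w _; rewrite lee_fin; apply: sumr_ge0 => j _; rewrite mulr_ge0// ltW// om0.
under eq_integral do rewrite -sumEFin.
rewrite ge0_integral_sum//=; last 2 first.
- by move=> j; apply/measurable_EFinP; apply: measurable_funM => //; exact: measurableT_comp.
- by move=> j w _; rewrite lee_fin mulr_ge0// ltW// om0.
rewrite (eq_bigr (fun j : 'I_n => (absmean * om j)%:E)) => [|j _].
  rewrite sumEFin -mulr_sumr -/t -EFinM lee_fin le_eqVlt; apply/orP; left; apply/eqP.
  move: s0 s2; move: (Num.sqrt t) => s s0 <-; by field; rewrite gt_eqF.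
under eq_integral do rewrite EFinM.
rewrite ge0_integralZl//; last 2 first.
- by apply/measurable_EFinP; exact: measurableT_comp.
- by rewrite lee_fin ltW// om0.
rewrite (@has_law_integral (fun w => g w j) (fun x => `|x|%:E))//.
- by rewrite absmean_fin -EFinM mulrC.
- exact: lawg.
- by apply/measurable_EFinP; exact: normr_measurable.
Qed.

End expect_wnorm.
End gauss_norm.

Section with_prob.
Context {R : realType} d (T : measurableType d) (P : probability T R).

Lemma with_prob_ge_sub (q q' : R) (E E' : set T) : q' <= q -> E `<=` E' ->
  with_prob_ge P q E -> with_prob_ge P q' E'.
Proof.
move=> qq EE [A [mA AE PA]]; exists A; split => //; first exact: subset_trans EE.
by apply: le_trans PA; rewrite lee_fin.
Qed.

Lemma with_prob_ge_setI (q q' : R) (E E' : set T) :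
  with_prob_ge P (1 - q) E -> with_prob_ge P (1 - q') E' ->
  with_prob_ge P (1 - (q + q')) (E `&` E').
Proof.
move=> [A [mA AE PA]] [B [mB BE PB]]; exists (A `&` B); split.
- exact: measurableI.
- exact: setISS.
have h : (P (A `&` B) = 1 - P (~` A `|` ~` B))%E.
  by rewrite -setCI -probability_setC ?setCK//; apply: measurableC; exact: measurableI.
have h1 (X : set T) (r : R) : measurable X -> ((1 - r)%:E <= P X)%E -> (P (~` X) <= r%:E)%E.
  move=> mX; rewrite probability_setC//.
  have : P X \is a fin_num by exact: fin_num_measure.
  case: (P X) => // x _; rewrite !lee_fin => hx.
  lra.
have PU : (P (~` A `|` ~` B) <= (q + q')%:E)%E.
  apply: le_trans (measureU2 _ _ _) _; [exact: measurableC|exact: measurableC|].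
  by rewrite EFinD; apply: leeD; exact: h1.
rewrite h; have : P (~` A `|` ~` B) \is a fin_num.
  by apply: fin_num_measure; apply: measurableU; exact: measurableC.
move: PU; case: (P _) => // x; rewrite lee_fin => hx _.
by rewrite lee_fin; lra.
Qed.

(** P(limsup) is the limit of the probabilities of the unions of the events from n on, each at least
    q. A bound proved at every finite stage with a common probability thus survives in the limit. *)
Lemma with_prob_ge_limsup (q : R) (n0 : nat) (E : nat -> set T) :
  (forall n, (n0 <= n)%N -> with_prob_ge P q (E n)) ->
  with_prob_ge P q [set w | forall m, exists2 n, (m <= n)%N & E n w].
Proof.
move=> h.
have /choice[A hA] : forall n, exists A : set T, (n0 <= n)%N ->
    [/\ measurable A, A `<=` E n & (q%:E <= P A)%E].
  move=> n; have [nn|nn] := leqP n0 n; last by exists set0.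
  by have [A hA] := h n nn; exists A.
pose B n := A (n0 + n)%N.
have mB n : measurable (B n) by have [] := hA _ (leq_addr n n0).
have PB n : (q%:E <= P (B n))%E by have [] := hA _ (leq_addr n n0).
exists (lim_sup_set B); split.
- by apply: bigcap_measurable => // n _; apply: bigcup_measurable.
- move=> w Bw m; have [j /= mj Bj] := Bw m I; exists (n0 + j)%N.
    by rewrite (leq_trans mj)// leq_addl.
  by have [_ AE _] := hA _ (leq_addr j n0); exact: AE.
have cv := @lim_sup_set_cvg _ _ _ P B mB.
have := cvg_lim (@ereal_hausdorff R) (cv _) => <-; last first.
  by apply: le_lt_trans (ltry 1); apply: probability_le1; apply: bigcup_measurable.
apply: lime_ge; first by apply/cvg_ex; exists (P (lim_sup_set B)); apply: cv;
  by apply: le_lt_trans (ltry 1); apply: probability_le1; apply: bigcup_measurable.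
near=> n; apply: le_trans (PB n) _; apply: le_measure; rewrite ?inE//.
  exact: bigcup_measurable.
by apply: bigcup_sup => /=.
Unshelve. all: by end_near. Qed.
End with_prob.

(** Dvoretzky-Milman for weighted Euclidean norms, with m an upper bound on the weights instead of
    the squared radius of the dual ball. The error is expressed by N and not by d_*, so it is the
    same for all windows. *)
Definition DM_weighted {R : realType} (kappa c : R) : Prop :=
  forall (N n : nat) (om : R^nat) (m : R)
    (d0 : measure_display) (T0 : measurableType d0) (P0 : probability T0 R) (g : T0 -> R^nat)
    (d : measure_display) (T : measurableType d) (P : probability T R) (G : 'I_N -> T -> R^nat),
  (0 < N)%N -> (forall j, (j < n)%N -> 0 < om j <= m) ->
  std_gaussian_vec P0 (Fin n) g -> std_gaussian_mx P (Fin n) G ->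
  let L := fine (\int[P0]_w (wnorm n om (g w))%:E)%E in
  N%:R <= kappa * (L ^+ 2 / m) ->
  with_prob_ge P (1 - expR (- (c * N%:R)))
    [set w | forall lam : 'I_N -> R,
      2^-1 * L ^+ 2 * (\sum_i lam i ^+ 2)
        <= \sum_(j < n) om j * (\sum_i lam i * G i w j) ^+ 2
        <= 3 / 2 * L ^+ 2 * (\sum_i lam i ^+ 2)].

Lemma DM_apply {R : realType} (kappa : R) : DM_constant kappa ->
  exists2 c : R, 0 < c & DM_weighted kappa c.
Proof.
move=> [/andP[k0 _] [c c0 DM]]; exists (c / kappa); first exact: divr_gt0.
move=> N n om m d0 T0 P0 g d T P G N0 omm sg sG L NL.
have om0 j : (j < n)%N -> 0 < om j by move=> /omm /andP[].
have gRp w : Rp (Fin n) (g w).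
  apply/Rp_FinP => j nj; have [_ /(_ j) h _ _] := sg.
  have /(congr1 (fun f => f w)) -> // : (fun w => g w j) = cst 0.
  by apply: h; rewrite /= ltnNge nj.
have ellE : fine (ell_star P0 g (dual_ball (Fin n) (wnorm n om))) = L.
  by congr fine; apply: eq_integral => w _; exact: sup_dual_wnorm.
have n0 : (0 < n)%N.
  (* For n = 0 the width L is 0 and the hypothesis would read N <= 0. *)
  rewrite lt0n; apply/negP => /eqP n0; move: NL.
  rewrite /L (_ : (\int[P0]_w _ = 0)%E).
    by rewrite expr0n mul0r mulr0 lern0 => /eqP N00; rewrite N00 in N0.
  apply: integral0_eq => w _; rewrite /wnorm /norm2 (@dot_supp _ 0) ?big_ord0 ?sqrtr0//.
  by move=> j _; rewrite /wvec n0.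
have m0 : 0 < m by have /andP[/lt_le_trans h /h] := omm _ n0.
set B := [set norm2 x | x in dual_ball (Fin n) (wnorm n om)].
have Bub : ubound B (Num.sqrt m).
  by move=> _ [y yB <-]; apply: (dual_norm2_le om0 _ yB) => j /omm /andP[].
(* A nonzero point of the dual ball: the supremum of the norms has to be positive before L is
   divided by it. *)
pose y0 : R^nat := fun j => if j == 0%N then Num.sqrt (om 0%N) else 0.
have By0 : B (norm2 y0).
  exists y0 => //; apply: dual_ballP => //.
    by apply/Rp_FinP => j nj; rewrite /y0; case: eqP => // j0; move: nj; rewrite j0 leqNgt n0.
  rewrite (bigD1 (Ordinal n0))//= big1 => [|i /negbTE i0].
    by rewrite addr0 [y0 _]/= /y0 eqxx sqr_sqrtr ?divff ?gt_eqF ?om0// ltW ?om0.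
  by rewrite /y0 -[(i : nat) == 0%N]/(i == Ordinal n0) i0 expr0n mul0r.
have sB : has_sup B by split; [exists (norm2 y0)|exists (Num.sqrt m)].
have ny0 : 0 < norm2 y0.
  rewrite sqrtr_gt0 (@dot_supp _ 1%N) => [|[]//].
  by rewrite big_ord1 /y0/= -expr2 sqr_sqrtr ?om0// ltW// om0.
have s0 : 0 < sup B by apply: lt_le_trans ny0 _; apply: ub_le_sup By0; exists (Num.sqrt m).
have sm : sup B <= Num.sqrt m by apply: ge_sup Bub; exists (norm2 y0).
have L0 : 0 <= L by apply: fine_ge0; apply: integral_ge0 => w _; rewrite lee_fin wnorm_ge0.
have dL : L ^+ 2 / m <= (L / sup B) ^+ 2.
  rewrite expr_div_n ler_wpM2l ?sqr_ge0// lef_pV2 ?posrE ?exprn_gt0//.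
  by rewrite -[leRHS](sqr_sqrtr (ltW m0)) lerXn2r ?nnegrE ?sqrtr_ge0// ltW.
have Nd : N%:R <= kappa * (L / sup B) ^+ 2.
  by apply: le_trans NL _; rewrite ler_pM2l.
have := DM N n (wnorm n om) d0 T0 P0 g d T P G N0 (wnorm_is_norm om0) sg sG.
rewrite ellE -/B => /(_ Nd); apply: with_prob_ge_sub.
  rewrite lerD2l lerN2 ler_expR lerN2 mulrAC -mulrA ler_pM2l// ler_pdivrMr//.
  by rewrite mulrC.
move=> w /= h lam.
pose l : R^nat := fun i => if insub i is Some i' then lam i' else 0.
have lE (i : 'I_N) : l i = lam i by rewrite /l valK.
have lRp : Rp (Fin N) l.
  by apply/Rp_FinP => j Nj; rewrite /l insubF// ltnNge Nj.
have nl : norm2 l ^+ 2 = \sum_i lam i ^+ 2.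
  rewrite norm2_sqr (@dot_supp _ N); last by move/Rp_FinP : lRp.
  by apply: eq_bigr => i _; rewrite lE expr2.
have e : wnorm n om (mx_tr_apply (fun i => G i w) l) ^+ 2 =
    \sum_(j < n) om j * (\sum_i lam i * G i w j) ^+ 2.
  rewrite wnorm_sqr//; apply: eq_bigr => j _; congr (_ * _ ^+ 2).
  by apply: eq_bigr => i _; rewrite lE.
have /andP[h1 h2] := h l lRp.
rewrite -e -nl; apply/andP; split.
- apply: le_trans (lerXn2r 2 _ _ h1);
    rewrite ?nnegrE ?wnorm_ge0 ?mulr_ge0 ?norm2_ge0 ?invr_ge0 ?sqrtr_ge0//.
  rewrite !exprMn exprVn [Num.sqrt 2 ^+ 2]sqr_sqrtr// le_eqVlt; apply/orP; left; apply/eqP.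
  by field.
- apply: (le_trans (lerXn2r 2 _ _ h2));
    rewrite ?nnegrE ?wnorm_ge0 ?mulr_ge0 ?norm2_ge0 ?invr_ge0 ?sqrtr_ge0//.
  rewrite !exprMn [Num.sqrt (3 / 2) ^+ 2]sqr_sqrtr ?divr_ge0// le_eqVlt; apply/orP; left; apply/eqP.
  by field.
Qed.

(** * Almost sure convergence of Gaussian series in l_2 *)

Section l2_complete.
Context {R : realType}.

Lemma cvg_ord_sum (f : nat -> nat -> R) (l : R^nat) (J : nat) :
  (forall j, (j < J)%N -> f n j @[n --> \oo] --> l j) ->
  \sum_(j < J) f n j @[n --> \oo] --> \sum_(j < J) l j.
Proof.
elim: J => [|J IH] fl; first by rewrite big_ord0; under eq_fun do rewrite big_ord0; exact: cvg_cst.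
rewrite big_ord_recr/=; under eq_fun do rewrite big_ord_recr/=.
by apply: cvgD; [apply: IH => j jJ; apply: fl; rewrite ltnW|exact: fl].
Qed.

Lemma dotB_le (x y : R^nat) : l2 x -> l2 y ->
  dot (x \- y) (x \- y) <= 2 * dot x x + 2 * dot y y.
Proof.
move=> lx ly; have lB := l2B lx ly; have lD := l2D lx ly.
have e1 : dot (x \- y) (x \- y) = dot x x - 2 * dot x y + dot y y.
  by rewrite dotBl// ![dot _ (_ \- _)]dotC !dotBl// (dotC y x); ring.
have e2 : dot (x \+ y) (x \+ y) = dot x x + 2 * dot x y + dot y y.
  by rewrite dotDl// ![dot _ (_ \+ _)]dotC !dotDl// (dotC y x); ring.
by have := dot_ge0 (x \+ y); lra.
Qed.

Lemma sqr_le_dot (x : R^nat) j : l2 x -> x j ^+ 2 <= dot x x.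
Proof.
move=> lx; apply: le_trans (sum_sqr_le_dot j.+1 lx).
by rewrite big_ord_recr/= lerDr; apply: sumr_ge0 => i _; exact: sqr_ge0.
Qed.

Lemma l2_complete (y : nat -> R^nat) : (forall n, l2 (y n)) ->
  (forall e : R, 0 < e -> exists m, forall n, (m <= n)%N -> dot (y n \- y m) (y n \- y m) <= e) ->
  exists2 z, l2 z & forall e : R, 0 < e -> exists m, forall n, (m <= n)%N ->
    dot (y n \- z) (y n \- z) <= e.
Proof.
move=> ly cy.
have cj j : cvgn (fun n => y n j).
  apply: cauchy_cvg; apply: cauchy_exP => e e0.
  have e1 : 0 < (e / 2) ^+ 2 by rewrite exprn_gt0// divr_gt0.
  have [m hm] := cy _ e1; exists (y m j); exists m => // n /= mn.
  rewrite /ball/= distrC; apply: (@le_lt_trans _ _ (e / 2)); last by lra.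
  rewrite -(@ler_sqr R) ?nnegrE ?divr_ge0 ?(ltW e0)// real_normK ?num_real//.
  apply: le_trans (hm n mn); exact: (sqr_le_dot j (l2B (ly n) (ly m))).
pose z j := limn (fun n => y n j).
have key e m : (forall n, (m <= n)%N -> dot (y n \- y m) (y n \- y m) <= e) ->
    l2 (z \- y m) /\ dot (z \- y m) (z \- y m) <= e.
  move=> h; have h1 J : \sum_(j < J) (z \- y m) j ^+ 2 <= e.
    have cs : \sum_(j < J) (y n \- y m) j ^+ 2 @[n --> \oo] --> \sum_(j < J) (z \- y m) j ^+ 2.
      apply: (@cvg_ord_sum (fun n j => (y n \- y m) j ^+ 2) (fun j => (z \- y m) j ^+ 2)) => j _.
      apply: (cvg_comp _ (fun x : R => x ^+ 2)); last exact: exprn_continuous.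
      by apply: cvgB; [exact: cj|exact: cvg_cst].
    rewrite -(cvg_lim _ cs)//; apply: limr_le; first by apply/cvg_ex; eexists; exact: cs.
    near=> n; apply: le_trans (sum_sqr_le_dot J (l2B (ly n) (ly m))) _.
    by apply: h; near: n; exact: nbhs_infty_ge.
  by split; [exact: l2_bound h1|exact: dot_le].
have lz : l2 z.
  have [m /key[l1 _]] := cy 1 ltr01.
  rewrite (_ : z = (z \- y m) \+ y m); first exact: l2D.
  by apply/funext => j; rewrite /= subrK.
exists z => // e e0; have e4 : 0 < e / 4 by rewrite divr_gt0.
have [m hm] := cy _ e4; exists m => n mn; have [l1 h1] := key _ _ hm.
rewrite (_ : y n \- z = (y n \- y m) \- (z \- y m)); last first.
  by apply/funext => j /=; ring.
have := dotB_le (l2B (ly n) (ly m)) l1; have := hm _ mn; lra.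
Unshelve. all: by end_near. Qed.
End l2_complete.

Lemma normal_quadratic {R : realType} (a b c : R) :
  (\int[normal_prob 0 1]_x (a + b * x + c * x ^+ 2)%:E = (a + c)%:E)%E.
Proof.
have i1 : (normal_prob 0 1).-integrable setT (fun x : measurableTypeR R => (b * x)%:E).
  under eq_fun do rewrite EFinM; exact: integrableZl (@normal_id_integrable R).
have i2 : (normal_prob 0 1).-integrable setT (fun x : measurableTypeR R => (c * x ^+ 2)%:E).
  under eq_fun do rewrite EFinM; exact: integrableZl (@normal_sqr_integrable R).
have i0 : (normal_prob 0 1).-integrable setT (fun x : measurableTypeR R => a%:E).
  exact: finite_measure_integrable_cst.
under eq_integral do rewrite !EFinD.
rewrite integralD//; last exact: integrableD.
rewrite integralD// integral_cst// [X in (_ * X)%E]probability_setT mule1.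
under [X in (_ + X + _)%E]eq_integral do rewrite EFinM.
under [X in (_ + _ + X)%E]eq_integral do rewrite EFinM.
rewrite !integralZl//; [|exact: normal_sqr_integrable|exact: normal_id_integrable].
by rewrite normal_mean normal_var mule0 mule1 adde0.
Qed.

Section kolmogorov.
Context {R : realType} d (T : measurableType d) (P : probability T R).
Variables (D : set nat) (V : nat -> T -> R) (s : nat -> R^nat).
Hypothesis sV : std_gaussian_family P D V.
Hypothesis ls : forall i, l2 (s i).

Definition psum (n : nat) (w : T) : R^nat := fun j => \sum_(i < n) V i w * s i j.

(* The partial sums from index m, stopped when their squared norm reaches a. *)
Fixpoint stop (m : nat) (a : R) (k : nat) (w : T) : R^nat :=
  if k is k'.+1 then
    let x := stop m a k' w in x \+ ((if dot x x < a then V (m + k') w else 0) \*o s (m + k'))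
  else cst 0.

Lemma stop_l2 m a k w : l2 (stop m a k w).
Proof. by elim: k => [|k IH] /=; [exact: l2_cst0|apply: l2D => //; exact: l2Z]. Qed.

Lemma psumS n w : psum n.+1 w = psum n w \+ (V n w \*o s n).
Proof. by apply/funext => j; rewrite /psum big_ord_recr. Qed.

Lemma psum_l2 n w : l2 (psum n w).
Proof.
elim: n => [|n IH]; last by rewrite psumS; apply: l2D => //; exact: l2Z.
rewrite (_ : psum 0 w = cst 0); first exact: l2_cst0.
by apply/funext => j; rewrite /psum big_ord0.
Qed.

Lemma dot_addZ (x y : R^nat) c : l2 x -> l2 y ->
  dot (x \+ (c \*o y)) (x \+ (c \*o y)) = dot x x + 2 * (c * dot x y) + c ^+ 2 * dot y y.
Proof.
move=> lx ly; have lc := l2Z c ly; have lD := l2D lx lc.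
rewrite dotDl// ![dot _ (_ \+ _)]dotC !dotDl// (dotC _ x) !(dotC _ (c \*o y)) !dotZl//.
by rewrite (dotC y (_ \*o _)) dotZl// (dotC y x); ring.
Qed.

Lemma stop_lt m a k w : dot (stop m a k w) (stop m a k w) < a ->
  stop m a k w = psum (m + k) w \- psum m w.
Proof.
elim: k => [|k IH] /= h.
  by apply/funext => j; rewrite /= addn0 subrr.
move: h; case: ifP => h1 h.
  by rewrite IH// addnS psumS; apply/funext => j /=; ring.
have : dot (stop m a k w) (stop m a k w) < a.
  by move: h; rewrite dot_addZ//; [rewrite mul0r mulr0 expr0n mul0r !addr0|exact: stop_l2].
by rewrite h1.
Qed.

Lemma stop_mono m a k w : a <= dot (stop m a k w) (stop m a k w) ->
  a <= dot (stop m a k.+1 w) (stop m a k.+1 w).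
Proof.
move=> h /=; rewrite ltNge h/= dot_addZ//; last exact: stop_l2.
by rewrite mul0r mulr0 expr0n mul0r !addr0.
Qed.

(** A stopped sum still below [a] coincides with the plain one. Together with [stop_mono], Markov's
    inequality for the stopped sum at the last index controls all earlier excursions, as
    Kolmogorov's maximal inequality would. *)
Lemma stop_ge m a k w : a <= dot (psum (m + k) w \- psum m w) (psum (m + k) w \- psum m w) ->
  a <= dot (stop m a k w) (stop m a k w).
Proof. by move=> h; rewrite leNgt; apply/negP => h1; move: h; rewrite -(stop_lt h1) leNgt h1. Qed.

Let J n : set nat := [set i | (i < n)%N /\ D i].

Lemma V_hist n i : (i < n)%N -> measurable_fun setT (V i : hist V (J n) -> R).
Proof.
move=> ni; have [Di|nD] := pselect (D i); first exact: hist_measurable.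
by have [_ /(_ i nD) -> _ _] := sV; exact: measurable_cst.
Qed.

Lemma stop_hist m a k :
  (forall v, l2 v -> measurable_fun setT (fun w : hist V (J (m + k)) => dot (stop m a k w) v)) /\
  measurable_fun setT (fun w : hist V (J (m + k)) => dot (stop m a k w) (stop m a k w)).
Proof.
have [mV _ _ _] := sV.
elim: k => [|k [IH1 IH2]]; first split => [v _|].
- exact: (measurable_cst (dot (cst 0) v)).
- exact: (measurable_cst (dot (cst 0 : R^nat) (cst 0))).
have sub : J (m + k) `<=` J (m + k.+1) by move=> i [/= ik Di]; split => //; rewrite addnS ltnS ltnW.
have mc : measurable_fun setT (fun w : hist V (J (m + k.+1)) =>
    if dot (stop m a k w) (stop m a k w) < a then V (m + k) w else 0).
  apply: measurable_fun_ifT.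
  - apply: measurable_fun_ltr; last exact: measurable_cst.
    exact: (hist_sub sub IH2).
  - by apply: V_hist; rewrite addnS.
  - exact: measurable_cst.
split => [v lv|].
  rewrite (_ : (fun w => _) = fun w => dot (stop m a k w) v +
      (if dot (stop m a k w) (stop m a k w) < a then V (m + k) w else 0) * dot (s (m + k)) v).
    apply: measurable_funD; first exact: (hist_sub sub (IH1 v lv)).
    by apply: measurable_funM => //; exact: measurable_cst.
  apply/funext => w /=; rewrite dotDl ?dotZl//; [exact: stop_l2|exact: l2Z].
rewrite (_ : (fun w => _) = fun w => dot (stop m a k w) (stop m a k w) +
   2 * ((if dot (stop m a k w) (stop m a k w) < a then V (m + k) w else 0) * dot (stop m a k w) (s (m + k)))
   + (if dot (stop m a k w) (stop m a k w) < a then V (m + k) w else 0) ^+ 2 * dot (s (m + k)) (s (m + k))).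
  apply: measurable_funD; last first.
    by apply: measurable_funM; [exact: measurable_funX|exact: measurable_cst].
  apply: measurable_funD; first exact: (hist_sub sub IH2).
  apply: measurable_funM; first exact: measurable_cst.
  apply: measurable_funM => //; exact: (hist_sub sub (IH1 _ (ls _))).
by apply/funext => w /=; rewrite dot_addZ//; exact: stop_l2.
Qed.

(** Given the past, the increment is either 0 or a standard normal multiple of s (m + k): the cross
    term has mean 0 and the square adds at most |s (m + k)|^2. *)
Lemma expect_stop m a k :
  (\int[P]_w (dot (stop m a k w) (stop m a k w))%:E <=
   (\sum_(i < k) dot (s (m + i)) (s (m + i)))%:E)%E.
Proof.
have [mV V0 lV mi] := sV.
elim: k => [|k IH].
  rewrite big_ord0 (_ : (\int[P]_w _ = 0)%E)//; apply: integral0_eq => w _ /=.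
  by congr EFin; rewrite (@dot_supp _ 0) ?big_ord0.
have [mS1 mS2] := stop_hist m a k.
set K := dot (s (m + k)) (s (m + k)).
have K0 : 0 <= K := dot_ge0 _.
rewrite big_ord_recr/= -/K EFinD; apply: le_trans (leeD IH (lexx _)).
have mS2' : measurable_fun setT (fun w => dot (stop m a k w) (stop m a k w)).
  exact: (hist_meas mV mS2).
have [Dk|nD] := pselect (D (m + k)); last first.
  rewrite [leLHS](_ : _ = \int[P]_w (dot (stop m a k w) (stop m a k w))%:E)%E.
    by rewrite leeDl.
  apply: eq_integral => w _; rewrite V0// if_same dot_addZ//; last exact: stop_l2.
  by rewrite mul0r mulr0 expr0n mul0r !addr0.
pose f (z : hist V (J (m + k)) * measurableTypeR R) : \bar R :=
  let x := stop m a k z.1 in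
  (dot (x \+ ((if dot x x < a then z.2 else 0) \*o s (m + k)))
       (x \+ ((if dot x x < a then z.2 else 0) \*o s (m + k))))%:E.
have mf : measurable_fun setT f.
  rewrite (_ : f = fun z => (dot (stop m a k z.1) (stop m a k z.1) +
     2 * ((if dot (stop m a k z.1) (stop m a k z.1) < a then z.2 else 0) * dot (stop m a k z.1) (s (m + k)))
     + (if dot (stop m a k z.1) (stop m a k z.1) < a then z.2 else 0) ^+ 2 * K)%:E).
    have m2 := measurableT_comp mS2 (@measurable_fst _ _ (hist V (J (m + k))) (measurableTypeR R)).
    have m1 := measurableT_comp (mS1 _ (ls (m + k))) (@measurable_fst _ _ (hist V (J (m + k))) (measurableTypeR R)).
    have mc : measurable_fun setT (fun z : hist V (J (m + k)) * measurableTypeR R =>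
        if dot (stop m a k z.1) (stop m a k z.1) < a then (z.2 : R) else 0).
      apply: measurable_fun_ifT; [|exact: measurable_snd|exact: measurable_cst].
      by apply: measurable_fun_ltr; [exact: m2|exact: measurable_cst].
    apply/measurable_EFinP; apply: measurable_funD; last first.
      by apply: measurable_funM; [exact: measurable_funX|exact: measurable_cst].
    apply: measurable_funD; first exact: m2.
    apply: measurable_funM; first exact: measurable_cst.
    by apply: measurable_funM => //; exact: m1.
  by apply/funext => z; rewrite /f/= dot_addZ//; exact: stop_l2.
rewrite (@hist_freeze _ _ _ P _ V mV D mi lV (J (m + k)) (m + k) f)//; last 3 first.
- by move=> i [].
- by move=> [/=]; rewrite ltnn.
- by move=> z; rewrite lee_fin dot_ge0.
rewrite -[X in (_ + X)%E]mule1 -[X in (_ + _ * X)%E](@probability_setT _ _ _ P) -integral_cst//.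
rewrite -ge0_integralD//=; last 2 first.
- by move=> w _; rewrite lee_fin dot_ge0.
- exact/measurable_EFinP.
apply: ge0_le_integral => //.
- by move=> w _; apply: integral_ge0 => y _; rewrite lee_fin dot_ge0.
- have h := @measurable_fun_fubini_tonelli_F _ _ (hist V (J (m + k))) (measurableTypeR R) R (normal_prob 0 1) f mf.
  apply: (@hist_meas _ _ _ _ V mV _ _ (J (m + k))); apply: h => z; by rewrite lee_fin dot_ge0.
- by apply/measurable_EFinP; apply: measurable_funD.
move=> w _; rewrite /f/=; have [h|h] := ltP (dot (stop m a k w) (stop m a k w)) a.
  rewrite (eq_integral (fun y : measurableTypeR R => (dot (stop m a k w) (stop m a k w) +
      (2 * dot (stop m a k w) (s (m + k))) * y + K * y ^+ 2)%:E)) => [|y _].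
    by rewrite normal_quadratic.
  by rewrite dot_addZ//; [congr EFin; rewrite /K; ring|exact: stop_l2].
rewrite (eq_integral (fun y : measurableTypeR R => (dot (stop m a k w) (stop m a k w))%:E)) => [|y _].
  by rewrite integral_cst// [X in (_ * X)%E]probability_setT mule1 leeDl.
by rewrite dot_addZ//; [rewrite mul0r mulr0 expr0n mul0r !addr0|exact: stop_l2].
Qed.

Lemma prob_stop m (a : R) k : 0 < a ->
  (P [set w | (a <= dot (stop m a k w) (stop m a k w))%R] <=
   (a^-1 * \sum_(i < k) dot (s (m + i)) (s (m + i)))%:E)%E.
Proof.
move=> a0; have [mV _ _ _] := sV.
have mS : measurable_fun setT (fun w => (dot (stop m a k w) (stop m a k w))).
  by have [_ h] := stop_hist m a k; exact: (hist_meas mV h).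
have mS' := (measurable_EFinP _ _).2 mS.
have := le_integral_abse P measurableT mS' a0; rewrite setTI => h.
rewrite EFinM muleC lee_pdivlMr// muleC; apply: le_trans (expect_stop m a k).
have -> : (\int[P]_w (dot (stop m a k w) (stop m a k w))%:E =
  \int[P]_w `|(dot (stop m a k w) (stop m a k w))%:E|)%E.
  by apply: eq_integral => w _; rewrite gee0_abs// lee_fin dot_ge0.
apply: le_trans h.
rewrite (_ : [set w | a <= _] = [set x | (a%:E <= `|(dot (stop m a k x) (stop m a k x))%:E|)%E])//.
by apply/seteqP; split => w /=; rewrite ger0_norm ?dot_ge0// lee_fin.
Qed.

Hypothesis cs : cvgn (series (fun i => dot (s i) (s i))).

Lemma kolmogorov_l2 : exists2 O : set T, measurable O /\ P O = 1%E &
  forall w, O w -> exists2 z, l2 z & forall e : R, 0 < e -> exists m, forall n, (m <= n)%N ->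
    dot (psum n w \- z) (psum n w \- z) <= e.
Proof.
have [mV _ _ _] := sV.
pose E m r k : set T := [set w | r.+1%:R^-1 <= dot (stop m r.+1%:R^-1 k w) (stop m r.+1%:R^-1 k w)].
have mE m r k : measurable (E m r k).
  rewrite -[E _ _ _]setTI; have [_ h] := stop_hist m r.+1%:R^-1 k.
  have := hist_meas mV h measurableT (measurable_itv `[r.+1%:R^-1, +oo[).
  by congr measurable; congr (_ `&` _); apply/seteqP; split => w; rewrite /= in_itv/= andbT.
have mEU m r : measurable (\bigcup_k E m r k) by exact: bigcupT_measurable.
(* The failure of the Cauchy property: for some level 1 / (r + 1), the sums started at every m
   exceed it at some k. *)
pose B := \bigcup_r \bigcap_m \bigcup_k E m r k.
have mB : measurable B.
  by apply: bigcupT_measurable => r; exact: bigcapT_measurable.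
have tot i : 0 <= dot (s i) (s i) by exact: dot_ge0.
pose S := limn (series (fun i => dot (s i) (s i))).
have PEU m r : (P (\bigcup_k E m r k) <= (r.+1%:R * (S - \sum_(i < m) dot (s i) (s i)))%:E)%E.
  have nd : nondecreasing_seq (E m r).
    by apply/nondecreasing_seqP => k; apply/subsetPset => w; exact: stop_mono.
  have cv := @nondecreasing_cvg_mu _ _ _ P (E m r) (mE m r) (mEU m r) nd.
  rewrite -(cvg_lim _ cv)//; apply: lime_le; first by apply/cvg_ex; eexists; exact: cv.
  apply: nearW => k /=; apply: le_trans (@prob_stop m r.+1%:R^-1 k _) _.
    by rewrite invr_gt0.
  rewrite invrK lee_fin ler_wpM2l// lerBrDl.
  have -> : \sum_(i < m) dot (s i) (s i) + \sum_(i < k) dot (s (m + i)) (s (m + i))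
     = \sum_(i < m + k) dot (s i) (s i) by rewrite big_split_ord.
  exact: nneg_sum_le_lim.
have PB : P B = 0%E.
  apply/negligibleP => //; apply: negligible_bigcup => r; apply/negligibleP.
    exact: bigcapT_measurable.
  apply/eqP; rewrite -measure_le0; apply/lee_addgt0Pr => e e0; rewrite add0e.
  have : \sum_(i < m) dot (s i) (s i) @[m --> \oo] --> S.
    by have := cs; rewrite /S /series/=; under eq_fun do rewrite big_mkord.
  move/cvgrPdist_le => /(_ (e / r.+1%:R)); rewrite divr_gt0// => /(_ isT)[m _ /(_ m)/= hm].
  have {hm} := hm (leqnn m); move=> hm.
  apply: le_trans (_ : P (\bigcup_k E m r k) <= _)%E.
    apply: le_measure; rewrite ?inE//; first exact: bigcapT_measurable.
    exact: bigcap_inf.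
  apply: le_trans (PEU m r) _; rewrite lee_fin -ler_pdivlMl// mulrC.
  by apply: le_trans (ler_norm _) hm.
exists (~` B).
  by split; [exact: measurableC|rewrite probability_setC// PB sube0].
move=> w Bw; apply: l2_complete; first by move=> n; exact: psum_l2.
move=> e e0; pose r := Num.truncn e^-1.
have re : r.+1%:R^-1 < e.
  by rewrite invf_plt ?posrE//; exact: truncnS_gt.
have : ~ (\bigcap_m \bigcup_k E m r k) w by move=> h; apply: Bw; exists r.
move=> /existsNP[m /not_implyP[_ hm]]; exists m => n mn.
rewrite leNgt; apply/negP => he; apply: hm; exists (n - m)%N => //.
by apply: stop_ge; rewrite subnKC// (le_trans (ltW re))// ltW.
Qed.

End kolmogorov.

Section conull.
Context {R : realType} d (T : measurableType d) (P : probability T R).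

(** Stated without measurability of f and h because the integrand of [ell_star] is a supremum over
    an uncountable set. A simple function below f, multiplied by the indicator of O, keeps its
    integral and falls below h. *)
Lemma integral_conull_le (f h : T -> \bar R) (O : set T) : measurable O -> P O = 1%E ->
  (forall w, 0 <= f w)%E -> (forall w, 0 <= h w)%E -> (forall w, O w -> (f w <= h w)%E) ->
  (\int[P]_w f w <= \int[P]_w h w)%E.
Proof.
move=> mO PO f0 h0 fh; rewrite !ge0_integralTE//.
have PO0 : P (~` O) = 0%E by rewrite probability_setC// PO subee.
apply: ge_ereal_sup => _ [phi phif <-]; apply: ereal_sup_ubound.
exists (proj_nnsfun phi mO) => [x /=|].
  rewrite /= mindicE; have [xO|_] := boolP (x \in O); last by rewrite mulr0.
  by rewrite mulr1; apply: le_trans (phif x) _; apply: fh; rewrite -inE.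
have e (g : {nnsfun T >-> R}) : sintegral P g = (\int[P]_x (g x)%:E)%E.
  by rewrite integral_nnsfun// patch_setT.
rewrite !e; apply: ae_eq_integral => //; [exact/measurable_EFinP|exact/measurable_EFinP|].
exists (~` O); split => //; first exact: measurableC.
move=> x /= hx Ox; apply: hx => _ /=.
by rewrite mindicE mem_set// mulr1.
Qed.

Lemma integral_conull (f h : T -> \bar R) (O : set T) : measurable O -> P O = 1%E ->
  (forall w, 0 <= f w)%E -> (forall w, 0 <= h w)%E -> (forall w, O w -> f w = h w) ->
  (\int[P]_w f w = \int[P]_w h w)%E.
Proof.
move=> mO PO f0 h0 fh; apply/eqP; rewrite eq_le.
by apply/andP; split; apply: (integral_conull_le mO PO) => // w /fh ->.
Qed.

Lemma integral_1D d' (T' : measurableType d') (P' : probability T' R) (c : T' -> R) :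
  measurable_fun setT c -> (forall w, `|c w| <= 1) ->
  (\int[P']_w (1 + c w)%:E = 1 + \int[P']_w (c w)%:E)%E.
Proof.
move=> mc c1; under eq_integral do rewrite EFinD.
rewrite integralD//=; last 2 first.
- exact: finite_measure_integrable_cst.
- by apply: (@bounded_integrable _ _ _ P' c 1) => //; exact: prob_lty.
by rewrite integral_cst// [X in (_ * X + _)%E]probability_setT mule1.
Qed.

(** Induction on n, integrating the last coordinate with the others frozen; 1 is added to the cosine
    because freezing is stated for nonnegative functions. *)
Lemma std_cos (D : set nat) (V : nat -> T -> R) (v : R^nat) (n : nat) (t : R) :
  std_gaussian_family P D V -> (forall i, ~ D i -> v i = 0) ->
  (\int[P]_w (cos (\sum_(i < n) v i * V i w + t))%:E =
   (expR (- ((\sum_(i < n) v i ^+ 2) / 2)) * cos t)%:E)%E.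
Proof.
move=> [mV V0 lV mi] v0; elim: n t => [|n IH] t.
  under eq_integral do rewrite big_ord0 add0r.
  by rewrite integral_cst// [X in (_ * X)%E]probability_setT mule1 big_ord0 mul0r oppr0 expR0 mul1r.
have [Dn|nD] := pselect (D n); last first.
  by rewrite big_ord_recr/= v0// expr0n addr0 -IH; apply: eq_integral => w _;
    rewrite big_ord_recr/= v0// mul0r addr0.
pose J : set nat := [set i | (i < n)%N /\ D i].
have hV i : (i < n)%N -> measurable_fun setT (V i : hist V J -> R).
  move=> ni; have [Di|nDi] := pselect (D i); first exact: hist_measurable.
  by rewrite V0//; exact: measurable_cst.
have hS : measurable_fun setT (fun w : hist V J => \sum_(i < n) v i * V i w).
  apply: measurable_sum => i; apply: measurable_funM; first exact: measurable_cst.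
  exact: hV.
pose f (z : hist V J * measurableTypeR R) : \bar R :=
  (1 + cos (v n * z.2 + (\sum_(i < n) v i * V i z.1 + t)))%:E.
have mf : measurable_fun setT f.
  apply/measurable_EFinP; apply: measurable_funD; first exact: measurable_cst.
  apply: (measurableT_comp (continuous_measurable_fun (@continuous_cos R))).
  apply: measurable_funD; first by apply: measurable_funM; [exact: measurable_cst|exact: measurable_snd].
  apply: measurable_funD; last exact: measurable_cst.
  exact: (measurableT_comp hS (@measurable_fst _ _ (hist V J) (measurableTypeR R))).
have f0 z : (0 <= f z)%E.
  by rewrite lee_fin -lerBlDl sub0r; have := cos_max (v n * z.2 + (\sum_(i < n) v i * V i z.1 + t)); rewrite ler_norml => /andP[].
have mS : measurable_fun setT (fun w => \sum_(i < n) v i * V i w) := hist_meas mV hS.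
have mcos (h : T -> R) : measurable_fun setT h -> measurable_fun setT (fun w => cos (h w)).
  exact: (measurableT_comp (continuous_measurable_fun (@continuous_cos R))).
have JD : J `<=` D by move=> i [].
have Jn : ~ J n by move=> [/=]; rewrite ltnn.
have := @hist_freeze _ _ _ P _ V mV D mi lV J n f JD Dn Jn mf f0.
have -> : (\int[P]_w f (w, V n w) = 1 + \int[P]_w (cos (\sum_(i < n.+1) v i * V i w + t))%:E)%E.
  rewrite -integral_1D; last by move=> w; exact: cos_max.
    apply: eq_integral => w _; rewrite /f/= big_ord_recr/=; congr (1 + cos _)%:E; ring.
  apply: mcos; apply: measurable_funD => //; apply: measurable_sum => i.
  by apply: measurable_funM => //; exact: mV.
have -> : (\int[P]_w \int[normal_prob 0 1]_y f (w, y) =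
    1 + \int[P]_w (expR (- (v n ^+ 2 / 2)) * cos (\sum_(i < n) v i * V i w + t))%:E)%E.
  rewrite -integral_1D; last 2 first.
  - by apply: measurable_funM => //; apply: mcos; apply: measurable_funD.
  - move=> w; rewrite normrM mulr_ile1// ?cos_max// ger0_norm ?expR_ge0//.
    by rewrite -expR0 ler_expR oppr_le0 divr_ge0 ?sqr_ge0.
  apply: eq_integral => w _; rewrite /f/= EFinD -normal_cosD.
  apply: integral_1D; last by move=> y; exact: cos_max.
  by mfun.
have mcn : measurable_fun setT (fun w => cos (\sum_(i < n) v i * V i w + t)).
  by apply: mcos; apply: measurable_funD.
under [in X in _ = X -> _]eq_integral do rewrite EFinM.
rewrite integralZl//; last first.
  by apply: (@bounded_integrable _ _ _ P _ 1) => //; [exact: prob_lty|move=> w; exact: cos_max].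
rewrite IH.
have fin : (\int[P]_w (cos (\sum_(i < n.+1) v i * V i w + t))%:E)%E \is a fin_num.
  apply: integrable_fin_num => //; apply: (@bounded_integrable _ _ _ P _ 1) => //.
  - exact: prob_lty.
  - apply: mcos; apply: measurable_funD => //; apply: measurable_sum => i.
    by apply: measurable_funM => //; exact: mV.
  - by move=> w; exact: cos_max.
rewrite -(fineK fin) -!EFinD => -[] /addrI ->; congr EFin.
by rewrite big_ord_recr/= mulrA -expRD; congr (expR _ * _); field.
Qed.
End conull.

(** * The spectrum, and the Gaussian series in the eigenbasis *)

Section eigen.
Context {R : realType} (p : xdim) (Sigma : R^nat -> R^nat) (sigma : R^nat) (u : nat -> R^nat).
Hypothesis es : eigen_system p Sigma sigma u.
Hypothesis cov : covariance_op p Sigma.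
Local Notation uc := (ucoord u).

Lemma sigma_ge0 j : 0 <= sigma j.
Proof.
have [pj|pj] := boolP (in_dim p j); first exact: ltW (eigen_val_gt0 es pj).
by rewrite (eigen_val_out es pj).
Qed.

Lemma in_dim_le i j : (i <= j)%N -> in_dim p j -> in_dim p i.
Proof. by case: p => //= n ij; exact: leq_ltn_trans. Qed.

Lemma sigma_noninc i j : (i <= j)%N -> sigma j <= sigma i.
Proof.
move=> ij; have [pj|pj] := boolP (in_dim p j); first exact: (eigen_val_noninc es ij).
by rewrite (eigen_val_out es pj) sigma_ge0.
Qed.

Lemma sqrt_sigma_le j : `|Num.sqrt (sigma j)| <= Num.sqrt (sigma 0%N).
Proof. by rewrite ger0_norm ?sqrtr_ge0// ler_wsqrtr// sigma_noninc. Qed.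

(** The vector Sigma^(1/2) e_i in the eigenbasis. Its squared norm is the diagonal entry <e_i, Sigma
    e_i>, so the trace condition is exactly the summability that the series of the g_i Sigma^(1/2)
    e_i needs. *)
Definition root_col (i : nat) : R^nat := fun j => Num.sqrt (sigma j) * u j i.

Lemma root_col_l2 i : l2 (root_col i).
Proof.
apply: (@l2_le _ (fun j => u j i) _ (Num.sqrt (sigma 0%N))); first exact: (l2_col es).
by move=> j; rewrite /root_col normrM ler_wpM2r// sqrt_sigma_le.
Qed.

Lemma coord_Sigma x j : Rp p x -> uc (Sigma x) j = sigma j * uc x j.
Proof.
move=> px; have [pj|pj] := boolP (in_dim p j); last first.
  by rewrite !(coord_out es)// mulr0.
have [[_ _ sym _] _] := cov.
rewrite /ucoord -sym//; last exact: (eigen_vec_in es).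
by rewrite (eigen_eq es pj) dotZl//; [exact: (l2_u es)|exact: Rp_l2 px].
Qed.

Lemma basis_vec_Rp i : in_dim p i -> Rp p (basis_vec i : R^nat).
Proof.
move=> pi; apply: RpI; last exact: l2_basis_vec.
by move=> j pj; rewrite /basis_vec; case: eqP => // ji; rewrite ji pi in pj.
Qed.

Lemma dot_root_col i : dot (root_col i) (root_col i) = diag_entry p Sigma i.
Proof.
rewrite /diag_entry; case: ifP => pi; last first.
  rewrite (@dot_supp _ 0) ?big_ord0// => j _.
  by rewrite /root_col (u_out es) ?pi// mulr0.
have [[SRp _ _ _] _] := cov.
have pb := basis_vec_Rp pi.
rewrite -(dot_basis_vec (Sigma _) i) -(parseval es (SRp _ pb) pb).
rewrite /dot; congr (limn (series _)); apply/funext => j.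
rewrite coord_Sigma// coord_basis_vec /root_col mulrACA -expr2 sqr_sqrtr ?sigma_ge0//.
by rewrite mulrA.
Qed.

Lemma root_col_cvg : cvgn (series (fun i => dot (root_col i) (root_col i))).
Proof. by under eq_fun do rewrite dot_root_col; have [] := cov. Qed.

Lemma u_norm j : in_dim p j -> dot (u j) (u j) = 1.
Proof. by move=> pj; rewrite (eigen_orthonormal es pj pj) eqxx. Qed.

(** The double sum of sigma_j u_j(i)^2 gives sigma_j when summed over i, and at most a diagonal
    entry of Sigma when summed over j. Only finite sums are exchanged. *)
Lemma sigma_cvg : cvgn (series sigma).
Proof.
apply: (@nneg_cvg_series _ _ (limn (series (fun i => dot (root_col i) (root_col i))))) => [j|J].
  exact: sigma_ge0.
have cv : \sum_(j < J) sigma j * (\sum_(i < n) u j i * u j i) @[n --> \oo] --> \sum_(j < J) sigma j.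
  apply: (@cvg_ord_sum _ (fun n j => sigma j * (\sum_(i < n) u j i * u j i))) => j _.
  have [pj|pj] := boolP (in_dim p j); last first.
    by rewrite (eigen_val_out es pj); under eq_fun do rewrite mul0r; exact: cvg_cst.
  rewrite -[X in _ --> X]mulr1 -(u_norm pj); apply: cvgM; first exact: cvg_cst.
  by apply: dot_cvg; exact: (l2_u es).
rewrite -(cvg_lim _ cv)//; apply: limr_le; first by apply/cvg_ex; eexists; exact: cv.
apply: nearW => n; apply: le_trans (nneg_sum_le_lim n _ root_col_cvg); last by move=> i; exact: dot_ge0.
under eq_bigr do rewrite mulr_sumr; rewrite exchange_big/=; apply: ler_sum => i _.
apply: le_trans (sum_sqr_le_dot J (root_col_l2 i)); apply: ler_sum => j _.
by rewrite /root_col exprMn sqr_sqrtr ?sigma_ge0// expr2.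
Qed.

End eigen.

Section zeta.
Context {R : realType} (p : xdim) (Sigma : R^nat -> R^nat) (sigma : R^nat) (u : nat -> R^nat).
Hypothesis es : eigen_system p Sigma sigma u.
Hypothesis cov : covariance_op p Sigma.
Local Notation uc := (ucoord u).
Context d (T : measurableType d) (P : probability T R) (g : T -> R^nat).
Hypothesis sg : std_gaussian_vec P p g.

Local Notation sv := (root_col sigma u).
Local Notation V := (fun j w => g w j).

Lemma psum_coord n w j : psum V sv n w j = Num.sqrt (sigma j) * \sum_(i < n) u j i * g w i.
Proof. by rewrite /psum mulr_sumr; apply: eq_bigr => i _; rewrite /root_col mulrCA (mulrC (g w i)). Qed.

(** Here z is Sigma^(1/2) g in the eigenbasis: the l_2 sum of the series with terms g_i Sigma^(1/2)
    e_i. *)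
Definition is_limit (w : T) (z : R^nat) : Prop := l2 z /\
  forall e : R, 0 < e -> exists m, forall n, (m <= n)%N ->
    dot (psum V sv n w \- z) (psum V sv n w \- z) <= e.

Lemma dot_psum_cvg (c : R^nat) w z : l2 c -> is_limit w z ->
  dot c (psum V sv n w) @[n --> \oo] --> dot c z.
Proof.
move=> lc [lz hz]; have lsv := root_col_l2 es.
have lp n : l2 (psum V sv n w) by exact: psum_l2.
apply/cvgrPdist_le => e e0.
have c1 : 0 < 1 + norm2 c by rewrite ltr_pwDl// norm2_ge0.
have e1 : 0 < (e / (1 + norm2 c)) ^+ 2 by rewrite exprn_gt0// divr_gt0.
have [m hm] := hz _ e1; exists m => // n /= mn.
rewrite distrC (dotC c) (dotC c) -dotBl//.
apply: le_trans (dot_le_norm (l2B (lp n) lz) lc) _.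
apply: (@le_trans _ _ (e / (1 + norm2 c) * norm2 c)).
  rewrite ler_wpM2r ?norm2_ge0//.
  rewrite -(@ler_sqr R) ?nnegrE ?norm2_ge0 ?divr_ge0 ?(ltW e0) ?(ltW c1)//.
  by rewrite norm2_sqr; exact: hm.
rewrite mulrAC ler_pdivrMr// ler_wpM2l ?(ltW e0)// lerDr//.
Qed.

Lemma psum_cvg w z j : is_limit w z -> psum V sv n w j @[n --> \oo] --> z j.
Proof.
move=> /(dot_psum_cvg (l2_basis_vec j)); rewrite dotC dot_basis_vec.
by under eq_fun do rewrite dotC dot_basis_vec.
Qed.

Lemma limit_out w z j : is_limit w z -> ~~ in_dim p j -> z j = 0.
Proof.
move=> lz pj; have h := psum_cvg lz (j := j); rewrite -(cvg_lim _ h)//; apply: cvg_lim => //.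
by under eq_fun do rewrite psum_coord (eigen_val_out es pj) sqrtr0 mul0r; exact: cvg_cst.
Qed.

(** Partial sums of the pairing with g are pairings of [c] with the partial sums of Sigma^(1/2) g:
    the square root moves to the side of g, where the limit exists in l_2. *)
Lemma dot_spec_root (b x : R^nat) w z : (forall j, `|b j| <= 1) -> Rp p x -> is_limit w z ->
  dot (spec_op u (fun j => b j * Num.sqrt (sigma j)) x) (g w) =
  dot (fun j => b j * uc x j) z.
Proof.
move=> b1 px lz; set c := fun j => b j * uc x j.
have lc : l2 c.
  apply: (@l2_le _ (uc x) _ 1); first exact: coord_l2 es _ (Rp_l2 px).
  by move=> j; rewrite normrM ler_wpM2r.
have lsv := root_col_l2 es.
have := dot_psum_cvg lc lz; rewrite (_ : (fun n => dot c _) =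
  series (fun i => spec_op u (fun j => b j * Num.sqrt (sigma j)) x i * g w i)).
  by move=> h; exact: cvg_lim h.
apply/funext => n; elim: n => [|n IH].
  by rewrite /series/= big_geq// dotC (@dot_supp _ 0) ?big_ord0// => j _; rewrite /psum big_ord0.
rewrite /series/= big_nat_recr//= -[X in _ = X + _]/(series _ n) -IH psumS dotC dotDl//; last 2 first.
- exact: psum_l2.
- exact: l2Z.
rewrite dotZl// dotC (mulrC (g w n)); congr (_ + _ * _).
rewrite /dot /spec_op; congr (limn (series _)); apply/funext => j.
by rewrite /root_col /c /ucoord; ring.
Qed.

Lemma limit_ex : exists2 O : set T, measurable O /\ P O = 1%E &
  forall w, O w -> exists z, is_limit w z.
Proof.
have [Om mO h] := kolmogorov_l2 sg (root_col_l2 es) (root_col_cvg es cov).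
by exists Om => // w /h[z lz hz]; exists z.
Qed.

(* g is not in l_2 for p = Infty, but Sigma^(1/2) g is, as a limit of partial sums; zeta is the sequence of
   its normalized coordinates in the eigenbasis. *)
Lemma zeta_ex : exists (Om : set T) (zeta : T -> R^nat),
  [/\ measurable Om, P Om = 1%E, std_gaussian_vec P p zeta &
      forall w, Om w -> is_limit w (fun j => Num.sqrt (sigma j) * zeta w j)].
Proof.
have [mV V0 _ _] := sg.
have [Om [mOm POm] hOm] := limit_ex.
have /choice[z hz] : forall w, exists z, Om w -> is_limit w z.
  by move=> w; have [/hOm[z hz]|nw] := pselect (Om w); [exists z|exists (cst 0)].
(* The indicator makes [zeta] a limit of measurable functions at every point of the space, and not
   only on [Om]. *)
pose zeta w : R^nat := fun j => \1_Om w * ((Num.sqrt (sigma j))^-1 * z w j).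
have zetaE w j : Om w -> Num.sqrt (sigma j) * zeta w j = z w j.
  move=> Ow; rewrite /zeta indicE mem_set// mul1r.
  have [pj|pj] := boolP (in_dim p j).
    by rewrite mulVKf// gt_eqF// sqrtr_gt0 (eigen_val_gt0 es pj).
  by rewrite (limit_out (hz w Ow) pj) !mulr0.
have mps n j : measurable_fun setT (fun w => \sum_(i < n) u j i * g w i).
  by apply: measurable_sum => i; apply: measurable_funM => //; exact: mV.
have cz w j : \1_Om w * ((Num.sqrt (sigma j))^-1 * psum V sv n w j) @[n --> \oo] --> zeta w j.
  rewrite /zeta indicE; have [/set_mem Ow|_] := boolP (w \in Om); last first.
    by rewrite mul0r; under eq_fun do rewrite mul0r; exact: cvg_cst.
  apply: cvgM; first exact: cvg_cst.
  by apply: cvgM; [exact: cvg_cst|exact: psum_cvg (hz w Ow)].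
have mzeta j : measurable_fun setT (fun w => zeta w j).
  apply: (@measurable_fun_cvg _ _ _ _ (fun n w => \1_Om w * ((Num.sqrt (sigma j))^-1 * psum V sv n w j))).
    move=> n; apply: measurable_funM; first exact: measurable_indic.
    apply: measurable_funM; first exact: measurable_cst.
    under eq_fun do rewrite psum_coord.
    by apply: measurable_funM; [exact: measurable_cst|exact: mps].
  by move=> w _; exact: cz.
exists Om, zeta; split => //; last first.
  by move=> w Ow; rewrite (_ : (fun j => _) = z w); [exact: hz|apply/funext => j; exact: zetaE].
(* The hypothesis of the Cramer-Wold device. On [Om] the combination is the limit of sum_(i < n) v_i
   g_i with v = sum_j a_j u_j, and |v|^2 = sum_j c_j^2 by orthonormality. *)
have cosz (s : seq nat) (c : nat -> R) (t : R) : uniq s -> (forall j, j \in s -> in_dim p j) ->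
    (\int[P]_w (cos (\sum_(j <- s) c j * zeta w j + t))%:E =
     (expR (- ((\sum_(j <- s) c j ^+ 2) / 2)) * cos t)%:E)%E.
  move=> us sD.
  pose a j := if j \in s then c j else 0.
  pose n0 := (\max_(j <- s) j).+1.
  have sn j : j \in s -> (j < n0)%N by move=> js; rewrite ltnS; exact: leq_bigmax_seq.
  have sumE (F : nat -> R) : \sum_(j <- s) F j = \sum_(j < n0) if (j : nat) \in s then F j else 0.
    rewrite -(big_mkord xpredT (fun j => if j \in s then F j else 0)) -big_mkcond/= -[RHS]big_filter.
    apply: perm_big; apply: uniq_perm => //; first by rewrite filter_uniq// iota_uniq.
    move=> j; rewrite mem_filter mem_index_iota /=.
    by have [/sn->|//] := boolP (j \in s).
  have a0 j : ~~ in_dim p j -> a j = 0.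
    by move=> pj; rewrite /a; case: ifP => // /sD; rewrite (negbTE pj).
  pose v i := \sum_(j < n0) a j * u j i.
  have v0 i : ~ in_dim p i -> v i = 0.
    by move=> /negP pi; rewrite /v big1// => j _; rewrite (u_out es)// mulr0.
  have vv : dot v v = \sum_(j <- s) c j ^+ 2.
    rewrite (dot_fin es)// sumE; apply: eq_bigr => j _.
    by rewrite /a; case: ifP => // _; rewrite expr0n.
  have lv : l2 v by exact: (fin_comb_l2 es).
  have vsum n w : \sum_(i < n) v i * g w i = \sum_(j < n0) a j * ((Num.sqrt (sigma j))^-1 * psum V sv n w j).
    under eq_bigr do rewrite mulr_suml; rewrite exchange_big/=; apply: eq_bigr => j _.
    have [js|js] := boolP ((j : nat) \in s); last first.
      by rewrite /a (negbTE js) mul0r big1// => i _; rewrite !mul0r.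
    rewrite psum_coord mulKf; last by rewrite gt_eqF// sqrtr_gt0 (eigen_val_gt0 es (sD _ js)).
    by rewrite mulr_sumr; apply: eq_bigr => i _; rewrite mulrA.
  have ccos n := std_cos n t sg v0.
  have ccosO n : (\int[P]_w (cos (\sum_(i < n) v i * g w i + t))%:E =
     \int[P]_w (cos (\1_Om w * \sum_(i < n) v i * g w i + t))%:E)%E.
    apply: ae_eq_integral => //.
    - apply/measurable_EFinP; apply: (measurableT_comp (continuous_measurable_fun (@continuous_cos R))).
      by apply: measurable_funD => //; apply: measurable_sum => i; apply: measurable_funM => //; exact: mV.
    - apply/measurable_EFinP; apply: (measurableT_comp (continuous_measurable_fun (@continuous_cos R))).
      apply: measurable_funD => //; apply: measurable_funM; first exact: measurable_indic.
      by apply: measurable_sum => i; apply: measurable_funM => //; exact: mV.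
    exists (~` Om); split; first exact: measurableC.
      by have := probability_setC P mOm; rewrite POm subee.
    by move=> w /= hw Ow; apply: hw => _; rewrite indicE mem_set// mul1r.
  have cv1 : (\int[P]_w (cos (\1_Om w * \sum_(i < n) v i * g w i + t))%:E)%E @[n --> \oo] -->
      (\int[P]_w (cos (\sum_(j <- s) c j * zeta w j + t))%:E)%E.
    apply: (@bounded_cvg_integral _ _ _ P _ _ 1); first exact: prob_lty.
    - move=> n; apply: (measurableT_comp (continuous_measurable_fun (@continuous_cos R))).
      apply: measurable_funD => //; apply: measurable_funM; first exact: measurable_indic.
      by apply: measurable_sum => i; apply: measurable_funM => //; exact: mV.
    - by move=> n w; exact: cos_max.
    move=> w; apply: (cvg_comp _ (@cos R)); last exact: continuous_cos.
    apply: cvgD; last exact: cvg_cst.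
    under eq_fun do rewrite vsum mulr_sumr.
    rewrite sumE (eq_bigr (fun j : 'I_n0 => a j * zeta w j)); last first.
      by move=> j _; rewrite /a; case: ifP => // _; rewrite mul0r.
    apply: (@cvg_ord_sum _ (fun n j => \1_Om w * (a j * ((Num.sqrt (sigma j))^-1 * psum V sv n w j)))
       (fun j => a j * zeta w j)) => j _.
    under eq_fun do rewrite mulrCA.
    by apply: cvgM; [exact: cvg_cst|exact: cz].
  have cv2 : (expR (- ((\sum_(i < n) v i ^+ 2) / 2)) * cos t)%:E @[n --> \oo] -->
     ((expR (- ((\sum_(j <- s) c j ^+ 2) / 2)) * cos t)%:E : \bar R).
    apply: cvg_EFin; first exact: nearW.
    apply: cvgM; last exact: cvg_cst.
    apply: (cvg_comp _ (@expR R)); last exact: continuous_expR.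
    apply: cvgN; apply: cvgM; last exact: cvg_cst.
    rewrite -vv; under eq_fun do under eq_bigr do rewrite expr2.
    exact: dot_cvg.
  apply: (eq_cvg_lim_eq cv1 cv2) => n.
  by rewrite -ccosO ccos.
split.
- exact: mzeta.
- move=> j /= pj; apply/funext => w; rewrite /zeta.
  by rewrite (eigen_val_out es) ?sqrtr0 ?invr0 ?mul0r ?mulr0//; exact/negP.
- by move=> j pj; exact: (@cos_law _ _ _ P nat [set j | in_dim p j] (fun j w => zeta w j) mzeta cosz j pj).
- exact: (@cos_mutual_indep _ _ _ P nat [set j | in_dim p j] (fun j w => zeta w j) mzeta cosz).
Qed.

End zeta.

Lemma bool_norm_le1 (R : realType) (b : bool) : `|b%:R| <= (1 : R).
Proof. by case: b; rewrite ?normr1 ?normr0. Qed.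

(** * Gaussian widths *)

Section width.
Context {R : realType} (p : xdim) (Sigma : R^nat -> R^nat) (sigma : R^nat) (u : nat -> R^nat).
Hypothesis es : eigen_system p Sigma sigma u.
Hypothesis cov : covariance_op p Sigma.
Local Notation uc := (ucoord u).
Context d (T : measurableType d) (P : probability T R) (g zeta : T -> R^nat) (Om : set T).
Hypotheses (mOm : measurable Om) (POm : P Om = 1%E).
Hypothesis sz : std_gaussian_vec P p zeta.
Hypothesis hz : forall w, Om w -> is_limit sigma u g w (fun j => Num.sqrt (sigma j) * zeta w j).
Variable k : nat.

Local Notation S_t := (spec_op u (high_part k (sqrt_seq sigma))).
Local Notation S_h := (spec_op u (low_part k (sqrt_seq sigma))).
Local Notation s0 := (sigma_ge0 es).

(** Window m consists of the first [win m] tail coordinates. For finite p it is the whole tail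
    whatever m; for p = Infty it stops before coordinate m. *)
Definition lev (m : nat) : nat := if p is Fin q then q else m.
Definition win (m : nat) : nat := (lev m - k)%N.
Definition om (j : nat) : R := sigma (k + j).
(* The Dvoretzky-Milman hypothesis bears on the limit width [ell] whereas the theorem applies only in
   finite dimension; these larger weights make the width of a finite window exceed [ell]. *)
Definition om' (j : nat) : R := Num.min (sigma k) (2 * sigma (k + j)).
Definition zk (w : T) : R^nat := fun j => zeta w (k + j).
Definition Yt (w : T) : R^nat := fun j => (k <= j)%:R * (Num.sqrt (sigma j) * zeta w j).
Definition trt : R := limn (series (high_part k sigma)).

Lemma win_dim m j : (j < win m)%N -> in_dim p (k + j).
Proof. by rewrite /win /lev ltn_subRL; case: p. Qed.

Lemma win_le m n : (m <= n)%N -> (win m <= win n)%N.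
Proof. by move=> mn; rewrite /win /lev; case: p => // *; rewrite leq_sub2r. Qed.

Lemma om_gt0 m j : (j < win m)%N -> 0 < om j.
Proof. by move=> /win_dim; exact: (eigen_val_gt0 es). Qed.

Lemma om'_bound m j : (j < win m)%N -> 0 < om' j <= sigma k.
Proof.
move=> /win_dim h; rewrite /om' ge_min lexx/= andbT lt_min mulr_gt0// ?(eigen_val_gt0 es)//.
by apply: in_dim_le h; exact: leq_addr.
Qed.

Lemma om_le_om' j : om j <= om' j.
Proof. by rewrite /om' le_min (sigma_noninc es) ?leq_addr//= mulr_natl mulr2n lerDl s0. Qed.

Lemma om'_le j : om' j <= 2 * om j.
Proof. by rewrite /om' ge_min lexx orbT. Qed.

Lemma Yt_l2 w : Om w -> l2 (Yt w).
Proof.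
move=> Ow; have [lz _] := hz Ow; apply: (l2_le (M := 1) lz) => j.
by rewrite /Yt normrM ler_wpM2r// bool_norm_le1.
Qed.

Lemma zeta_out w j : ~~ in_dim p j -> zeta w j = 0.
Proof.
move=> pj; have [_ z0 _ _] := sz.
by have /(congr1 (fun f => f w)) -> : (fun w => zeta w j) = cst 0 by apply: z0; exact/negP.
Qed.

Lemma Yt_Rp w : Om w -> Rp p (Yt w).
Proof.
move=> Ow; apply: RpI; last exact: Yt_l2.
by move=> j pj; rewrite /Yt zeta_out// !mulr0.
Qed.

Lemma dot_tail_root w y : Om w -> Rp p y -> dot (S_t y) (g w) = dot (uc y) (Yt w).
Proof.
move=> Ow py.
have -> : high_part k (sqrt_seq sigma) = fun j => (k <= j)%:R * Num.sqrt (sigma j).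
  by apply/funext => j; rewrite /high_part /sqrt_seq; case: leqP => _; rewrite ?mul1r ?mul0r.
have b1 j : `|(k <= j)%:R| <= (1 : R) by exact: bool_norm_le1.
rewrite (dot_spec_root es b1 py (hz Ow)).
by rewrite /dot; congr (limn (series _)); apply/funext => j; rewrite /Yt; ring.
Qed.

(** Duality in l_2: the supremum is attained at Yt / |Yt|, brought back from the eigenbasis by
    [syn]. *)
Lemma sup_tail w : Om w ->
  ereal_sup [set (dot x (g w))%:E | x in S_t @` ball2 p 1] = (norm2 (Yt w))%:E.
Proof.
move=> Ow; have lY := Yt_l2 Ow; apply/eqP; rewrite eq_le; apply/andP; split.
  apply: ge_ereal_sup => _ [_ [y [py y1] <-] <-]; rewrite lee_fin dot_tail_root//.
  apply: le_trans (ler_norm _) _; apply: le_trans (dot_le_norm (coord_l2 es (Rp_l2 py)) lY) _.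
  by rewrite ler_piMl ?norm2_ge0// -(norm2_coord es).
set a := norm2 (Yt w).
have pY : Rp p (a^-1 \*o Yt w) by apply: RpZ; exact: Yt_Rp.
apply: ereal_sup_ubound; exists (S_t (syn u (a^-1 \*o Yt w))).
  exists (syn u (a^-1 \*o Yt w)) => //; split; first exact: (syn_Rp es).
  rewrite (norm2_coord es) ?(coord_syn es) ?norm2Z//; last exact: (syn_Rp es).
  rewrite ger0_norm ?invr_ge0 ?norm2_ge0// -/a.
  by have [->|a0] := eqVneq a 0; rewrite ?mulr0// mulVf.
congr EFin; rewrite dot_tail_root//; last exact: (syn_Rp es).
rewrite (coord_syn es)// dotZl// -norm2_sqr -/a.
by have [->|a0] := eqVneq a 0; rewrite ?expr0n ?mulr0// expr2 mulKf.
Qed.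

Lemma spec_op0 (a : R^nat) : spec_op u a (cst 0) = cst 0.
Proof.
apply/funext => i; apply: cvg_lim => //.
rewrite (_ : series _ = cst 0); first exact: cvg_cst.
apply/funext => n; rewrite /series/= big1// => j _.
by rewrite dotC (@dot_supp _ 0) ?big_ord0 ?mulr0 ?mul0r.
Qed.

Lemma ball0 (r : R) q : 0 <= r -> ball2 q r (cst 0).
Proof.
move=> r0; split; first by apply: RpI => //; exact: l2_cst0.
by rewrite /norm2 (@dot_supp _ 0) ?big_ord0 ?sqrtr0.
Qed.

Lemma sup_ge0 (A : set R^nat) (h : R^nat) : A (cst 0) ->
  (0 <= ereal_sup [set (dot x h)%:E | x in A])%E.
Proof.
move=> A0; apply: ereal_sup_ubound; exists (cst 0) => //.
by congr EFin; rewrite (@dot_supp _ 0) ?big_ord0.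
Qed.

Lemma ell_starE : ell_star P g (S_t @` ball2 p 1) = (\int[P]_w (norm2 (Yt w) * \1_Om w)%:E)%E.
Proof.
apply: (integral_conull mOm POm).
- by move=> w; apply: sup_ge0; exists (cst 0); [exact: ball0|exact: spec_op0].
- by move=> w; rewrite lee_fin mulr_ge0 ?norm2_ge0.
by move=> w Ow; rewrite sup_tail// indicE mem_set// mulr1.
Qed.

Lemma mzk j : measurable_fun setT (fun w => zk w j).
Proof. by have [mz _ _ _] := sz; exact: mz. Qed.

Lemma lawzk m j : (j < win m)%N -> has_law P (fun w => zk w j) (normal_law 1).
Proof. by move=> /win_dim h; have [_ _ lz _] := sz; exact: lz. Qed.

Lemma wnorm_win_sqr m w : wnorm (win m) om (zk w) ^+ 2 = \sum_(j < k + win m) Yt w j ^+ 2.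
Proof.
rewrite wnorm_sqr; last by move=> j; exact: om_gt0.
rewrite big_split_ord/= [X in _ = X + _]big1 ?add0r; last first.
  by move=> j _; rewrite /Yt leqNgt ltn_ord mul0r expr0n.
apply: eq_bigr => j _; rewrite /Yt leq_addr mul1r exprMn sqr_sqrtr ?s0//.
Qed.

Lemma sum_win_cvg (a : R^nat) : (forall j, ~~ in_dim p j -> a j = 0) -> forall l : R,
  \sum_(j < n) a j @[n --> \oo] --> l -> \sum_(j < k + win m) a j @[m --> \oo] --> l.
Proof.
move=> a0 l cl; rewrite /win /lev; case: p a0 => [q a0|_].
  rewrite (_ : l = \sum_(j < k + (q - k)) a j); first exact: cvg_cst.
  apply/esym; have h : \sum_(j < n) a j @[n --> \oo] --> \sum_(j < k + (q - k)) a j.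
    apply: cvg_near_cst; near=> n.
    have nq : (k + (q - k) <= n)%N by near: n; exact: nbhs_infty_ge.
    rewrite -(sum_trunc a nq); apply: eq_bigr => j _; case: ltnP => // jq.
    apply: a0; rewrite /= -leqNgt; apply: leq_trans jq.
    by rewrite -leq_subLR.
  exact: (cvg_unique _ h cl).
apply/cvgrPdist_le => e e0; move/cvgrPdist_le: cl => /(_ e e0)[N _ hN].
exists (N + k)%N => // n /= Nn; apply: hN => /=; rewrite subnKC.
  by apply: leq_trans Nn; exact: leq_addr.
by apply: leq_trans Nn; exact: leq_addl.
Unshelve. all: by end_near. Qed.

Lemma wnorm_win_cvg w : Om w -> wnorm (win m) om (zk w) @[m --> \oo] --> norm2 (Yt w).
Proof.
move=> Ow.
under eq_fun do rewrite -[wnorm _ _ _]ger0_norm ?wnorm_ge0// -sqrtr_sqr wnorm_win_sqr.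
apply: (cvg_comp _ (@Num.sqrt R)); last exact: sqrt_continuous.
apply: (@sum_win_cvg (fun j => Yt w j ^+ 2)).
  by move=> j pj; rewrite /Yt zeta_out// !mulr0 expr0n.
have := dot_cvg (Yt_l2 Ow) (Yt_l2 Ow).
by under eq_fun do under eq_bigr do rewrite -expr2.
Qed.

Lemma wnorm_win_le m n w : (m <= n)%N -> wnorm (win m) om (zk w) <= wnorm (win n) om (zk w).
Proof.
move=> mn; rewrite -(@ler_sqr R) ?nnegrE ?wnorm_ge0// !wnorm_win_sqr.
have h : (k + win m <= k + win n)%N by rewrite leq_add2l win_le.
rewrite -(sum_trunc (fun j => Yt w j ^+ 2) h); apply: ler_sum => j _.
by case: ifP => // _; exact: sqr_ge0.
Qed.

Lemma mwnorm m : measurable_fun setT (fun w => wnorm (win m) om (zk w)).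
Proof. by apply: measurable_wnorm; [exact: mzk|move=> j; exact: om_gt0]. Qed.

Lemma mwnorm_Om m : measurable_fun setT (fun w => (wnorm (win m) om (zk w) * \1_Om w)%:E).
Proof.
apply/measurable_EFinP; apply: measurable_funM; first exact: mwnorm.
exact: measurable_indic.
Qed.

Lemma width_cvg : (\int[P]_w (wnorm (win m) om (zk w))%:E)%E @[m --> \oo] -->
  (\int[P]_w (norm2 (Yt w) * \1_Om w)%:E)%E.
Proof.
have e m : (\int[P]_w (wnorm (win m) om (zk w))%:E = \int[P]_w (wnorm (win m) om (zk w) * \1_Om w)%:E)%E.
  apply: (integral_conull mOm POm).
  - by move=> w; rewrite lee_fin wnorm_ge0.
  - by move=> w; rewrite lee_fin mulr_ge0 ?wnorm_ge0.
  by move=> w Ow; rewrite indicE mem_set// mulr1.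
under eq_fun do rewrite e.
have h := @cvg_monotone_convergence _ _ _ P setT measurableT
  (fun m w => (wnorm (win m) om (zk w) * \1_Om w)%:E) mwnorm_Om.
rewrite (_ : \int[P]_w (norm2 (Yt w) * \1_Om w)%:E =
    \int[P]_w (limn (fun m => (wnorm (win m) om (zk w) * \1_Om w)%:E)))%E.
  apply: h.
  - by move=> m w _; rewrite lee_fin mulr_ge0 ?wnorm_ge0.
  - by move=> w _ m n mn; rewrite lee_fin ler_wpM2r// wnorm_win_le.
apply: eq_integral => w _; apply/esym/cvg_lim => //.
rewrite indicE; have [/set_mem Ow|_] := boolP (w \in Om); last first.
  by rewrite mulr0; under eq_fun do rewrite mulr0; exact: cvg_cst.
rewrite mulr1; under eq_fun do rewrite mulr1.
by apply: cvg_EFin; [exact: nearW|exact: wnorm_win_cvg].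
Qed.

Lemma trt_cvg : \sum_(j < win m) om j @[m --> \oo] --> trt.
Proof.
have h0 j : ~~ in_dim p j -> high_part k sigma j = 0.
  by move=> pj; rewrite /high_part; case: leqP => // _; rewrite (eigen_val_out es pj).
have ch : cvgn (series (high_part k sigma)).
  apply: (@nneg_cvg_series _ _ (limn (series sigma))) => [j|n].
    by rewrite /high_part; case: leqP; rewrite ?s0.
  apply: le_trans (nneg_sum_le_lim n s0 (sigma_cvg es cov)); apply: ler_sum => j _.
  by rewrite /high_part; case: leqP; rewrite ?s0.
have {ch} : \sum_(j < n) high_part k sigma j @[n --> \oo] --> trt.
  by move: ch; rewrite /trt /series/=; under eq_fun do rewrite big_mkord.
move=> /(sum_win_cvg h0); under eq_fun do rewrite big_split_ord/=.
under eq_fun => m.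
  rewrite [X in X + _]big1 ?add0r; last by move=> j _; rewrite /high_part leqNgt ltn_ord.
  under eq_bigr do rewrite /high_part leq_addr; over.
done.
Qed.

Lemma sum_om_le m : \sum_(j < win m) om j <= trt.
Proof.
have nd : nondecreasing_seq (fun m => \sum_(j < win m) om j).
  move=> a b ab; rewrite -(sum_trunc om (win_le ab)); apply: ler_sum => j _.
  by case: ifP => // _; exact: s0.
rewrite -(cvg_lim _ trt_cvg)//; apply: (nondecreasing_cvgn_le nd).
by apply/cvg_ex; eexists; exact: trt_cvg.
Qed.

Lemma trt_ge0 : 0 <= trt.
Proof. by apply: le_trans (sum_om_le 0); apply: sumr_ge0 => j _; exact: s0. Qed.

Definition ell : R := fine (ell_star P g (S_t @` ball2 p 1)).

Lemma width_le : (\int[P]_w (norm2 (Yt w) * \1_Om w)%:E <= (Num.sqrt trt)%:E)%E.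
Proof.
rewrite -(cvg_lim _ width_cvg)//; apply: lime_le; first by apply/cvg_ex; eexists; exact: width_cvg.
apply: nearW => m; apply: le_trans (expect_wnorm_le mzk (fun j => @om_gt0 m j) (@lawzk m)) _.
by rewrite lee_fin ler_wsqrtr// sum_om_le.
Qed.

Lemma width_ge0 : (0 <= \int[P]_w (norm2 (Yt w) * \1_Om w)%:E)%E.
Proof. by apply: integral_ge0 => w _; rewrite lee_fin mulr_ge0 ?norm2_ge0. Qed.

Lemma ellE : (\int[P]_w (norm2 (Yt w) * \1_Om w)%:E = ell%:E)%E.
Proof.
rewrite /ell ell_starE fineK// fin_numElt (lt_le_trans (ltNyr 0) width_ge0)/=.
exact: le_lt_trans width_le (ltry _).
Qed.

Lemma ell_le : ell <= Num.sqrt trt. Proof. by rewrite -lee_fin -ellE width_le. Qed.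

Lemma ell_ge0 : 0 <= ell. Proof. by rewrite -lee_fin -ellE width_ge0. Qed.

Lemma ell_ge : @absmean R * Num.sqrt trt <= ell.
Proof.
have h : (@absmean R * Num.sqrt (\sum_(j < win m) om j))%:E @[m --> \oo] -->
    ((@absmean R * Num.sqrt trt)%:E : \bar R).
  apply: cvg_EFin; first exact: nearW.
  apply: cvgM; first exact: cvg_cst.
  by apply: (cvg_comp _ (@Num.sqrt R)); [exact: trt_cvg|exact: sqrt_continuous].
rewrite -lee_fin -ellE -(cvg_lim _ h)// -(cvg_lim _ width_cvg)//.
apply: lee_lim; [by apply/cvg_ex; eexists; exact: h|by apply/cvg_ex; eexists; exact: width_cvg|].
by apply: nearW => m; exact: expect_wnorm_ge mzk (fun j => @om_gt0 m j) (@lawzk m).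
Qed.

Definition Lw (m : nat) : R := fine (\int[P]_w (wnorm (win m) om' (zk w))%:E)%E.

Lemma om'_gt0 m j : (j < win m)%N -> 0 < om' j.
Proof. by move=> /om'_bound/andP[]. Qed.

Lemma LwE m : (\int[P]_w (wnorm (win m) om' (zk w))%:E = (Lw m)%:E)%E.
Proof.
rewrite /Lw fineK// fin_numElt (lt_le_trans (ltNyr 0))/=; last first.
  by apply: integral_ge0 => w _; rewrite lee_fin wnorm_ge0.
exact: le_lt_trans (expect_wnorm_le mzk (fun j => @om'_gt0 m j) (@lawzk m)) (ltry _).
Qed.

Lemma Lw_le m : Lw m <= Num.sqrt (2 * trt).
Proof.
rewrite -lee_fin -LwE; apply: le_trans (expect_wnorm_le mzk (fun j => @om'_gt0 m j) (@lawzk m)) _.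
rewrite lee_fin ler_wsqrtr//; apply: (@le_trans _ _ (2 * \sum_(j < win m) om j)).
  by rewrite mulr_sumr; apply: ler_sum => j _; exact: om'_le.
by rewrite ler_wpM2l// sum_om_le.
Qed.

Lemma Lw_ge0 m : 0 <= Lw m.
Proof. by rewrite -lee_fin -LwE; apply: integral_ge0 => w _; rewrite lee_fin wnorm_ge0. Qed.

Lemma win_cases : (forall m n, win m = win n) \/ (forall m, win m = (m - k)%N).
Proof. by rewrite /win /lev; case: p => [q|]; [left|right]. Qed.

Lemma mnormYt : measurable_fun setT (fun w => norm2 (Yt w) * \1_Om w).
Proof.
apply: (@measurable_fun_cvg _ _ _ _ (fun m w => wnorm (win m) om (zk w) * \1_Om w)).
  by move=> m; apply/measurable_EFinP; exact: mwnorm_Om.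
move=> w _; rewrite indicE; have [/set_mem Ow|_] := boolP (w \in Om); last first.
  by rewrite mulr0; under eq_fun do rewrite mulr0; exact: cvg_cst.
by rewrite mulr1; under eq_fun do rewrite mulr1; exact: wnorm_win_cvg.
Qed.

(* Since om' > om at some index j0, the limit of the widths for om' is strictly larger than [ell]. *)
Section bump.
Variables (j0 : nat) (dl : R).
Hypothesis (dl0 : 0 < dl) (dlE : om' j0 = om j0 + dl).

Definition bump_norm (m : nat) (w : T) : R :=
  Num.sqrt (wnorm (win m) om (zk w) ^+ 2 + dl * zk w j0 ^+ 2).

Lemma bump_norm_le m w : (j0 < win m)%N -> bump_norm m w <= wnorm (win m) om' (zk w).
Proof.
move=> jm; rewrite -[leRHS]ger0_norm ?wnorm_ge0// -sqrtr_sqr ler_wsqrtr//.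
rewrite !wnorm_sqr; [|exact: om'_gt0|exact: om_gt0].
rewrite -lerBrDl -sumrB (bigD1 (Ordinal jm))//= dlE -mulrBl addrAC subrr add0r lerDl.
by apply: sumr_ge0 => j _; rewrite -mulrBl mulr_ge0 ?sqr_ge0// subr_ge0 om_le_om'.
Qed.

Lemma mbump m : measurable_fun setT (bump_norm m).
Proof.
apply: (measurableT_comp (continuous_measurable_fun (@sqrt_continuous R))).
apply: measurable_funD; first by apply: measurable_funX; exact: mwnorm.
by apply: measurable_funM; [exact: measurable_cst|apply: measurable_funX; exact: mzk].
Qed.

(** Equal expectations would force dl * zk_(j0)^2 = 0 almost surely, against the unit variance of a
    standard normal coordinate. *)
Lemma bump_limit_gt : (ell%:E < \int[P]_w
  (Num.sqrt (norm2 (Yt w) ^+ 2 + dl * zk w j0 ^+ 2) * \1_Om w)%:E)%E \/ ~ in_dim p (k + j0).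
Proof.
have [pj|pj] := boolP (in_dim p (k + j0)); last by right; exact/negP.
left; set H := fun w => Num.sqrt (norm2 (Yt w) ^+ 2 + dl * zk w j0 ^+ 2) * \1_Om w.
pose F w := norm2 (Yt w) * \1_Om w.
have mF : measurable_fun setT F := mnormYt.
have HE w : H w = Num.sqrt (F w ^+ 2 + dl * (zk w j0 * \1_Om w) ^+ 2).
  rewrite /H /F indicE; case: (_ \in _); rewrite ?mulr1// !mulr0 expr0n mulr0 addr0 sqrtr0//.
have mz : measurable_fun setT (fun w => (zk w j0 * \1_Om w) ^+ 2).
  by apply: measurable_funX; apply: measurable_funM; [exact: mzk|exact: measurable_indic].
have mH : measurable_fun setT H.
  rewrite (_ : H = fun w => Num.sqrt (F w ^+ 2 + dl * (zk w j0 * \1_Om w) ^+ 2)); last first.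
    by apply/funext => w; exact: HE.
  apply: (measurableT_comp (continuous_measurable_fun (@sqrt_continuous R))).
  by apply: measurable_funD; [exact: measurable_funX|apply: measurable_funM].
have F0 w : 0 <= F w by rewrite mulr_ge0 ?norm2_ge0.
have FH w : F w <= H w.
  rewrite HE -[leLHS]ger0_norm ?F0// -sqrtr_sqr ler_wsqrtr// lerDl.
  by rewrite mulr_ge0 ?sqr_ge0// ltW.
have e : (\int[P]_w (H w)%:E = ell%:E + \int[P]_w (H w - F w)%:E)%E.
  rewrite -ellE -ge0_integralD//=.
  - by apply: eq_integral => w _; rewrite -EFinD addrC subrK.
  - by move=> w _; rewrite lee_fin F0.
  - exact/measurable_EFinP.
  - by move=> w _; rewrite lee_fin subr_ge0.
  - by apply/measurable_EFinP; exact: measurable_funB.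
rewrite -/H e -[X in (X < _)%E]adde0 lteD2lE//.
have I0 : (0 <= \int[P]_w (H w - F w)%:E)%E by apply: integral_ge0 => w _; rewrite lee_fin subr_ge0.
rewrite lt_neqAle I0 andbT; apply/negP => /eqP/esym I1.
have : (\int[P]_w ((zk w j0 * \1_Om w) ^+ 2)%:E = 0)%E.
  apply: (@integral_eq0_sub _ _ _ P (fun w => (H w - F w)%:E)) I1.
  - by apply/measurable_EFinP; exact: measurable_funB.
  - exact/measurable_EFinP.
  - by move=> w; rewrite lee_fin subr_ge0.
  - by move=> w; rewrite lee_fin sqr_ge0.
  move=> w [] /eqP; rewrite subr_eq0 => /eqP HF; congr EFin.
  have : H w ^+ 2 = F w ^+ 2 by rewrite HF.
  rewrite HE sqr_sqrtr; last by rewrite addr_ge0 ?sqr_ge0// mulr_ge0 ?sqr_ge0// ltW.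
  move=> /eqP; rewrite -subr_eq0 addrAC subrr add0r mulf_eq0 gt_eqF//=.
  by move/eqP.
rewrite (integral_conull (h := fun w => (zk w j0 ^+ 2)%:E) mOm POm); last 3 first.
- by move=> w; rewrite lee_fin sqr_ge0.
- by move=> w; rewrite lee_fin sqr_ge0.
- by move=> w Ow; rewrite indicE mem_set// mulr1.
rewrite (@has_law_integral _ _ _ P (fun w => zk w j0) (fun x => (x ^+ 2)%:E)).
- by rewrite normal_var => -[] /eqP; rewrite oner_eq0.
- exact: mzk.
- by have [_ _ lz _] := sz; exact: lz.
- by apply/measurable_EFinP; exact: measurable_funX.
- by move=> x; rewrite lee_fin sqr_ge0.
Qed.

Lemma bump_cvg : (\int[P]_w (bump_norm m w * \1_Om w)%:E)%E @[m --> \oo] -->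
  (\int[P]_w (Num.sqrt (norm2 (Yt w) ^+ 2 + dl * zk w j0 ^+ 2) * \1_Om w)%:E)%E.
Proof.
have mb m : measurable_fun setT (fun w => (bump_norm m w * \1_Om w)%:E).
  by apply/measurable_EFinP; apply: measurable_funM; [exact: mbump|exact: measurable_indic].
have h := @cvg_monotone_convergence _ _ _ P setT measurableT
  (fun m w => (bump_norm m w * \1_Om w)%:E) mb.
rewrite (_ : (\int[P]_w (Num.sqrt (norm2 (Yt w) ^+ 2 + dl * zk w j0 ^+ 2) * \1_Om w)%:E)%E =
    (\int[P]_w (limn (fun m => (bump_norm m w * \1_Om w)%:E)))%E).
  apply: h.
  - by move=> m w _; rewrite lee_fin mulr_ge0 ?sqrtr_ge0.
  - move=> w _ m n mn; rewrite lee_fin ler_wpM2r// ler_wsqrtr// lerD2r.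
    by rewrite ler_sqr ?nnegrE ?wnorm_ge0// wnorm_win_le.
apply: eq_integral => w _; apply/esym/cvg_lim => //.
rewrite indicE; have [/set_mem Ow|_] := boolP (w \in Om); last first.
  by rewrite mulr0; under eq_fun do rewrite mulr0; exact: cvg_cst.
rewrite mulr1; under eq_fun do rewrite mulr1.
apply: cvg_EFin; first exact: nearW.
apply: (cvg_comp _ (@Num.sqrt R)); last exact: sqrt_continuous.
apply: cvgD; last exact: cvg_cst.
by apply: (cvg_comp _ (fun x : R => x ^+ 2)); [exact: wnorm_win_cvg|exact: exprn_continuous].
Qed.

(** The bumped widths converge to a limit strictly above [ell], so one of them already reaches
    [ell], and they increase with the window. *)
Lemma ell_le_bump m1 : (forall m, (m1 <= m)%N -> (j0 < win m)%N) ->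
  exists m0, forall m, (m0 <= m)%N -> ell <= Lw m.
Proof.
move=> hm1.
have gt : (ell%:E < \int[P]_w
  (Num.sqrt (norm2 (Yt w) ^+ 2 + dl * zk w j0 ^+ 2) * \1_Om w)%:E)%E.
  by case: bump_limit_gt => // -[]; exact: win_dim (hm1 m1 (leqnn _)).
have [[m2 m12 h2]|h] := pselect (exists2 m2, (m1 <= m2)%N &
    (ell%:E <= \int[P]_w (bump_norm m2 w * \1_Om w)%:E)%E); last first.
  exfalso; move: gt; apply/negP; rewrite -leNgt -(cvg_lim _ bump_cvg)//.
  apply: lime_le; first by apply/cvg_ex; eexists; exact: bump_cvg.
  near=> m; rewrite leNgt; apply/negP => h1; apply: h; exists m; last exact: ltW.
  by near: m; exact: nbhs_infty_ge.
exists m2 => m mm; rewrite -lee_fin -LwE; apply: le_trans h2 _.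
apply: ge0_le_integral => //.
- by move=> w _; rewrite lee_fin mulr_ge0 ?sqrtr_ge0.
- by apply/measurable_EFinP; apply: measurable_funM; [exact: mbump|exact: measurable_indic].
- by apply/measurable_EFinP; apply: measurable_wnorm; [exact: mzk|exact: om'_gt0].
move=> w _; rewrite lee_fin; apply: le_trans (bump_norm_le w (hm1 m (leq_trans m12 mm))).
apply: (@le_trans _ _ (bump_norm m2 w)).
  by rewrite ler_piMr ?sqrtr_ge0// indicE lern1; case: (_ \in _).
by rewrite ler_wsqrtr// lerD2r ler_sqr ?nnegrE ?wnorm_ge0// wnorm_win_le.
Unshelve. all: by end_near. Qed.
End bump.

(** In finite dimension the windows are constant and om <= om' suffices. For p = Infty the
    eigenvalues tend to 0, so some sigma_J is below sigma_k; at that index of the tail om' is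
    strictly larger than om and the bump argument applies. *)
Lemma ell_le_Lw : 0 < sigma k -> exists m0, forall m, (m0 <= m)%N -> ell <= Lw m.
Proof.
move=> sk; case: win_cases => hw.
  exists 0%N => m _; rewrite -lee_fin -LwE -ellE.
  have h := width_cvg; rewrite (_ : (fun m => _) = cst (\int[P]_w (wnorm (win m) om (zk w))%:E)%E) in h.
    have e : (\int[P]_w (norm2 (Yt w) * \1_Om w)%:E)%E = (\int[P]_w (wnorm (win m) om (zk w))%:E)%E.
      have h1 := cvg_lim (@ereal_hausdorff R) h; rewrite -h1; exact: (lim_cst (@ereal_hausdorff R)).
    rewrite e; apply: ge0_le_integral => //.
    - by move=> w _; rewrite lee_fin wnorm_ge0.
    - by apply/measurable_EFinP; exact: mwnorm.
    - by apply/measurable_EFinP; apply: measurable_wnorm; [exact: mzk|exact: om'_gt0].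
    move=> w _; rewrite lee_fin -(@ler_sqr R) ?nnegrE ?wnorm_ge0//.
    rewrite !wnorm_sqr; [|exact: om'_gt0|exact: om_gt0]; apply: ler_sum => j _.
    by rewrite ler_wpM2r ?sqr_ge0// om_le_om'.
  by apply/funext => n /=; rewrite (hw n m).
have /cvgrPdist_lt/(_ _ sk)[J _ hJ] := cvg_series_cvg_0 (sigma_cvg es cov).
have hJ' : sigma J < sigma k.
  by have := hJ J (leqnn J); rewrite /= sub0r normrN ger0_norm// s0.
have j1 m : (k + J.+1 <= m)%N -> (J < win m)%N by move=> h; rewrite hw ltn_subRL addnS in h *.
apply: (@ell_le_bump J (om' J - om J) _ _ (k + J.+1)%N j1); last by rewrite addrC subrK.
have sJ : 0 < om J by exact: om_gt0 (j1 _ (leqnn _)).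
rewrite subr_gt0 /om' lt_min; apply/andP; split; last by rewrite /om in sJ *; lra.
by apply: le_lt_trans hJ'; apply: (sigma_noninc es); exact: leq_addl.
Qed.

Section head.
Hypothesis kp : forall j, (j < k)%N -> in_dim p j.

Definition head_root (x : R^nat) : R^nat := fun j => low_part k (sqrt_seq sigma) j * x j.
Definition zh (w : T) : R^nat := fun j => if (j < k)%N then zeta w j else 0.

Lemma zh_std : std_gaussian_vec P (Fin k) zh.
Proof.
have h := @std_subfamily _ _ _ P _ _ _ [set j | in_dim (Fin k) j] _ id sz (fun j => @kp j)
  (fun _ _ _ _ => id).
rewrite /std_gaussian_vec (_ : (fun j w => zh w j) = (fun i => if pselect ([set j | in_dim (Fin k) j] i)
   then (fun w => zeta w (id i)) else cst 0))//.
apply/funext => j; apply/funext => w; rewrite /zh; case: pselect => /= h1.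
  by rewrite h1.
by case: ifP.
Qed.

Lemma Rp_Fin_sub (x : R^nat) : Rp (Fin k) x -> Rp p x.
Proof.
move=> px; apply: RpI; last exact: Rp_l2 px.
by move=> j pj; have /Rp_FinP := px; apply; rewrite leqNgt; apply: contra pj; exact: kp.
Qed.

Lemma head_coord y : Rp p y -> uc (S_h y) = head_root (uc y).
Proof.
move=> py; rewrite (coord_spec_op es (M := Num.sqrt (sigma 0%N)))// => j.
rewrite /low_part /sqrt_seq; case: ifP => _; rewrite ?normr0 ?sqrtr_ge0//.
exact: (sqrt_sigma_le es).
Qed.

Lemma S_h_Rp y : Rp p y -> Rp p (S_h y).
Proof.
move=> py; apply: (spec_op_Rp es (M := Num.sqrt (sigma 0%N))) => // j.
rewrite /low_part /sqrt_seq; case: ifP => _; rewrite ?normr0 ?sqrtr_ge0//.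
exact: (sqrt_sigma_le es).
Qed.

Lemma head_root_supp x j : (k <= j)%N -> head_root x j = 0.
Proof. by move=> kj; rewrite /head_root /low_part ltnNge kj mul0r. Qed.

Lemma dot_head_root w y : Om w -> Rp p y -> dot (S_h y) (g w) = dot (head_root (uc y)) (zh w).
Proof.
move=> Ow py.
have -> : low_part k (sqrt_seq sigma) = fun j => (j < k)%:R * Num.sqrt (sigma j).
  by apply/funext => j; rewrite /low_part /sqrt_seq; case: ltnP => _; rewrite ?mul1r ?mul0r.
have b1 j : `|(j < k)%:R| <= (1 : R) by exact: bool_norm_le1.
rewrite (dot_spec_root es b1 py (hz Ow)).
rewrite (dot_supp _ (@head_root_supp _)) (@dot_supp _ k); last first.
  by move=> j kj; rewrite ltnNge kj mul0r.
apply: eq_bigr => j _; rewrite /head_root /low_part /zh /sqrt_seq ltn_ord mul1r; ring.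
Qed.

Lemma ell_head (r : R) : 0 <= r ->
  ell_star P g ((S_h @` ball2 p 1) `&` ball2 p r) =
  ell_star P zh ((head_root @` ball2 (Fin k) 1) `&` ball2 (Fin k) r).
Proof.
move=> r0; apply: (integral_conull mOm POm).
- move=> w; apply: sup_ge0; split; last exact: ball0.
  by exists (cst 0); [exact: ball0|exact: spec_op0].
- move=> w; apply: sup_ge0; split; last exact: ball0.
  by exists (cst 0); [exact: ball0|apply/funext => j; rewrite /head_root mulr0].
move=> w Ow; congr ereal_sup; apply/seteqP; split => _ [_ [[y [py y1] <-] [_ yr]] <-].
- pose y2 := low_part k (uc y).
  have hy2 : head_root y2 = head_root (uc y).
    by apply/funext => j; rewrite /head_root /y2 /low_part; case: ifP => _; rewrite ?mul0r.
  have py2 : Rp (Fin k) y2.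
    by apply/Rp_FinP => j kj; rewrite /y2 /low_part ltnNge kj.
  exists (head_root (uc y)); last by rewrite dot_head_root.
  split; first (exists y2 => //; split => //).
    apply: le_trans y1; rewrite (norm2_coord es py); apply: norm2_le_sqr.
    apply: dot_le => n; apply: le_trans (sum_sqr_le_dot n (coord_l2 es (Rp_l2 py))).
    apply: ler_sum => j _; rewrite /y2 /low_part; case: ifP => // _.
    by rewrite expr0n sqr_ge0.
  split; first by apply/Rp_FinP => j; exact: head_root_supp.
  by rewrite -head_coord// -(norm2_coord es)//; exact: S_h_Rp.
- have py2 := Rp_Fin_sub py; have ps := syn_Rp es py2.
  have e := coord_syn es py2.
  exists (S_h (syn u y)); last by rewrite dot_head_root// e.
  split; first (exists (syn u y) => //; split => //).
    by rewrite (norm2_coord es)// e.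
  split; first exact: S_h_Rp.
  by rewrite (norm2_coord es) ?head_coord ?e//; exact: S_h_Rp.
Qed.

(** The restricted isometry property is applied in dimension k and in the eigenbasis, where the
    normalized design has standard Gaussian entries. The rotation and the restriction to k
    coordinates preserve the localized widths ([ell_head]), hence the radius. *)
Lemma R_N_head (kappa : R) (N : nat) : R_N P g kappa N p (S_h @` ball2 p 1) =
  R_N P zh kappa N (Fin k) (head_root @` ball2 (Fin k) 1).
Proof.
congr inf; apply/seteqP; split => r /= [r0 h]; (split; first exact: r0).
  by rewrite -(ell_head (ltW r0)).
by rewrite (ell_head (ltW r0)).
Qed.
End head.

End width.

(** * The normalized design *)

Section gaussian_rows.
Context {R : realType} d (T : measurableType d) (P : probability T R).

Lemma big_seq_box (s : seq (nat * nat)) (F : nat * nat -> R) (m n : nat) : uniq s ->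
  (forall q, q \in s -> (q.1 < m)%N && (q.2 < n)%N) ->
  \sum_(q <- s) F q = \sum_(r < m) \sum_(j < n) if ((r : nat), (j : nat)) \in s then F ((r : nat), (j : nat)) else 0.
Proof.
move=> us sb; transitivity (\sum_(q <- [seq (r, j) | r <- iota 0 m, j <- iota 0 n]) if q \in s then F q else 0).
  rewrite -big_mkcond -[RHS]big_filter; apply: perm_big; apply: uniq_perm => //.
    rewrite filter_uniq//; apply: allpairs_uniq; rewrite ?iota_uniq//.
    by move=> [? ?] [? ?].
  move=> [r j]; rewrite mem_filter; have [/sb/= /andP[rm jn]|//] := boolP (_ \in s).
  by apply/esym/allpairsP; exists (r, j); rewrite !mem_iota/= !add0n rm jn.
rewrite big_allpairs -(big_mkord xpredT (fun r => \sum_(j < n) if (r, (j : nat)) \in s then F (r, (j : nat)) else 0)).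
rewrite /index_iota subn0; apply: eq_bigr => r _.
by rewrite -(big_mkord xpredT (fun j => if (r, j) \in s then F (r, j) else 0)) /index_iota subn0.
Qed.

Variables (M : nat) (D : set (nat * nat)) (V : nat * nat -> T -> R).
Hypothesis mV : forall q, measurable_fun setT (V q).
Hypothesis V0 : forall q, ~ D q -> V q = cst 0.
Hypothesis DM : forall q, D q -> (q.1 < M)%N.
Hypothesis row_law : forall m (c : R^nat) n, (m < M)%N -> (forall j, ~ D (m, j) -> c j = 0) ->
  \sum_(j < n) c j ^+ 2 = 1 -> has_law P (fun w => \sum_(j < n) c j * V (m, (j : nat)) w) (normal_law 1).
Hypothesis row_indep : forall m A B, (m < M)%N ->
  <<s hist_gen V [set q | (q.1 < m)%N] >> A -> sigma_of (fun j => V (m, j)) B ->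
  P (A `&` B) = (P A * P B)%E.

Let cosM (h : T -> R) : measurable_fun setT h -> measurable_fun setT (fun w => cos (h w)).
Proof. exact: (measurableT_comp (continuous_measurable_fun (@continuous_cos R))). Qed.

(** Induction on the rows: the linear form on row m is s times a standard normal variable Y,
    independent of the earlier rows, and [normal_cosD] integrates its cosine. *)
Lemma rows_cos (a : nat * nat -> R) (n m : nat) (t : R) : (m <= M)%N ->
  (forall q, ~ D q -> a q = 0) ->
  (\int[P]_w (cos (\sum_(r < m) \sum_(j < n) a ((r : nat), (j : nat)) * V ((r : nat), (j : nat)) w + t))%:E =
   (expR (- ((\sum_(r < m) \sum_(j < n) a ((r : nat), (j : nat)) ^+ 2) / 2)) * cos t)%:E)%E.
Proof.
move=> + a0; elim: m t => [|m IH] t mM.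
  under eq_integral do rewrite big_ord0 add0r.
  by rewrite integral_cst// [X in (_ * X)%E]probability_setT mule1 big_ord0 mul0r oppr0 expR0 mul1r.
set s2 := \sum_(j < n) a (m, (j : nat)) ^+ 2.
have s20 : 0 <= s2 by apply: sumr_ge0 => j _; exact: sqr_ge0.
rewrite big_ord_recr/= -/s2.
(* A row of zero coefficients cannot be normalized, but contributes nothing. *)
have [s0|s0] := eqVneq s2 0.
  have am (j : 'I_n) : a (m, (j : nat)) = 0.
    move/eqP : s0; rewrite psumr_eq0 => [/allP/(_ j)|i _]; last exact: sqr_ge0.
    by rewrite mem_index_enum => /(_ isT)/=; rewrite sqrf_eq0 => /eqP.
  rewrite s0 addr0 -IH; last exact: ltnW.
  apply: eq_integral => w _; rewrite big_ord_recr/= [X in cos (_ + X + _)]big1 ?addr0// => j _.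
  by rewrite am mul0r.
have sp : 0 < Num.sqrt s2 by rewrite sqrtr_gt0 lt_neqAle eq_sym s0.
set s := Num.sqrt s2 in sp.
have ss : s ^+ 2 = s2 by rewrite sqr_sqrtr.
pose J : set (nat * nat) := [set q | (q.1 < m)%N].
pose S w := \sum_(r < m) \sum_(j < n) a ((r : nat), (j : nat)) * V ((r : nat), (j : nat)) w.
have hS : measurable_fun setT (S : hist V J -> R).
  apply: measurable_sum => r; apply: measurable_sum => j; apply: measurable_funM; first exact: measurable_cst.
  by apply: hist_measurable; exact: ltn_ord.
pose c (j : nat) := s^-1 * a (m, j).
pose Y w := \sum_(j < n) c j * V (m, (j : nat)) w.
have YE w : s * Y w = \sum_(j < n) a (m, (j : nat)) * V (m, (j : nat)) w.
  rewrite /Y mulr_sumr; apply: eq_bigr => j _.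
  by rewrite /c -!mulrA mulVKf// gt_eqF.
have mY : measurable_fun setT Y.
  by apply: measurable_sum => j; apply: measurable_funM => //; exact: mV.
have lY : has_law P Y (normal_law 1).
  apply: row_law => //; first by move=> j nD; rewrite /c a0// mulr0.
  under eq_bigr do rewrite exprMn; rewrite -mulr_sumr -/s2 exprVn ss mulVf//.
have rY B : measurable B -> sigma_of (fun j => V (m, j)) (Y @^-1` B).
  move=> mB; pose G : set (set T) := [set A | exists j, exists2 B : set R, measurable B & A = V (m, j) @^-1` B].
  have h : measurable_fun setT (Y : g_sigma_algebraType G -> R).
    apply: measurable_sum => j; apply: measurable_funM; first exact: measurable_cst.
    move=> _ B' mB'; rewrite setTI; apply: sub_sigma_algebra; by exists j, B'.
  by have := h measurableT B mB; rewrite setTI.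
pose f (z : hist V J * measurableTypeR R) : \bar R := (1 + cos (s * z.2 + (S z.1 + t)))%:E.
have mf : measurable_fun setT f.
  apply/measurable_EFinP; apply: measurable_funD; first exact: measurable_cst.
  apply: (measurableT_comp (continuous_measurable_fun (@continuous_cos R))).
  apply: measurable_funD; first by apply: measurable_funM; [exact: measurable_cst|exact: measurable_snd].
  apply: measurable_funD; last exact: measurable_cst.
  exact: (measurableT_comp hS (@measurable_fst _ _ (hist V J) (measurableTypeR R))).
have f0 z : (0 <= f z)%E.
  by rewrite lee_fin -lerBlDl sub0r; have := cos_max (s * z.2 + (S z.1 + t)); rewrite ler_norml => /andP[].
have mS : measurable_fun setT S := hist_meas mV hS.
have mY' : measurable_fun setT (Y : T -> measurableTypeR R) := mY.
have := @freeze _ _ _ P _ (hist V J) _ (measurableTypeR R) (@normal_prob R 0 1) (id : T -> hist V J) Y f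
  (@hist_id_measurable _ _ _ _ V mV J) mY' _ mf f0.
have ind A B : (measurable (A : set (hist V J))) -> measurable (B : set (measurableTypeR R)) ->
     P ((id : T -> hist V J) @^-1` A `&` Y @^-1` B) = (P ((id : T -> hist V J) @^-1` A) * normal_prob 0 1 B)%E.
  move=> mA mB; rewrite preimage_id (row_indep mM mA (rY B mB)).
  by rewrite (lY B mB) /normal_law oner_eq0.
move=> /(_ ind).
have -> : (\int[P]_w f (w, Y w) = 1 + \int[P]_w (cos (\sum_(r < m.+1) \sum_(j < n) a ((r : nat), (j : nat)) * V ((r : nat), (j : nat)) w + t))%:E)%E.
  rewrite -integral_1D; last by move=> w; exact: cos_max.
    apply: eq_integral => w _; rewrite /f/= YE big_ord_recr/= -/(S w); congr (1 + cos _)%:E; ring.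
  apply: cosM; apply: measurable_funD => //; apply: measurable_sum => r; apply: measurable_sum => j.
  by apply: measurable_funM => //; exact: mV.
have -> : (\int[P]_w \int[normal_prob 0 1]_y f (w, y) =
    1 + \int[P]_w (expR (- (s2 / 2)) * cos (S w + t))%:E)%E.
  rewrite -integral_1D; last 2 first.
  - by apply: measurable_funM => //; apply: cosM; apply: measurable_funD.
  - move=> w; rewrite normrM mulr_ile1// ?cos_max// ger0_norm ?expR_ge0//.
    by rewrite -expR0 ler_expR oppr_le0 divr_ge0.
  apply: eq_integral => w _; rewrite /f/= EFinD -ss -normal_cosD.
  apply: integral_1D; last by move=> y; exact: cos_max.
  by mfun.
have mcn : measurable_fun setT (fun w => cos (S w + t)).
  by apply: cosM; apply: measurable_funD.
under [in X in _ = X -> _]eq_integral do rewrite EFinM.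
rewrite integralZl//; last first.
  by apply: (@bounded_integrable _ _ _ P _ 1) => //; [exact: prob_lty|move=> w; exact: cos_max].
rewrite IH; last exact: ltnW.
set I1 := (\int[P]_w _)%E.
have fin : I1 \is a fin_num.
  apply: integrable_fin_num => //; apply: (@bounded_integrable _ _ _ P _ 1) => //.
  - exact: prob_lty.
  - apply: cosM; apply: measurable_funD => //; apply: measurable_sum => r; apply: measurable_sum => j.
    by apply: measurable_funM => //; exact: mV.
  - by move=> w; exact: cos_max.
rewrite -(fineK fin) -!EFinD => -[] /addrI ->; congr EFin.
by rewrite mulrA -expRD; congr (expR _ * _); field.
Qed.

Lemma std_of_rows : std_gaussian_family P D V.
Proof.
have cosV (s : seq (nat * nat)) (c : nat * nat -> R) (t : R) : uniq s -> (forall q, q \in s -> D q) ->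
    (\int[P]_w (cos (\sum_(q <- s) c q * V q w + t))%:E =
     (expR (- ((\sum_(q <- s) c q ^+ 2) / 2)) * cos t)%:E)%E.
  move=> us sD; pose n := (\max_(q <- s) q.2).+1.
  have sb q : q \in s -> (q.1 < M)%N && (q.2 < n)%N.
    by move=> qs; rewrite (DM (sD _ qs))/= ltnS; exact: (@leq_bigmax_seq _ s xpredT (fun q : nat * nat => q.2) q).
  pose a q := if q \in s then c q else 0.
  rewrite (big_seq_box _ us sb).
  have := @rows_cos a n M t (leqnn _) _; rewrite (eq_bigr (fun r : 'I_M => \sum_(j < n)
     if ((r : nat), (j : nat)) \in s then c ((r : nat), (j : nat)) ^+ 2 else 0)) => [<-|r _].
  - apply: eq_integral => w _; rewrite (big_seq_box _ us sb); congr (cos (_ + _))%:E.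
    apply: eq_bigr => r _; apply: eq_bigr => j _; rewrite /a; case: ifP => // _.
    by rewrite mul0r.
  - by move=> q nD; rewrite /a; case: ifP => // /sD.
  - by apply: eq_bigr => j _; rewrite /a; case: ifP => // _; rewrite expr0n.
split => //.
- by move=> q Dq; exact: (cos_law mV cosV Dq).
- exact: (cos_mutual_indep mV cosV).
Qed.
End gaussian_rows.

Section model.
Context {R : realType} (N : nat) (p : xdim) (Sigma : R^nat -> R^nat) (sigma : R^nat)
  (u : nat -> R^nat) (beta : R^nat) (sxi : R) d (T : measurableType d) (P : probability T R)
  (X : 'I_N -> T -> R^nat) (xi betahat : T -> R^nat).
Hypothesis gm : gaussian_linear_model p Sigma sigma u beta sxi P X xi betahat.
Local Notation es := (model_eigen gm).
Local Notation uc := (ucoord u).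

Definition design (i : 'I_N) (j : nat) (w : T) : R := (Num.sqrt (sigma j))^-1 * uc (X i w) j.

(* Rows 0, ..., N - 1 are those of the normalized design, row N is the normalized noise. *)
Definition gauss (q : nat * nat) (w : T) : R :=
  if insub q.1 is Some i then design i q.2 w
  else if q.1 == N then sxi^-1 * xi w q.2 else 0.

(** The noise row belongs to the family only for sxi != 0: otherwise 0^-1 = 0 makes the normalized
    noise identically zero, which is not a standard normal variable. *)
Definition gauss_dom : set (nat * nat) :=
  [set q | if (q.1 < N)%N then in_dim p q.2 else [&& q.1 == N, (q.2 < N)%N & sxi != 0]].

Lemma gauss_design (i : 'I_N) j : gauss ((i : nat), j) = design i j.
Proof. by apply/funext => w; rewrite /gauss/= valK. Qed.

Lemma gauss_noise j w : gauss (N, j) w = sxi^-1 * xi w j.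
Proof. by rewrite /gauss/= insubF ?ltnn// eqxx. Qed.

Lemma X_Rp i w : Rp p (X i w). Proof. by have [h _ _] := model_rows gm i. Qed.

Lemma xi_out w j : (N <= j)%N -> xi w j = 0.
Proof. by have [h _ _] := model_noise gm; move: j; apply/Rp_FinP; exact: h. Qed.

Lemma coord_design i j w : uc (X i w) j = Num.sqrt (sigma j) * design i j w.
Proof.
rewrite /design; have [pj|pj] := boolP (in_dim p j); last by rewrite (coord_out es)// !mulr0.
by rewrite mulVKf// gt_eqF// sqrtr_gt0 (eigen_val_gt0 es).
Qed.

Lemma sigma_of_sub (I I' : Type) (Y : I -> T -> R) (Y' : I' -> T -> R) :
  (forall i B, measurable B -> sigma_of Y' (Y i @^-1` B)) -> sigma_of Y `<=` sigma_of Y'.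
Proof.
move=> h; apply: smallest_sub; first exact: smallest_sigma_algebra.
by move=> _ [i [B mB ->]]; exact: h.
Qed.

(** An entry of the normalized design is a limit of finite combinations of the coordinates of its
    own row, so the independence of the rows is inherited. *)
Lemma design_sigma i j B : measurable B ->
  sigma_of (fun j w => X i w j) (design i j @^-1` B).
Proof.
move=> mB.
pose G : set (set T) := [set A | exists j, exists2 B : set R, measurable B & A = (fun w => X i w j) @^-1` B].
have mX l : measurable_fun setT ((fun w => X i w l) : g_sigma_algebraType G -> R).
  by move=> _ B' mB'; rewrite setTI; apply: sub_sigma_algebra; exists l, B'.
have h : measurable_fun setT (design i j : g_sigma_algebraType G -> R).
  apply: measurable_funM; first exact: measurable_cst.
  apply: (@measurable_fun_cvg _ (g_sigma_algebraType G) _ _ (fun n w => \sum_(l < n) u j l * X i w l)).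
    move=> n; apply: measurable_sum => l; apply: measurable_funM; [exact: measurable_cst|exact: mX].
  by move=> w _; apply: dot_cvg; [exact: (l2_u es)|exact: Rp_l2 (X_Rp i w)].
by have := h measurableT B mB; rewrite setTI.
Qed.

Lemma sigma_of_gsub (I : Type) (Y : I -> T -> R) : (forall i, measurable_fun setT (Y i)) ->
  sigma_of Y `<=` measurable.
Proof.
move=> mY; apply: smallest_sub; first exact: sigma_algebra_measurable.
by move=> _ [i [B mB ->]]; rewrite -[X in measurable X]setTI; exact: mY.
Qed.

Lemma row_sigma_measurable i : sigma_of (fun j w => X i w j) `<=` measurable.
Proof. by apply: sigma_of_gsub => j; have [_ h _] := model_rows gm i; exact: h. Qed.

Lemma mxi j : measurable_fun setT (fun w => xi w j).
Proof. by have [_ h _] := model_noise gm; exact: h. Qed.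

Lemma gauss_measurable q : measurable_fun setT (gauss q).
Proof.
rewrite /gauss; case: insubP => [i _ _|_].
  by move=> _ B mB; rewrite setTI; exact: (@row_sigma_measurable i _ (@design_sigma i q.2 B mB)).
case: eqP => _; last exact: measurable_cst.
by apply: measurable_funM => //; exact: mxi.
Qed.

Lemma gauss_off q : ~ gauss_dom q -> gauss q = cst 0.
Proof.
case: q => r j; rewrite /gauss_dom /gauss /= => nD; apply/funext => w; move: nD.
case: insubP => [i -> /= _|/negbTE ->].
  by move/negP => pj; rewrite /design (coord_out es)// mulr0.
case: eqP => //= _ /negP; rewrite negb_and -leqNgt negbK => /orP[jN|/eqP ->].
  by rewrite xi_out// mulr0.
by rewrite invr0 mul0r.
Qed.

(** The combination is the pairing of row m with v = sum_j (c_j / sqrt(sigma_j)) u_j, for which <v,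
    Sigma v> = sum_j c_j^2 = 1. For the noise row, v is c / sxi. *)
Lemma gauss_row_law m (c : R^nat) n : (m < N.+1)%N -> (forall j, ~ gauss_dom (m, j) -> c j = 0) ->
  \sum_(j < n) c j ^+ 2 = 1 -> has_law P (fun w => \sum_(j < n) c j * gauss (m, (j : nat)) w) (normal_law 1).
Proof.
rewrite ltnS leq_eqVlt => /orP[/eqP ->|mN] c0 c1.
  have [s0|s0] := eqVneq sxi 0.
    suff : \sum_(j < n) c j ^+ 2 = 0 by rewrite c1 => /eqP; rewrite oner_eq0.
    apply: big1 => j _; have -> : c j = 0; last by rewrite expr0n.
    by apply: c0; rewrite /gauss_dom/= ltnn s0 !eqxx/=; case/andP.
  pose b : R^nat := fun j => if (j < n)%N then c j / sxi else 0.
  have b0 j : (n <= j)%N -> b j = 0 by rewrite /b leqNgt => /negbTE ->.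
  have pb : Rp (Fin N) b.
    apply/Rp_FinP => j Nj; rewrite /b c0 ?mul0r ?if_same//.
    by rewrite /gauss_dom/= ltnn (ltnNge j) Nj andbF.
  have [_ _ law] := model_noise gm; have := law b pb.
  have -> : dot b ((sxi ^+ 2) \*o b) = 1.
    rewrite (dot_supp _ b0) -c1; apply: eq_bigr => j _.
    rewrite /= /b ltn_ord; by field.
  rewrite sqrtr1 (_ : (fun w => dot b (xi w)) = fun w => \sum_(j < n) c j * gauss (N, (j : nat)) w)//.
  apply/funext => w; rewrite (dot_supp _ b0); apply: eq_bigr => j _.
  by rewrite /b ltn_ord gauss_noise mulrA.
pose i := Ordinal mN.
have c0' j : ~~ in_dim p j -> c j = 0 by move=> pj; apply: c0; rewrite /gauss_dom/= mN; exact/negP.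
pose a : R^nat := fun j => c j * (Num.sqrt (sigma j))^-1.
have a0 j : ~~ in_dim p j -> a j = 0 by move=> /c0' cj; rewrite /a cj mul0r.
pose v : R^nat := fun l => \sum_(j < n) a j * u j l.
have pv : Rp p v.
  apply: RpI; last exact: (fin_comb_l2 es).
  by move=> l pl; rewrite /v big1// => j _; rewrite (u_out es)// mulr0.
have [_ _ law] := model_rows gm i; have := law v pv.
have -> : dot v (Sigma v) = 1.
  have [[SRp _ _ _] _] := model_cov gm.
  rewrite -(parseval es pv (SRp _ pv)) (@dot_supp _ n); last first.
    by move=> j nj; rewrite /ucoord (dot_u_fin es)// ltnNge nj.
  rewrite -c1; apply: eq_bigr => j _.
  rewrite (coord_Sigma es (model_cov gm))// /ucoord (dot_u_fin es)// ltn_ord.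
  have [pj|pj] := boolP (in_dim p j); last by rewrite a0// c0'// mul0r expr0n.
  have sj := eigen_val_gt0 es pj.
  rewrite /a mulrCA -expr2 exprMn exprVn sqr_sqrtr; last exact: ltW.
  by rewrite mulrCA divff ?mulr1// gt_eqF.
rewrite sqrtr1 (_ : (fun w => dot v (X i w)) = fun w => \sum_(j < n) c j * gauss (m, (j : nat)) w)//.
apply/funext => w; rewrite (dot_fin_comb es)//; last exact: Rp_l2 (X_Rp i w).
by apply: eq_bigr => j _; rewrite (gauss_design i) /design mulrA.
Qed.

Lemma gauss_row_indep m A B : (m < N.+1)%N ->
  <<s hist_gen gauss [set q | (q.1 < m)%N] >> A -> sigma_of (fun j => gauss (m, j)) B ->
  P (A `&` B) = (P A * P B)%E.
Proof.
have gs (i : 'I_N) j C : measurable C -> sigma_of (fun j w => X i w j) (gauss ((i : nat), j) @^-1` C).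
  by rewrite gauss_design; exact: design_sigma.
rewrite ltnS leq_eqVlt => /orP[/eqP ->|mN] hA hB.
  apply: (model_noise_indep gm).
    move: A hA; apply: smallest_sub; first exact: smallest_sigma_algebra.
    move=> A [[r j] /= rN]; apply: sigma_of_sub => _ C mC.
    apply: (@sigma_of_sub _ _ (fun j w => X (Ordinal rN) w j)); last exact: (gs (Ordinal rN)).
    by move=> l E mE; apply: sub_sigma_algebra; exists (Ordinal rN, l), E.
  move: B hB; apply: sigma_of_sub => j C mC.
  pose G : set (set T) := [set A | exists j, exists2 B : set R, measurable B & A = (fun w => xi w j) @^-1` B].
  have h : measurable_fun setT (gauss (N, j) : g_sigma_algebraType G -> R).
    rewrite (_ : gauss (N, j) = fun w => sxi^-1 * xi w j); last first.
      by apply/funext => w; exact: gauss_noise.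
    apply: measurable_funM; first exact: measurable_cst.
    by move=> _ E mE; rewrite setTI; apply: sub_sigma_algebra; exists j, E.
  by have := h measurableT C mC; rewrite setTI.
pose i := Ordinal mN.
apply: (mutual_indep_group (J := [set k : 'I_N | (k < m)%N]) (j := i) (model_rows_indep gm)) => //.
- by move=> k _; exact: row_sigma_measurable.
- move=> k _; pose G : set (set T) := [set A | exists j, exists2 B : set R, measurable B & A = (fun w => X k w j) @^-1` B].
  exact: (@measurableT _ (g_sigma_algebraType G)).
- move=> k _; pose G : set (set T) := [set A | exists j, exists2 B : set R, measurable B & A = (fun w => X k w j) @^-1` B].
  exact: (@measurableI _ (g_sigma_algebraType G)).
- by rewrite /= ltnn.
- move: A hA; apply: smallest_sub; first exact: smallest_sigma_algebra.
  move=> A [[r j] /= rm] hA; apply: sub_sigma_algebra.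
  have rN := ltn_trans rm mN; exists (Ordinal rN) => //.
  by move: A hA; apply: sigma_of_sub => _ C mC; exact: (gs (Ordinal rN)).
- by move: B hB; apply: sigma_of_sub => j C mC; exact: (gs i).
Qed.

Lemma gauss_std : std_gaussian_family P gauss_dom gauss.
Proof.
apply: (@std_of_rows _ _ _ _ N.+1) => //.
- exact: gauss_measurable.
- exact: gauss_off.
- move=> [r j]; rewrite /gauss_dom/=; case: ltnP => [rN _|_ /andP[/eqP -> _]]; rewrite ltnS//.
  exact: ltnW.
- exact: gauss_row_law.
- exact: gauss_row_indep.
Qed.

(** For sxi = 0 each coordinate of the noise has the Dirac mass as law, hence vanishes almost
    surely; for sxi != 0 the identity holds everywhere. *)
Lemma noise_conull : exists Om : set T, [/\ measurable Om, P Om = 1%E &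
  forall w, Om w -> forall j, xi w j = sxi * gauss (N, j) w].
Proof.
have [s0|s0] := eqVneq sxi 0; last first.
  exists setT; split => //; first exact: probability_setT.
  by move=> w _ j; rewrite gauss_noise mulVKf.
pose E j : set T := [set w | xi w j != 0].
have EE j : E j = ~` ((fun w => xi w j) @^-1` [set 0]).
  by apply/seteqP; split => w /=; [move=> /eqP|move=> h; apply/eqP].
have m0 j : measurable ((fun w => xi w j) @^-1` [set 0]).
  by rewrite -[X in measurable X]setTI; apply: mxi.
have mE j : measurable (E j) by rewrite EE; exact: measurableC.
exists (~` \bigcup_j E j); split.
- by apply: measurableC; exact: bigcupT_measurable.
- rewrite probability_setC; last exact: bigcupT_measurable.
  suff -> : P (\bigcup_j E j) = 0%E by rewrite sube0.
  apply/negligibleP; first exact: bigcupT_measurable.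
  apply: negligible_bigcup => j; apply/negligibleP => //.
  have [jN|Nj] := ltnP j N; last first.
    rewrite (_ : E j = set0) ?measure0//; apply/seteqP; split => w //=.
    by rewrite /E/= xi_out// eqxx.
  have [_ _ law] := model_noise gm.
  have pb : Rp (Fin N) (basis_vec j : R^nat).
    by apply/Rp_FinP => l Nl; rewrite /basis_vec; case: eqP => // lj; rewrite lj leqNgt jN in Nl.
  have := law _ pb [set 0] (measurable_set1 _); rewrite s0 expr0n /=.
  have -> : dot (basis_vec j) (0 \*o basis_vec j) = 0 :> R.
    by rewrite dotC dotZl ?mul0r//; exact: l2_basis_vec.
  rewrite sqrtr0 /normal_law eqxx diracE mem_set// (_ : (fun w => dot (basis_vec j) (xi w)) = fun w => xi w j); last first.
    by apply/funext => w; rewrite dotC dot_basis_vec.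
  move=> P1; have := probability_setC P (m0 j).
  by rewrite EE => h; transitivity (1 - P ((fun w => xi w j) @^-1` [set 0%R]))%E; [exact: h|rewrite P1 subee].
- move=> w /= h j; rewrite s0 mul0r; apply: contrapT => /eqP xj; apply: h.
  by exists j.
Qed.
End model.

(** * The deterministic risk bound *)

Section inner.
Context {R : realType} (N : nat).
Implicit Types x y z : 'cV[R]_N.

Definition ip x y : R := \sum_i x i 0 * y i 0.

Lemma ipC x y : ip x y = ip y x.
Proof. by apply: eq_bigr => i _; rewrite mulrC. Qed.

Lemma ipDl x y z : ip (x + y) z = ip x z + ip y z.
Proof. by rewrite /ip -big_split; apply: eq_bigr => i _; rewrite mxE mulrDl. Qed.

Lemma ipZl (c : R) x y : ip (c *: x) y = c * ip x y.
Proof. by rewrite /ip mulr_sumr; apply: eq_bigr => i _; rewrite mxE mulrA. Qed.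

Lemma ipBl x y z : ip (x - y) z = ip x z - ip y z.
Proof. by rewrite -scaleN1r ipDl ipZl mulN1r. Qed.

Lemma ip_ge0 x : 0 <= ip x x.
Proof. by apply: sumr_ge0 => i _; rewrite -expr2 sqr_ge0. Qed.

Lemma ip_eq0 x : ip x x = 0 -> x = 0.
Proof.
move/eqP; rewrite psumr_eq0 => [/allP h|i _]; last by rewrite -expr2 sqr_ge0.
apply/matrixP => i j; rewrite ord1 mxE; apply/eqP.
by have := h i; rewrite mem_index_enum -expr2 sqrf_eq0 => /(_ isT).
Qed.

Lemma ip_mxl (A : 'M[R]_N) x y : ip (A *m x) y = ip x (A^T *m y).
Proof.
rewrite /ip; under eq_bigr do rewrite mxE mulr_suml.
rewrite exchange_big/=; apply: eq_bigr => j _; rewrite mxE mulr_sumr.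
by apply: eq_bigr => i _; rewrite mxE mulrAC mulrC mulrCA.
Qed.

Section psd.
Variable A : 'M[R]_N.
Hypothesis (Asym : A^T = A) (A0 : forall x, 0 <= ip x (A *m x)).

Lemma form_sym x y : ip x (A *m y) = ip y (A *m x).
Proof. by rewrite ipC ip_mxl Asym. Qed.

Lemma form_CS x y : ip x (A *m y) ^+ 2 <= ip x (A *m x) * ip y (A *m y).
Proof.
set c := ip x (A *m y); set a := ip x (A *m x); set b := ip y (A *m y).
have h t : 0 <= a + 2 * t * c + t ^+ 2 * b.
  have := A0 (x + t *: y); rewrite mulmxDr -scalemxAr ipDl ipZl ![ip _ (_ + _)]ipC !ipDl.
  rewrite !ipZl (ipC _ x) (ipC _ y) -/a (ipC _ x) (ipC _ y) -/b -/c (form_sym y x) -/c.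
  by rewrite (_ : _ + _ = a + 2 * t * c + t ^+ 2 * b)//; ring.
have b0 : 0 <= b := A0 y.
have [b1|b1] := eqVneq b 0.
  have := h (- (a + 1) * c^-1 / 2); rewrite b1 !mulr0 addr0.
  (* If <y, A y> = 0 and c != 0, then t = - (a + 1) / (2 c) gives the form the value -1. *)
  have [->|c0] := eqVneq c 0; first by rewrite expr0n.
  by rewrite (_ : a + _ = -1) ?ler0N1 //; field.
have bp : 0 < b by rewrite lt_neqAle eq_sym b1.
have := h (- c / b); rewrite (_ : a + _ + _ = (a * b - c ^+ 2) / b); last by field.
by rewrite pmulr_lge0 ?invr_gt0// subr_ge0.
Qed.
End psd.

Lemma ip_CS x y : ip x y ^+ 2 <= ip x x * ip y y.
Proof.
have h := @form_CS 1%:M (trmx1 _ _) _ x y; rewrite !mul1mx in h; apply: h => z.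
by rewrite mul1mx ip_ge0.
Qed.

Lemma coercive_unit (A : 'M[R]_N) (a : R) : 0 < a -> A^T = A ->
  (forall x, a * ip x x <= ip x (A *m x)) -> A \in unitmx.
Proof.
move=> a0 Asym Aa; rewrite -unitmx_tr -row_free_unit; apply/inj_row_free => v vA.
apply: trmx_inj; rewrite trmx0; apply: ip_eq0.
have := Aa v^T; rewrite -[A]trmxK -trmx_mul vA trmx0 => h.
have h0 : ip v^T 0 = 0 by rewrite /ip big1// => i _; rewrite [X in _ * X]mxE mulr0.
rewrite h0 in h; apply/eqP; rewrite eq_le ip_ge0 andbT.
by rewrite -(pmulr_rle0 _ a0).
Qed.

Section inverse.
Variables (A : 'M[R]_N) (a b : R).
Hypotheses (a0 : 0 < a) (b0 : 0 < b).
Hypothesis (Asym : A^T = A).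
Hypothesis Aab : forall x, a * ip x x <= ip x (A *m x) <= b * ip x x.

Lemma form_ge0 x : 0 <= ip x (A *m x).
Proof. by have /andP[h _] := Aab x; apply: le_trans h; rewrite mulr_ge0 ?ip_ge0// ltW. Qed.

Lemma bounded_unit : A \in unitmx.
Proof. by apply: (coercive_unit a0 Asym) => x; have /andP[] := Aab x. Qed.

Lemma invmx_sym : (invmx A)^T = invmx A.
Proof. by rewrite trmx_inv Asym. Qed.

(** With y = A^-1 x, a |y|^2 <= <y, x> <= |y| |x|. The bounds on the inverse rest on Cauchy-Schwarz
    and not on a diagonalization. *)
Lemma invmx_norm x : ip (invmx A *m x) (invmx A *m x) <= ip x x / a ^+ 2.
Proof.
set y := invmx A *m x.
have yx : A *m y = x by rewrite /y mulmxA mulmxV ?bounded_unit// mul1mx.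
have /andP[h _] := Aab y; rewrite yx in h.
have := ip_CS y x; have := ip_ge0 y; have := ip_ge0 x.
move: (ip y y) (ip x x) (ip y x) h => Y X c h X0 Y0 cs.
rewrite ler_pdivlMr ?exprn_gt0//.
have [->|Yn] := eqVneq Y 0; first by rewrite mul0r.
have Yp : 0 < Y by rewrite lt_neqAle eq_sym Yn.
rewrite -(ler_pM2l Yp); apply: le_trans cs.
rewrite mulrA -expr2 -exprMn ler_sqr ?nnegrE; first by rewrite mulrC.
- by rewrite mulr_ge0// ltW.
- by apply: le_trans h; rewrite mulr_ge0// ltW.
Qed.

Lemma invmx_form_le x : ip x (invmx A *m x) <= ip x x / a.
Proof.
have h := invmx_norm x; have cs := ip_CS x (invmx A *m x).
have X0 := ip_ge0 x.
have [|n0] := lerP (ip x (invmx A *m x)) 0.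
  by move/le_trans; apply; rewrite divr_ge0// ltW.
rewrite -(@ler_sqr R) ?nnegrE ?divr_ge0// ?(ltW n0) ?(ltW a0)//.
apply: le_trans cs _; rewrite expr_div_n expr2 -mulrA ler_wpM2l//.
Qed.

(** Cauchy-Schwarz for the form of A between x and y = A^-1 x: |x|^4 <= <x, A x> <y, x> <= b |x|^2
    <y, x>. *)
Lemma invmx_form_ge x : ip x x / b <= ip x (invmx A *m x).
Proof.
set y := invmx A *m x.
have yx : A *m y = x by rewrite /y mulmxA mulmxV ?bounded_unit// mul1mx.
have cs := form_CS Asym form_ge0 x y; rewrite yx in cs.
have /andP[_ h] := Aab x; have X0 := ip_ge0 x.
have y0 : 0 <= ip y x by rewrite -[X in ip _ X]yx form_ge0.
rewrite (ipC x y) ler_pdivrMr//.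
have [->|Xn] := eqVneq (ip x x) 0; first by rewrite mulr_ge0// ltW.
have Xp : 0 < ip x x by rewrite lt_neqAle eq_sym Xn.
rewrite -(ler_pM2l Xp) -expr2; apply: le_trans cs _.
by rewrite [leRHS](_ : _ = b * ip x x * ip y x) ?ler_wpM2r//; ring.
Qed.
End inverse.
End inner.

Section gram.
Context {R : realType} (N : nat).
Implicit Types (f : 'I_N -> R^nat) (t : 'cV[R]_N).

(** If f lists the rows of a matrix X, [gram f] is X X^T and [lcomb t f] is X^T t. *)
Definition gram f : 'M[R]_N := \matrix_(i, j) dot (f i) (f j).
Definition lcomb t f : R^nat := fun j => \sum_i t i 0 * f i j.

Lemma gram_sym f : (gram f)^T = gram f.
Proof. by apply/matrixP => i j; rewrite !mxE dotC. Qed.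

Lemma l2_sum (I : Type) (s : seq I) (F : I -> R^nat) : (forall i, l2 (F i)) ->
  l2 (fun j => \sum_(i <- s) F i j).
Proof.
move=> lF; elim: s => [|i s IH].
  by under eq_fun do rewrite big_nil; exact: l2_cst0.
rewrite (_ : (fun j => _) = F i \+ (fun j => \sum_(i <- s) F i j)); first exact: l2D.
by apply/funext => j; rewrite big_cons.
Qed.

Lemma dot_sum (I : Type) (s : seq I) (F : I -> R^nat) x : (forall i, l2 (F i)) -> l2 x ->
  dot (fun j => \sum_(i <- s) F i j) x = \sum_(i <- s) dot (F i) x.
Proof.
move=> lF lx; elim: s => [|i s IH].
  by under eq_fun do rewrite big_nil; rewrite big_nil (@dot_supp _ 0) ?big_ord0.
rewrite big_cons -IH (_ : (fun j => _) = F i \+ (fun j => \sum_(i <- s) F i j)).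
  by rewrite dotDl//; exact: l2_sum.
by apply/funext => j; rewrite big_cons.
Qed.

Lemma lcomb_l2 t f : (forall i, l2 (f i)) -> l2 (lcomb t f).
Proof. by move=> lf; apply: l2_sum => i; exact: (l2Z (t i 0) (lf i)). Qed.

Lemma dot_lcomb t f x : (forall i, l2 (f i)) -> l2 x ->
  dot (lcomb t f) x = \sum_i t i 0 * dot (f i) x.
Proof.
move=> lf lx; rewrite (dot_sum _ (fun i => l2Z (t i 0) (lf i)) lx).
by apply: eq_bigr => i _; rewrite dotZl.
Qed.

Lemma gram_form t t' f : (forall i, l2 (f i)) ->
  ip t (gram f *m t') = dot (lcomb t f) (lcomb t' f).
Proof.
move=> lf; rewrite dot_lcomb//; last exact: lcomb_l2.
apply: eq_bigr => i _; rewrite mxE dotC dot_lcomb//; congr (_ * _).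
by apply: eq_bigr => j _; rewrite mxE dotC mulrC.
Qed.

Lemma lcombD t t' f : lcomb (t + t') f = lcomb t f \+ lcomb t' f.
Proof.
by apply/funext => j; rewrite /lcomb /= -big_split; apply: eq_bigr => i _; rewrite mxE mulrDl.
Qed.

Lemma lcombB t t' f : lcomb (t - t') f = lcomb t f \- lcomb t' f.
Proof.
by apply/funext => j; rewrite /lcomb /= -sumrB; apply: eq_bigr => i _; rewrite !mxE mulrBl.
Qed.

End gram.

Lemma high_partE {R : realType} (k : nat) (x : R^nat) j : high_part k x j = if (k <= j)%N then x j else 0.
Proof. by []. Qed.

Lemma high_part_l2 {R : realType} (k : nat) (x : R^nat) : l2 x -> l2 (high_part k x).
Proof.
move=> lx; apply: (l2_le (M := 1) lx) => j; rewrite mul1r high_partE.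
by case: ifP => _; rewrite ?normr0.
Qed.

Lemma dot_split {R : realType} (k : nat) (x y : R^nat) : l2 x -> l2 y ->
  dot x y = \sum_(j < k) x j * y j + dot (high_part k x) y.
Proof.
move=> lx ly; have lh := high_part_l2 k lx.
have sl j : (k <= j)%N -> low_part k x j = 0 by rewrite /low_part leqNgt => /negbTE ->.
rewrite {1}(_ : x = low_part k x \+ high_part k x); last first.
  by apply/funext => j; rewrite /low_part /high_part /=; case: ltnP; rewrite ?addr0 ?add0r.
rewrite dotDl//; last exact: l2_supp sl.
by rewrite (dot_supp _ sl); congr (_ + _); apply: eq_bigr => j _; rewrite /low_part ltn_ord.
Qed.

Lemma dot_pythagoras {R : realType} (x y : R^nat) : l2 x -> l2 y -> dot (x \- y) y = 0 ->
  dot x x = dot (x \- y) (x \- y) + dot y y.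
Proof.
move=> lx ly h; have lB := l2B lx ly.
have h1 : dot x y = dot y y by move: h; rewrite dotBl// => /eqP; rewrite subr_eq0 => /eqP.
rewrite (dotBl lx ly lB) (dotC y (x \- y)) h subr0 dotC (dotBl lx ly lx) (dotC y x) h1.
by rewrite subrK.
Qed.

Lemma norm2B {R : realType} (x y : R^nat) : l2 x -> l2 y -> norm2 (x \- y) <= norm2 x + norm2 y.
Proof.
move=> lx ly; rewrite (_ : x \- y = x \+ ((-1) \*o y)); last first.
  by apply/funext => j; rewrite /= mulN1r.
by apply: le_trans (norm2D lx (l2Z (-1) ly)) _; rewrite norm2Z// normrN normr1 mul1r.
Qed.

Lemma weighted_CS {R : realType} (k : nat) (D x y : R^nat) : (forall j, (j < k)%N -> 0 < D j) ->
  \sum_(j < k) x j * y j <=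
  Num.sqrt (\sum_(j < k) D j * x j ^+ 2) * Num.sqrt (\sum_(j < k) (D j)^-1 * y j ^+ 2).
Proof.
move=> D0; set a := \sum_(j < k) D j * x j ^+ 2; set b := \sum_(j < k) (D j)^-1 * y j ^+ 2.
have a0 : 0 <= a by apply: sumr_ge0 => j _; rewrite mulr_ge0 ?sqr_ge0// ltW// D0.
have b0 : 0 <= b by apply: sumr_ge0 => j _; rewrite mulr_ge0 ?sqr_ge0// invr_ge0 ltW// D0.
pose p : 'cV[R]_k := \col_j (Num.sqrt (D j) * x j).
pose q : 'cV[R]_k := \col_j ((Num.sqrt (D j))^-1 * y j).
have sD (j : 'I_k) : 0 < Num.sqrt (D j) by rewrite sqrtr_gt0 D0.
have pp : ip p p = a.
  apply: eq_bigr => j _; rewrite mxE mulrACA -!expr2 sqr_sqrtr// ltW// D0//.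
have qq : ip q q = b.
  by apply: eq_bigr => j _; rewrite mxE mulrACA -!expr2 exprVn sqr_sqrtr// ltW// D0.
have pq : ip p q = \sum_(j < k) x j * y j.
  by apply: eq_bigr => j _; rewrite !mxE mulrACA divff ?mul1r// gt_eqF.
rewrite -pq; apply: le_trans (ler_norm _) _.
rewrite -sqrtrM// -sqrtr_sqr ler_wsqrtr// -pp -qq; exact: ip_CS.
Qed.

Section deterministic.
Context {R : realType} (N k : nat) (sigma D b bh : R^nat) (x : 'I_N -> R^nat) (xi : 'cV[R]_N).
(** The bounds of the good event: a and bA for the Gram matrix of the tail, n2 and thr for the
    restricted isometry, q for the squared norm of D^(-1/2) X_h^T, m2 and m3 for the noise seen by
    the head and by the tail, m4 for the bias of the tail, sk for its largest eigenvalue. *)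
Variables (a bA n2 thr q m2 m3 m4 sk : R).
Local Notation xt := (fun i => high_part k (x i)).
Local Notation qt := (fun i => (fun j => Num.sqrt (sigma j) * high_part k (x i) j)).
Local Notation A := (gram xt).
Hypotheses (a0 : 0 < a) (bA0 : 0 < bA) (n20 : 0 <= n2) (thr0 : 0 <= thr) (q0 : 0 <= q) (sk0 : 0 <= sk).
Hypothesis sigma0 : forall j, 0 <= sigma j.
Hypothesis sigma_sk : forall j, (k <= j)%N -> sigma j <= sk.
Hypothesis D0 : forall j, (j < k)%N -> 0 < D j.
Hypothesis sigmaD : forall j, (j < k)%N -> sigma j <= D j.
Hypotheses (lx : forall i, l2 (x i)) (lb : l2 b) (lbh : l2 bh).
Hypothesis interp : forall i, dot (x i) bh = dot (x i) b + xi i 0.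
Hypothesis minnorm : forall t, (forall i, dot (x i) (lcomb t x) = dot (x i) b + xi i 0) ->
  norm2 bh <= norm2 (lcomb t x).
Hypothesis HA : forall t, a * ip t t <= dot (lcomb t xt) (lcomb t xt) <= bA * ip t t.
Hypothesis Hrip : forall v : R^nat,
  \sum_(j < k) D j * v j ^+ 2 <=
  n2 * (\sum_i (\sum_(j < k) x i j * v j) ^+ 2) + thr * \sum_(j < k) v j ^+ 2.
Hypothesis Hop : forall t, \sum_(j < k) (D j)^-1 * lcomb t x j ^+ 2 <= q * ip t t.
Local Notation mu := (invmx A *m xi).
Hypothesis Hmu : \sum_(j < k) (D j)^-1 * lcomb mu x j ^+ 2 <= m2.
Hypothesis HQ : dot (lcomb mu qt) (lcomb mu qt) <= m3.
Hypothesis Htb : \sum_i dot (xt i) b ^+ 2 <= m4.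

Let lxt i : l2 (xt i). Proof. exact: high_part_l2. Qed.

Let sqrt_sigma_bd : exists M : R, forall j, Num.sqrt (sigma j) <= M.
Proof.
exists (Num.sqrt (sk + \sum_(j < k) sigma j)) => j; apply: ler_wsqrtr.
have S0 : 0 <= \sum_(j < k) sigma j by apply: sumr_ge0.
have [jk|kj] := ltnP j k; last by apply: (le_trans (sigma_sk kj)); rewrite lerDl.
by rewrite (bigD1 (Ordinal jk))//= addrCA lerDl addr_ge0// sumr_ge0.
Qed.

Let sqrt_mul_l2 (v : R^nat) : l2 v -> l2 (fun j => Num.sqrt (sigma j) * v j).
Proof.
move=> lv; have [M hM] := sqrt_sigma_bd; apply: (l2_le (M := M) lv) => j.
by rewrite normrM ler_wpM2r// ger0_norm ?sqrtr_ge0.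
Qed.

Let lqt i : l2 (qt i). Proof. exact: sqrt_mul_l2. Qed.

Lemma form_bounds t : a * ip t t <= ip t (A *m t) <= bA * ip t t.
Proof. by rewrite gram_form. Qed.

Let Au := bounded_unit a0 (gram_sym xt) form_bounds.

(** The full Gram matrix K dominates that of the tail, so K^-1 y yields an interpolant in the span
    of the rows. The difference with [bh] is orthogonal to the rows, and Pythagoras with the
    minimality of the norm forces it to be 0. *)
Lemma interpolant_span : exists t, bh = lcomb t x.
Proof.
pose K := gram x; pose y : 'cV[R]_N := \col_i (dot (x i) b + xi i 0).
have Ku : K \in unitmx.
  apply: (coercive_unit a0 (gram_sym x)) => t; have /andP[h _] := HA t.
  apply: le_trans h _; rewrite gram_form//.
  apply: dot_le => n; apply: le_trans (sum_sqr_le_dot n (lcomb_l2 t lx)).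
  apply: ler_sum => j _; rewrite /lcomb /high_part; case: leqP => // _.
  by rewrite big1 ?expr0n ?sqr_ge0// => i _; rewrite mulr0.
pose t := invmx K *m y; exists t.
have Kt i : dot (x i) (lcomb t x) = dot (x i) b + xi i 0.
  have : (K *m t) i 0 = y i 0 by rewrite /t mulmxA mulmxV// mul1mx.
  rewrite !mxE => <-; rewrite dotC dot_lcomb//; apply: eq_bigr => j _.
  by rewrite [K _ _]mxE dotC mulrC.
have l0 := lcomb_l2 t lx.
have orth : dot (bh \- lcomb t x) (lcomb t x) = 0.
  rewrite dotC dot_lcomb//; last exact: l2B.
  apply: big1 => i _; rewrite dotC dotBl// dotC interp (dotC (lcomb t x)) Kt subrr mulr0//.
have nb := minnorm Kt.
have e : dot bh bh = dot (bh \- lcomb t x) (bh \- lcomb t x) + dot (lcomb t x) (lcomb t x).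
  exact: dot_pythagoras.
have d0 : dot (bh \- lcomb t x) (bh \- lcomb t x) = 0.
  apply/eqP; rewrite eq_le dot_ge0 andbT.
  have : norm2 bh ^+ 2 <= norm2 (lcomb t x) ^+ 2 by rewrite ler_sqr ?nnegrE ?norm2_ge0.
  by rewrite !norm2_sqr; lra.
have /(congr1 (fun f => fun j => f j + lcomb t x j)) := dot_eq0 (l2B lbh l0) d0.
move=> h; apply/funext => j; have := congr1 (fun f => f j) h.
by rewrite /= add0r subrK.
Qed.

Lemma lcomb_qt_le t : dot (lcomb t qt) (lcomb t qt) <= sk * ip t (A *m t).
Proof.
rewrite gram_form//; apply: dot_le => n.
apply: (@le_trans _ _ (\sum_(j < n) sk * lcomb t xt j ^+ 2)).
  apply: ler_sum => j _; have -> : lcomb t qt j = Num.sqrt (sigma j) * lcomb t xt j.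
    by rewrite /lcomb mulr_sumr; apply: eq_bigr => i _; rewrite mulrCA.
  rewrite exprMn sqr_sqrtr//; have [jk|kj] := ltnP j k.
    rewrite (_ : lcomb t xt j = 0) ?expr0n ?mulr0// /lcomb big1// => i _.
    by rewrite high_partE leqNgt jk mulr0.
  by rewrite ler_wpM2r ?sqr_ge0// sigma_sk.
by rewrite -mulr_sumr ler_wpM2l// sum_sqr_le_dot//; exact: lcomb_l2.
Qed.

(** Bounds the norm, weighted by D^(-1), of the vector paired with the head error. The three terms
    come from the head of beta, the bias of the tail and the noise. *)
Definition noise_level : R :=
  Num.sqrt (\sum_(j < k) (D j)^-1 * b j ^+ 2) + Num.sqrt (q * m4) / a + Num.sqrt m2.

(** With r = n2 bA + thr, the energy E satisfies G^2 <= r E and E <= G W, hence G <= r W and E <= r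
    W^2. The first inequality bounds the head error, the second the part of the tail error that the
    head error creates. *)
Lemma risk_bound :
  norm2 (fun j => Num.sqrt (sigma j) * (bh j - b j)) <=
  (n2 * bA + thr) * noise_level + (Num.sqrt (sk * m4 / a) + Num.sqrt m3 +
    noise_level * Num.sqrt (sk * (n2 * bA + thr))) +
  norm2 (fun j => Num.sqrt (sigma j) * high_part k b j).
Proof.
set W := noise_level; set r := n2 * bA + thr.
have [t bhE] := interpolant_span.
pose v j := bh j - b j.
pose z : 'cV[R]_N := \col_i \sum_(j < k) x i j * v j.
pose tb : 'cV[R]_N := \col_i dot (xt i) b.
(* The weights of the interpolant split into the responses to the bias of the tail (nu), to the
   noise (mu) and, with a minus sign, to the head error (eta). *)
pose nu := invmx A *m tb; pose eta := invmx A *m z.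
have At : A *m t = tb + xi - z.
  apply/matrixP => i o; rewrite ord1 !mxE.
  transitivity (dot (xt i) bh).
    rewrite bhE dotC dot_lcomb//; apply: eq_bigr => l _; rewrite mxE mulrC; congr (_ * _).
    rewrite dotC (dot_split k (lx l) (lxt i)) big1 ?add0r// => j _.
    by rewrite high_partE leqNgt ltn_ord mulr0.
  have := interp i; rewrite (dot_split k (lx i) lbh) (dot_split k (lx i) lb) => h.
  have -> : \sum_(j < k) x i j * v j = \sum_(j < k) x i j * bh j - \sum_(j < k) x i j * b j.
    by rewrite -sumrB; apply: eq_bigr => j _; rewrite mulrBr.
  by move: h; lra.
have tE : t = nu + mu - eta.
  by rewrite /nu /eta -mulmxDr -mulmxBr -At mulmxA mulVmx// mul1mx.
have ipz (s : 'cV[R]_N) : ip s z = \sum_(j < k) v j * lcomb s x j.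
  rewrite /ip; under eq_bigr do rewrite mxE mulr_sumr.
  rewrite exchange_big/=; apply: eq_bigr => j _; rewrite /lcomb mulr_sumr.
  by apply: eq_bigr => i _; rewrite mulrA mulrC.
set G := Num.sqrt (\sum_(j < k) D j * v j ^+ 2).
have G0 : 0 <= G by exact: sqrtr_ge0.
have ipz_le s m : \sum_(j < k) (D j)^-1 * lcomb s x j ^+ 2 <= m -> ip s z <= G * Num.sqrt m.
  move=> h; rewrite ipz; apply: le_trans (weighted_CS _ _ D0) _.
  by rewrite ler_wpM2l// ler_wsqrtr.
set E := ip z (invmx A *m z) + \sum_(j < k) v j ^+ 2.
have EE : E = ip nu z + ip mu z - \sum_(j < k) v j * b j.
  have : ip t z = \sum_(j < k) v j * b j + \sum_(j < k) v j ^+ 2.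
    rewrite ipz -bhE -big_split; apply: eq_bigr => j _ /=.
    by rewrite /v; ring.
  by rewrite {1}tE ipBl ipDl (ipC eta) /E; lra.
have tbb : ip tb tb <= m4.
  by apply: le_trans Htb; apply: ler_sum => i _; rewrite mxE expr2.
have m40 : 0 <= m4 by apply: le_trans tbb; exact: ip_ge0.
have nuz : ip nu z <= G * (Num.sqrt (q * m4) / a).
  have -> : Num.sqrt (q * m4) / a = Num.sqrt (q * (m4 / a ^+ 2)).
    rewrite mulrA [RHS]sqrtrM ?mulr_ge0// sqrtrV ?exprn_ge0 ?(ltW a0)//.
    by rewrite sqrtr_sqr ger0_norm// ltW.
  apply: ipz_le; apply: le_trans (Hop nu) _; rewrite ler_wpM2l//.
  apply: le_trans (invmx_norm a0 (gram_sym xt) form_bounds tb) _.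
  by rewrite ler_wpM2r// invr_ge0 exprn_ge0// ltW.
have muz : ip mu z <= G * Num.sqrt m2 by exact: ipz_le.
have bz : - \sum_(j < k) v j * b j <= G * Num.sqrt (\sum_(j < k) (D j)^-1 * b j ^+ 2).
  rewrite -sumrN (eq_bigr (fun j : 'I_k => v j * (- b j))) => [|j _]; last by rewrite mulrN.
  apply: le_trans (weighted_CS v (fun j => - b j) D0) _.
  by under [X in _ * Num.sqrt X <= _]eq_bigr do rewrite sqrrN.
have EW : E <= G * W by rewrite EE /W /noise_level !mulrDr; lra.
have Ai0 : 0 <= ip z (invmx A *m z).
  by apply: le_trans (invmx_form_ge a0 bA0 (gram_sym xt) form_bounds z); rewrite divr_ge0 ?ip_ge0// ltW.
have v20 : 0 <= \sum_(j < k) v j ^+ 2 by apply: sumr_ge0 => j _; exact: sqr_ge0.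
have r0 : 0 <= r by rewrite addr_ge0 ?mulr_ge0// ltW.
have W0 : 0 <= W.
  by rewrite /W /noise_level !addr_ge0 ?sqrtr_ge0// divr_ge0 ?sqrtr_ge0// ltW.
have GE : G ^+ 2 <= r * E.
  rewrite sqr_sqrtr; last by apply: sumr_ge0 => j _; rewrite mulr_ge0 ?sqr_ge0// ltW// D0.
  apply: le_trans (Hrip v) _.
  have zz : ip z z <= bA * ip z (invmx A *m z).
    by rewrite mulrC -ler_pdivrMr//; exact: (invmx_form_ge a0 bA0 (gram_sym xt) form_bounds).
  have -> : \sum_i (\sum_(j < k) x i j * v j) ^+ 2 = ip z z.
    by apply: eq_bigr => i _; rewrite mxE expr2.
  have h1 : n2 * ip z z <= n2 * bA * ip z (invmx A *m z) by rewrite -mulrA ler_wpM2l.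
  rewrite /r /E mulrDl !mulrDr.
  have h2 : 0 <= n2 * bA * \sum_(j < k) v j ^+ 2 by rewrite !mulr_ge0// ltW.
  have h3 : 0 <= thr * ip z (invmx A *m z) by rewrite mulr_ge0.
  lra.
have GW : G <= r * W.
  have [->|Gn] := eqVneq G 0; first by rewrite mulr_ge0.
  have Gp : 0 < G by rewrite lt_neqAle eq_sym Gn.
  rewrite -(ler_pM2l Gp) -expr2; apply: le_trans GE _.
  by rewrite mulrCA ler_wpM2l.
have EW2 : E <= r * W ^+ 2.
  by apply: le_trans EW _; rewrite expr2 mulrA ler_wpM2r.
pose lp := low_part k (fun j => Num.sqrt (sigma j) * v j).
have slp j : (k <= j)%N -> lp j = 0 by rewrite /lp /low_part leqNgt => /negbTE ->.
pose te : R^nat := fun j => Num.sqrt (sigma j) * high_part k b j.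
have lte : l2 te by apply: sqrt_mul_l2; exact: high_part_l2.
have lL s : l2 (lcomb s qt) by exact: lcomb_l2.
have -> : (fun j => Num.sqrt (sigma j) * (bh j - b j)) =
    lp \+ (((lcomb nu qt \+ lcomb mu qt) \- lcomb eta qt) \- te).
  rewrite -lcombD -lcombB -tE; apply/funext => j.
  rewrite /= /lp /low_part /te high_partE ltnNge; case: leqP => kj /=.
    rewrite add0r mulrBr; congr (_ - _); rewrite bhE /lcomb mulr_sumr.
    by apply: eq_bigr => i _; rewrite high_partE kj mulrCA.
  rewrite mulr0 subr0 (_ : lcomb t qt j = 0) ?addr0// /lcomb big1// => i _.
  by rewrite high_partE leqNgt kj !mulr0.
have lD := l2D (lL nu) (lL mu); have lB := l2B lD (lL eta).
apply: le_trans (norm2D (l2_supp slp) (l2B lB lte)) _.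
have n1 := norm2B lB lte; have n2' := norm2B lD (lL eta); have n3 := norm2D (lL nu) (lL mu).
have nlp : norm2 lp <= G.
  rewrite /norm2 (dot_supp _ slp); apply: ler_wsqrtr; apply: ler_sum => j _.
  rewrite /lp /low_part ltn_ord -expr2 exprMn sqr_sqrtr//.
  by rewrite ler_wpM2r ?sqr_ge0// sigmaD.
(* The form of [qt] is at most sk A, and A nu = tb leaves <nu, tb>: a single inverse of A is paid,
   so 1 / a appears and not its square. *)
have nnu : norm2 (lcomb nu qt) <= Num.sqrt (sk * m4 / a).
  apply: ler_wsqrtr; apply: le_trans (lcomb_qt_le nu) _; rewrite -mulrA ler_wpM2l//.
  rewrite /nu mulmxA mulmxV// mul1mx ipC.
  apply: le_trans (invmx_form_le a0 (gram_sym xt) form_bounds tb) _.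
  by rewrite ler_wpM2r// invr_ge0 ltW.
have nmu : norm2 (lcomb mu qt) <= Num.sqrt m3 by exact: ler_wsqrtr.
have neta : norm2 (lcomb eta qt) <= W * Num.sqrt (sk * r).
  have -> : W * Num.sqrt (sk * r) = Num.sqrt (sk * (r * W ^+ 2)).
    by rewrite mulrA [RHS]sqrtrM ?mulr_ge0// sqrtr_sqr ger0_norm// mulrC.
  apply: ler_wsqrtr; apply: le_trans (lcomb_qt_le eta) _; rewrite ler_wpM2l//.
  rewrite /eta mulmxA mulmxV// mul1mx ipC; apply: le_trans EW2.
  by rewrite /E lerDl.
rewrite -/te; lra.
Qed.
End deterministic.

(** * Concentration events *)

Section chaos2.
Context {R : realType} d (T : measurableType d) (P : probability T R).
Context (I : choiceType) (V : I -> T -> R) (D J : set I).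
Hypothesis sV : std_gaussian_family P D V.
Hypothesis JD : J `<=` D.

Lemma sum_divmod (m n : nat) (F : nat -> nat -> R) :
  \sum_(a < m * n) F (a %/ n)%N (a %% n)%N = \sum_(i < m) \sum_(j < n) F i j.
Proof.
have [->|n0] := posnP n; first by rewrite muln0 big_ord0 big1// => i _; rewrite big_ord0.
elim: m => [|m IH]; first by rewrite mul0n !big_ord0.
rewrite mulSnr big_split_ord/= big_ord_recr/= IH; congr (_ + _); apply: eq_bigr => j _.
by rewrite divnMDl// divn_small// addn0 modnMDl modn_small.
Qed.

Definition qf2 (m n : nat) (B : nat -> nat -> nat -> nat -> R) (x : nat -> nat -> R) : R :=
  \sum_(i < m) \sum_(j < n) \sum_(i' < m) \sum_(j' < n) B i j i' j' * x i j * x i' j'.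

(** The two indices are flattened to i * n + j, which reduces the claim to [chaos_tail]. *)
Lemma chaos_tail2 (z : nat -> nat -> I) (m n : nat) (B : nat -> nat -> nat -> nat -> T -> R) (t : R) :
  (forall i j, (i < m)%N -> (j < n)%N -> D (z i j) /\ ~ J (z i j)) ->
  (forall i j i' j', (i < m)%N -> (j < n)%N -> (i' < m)%N -> (j' < n)%N ->
     z i j = z i' j' -> i = i' /\ j = j') ->
  (forall i j i' j', measurable_fun setT (B i j i' j' : hist V J -> R)) ->
  (forall i j i' j' w, B i j i' j' w = B i' j' i j w) ->
  (forall w x, 0 <= qf2 m n (fun i j i' j' => B i j i' j' w) x
     <= 2^-1 * \sum_(i < m) \sum_(j < n) x i j ^+ 2) ->
  exists A : set T, [/\ measurable A, ((1 - expR (- t))%:E <= P A)%E &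
    forall w, A w -> 2^-1 * qf2 m n (fun i j i' j' => B i j i' j' w) (fun i j => V (z i j) w) <=
      2 * (\sum_(i < m) \sum_(j < n) B i j i j w) + t].
Proof.
move=> zD zi mB sB pB; have [mV _ lV mi] := sV.
pose z' a := z (a %/ n)%N (a %% n)%N.
pose B' a b := B (a %/ n)%N (a %% n)%N (b %/ n)%N (b %% n)%N.
have lt a : (a < m * n)%N -> (a %/ n < m)%N /\ (a %% n < n)%N.
  move=> amn; have n0 : (0 < n)%N.
    by rewrite lt0n; apply: contraTneq amn => ->; rewrite muln0.
  by rewrite ltn_divLR// amn ltn_pmod.
have qfE w x : qf (m * n) (fun a b => B' a b w) (fun a => x (a %/ n)%N (a %% n)%N) =
    qf2 m n (fun i j i' j' => B i j i' j' w) x.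
  rewrite /qf /B' (sum_divmod m n (fun i j => \sum_(b < m * n)
    B i j (b %/ n)%N (b %% n)%N w * x i j * x (b %/ n)%N (b %% n)%N)).
  apply: eq_bigr => i _; apply: eq_bigr => j _.
  exact: (sum_divmod m n (fun i' j' => B i j i' j' w * x i j * x i' j')).
have hpsd w : half_psd (m * n) (fun a b => B' a b w).
  split; first by move=> a b; exact: sB.
  move=> y; pose x i j := y (i * n + j)%N.
  have e (a : 'I_(m * n)) : y a = x (a %/ n)%N (a %% n)%N by rewrite /x -divn_eq.
  have -> : qf (m * n) (fun a b => B' a b w) y =
      qf (m * n) (fun a b => B' a b w) (fun a => x (a %/ n)%N (a %% n)%N).
    by apply: eq_bigr => a _; apply: eq_bigr => b _; rewrite -!e.
  rewrite qfE; under eq_bigr do rewrite e.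
  by rewrite (sum_divmod m n (fun i j => x i j ^+ 2)); exact: pB.
have [|||A [mA PA hA]] := @chaos_tail _ _ _ P I V D J mV mi lV JD z' (m * n) B' t _ _ _ hpsd.
- by move=> a /lt[h1 h2]; exact: zD.
- move=> a b /lt[a1 a2] /lt[b1 b2] /zi[]// e1 e2.
  by rewrite (divn_eq a n) (divn_eq b n) e1 e2.
- by move=> a b; exact: mB.
exists A; split => // w Aw; have := hA w Aw.
rewrite (qfE w (fun i j => V (z i j) w)).
by rewrite (sum_divmod m n (fun i j => B i j i j w)).
Qed.

End chaos2.

Section chaos_instances.
Context {R : realType} d (T : measurableType d) (P : probability T R).
Context (I : choiceType) (V : I -> T -> R) (D : set I).
Hypothesis sV : std_gaussian_family P D V.

Lemma sum_delta (m : nat) (i : 'I_m) (F : nat -> R) :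
  \sum_(i' < m) ((i : nat) == i')%:R * F i' = F i.
Proof.
rewrite (bigD1 i)//= eqxx mul1r big1 ?addr0// => i' ne.
by rewrite (_ : (_ == _) = false) ?mul0r//; apply/negbTE; rewrite eq_sym.
Qed.

(** B is diagonal with entries c_j / (2 M), the scaling permitted by B <= 1/2; undoing it gives the
    factors 4 and 4 M. *)
Lemma chaos_diag (z : nat -> nat -> I) (m n : nat) (c : R^nat) (M t : R) :
  (forall i j, (i < m)%N -> (j < n)%N -> D (z i j)) ->
  (forall i j i' j', (i < m)%N -> (j < n)%N -> (i' < m)%N -> (j' < n)%N ->
     z i j = z i' j' -> i = i' /\ j = j') ->
  0 < M -> (forall j, 0 <= c j <= M) ->
  with_prob_ge P (1 - expR (- t)) [set w |
    \sum_(i < m) \sum_(j < n) c j * V (z i j) w ^+ 2 <= 4 * (m%:R * \sum_(j < n) c j) + 4 * M * t].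
Proof.
move=> zD zi M0 cM.
pose B (i j i' j' : nat) (w : T) : R := (i == i')%:R * ((j == j')%:R * (c j / (2 * M))).
have qE w x : qf2 m n (fun i j i' j' => B i j i' j' w) x =
    (2 * M)^-1 * \sum_(i < m) \sum_(j < n) c j * x i j ^+ 2.
  rewrite mulr_sumr; apply: eq_bigr => i _; rewrite mulr_sumr; apply: eq_bigr => j _.
  under eq_bigr => i' _.
    under eq_bigr => j' _ do rewrite /B -!mulrA.
    rewrite -mulr_sumr (sum_delta j (fun j' => c j * ((2 * M)^-1 * (x i j * x i' j')))); over.
  rewrite (sum_delta i (fun i' => c j * ((2 * M)^-1 * (x i j * x i' j)))) expr2.
  by rewrite mulrCA.
have S0 (x : nat -> nat -> R) : 0 <= \sum_(i < m) \sum_(j < n) c j * x i j ^+ 2.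
  by apply: sumr_ge0 => i _; apply: sumr_ge0 => j _; rewrite mulr_ge0 ?sqr_ge0//; have /andP[] := cM j.
have [|||||w x|A [mA PA hA]] := @chaos_tail2 _ _ _ P I V D set0 sV _ z m n B t.
- exact: sub0set.
- by move=> i j im jn; split => //; exact: zD.
- exact: zi.
- by move=> i j i' j'; exact: measurable_cst.
- move=> i j i' j' w; rewrite /B (eq_sym i') (eq_sym j'); case: eqVneq => [_|_]; last by rewrite !mul0r.
  by case: eqVneq => [->//|_]; rewrite !mul0r.
- rewrite qE mulr_ge0 ?S0 ?invr_ge0 ?mulr_ge0 ?(ltW M0)//= invfM -mulrA ler_pM2l ?invr_gt0//.
  rewrite ler_pdivrMl//mulr_sumr; apply: ler_sum => i _; rewrite mulr_sumr; apply: ler_sum => j _.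
  by rewrite ler_wpM2r ?sqr_ge0//; have /andP[] := cM j.
exists A; split => // w Aw /=; have := hA w Aw; rewrite qE.
have -> : \sum_(i < m) \sum_(j < n) B i j i j w = (2 * M)^-1 * (m%:R * \sum_(j < n) c j).
  rewrite (eq_bigr (fun=> (2 * M)^-1 * \sum_(j < n) c j)) => [|i _].
    by rewrite sumr_const card_ord -[X in X = _]mulr_natl mulrCA.
  by rewrite mulr_sumr; apply: eq_bigr => j _; rewrite /B !eqxx !mul1r mulrC.
move: (\sum_(i < m) _) (m%:R * _) => X Y h.
rewrite -(@ler_pM2l _ (2^-1 * (2 * M)^-1)) ?mulr_gt0 ?invr_gt0 ?mulr_gt0//.
rewrite -[leLHS]mulrA; apply: le_trans h _; rewrite le_eqVlt; apply/orP; left; apply/eqP.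
by field; rewrite gt_eqF.
Qed.

(** In each row B is the rank-one matrix v v^T / (2 s), bounded by 1/2 through Cauchy-Schwarz and of
    trace at most 1/2. *)
Lemma chaos_rows (z : nat -> nat -> I) (m n : nat) (v : R^nat) (s t : R) : 0 <= t ->
  (forall i j, (i < m)%N -> (j < n)%N -> D (z i j)) ->
  (forall i j i' j', (i < m)%N -> (j < n)%N -> (i' < m)%N -> (j' < n)%N ->
     z i j = z i' j' -> i = i' /\ j = j') ->
  \sum_(j < n) v j ^+ 2 <= s ->
  with_prob_ge P (1 - expR (- t)) [set w |
    \sum_(i < m) (\sum_(j < n) v j * V (z i j) w) ^+ 2 <= 4 * s * (m%:R + t)].
Proof.
move=> t0 zD zi vs.
have s0 : 0 <= s by apply: le_trans vs; apply: sumr_ge0 => j _; exact: sqr_ge0.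
pose B (i j i' j' : nat) (w : T) : R := (i == i')%:R * (v j * v j' / (2 * s)).
have qE w x : qf2 m n (fun i j i' j' => B i j i' j' w) x =
    (2 * s)^-1 * \sum_(i < m) (\sum_(j < n) v j * x i j) ^+ 2.
  rewrite mulr_sumr; apply: eq_bigr => i _; rewrite expr2 mulr_suml mulr_sumr; apply: eq_bigr => j _.
  under eq_bigr => i' _.
    under eq_bigr => j' _ do rewrite /B -!mulrA.
    rewrite -mulr_sumr; over.
  rewrite (sum_delta i (fun i' => \sum_(j' < n) v j * (v j' * ((2 * s)^-1 * (x i j * x i' j'))))).
  by rewrite mulr_sumr mulr_sumr; apply: eq_bigr => j' _; ring.
have CS (x : nat -> nat -> R) (i : nat) : (\sum_(j < n) v j * x i j) ^+ 2 <= s * \sum_(j < n) x i j ^+ 2 :> R.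
  pose p : 'cV[R]_n := \col_j v j; pose q : 'cV[R]_n := \col_j x i j.
  have := ip_CS p q.
  have -> : ip p q = \sum_(j < n) v j * x i j by apply: eq_bigr => j _; rewrite !mxE.
  have -> : ip p p = \sum_(j < n) v j ^+ 2 by apply: eq_bigr => j _; rewrite !mxE.
  have -> : ip q q = \sum_(j < n) x i j ^+ 2 by apply: eq_bigr => j _; rewrite !mxE.
  move/le_trans; apply; rewrite ler_wpM2r//; apply: sumr_ge0 => j _; exact: sqr_ge0.
have S0 (x : nat -> nat -> R) : 0 <= \sum_(i < m) (\sum_(j < n) v j * x i j) ^+ 2 :> R.
  by apply: sumr_ge0 => i _; rewrite sqr_ge0.
have [|||||w x|A [mA PA hA]] := @chaos_tail2 _ _ _ P I V D set0 sV _ z m n B t.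
- exact: sub0set.
- by move=> i j im jn; split => //; exact: zD.
- exact: zi.
- by move=> i j i' j'; exact: measurable_cst.
- by move=> i j i' j' w; rewrite /B (eq_sym i') (mulrC (v j')).
- rewrite qE mulr_ge0 ?S0 ?invr_ge0 ?mulr_ge0//= invfM -mulrA ler_pM2l ?invr_gt0//.
  have [s1|s1] := eqVneq s 0.
    by rewrite s1 invr0 mul0r; apply: sumr_ge0 => i _; apply: sumr_ge0 => j _; exact: sqr_ge0.
  rewrite ler_pdivrMl; last by rewrite lt_neqAle eq_sym s1.
  by rewrite mulr_sumr; apply: ler_sum => i _; exact: CS.
exists A; split => // w Aw /=; have [s1|s1] := eqVneq s 0.
  rewrite s1 mulr0 mul0r big1// => i _; apply/eqP; rewrite eq_le sqr_ge0 andbT.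
  by have := CS (fun i j => V (z i j) w) i; rewrite s1 mul0r.
have sp : 0 < s by rewrite lt_neqAle eq_sym s1.
have := hA w Aw; rewrite qE.
have h1 : \sum_(i < m) \sum_(j < n) B i j i j w <= m%:R / 2.
  rewrite (eq_bigr (fun=> (2 * s)^-1 * \sum_(j < n) v j ^+ 2)) => [|i _].
    rewrite sumr_const card_ord -[X in X <= _]mulr_natl ler_wpM2l// invfM -mulrA ler_piMr ?invr_ge0//.
    by rewrite ler_pdivrMl// mulr1.
  by rewrite mulr_sumr; apply: eq_bigr => j _; rewrite /B !eqxx !mul1r mulrC expr2.
move: (\sum_(i < m) _) (\sum_(i < m) _) h1 => X Y h1 h.
rewrite -(@ler_pM2l _ (2^-1 * (2 * s)^-1)) ?mulr_gt0 ?invr_gt0 ?mulr_gt0//.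
rewrite -[leLHS]mulrA; apply: le_trans h _.
rewrite (_ : 2^-1 * _ * _ = m%:R + t); first by lra.
by field.
Qed.

(** For each j, B has the block om_j th th^T / 2. The vector th is random, but known from the
    history J, which [chaos_tail] allows. *)
Lemma chaos_features (z : nat -> nat -> I) (J : set I) (m n : nat) (om : R^nat)
    (th : nat -> T -> R) (t : R) : J `<=` D ->
  (forall i j, (i < m)%N -> (j < n)%N -> D (z i j) /\ ~ J (z i j)) ->
  (forall i j i' j', (i < m)%N -> (j < n)%N -> (i' < m)%N -> (j' < n)%N ->
     z i j = z i' j' -> i = i' /\ j = j') ->
  (forall j, 0 <= om j <= 1) ->
  (forall i, measurable_fun setT (th i : hist V J -> R)) ->
  (forall w, \sum_(i < m) th i w ^+ 2 <= 1) ->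
  with_prob_ge P (1 - expR (- t)) [set w |
    \sum_(j < n) om j * (\sum_(i < m) th i w * V (z i j) w) ^+ 2 <= 4 * (\sum_(j < n) om j + t)].
Proof.
move=> JD zD zi om1 mth th1.
have om0 j : 0 <= om j by have /andP[] := om1 j.
pose B (i j i' j' : nat) (w : T) : R := (j == j')%:R * (om j * (th i w * th i' w) / 2).
have qE w x : qf2 m n (fun i j i' j' => B i j i' j' w) x =
    2^-1 * \sum_(j < n) om j * (\sum_(i < m) th i w * x i j) ^+ 2.
  rewrite /qf2 exchange_big/= mulr_sumr; apply: eq_bigr => j _.
  rewrite expr2 mulr_suml mulr_sumr mulr_sumr; apply: eq_bigr => i _.
  under eq_bigr => i' _.
    under eq_bigr => j' _ do rewrite /B -!mulrA.
    rewrite (sum_delta j (fun j' => om j * (th i w * (th i' w * (2^-1 * (x i j * x i' j')))))); over.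
  by rewrite !mulr_sumr; apply: eq_bigr => i' _; ring.
have CS w (x : nat -> nat -> R) (j : 'I_n) : (\sum_(i < m) th i w * x i (j : nat)) ^+ 2 <= \sum_(i < m) x i (j : nat) ^+ 2 :> R.
  pose p : 'cV[R]_m := \col_i th i w; pose q : 'cV[R]_m := \col_i x i (j : nat).
  have := ip_CS p q.
  have -> : ip p q = \sum_(i < m) th i w * x i (j : nat) by apply: eq_bigr => i _; rewrite !mxE.
  have -> : ip p p = \sum_(i < m) th i w ^+ 2 by apply: eq_bigr => i _; rewrite !mxE.
  have -> : ip q q = \sum_(i < m) x i (j : nat) ^+ 2 by apply: eq_bigr => i _; rewrite !mxE.
  move/le_trans; apply; rewrite ler_piMl//; apply: sumr_ge0 => i _; exact: sqr_ge0.
have S0 w (x : nat -> nat -> R) : 0 <= \sum_(j < n) om j * (\sum_(i < m) th i w * x i (j : nat)) ^+ 2 :> R.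
  by apply: sumr_ge0 => i _; rewrite mulr_ge0 ?sqr_ge0.
have [||||w x|A [mA PA hA]] := @chaos_tail2 _ _ _ P I V D J sV JD z m n B t.
- exact: zD.
- exact: zi.
- move=> i j i' j'; apply: measurable_funM; first exact: measurable_cst.
  apply: measurable_funM; last exact: measurable_cst.
  by apply: measurable_funM; [exact: measurable_cst|apply: measurable_funM; exact: mth].
- move=> i j i' j' w; rewrite /B (eq_sym j'); case: eqVneq => [->|_]; last by rewrite !mul0r.
  by rewrite (mulrC (th i' w)).
- rewrite qE; apply/andP; split; first by rewrite mulr_ge0// S0.
  rewrite ler_pM2l ?invr_gt0// exchange_big/=; apply: ler_sum => j _.
  by apply: le_trans (CS w x j); rewrite ler_piMl ?sqr_ge0//; have /andP[] := om1 j.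
exists A; split => // w Aw /=; have := hA w Aw; rewrite qE.
have h1 : \sum_(i < m) \sum_(j < n) B i j i j w <= 2^-1 * \sum_(j < n) om j.
  rewrite exchange_big/= mulr_sumr; apply: ler_sum => j _.
  rewrite (eq_bigr (fun i : 'I_m => (om j / 2) * th i w ^+ 2)) => [|i _]; last first.
    by rewrite /B eqxx mul1r expr2; ring.
  by rewrite -mulr_sumr mulrC -[leRHS]mul1r -[2^-1 * _]mulrC ler_wpM2r// divr_ge0.
move: (\sum_(i < m) _) (\sum_(i < n) _) h1 => X Y h1 h; lra.
Qed.
End chaos_instances.

(** * Measurability of inverses and of coercivity *)

Section matrix_measurability.
Context {R : realType} d (T : measurableType d).

Lemma measurable_det n (M : T -> 'M[R]_n) : (forall i j, measurable_fun setT (fun w => M w i j)) ->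
  measurable_fun setT (fun w => \det (M w)).
Proof.
move=> mM; apply: measurable_sum => s; apply: measurable_funM; first exact: measurable_cst.
by apply: measurable_prod => i _; exact: mM.
Qed.

(* Equal to [invmx] on invertible matrices, and visibly measurable in the entries. *)
Definition adj_inv n (A : 'M[R]_n) : 'M[R]_n := (\det A)^-1 *: \adj A.

Lemma adj_invE n (A : 'M[R]_n) : A \in unitmx -> adj_inv A = invmx A.
Proof. by rewrite /adj_inv /invmx => ->. Qed.

Lemma measurable_adj_inv n (M : T -> 'M[R]_n) i j :
  (forall i j, measurable_fun setT (fun w => M w i j)) ->
  measurable_fun setT (fun w => adj_inv (M w) i j).
Proof.
move=> mM; under eq_fun do rewrite !mxE /cofactor.
apply: measurable_funM.
  exact: (measurableT_comp measurable_invr (measurable_det mM)).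
apply: measurable_funM; first exact: measurable_cst.
by apply: measurable_det => a b; under eq_fun do rewrite !mxE; exact: mM.
Qed.

Lemma measurable_mulmx m n q (M : T -> 'M[R]_(m, n)) (N : T -> 'M[R]_(n, q)) i j :
  (forall i j, measurable_fun setT (fun w => M w i j)) ->
  (forall i j, measurable_fun setT (fun w => N w i j)) ->
  measurable_fun setT (fun w => (M w *m N w) i j).
Proof.
move=> mM mN; under eq_fun do rewrite mxE.
by apply: measurable_sum => l; exact: measurable_funM.
Qed.

Lemma cvg_seq_sum (I : Type) (s : seq I) (f : nat -> I -> R) (l : I -> R) :
  (forall i, f n i @[n --> \oo] --> l i) ->
  \sum_(i <- s) f n i @[n --> \oo] --> \sum_(i <- s) l i.
Proof.
move=> fl; elim: s => [|i s IH].
  by rewrite big_nil; under eq_fun do rewrite big_nil; exact: cvg_cst.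
by rewrite big_cons; under eq_fun do rewrite big_cons; exact: cvgD.
Qed.

Lemma floor_cvg (x : R) : (Num.floor (n.+1%:R * x))%:~R / n.+1%:R @[n --> \oo] --> x.
Proof.
apply: (@squeeze_cvgr _ _ _ _ (fun n => x - n.+1%:R^-1) (cst x)).
- apply: nearW => n /=.
  have n0 : 0 < n.+1%:R :> R by [].
  rewrite ler_pdivrMr// (mulrC x) floor_le andbT ler_pdivlMr// mulrBl mulVf// ?gt_eqF//.
  by rewrite (mulrC x) lerBlDr ltW//; have := floorD1_gt (n.+1%:R * x); rewrite intrD.
- rewrite -[X in _ --> X]subr0; apply: cvgB; first exact: cvg_cst.
  exact: cvg_harmonic.
- exact: cvg_cst.
Qed.

(** By homogeneity integer vectors stand for rational ones, and floor(m x) / m tends to x.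
    Coercivity is thereby a countable intersection of conditions, hence a measurable event. *)
Lemma coercive_int n (A : 'M[R]_n) (c : R) :
  (forall z : {ffun 'I_n -> int}, let x : 'cV_n := \col_i (z i)%:~R in c * ip x x <= ip x (A *m x)) ->
  forall x, c * ip x x <= ip x (A *m x).
Proof.
move=> h x.
pose v m : 'cV[R]_n := \col_i ((Num.floor (m.+1%:R * x i 0))%:~R / m.+1%:R).
have cv i : v m i 0 @[m --> \oo] --> x i 0.
  by under eq_fun do rewrite mxE; exact: floor_cvg.
have c1 : c * ip (v m) (v m) @[m --> \oo] --> c * ip x x.
  apply: cvgM; first exact: cvg_cst.
  by apply: cvg_seq_sum => i; apply: cvgM; exact: cv.
have c2 : ip (v m) (A *m v m) @[m --> \oo] --> ip x (A *m x).
  apply: cvg_seq_sum => i; apply: cvgM; first exact: cv.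
  rewrite mxE; under eq_fun do rewrite mxE.
  by apply: cvg_seq_sum => j; apply: cvgM; [exact: cvg_cst|exact: cv].
rewrite -(cvg_lim _ c1)// -(cvg_lim _ c2)//; apply: ler_lim.
- by apply/cvg_ex; eexists; exact: c1.
- by apply/cvg_ex; eexists; exact: c2.
apply: nearW => m; have := h [ffun i => Num.floor (m.+1%:R * x i 0)].
set y := \col_i _ => /= hy.
have -> : v m = m.+1%:R^-1 *: y.
  by apply/matrixP => i j; rewrite ord1 !mxE ffunE mulrC.
rewrite -scalemxAr !ipZl ![ip _ (_ *: _)]ipC !ipZl (ipC (A *m y)).
by rewrite mulrCA (mulrCA c) !ler_wpM2l.
Qed.

Lemma measurable_coercive n (M : T -> 'M[R]_n) (c : R) :
  (forall i j, measurable_fun setT (fun w => M w i j)) ->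
  measurable [set w | forall x, c * ip x x <= ip x (M w *m x)].
Proof.
move=> mM.
pose x (z : {ffun 'I_n -> int}) : 'cV[R]_n := \col_i (z i)%:~R.
pose E l : set T := if @choice.unpickle {ffun 'I_n -> int} l is Some z
  then [set w | c * ip (x z) (x z) <= ip (x z) (M w *m x z)] else setT.
have -> : [set w | forall x, c * ip x x <= ip x (M w *m x)] = \bigcap_l E l.
  apply/seteqP; split => [w h l _|w h].
    by rewrite /E; case: choice.unpickle => // z; exact: h.
  by apply: coercive_int => z; have := h (choice.pickle z) I; rewrite /E choice.pickleK.
apply: bigcapT_measurable => l; rewrite /E; case: choice.unpickle => [z|]; last exact: measurableT.
have m1 : measurable_fun setT (fun w => ip (x z) (M w *m x z)).
  apply: measurable_sum => i; apply: measurable_funM; first exact: measurable_cst.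
  under eq_fun do rewrite mxE; apply: measurable_sum => j.
  by apply: measurable_funM; [exact: mM|exact: measurable_cst].
have := m1 measurableT `[c * ip (x z) (x z), +oo[%classic (measurable_itv _).
rewrite setTI; congr measurable; apply/seteqP; split => w; rewrite /= in_itv/= andbT//.
Qed.
End matrix_measurability.

Section entries.
Context {R : realType} (N : nat).

Definition ent (M : 'M[R]_N) (a b : nat) : R :=
  if insub a is Some i then if insub b is Some j then M i j else 0 else 0.

Lemma entE (M : 'M[R]_N) (i j : 'I_N) : ent M i j = M i j.
Proof. by rewrite /ent !valK. Qed.

Lemma qf_ent (M : 'M[R]_N) (y : nat -> R) : qf N (ent M) y = ip (\col_i y i) (M *m \col_i y i).
Proof.
apply: eq_bigr => i _; rewrite !mxE mulr_sumr; apply: eq_bigr => j _.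
by rewrite entE mxE; ring.
Qed.
End entries.

Section noise_chaos.
Context {R : realType} d (T : measurableType d) (P : probability T R).
Context (I : choiceType) (V : I -> T -> R) (D J : set I) (N : nat) (z : nat -> I).
Hypothesis sV : std_gaussian_family P D V.
Hypothesis JD : J `<=` D.
Hypothesis zD : forall a, (a < N)%N -> D (z a) /\ ~ J (z a).
Hypothesis zi : forall a b, (a < N)%N -> (b < N)%N -> z a = z b -> a = b.
Variables (A Q : T -> 'M[R]_N) (a sk : R).
Hypotheses (a0 : 0 < a) (sk0 : 0 < sk).
Hypothesis mA : forall i j, measurable_fun setT ((fun w => A w i j) : hist V J -> R).
Hypothesis mQ : forall i j, measurable_fun setT ((fun w => Q w i j) : hist V J -> R).
Hypothesis Asym : forall w, (A w)^T = A w.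
Hypothesis Qsym : forall w, (Q w)^T = Q w.
Hypothesis QA : forall w x, 0 <= ip x (Q w *m x) <= sk * ip x (A w *m x).
Local Notation noise := (fun w => \col_(i < N) V (z i) w).

(** From Q <= sk A one gets A^-1 Q A^-1 <= sk A^-1 <= sk / a, so a / (2 sk) times this matrix lies
    between 0 and 1/2. Coercivity holds only on the event [G], whose indicator makes the bound valid
    at every point, as the chaos bound requires. *)
Lemma noise_quadratic (t : R) : with_prob_ge P (1 - expR (- t)) [set w |
  (forall x, a * ip x x <= ip x (A w *m x)) ->
  let mu := invmx (A w) *m noise w in
  ip mu (Q w *m mu) <= 4 * \tr (invmx (A w) *m Q w *m invmx (A w)) + 4 * (sk * t / a)].
Proof.
have [mV _ lV mi] := sV.
pose G : set (hist V J) := [set w | forall x, a * ip x x <= ip x (A w *m x)].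
have mG : measurable G by exact: (@measurable_coercive _ _ (hist V J)).
pose M w := adj_inv (A w) *m Q w *m adj_inv (A w).
pose B i j w := \1_G w * (a / (2 * sk) * ent (M w) i j).
have mB i j : measurable_fun setT (B i j : hist V J -> R).
  apply: measurable_funM; first exact: measurable_indic.
  apply: measurable_funM; first exact: measurable_cst.
  rewrite /ent; case: insub => [i'|]; last exact: measurable_cst.
  case: insub => [j'|]; last exact: measurable_cst.
  apply: (@measurable_mulmx _ _ (hist V J)) => i1 j1.
    apply: (@measurable_mulmx _ _ (hist V J)) => i2 j2; last exact: mQ.
    exact: (@measurable_adj_inv _ _ (hist V J)).
  exact: (@measurable_adj_inv _ _ (hist V J)).
have Au w : G w -> A w \in unitmx by exact: coercive_unit.
have Ms w : G w -> (M w)^T = M w.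
  move=> Gw; rewrite /M adj_invE ?Au// !trmx_mul !trmx_inv Asym Qsym mulmxA//.
have Mform w x : G w -> ip x (M w *m x) = ip (invmx (A w) *m x) (Q w *m (invmx (A w) *m x)).
  by move=> Gw; rewrite /M adj_invE ?Au// ip_mxl trmx_inv Asym -!mulmxA.
have hB w : half_psd N (fun i j => B i j w).
  split => [i j|y].
    rewrite /B indicE; case: (boolP (w \in G)) => [/set_mem Gw|_]; last by rewrite !mul0r.
    rewrite /ent; case: insub => [i'|]; case: insub => // j'.
    by rewrite -{1}(Ms w Gw) mxE.
  have -> : qf N (fun i j => B i j w) y = \1_G w * (a / (2 * sk) * qf N (ent (M w)) y).
    rewrite /qf !mulr_sumr; apply: eq_bigr => i _; rewrite !mulr_sumr; apply: eq_bigr => j _.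
    by rewrite /B; ring.
  have s0 : 0 <= \sum_(i < N) y i ^+ 2 by apply: sumr_ge0 => i _; exact: sqr_ge0.
  rewrite indicE; case: (boolP (w \in G)) => [/set_mem Gw|_]; last first.
    by rewrite mul0r lexx mulr_ge0.
  rewrite mul1r qf_ent Mform//; set x := \col_i y i; set u := invmx _ *m x.
  have /andP[h1 h2] := QA w u.
  have -> : \sum_(i < N) y i ^+ 2 = ip x x by apply: eq_bigr => i _; rewrite mxE.
  rewrite mulr_ge0 ?divr_ge0 ?mulr_ge0 ?(ltW a0) ?(ltW sk0)//=.
  have Gw' : forall x, a * ip x x <= ip x (A w *m x) := Gw.
  have ux : A w *m u = x by rewrite /u mulmxA mulmxV ?Au// mul1mx.
  rewrite ux in h2.
  have h3 : ip u x <= ip x x / a.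
    have g1 := Gw' u; rewrite ux in g1.
    have cs := ip_CS u x; have X0 := ip_ge0 x; have U0 := ip_ge0 u.
    rewrite ler_pdivlMr//.
    move: (ip u x) (ip u u) (ip x x) g1 cs X0 U0 => c U X g1 cs X0 U0.
    have c0 : 0 <= c by apply: le_trans g1; rewrite mulr_ge0// ltW.
    have [->|cn] := eqVneq c 0; first by rewrite mul0r.
    have cp : 0 < c by rewrite lt_neqAle eq_sym cn.
    rewrite -(ler_pM2l cp) mulrA -expr2 mulrC.
    apply: (@le_trans _ _ (a * (U * X))); first by rewrite ler_pM2l.
    by rewrite mulrA ler_wpM2r.
  apply: (@le_trans _ _ (a / (2 * sk) * (sk * (ip x x / a)))).
    rewrite ler_wpM2l ?divr_ge0 ?mulr_ge0 ?(ltW a0) ?(ltW sk0)//.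
    by apply: le_trans h2 _; rewrite ler_pM2l.
  rewrite le_eqVlt; apply/orP; left; apply/eqP.
  by field; rewrite !gt_eqF.
have [E [mE PE hE]] := @chaos_tail _ _ _ P I V D J mV mi lV JD z N B t zD zi mB hB.
exists E; split => // w Ew Gw /=; have := hE w Ew.
have G1 : \1_G w = 1 :> R by rewrite indicE mem_set.
have -> : qf N (fun i j => B i j w) (fun a => V (z a) w) =
    a / (2 * sk) * ip (noise w) (M w *m noise w).
  rewrite -(qf_ent (M w) (fun a => V (z a) w)) /qf !mulr_sumr; apply: eq_bigr => i _; rewrite !mulr_sumr; apply: eq_bigr => j _.
  by rewrite /B G1; ring.
have -> : \sum_(i < N) B i i w = a / (2 * sk) * \tr (M w).
  by rewrite /mxtrace mulr_sumr; apply: eq_bigr => i _; rewrite /B G1 mul1r entE.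
rewrite Mform// /M adj_invE ?Au//; move: (ip _ _) (\tr _) => X Y h.
have h2 : X <= (4 * sk / a) * (2 * (a / (2 * sk) * Y) + t).
  apply: le_trans (_ : (4 * sk / a) * (2^-1 * (a / (2 * sk) * X)) <= _).
    by rewrite le_eqVlt; apply/orP; left; apply/eqP; field; rewrite !gt_eqF.
  by rewrite ler_wpM2l// divr_ge0 ?mulr_ge0 ?(ltW a0) ?(ltW sk0).
apply: le_trans h2 _; rewrite le_eqVlt; apply/orP; left; apply/eqP.
by field; rewrite !gt_eqF.
Qed.
End noise_chaos.

(** The companion of [with_prob_ge_limsup]: a point of the limsup satisfies the bound on infinitely
    many windows, which is enough for the limit of the window sums. *)
Lemma cvg_io_le {R : realType} (v : R^nat) (l C : R) : v n @[n --> \oo] --> l ->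
  (forall m, exists2 n, (m <= n)%N & v n <= C) -> l <= C.
Proof.
move=> vl h; apply/ler_addgt0Pr => e e0; move/cvgrPdist_lt : vl => /(_ e e0)[m _ hm].
have [n mn vn] := h m; have := hm n mn => /=; rewrite ltr_norml => /andP[_].
by move=> h2; lra.
Qed.

Lemma wnorm_eq {R : realType} n (om x y : R^nat) : (forall j, (j < n)%N -> x j = y j) ->
  wnorm n om x = wnorm n om y.
Proof.
move=> xy; congr norm2; apply/funext => j; rewrite /wvec; case: ifP => // /xy -> //.
Qed.

Definition RIP_body {R : realType} (kappa c : R) : Prop :=
  forall (N : nat) (p : xdim) (Gamma S : R^nat -> R^nat)
    (d0 : measure_display) (T0 : measurableType d0) (P0 : probability T0 R)
    (g : T0 -> R^nat)
    (d : measure_display) (T : measurableType d) (P : probability T R)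
    (G : 'I_N -> T -> R^nat),
  (0 < N)%N -> covariance_op p Gamma -> is_sqrt_op p Gamma S ->
  std_gaussian_vec P0 p g -> std_gaussian_mx P p G ->
  with_prob_ge P (1 - expR (- (c * N%:R)))
    [set w | forall v, Rp p v ->
      R_N P0 g kappa N p (S @` ball2 p 1) * norm2 v <= norm2 (S v) ->
      let q := N%:R^-1 * \sum_(i < N) dot (G i w) (S v) ^+ 2 in
      2^-1 * norm2 (S v) ^+ 2 <= q <= 3 / 2 * norm2 (S v) ^+ 2].

(** * The high-probability events of the design and of the noise *)

Section events.
Context {R : realType} (N : nat) (p : xdim) (Sigma : R^nat -> R^nat) (sigma : R^nat)
  (u : nat -> R^nat) (beta : R^nat) (sxi : R) d (T : measurableType d) (P : probability T R)
  (X : 'I_N -> T -> R^nat) (xi betahat : T -> R^nat).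
Hypothesis gm : gaussian_linear_model p Sigma sigma u beta sxi P X xi betahat.
Context d0 (T0 : measurableType d0) (P0 : probability T0 R) (g zeta : T0 -> R^nat) (Om : set T0).
Hypotheses (mOm : measurable Om) (POm : P0 Om = 1%E).
Hypothesis sz : std_gaussian_vec P0 p zeta.
Hypothesis hz : forall w, Om w -> is_limit sigma u g w (fun j => Num.sqrt (sigma j) * zeta w j).
Variable k : nat.
Hypothesis kp : forall j, (j < k)%N -> in_dim p j.
Hypothesis N0 : (0 < N)%N.
Local Notation es := (model_eigen gm).
Local Notation cov := (model_cov gm).
Local Notation ell := (ell p sigma u P0 g k).
Local Notation trt := (trt sigma k).
Local Notation s0 := (sigma_ge0 es).
Local Notation gauss := (gauss sigma u sxi X xi).
Local Notation win := (win p k).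
Local Notation om' := (om' sigma k).
Local Notation zk := (zk zeta k).
Local Notation Lw := (Lw p sigma P0 zeta k).

Definition xc (w : T) (i : 'I_N) : R^nat := ucoord u (X i w).
Definition xt (w : T) (i : 'I_N) : R^nat := high_part k (xc w i).
(** The Gram matrix of these rows is X_t Sigma_t X_t^T, the form that measures in prediction norm
    the tail of an interpolant X^T t. *)
Definition qt (w : T) (i : 'I_N) : R^nat := fun j => Num.sqrt (sigma j) * high_part k (xc w i) j.

Lemma xc_l2 w i : l2 (xc w i). Proof. exact: (coord_l2 es (Rp_l2 (X_Rp gm i w))). Qed.
Lemma xt_l2 w i : l2 (xt w i). Proof. exact: high_part_l2 (xc_l2 w i). Qed.

Lemma qt_l2 w i : l2 (qt w i).
Proof.
apply: (l2_le (M := Num.sqrt (sigma 0%N)) (xt_l2 w i)) => j.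
by rewrite normrM ler_wpM2r// (sqrt_sigma_le es).
Qed.

Lemma xcE w i j : xc w i j = Num.sqrt (sigma j) * gauss ((i : nat), j) w.
Proof. by rewrite gauss_design /xc (coord_design gm). Qed.

Lemma gauss_dom_design (i : 'I_N) j : in_dim p j -> gauss_dom N p sxi ((i : nat), j).
Proof. by rewrite /gauss_dom/= ltn_ord. Qed.

Definition tsum (t : 'cV[R]_N) (w : T) (j : nat) : R := \sum_i t i 0 * gauss ((i : nat), j) w.

Lemma lcomb_xcE t w j : lcomb t (xc w) j = Num.sqrt (sigma j) * tsum t w j.
Proof.
by rewrite /lcomb /tsum mulr_sumr; apply: eq_bigr => i _; rewrite xcE mulrCA.
Qed.

Lemma lcomb_xtE t w j : lcomb t (xt w) j = if (k <= j)%N then Num.sqrt (sigma j) * tsum t w j else 0.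
Proof.
case: ifP => kj; last by rewrite /lcomb big1// => i _; rewrite /xt high_partE kj mulr0.
by rewrite -lcomb_xcE /lcomb; apply: eq_bigr => i _; rewrite /xt high_partE kj.
Qed.

Lemma lcomb_win t w m : \sum_(j < k + win m) lcomb t (xt w) j ^+ 2 =
  \sum_(j < win m) sigma (k + j) * tsum t w (k + j) ^+ 2.
Proof.
rewrite big_split_ord/= big1 ?add0r; last first.
  by move=> j _; rewrite lcomb_xtE leqNgt ltn_ord expr0n.
by apply: eq_bigr => j _; rewrite lcomb_xtE leq_addr exprMn sqr_sqrtr// s0.
Qed.

Lemma lcomb_win_cvg t w : \sum_(j < k + win m) lcomb t (xt w) j ^+ 2 @[m --> \oo] -->
  dot (lcomb t (xt w)) (lcomb t (xt w)).
Proof.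
have ll := lcomb_l2 t (xt_l2 w).
apply: (@sum_win_cvg R p k (fun j => lcomb t (xt w) j ^+ 2)).
  by move=> j pj; rewrite lcomb_xtE (eigen_val_out es pj) sqrtr0 mul0r if_same expr0n.
have := dot_cvg ll ll.
by under eq_fun do under eq_bigr do rewrite -expr2.
Qed.

Lemma sub_vec n (f : nat -> nat) : (forall j, (j < n)%N -> in_dim p (f j)) ->
  (forall i j, (i < n)%N -> (j < n)%N -> f i = f j -> i = j) ->
  std_gaussian_vec P0 (Fin n) (fun w j => if (j < n)%N then zeta w (f j) else 0).
Proof.
move=> fp fi; have h := @std_subfamily _ _ _ P0 _ _ _ [set j | in_dim (Fin n) j] _ f sz fp fi.
rewrite /std_gaussian_vec (_ : (fun j w => if (j < n)%N then zeta w (f j) else 0) =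
  (fun i => if pselect ([set j | in_dim (Fin n) j] i) then (fun w => zeta w (f i)) else cst 0))//.
by apply/funext => j; apply/funext => w; case: pselect => /= h1; [rewrite h1|case: ifP].
Qed.

Lemma sub_mx n (f : nat -> nat) : (forall j, (j < n)%N -> in_dim p (f j)) ->
  (forall i j, (i < n)%N -> (j < n)%N -> f i = f j -> i = j) ->
  std_gaussian_mx P (Fin n) (fun (i : 'I_N) w j => if (j < n)%N then gauss ((i : nat), f j) w else 0).
Proof.
move=> fp fi.
have h := @std_subfamily _ _ _ P _ _ _ [set q : 'I_N * nat | in_dim (Fin n) q.2] _
  (fun q => ((q.1 : nat), f q.2)) (gauss_std gm) _ _.
rewrite /std_gaussian_mx (_ : (fun (ij : 'I_N * nat) w => if (ij.2 < n)%N then gauss ((ij.1 : nat), f ij.2) w else 0) =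
  (fun i => if pselect ([set q : 'I_N * nat | in_dim (Fin n) q.2] i) then gauss ((i.1 : nat), f i.2) else cst 0)); last first.
  by apply/funext => q; apply/funext => w; case: pselect => /= h1; [rewrite h1|case: ifP].
apply: h => [[i j] /= jn|[i j] [i' j'] /= jn jn' [/val_inj -> /fi ->]//].
by apply: gauss_dom_design; exact: fp.
Qed.

(* [DM_weighted] is applied on each window m >= m0; the limsup of these events has the same probability
   bound because the error does not depend on m. *)
Lemma tail_event (kappa c : R) : DM_weighted kappa c -> 0 < sigma k ->
  N%:R <= kappa * (ell ^+ 2 / sigma k) -> 0 < kappa ->
  with_prob_ge P (1 - expR (- (c * N%:R))) [set w | forall t : 'cV[R]_N,
    ell ^+ 2 / 4 * ip t t <= dot (lcomb t (xt w)) (lcomb t (xt w)) <= 3 * trt * ip t t].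
Proof.
move=> DM sk NL kap0.
have [m0 hm0] := ell_le_Lw es cov mOm POm sz hz sk.
have ell0 : 0 <= ell := ell_ge0 es cov mOm POm sz hz k.
have trt0 := trt_ge0 es cov k.
have Lw2 m : Lw m ^+ 2 <= 2 * trt.
  rewrite -[leRHS]sqr_sqrtr ?mulr_ge0// ler_sqr ?nnegrE ?sqrtr_ge0 ?(Lw_ge0 es sz)//.
  exact: (Lw_le es cov sz).
have Em m : (m0 <= m)%N -> with_prob_ge P (1 - expR (- (c * N%:R))) [set w | forall t : 'cV[R]_N,
    2^-1 * Lw m ^+ 2 * ip t t <= \sum_(j < win m) om' j * tsum t w (k + j) ^+ 2
     <= 3 / 2 * Lw m ^+ 2 * ip t t].
  move=> mm.
  have fp j : (j < win m)%N -> in_dim p (k + j) by exact: win_dim.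
  have fi i j : (i < win m)%N -> (j < win m)%N -> (k + i = k + j -> i = j)%N by move=> _ _ /addnI.
  have := DM N (win m) om' (sigma k) _ _ P0 _ _ _ P _ N0
    (fun j h => om'_bound es h) (sub_vec fp fi) (sub_mx fp fi).
  have -> : fine (\int[P0]_w (wnorm (win m) om' (fun j => if (j < win m)%N then zeta w (k + j) else 0))%:E) = Lw m.
    congr fine; apply: eq_integral => w _; congr EFin; apply: wnorm_eq => j jm.
    by rewrite jm.
  have hN : N%:R <= kappa * (Lw m ^+ 2 / sigma k).
    apply: le_trans NL _; rewrite ler_pM2l// ler_wpM2r ?invr_ge0 ?(ltW sk)//.
    by rewrite ler_sqr ?nnegrE ?(Lw_ge0 es sz)// hm0.
  move=> /(_ hN); apply: with_prob_ge_sub => // w /= h t.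
  have := h (fun i => t i 0).
  have -> : \sum_i t i 0 ^+ 2 = ip t t by apply: eq_bigr => i _; rewrite expr2.
  rewrite (eq_bigr (fun j : 'I_(win m) => om' j * tsum t w (k + j) ^+ 2))// => j _.
  by congr (_ * _ ^+ 2); apply: eq_bigr => i _; rewrite ltn_ord.
(* For the lower bound one window suffices, and om' <= 2 om costs a factor 2. The upper bound holds
   on infinitely many windows, with Lw^2 <= 2 Tr(Sigma_t), and passes to the limit. *)
apply: with_prob_ge_sub (with_prob_ge_limsup Em) => // w /= h t; apply/andP; split.
  have [m mm /(_ t)/andP[h1 _]] := h m0.
  have hL : ell ^+ 2 <= Lw m ^+ 2.
    by rewrite ler_sqr ?nnegrE ?(Lw_ge0 es sz)// hm0.
  have ll := lcomb_l2 t (xt_l2 w).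
  have h2 := sum_sqr_le_dot (k + win m) ll; rewrite lcomb_win in h2.
  have h3 : \sum_(j < win m) om' j * tsum t w (k + j) ^+ 2 <=
      2 * \sum_(j < win m) sigma (k + j) * tsum t w (k + j) ^+ 2.
    rewrite mulr_sumr; apply: ler_sum => j _; rewrite mulrA ler_wpM2r ?sqr_ge0//.
    exact: om'_le.
  have h4 : ell ^+ 2 * ip t t <= Lw m ^+ 2 * ip t t by rewrite ler_wpM2r ?ip_ge0.
  rewrite -mulrA in h1; rewrite mulrAC; lra.
apply: (cvg_io_le (@lcomb_win_cvg t w)) => m.
have [n mn /(_ t)/andP[_ h1]] := h m; exists n => //; rewrite lcomb_win.
apply: (@le_trans _ _ (\sum_(j < win n) om' j * tsum t w (k + j) ^+ 2)).
  by apply: ler_sum => j _; rewrite ler_wpM2r ?sqr_ge0//; exact: (om_le_om' es).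
apply: le_trans h1 _; rewrite ler_wpM2r ?ip_ge0//.
by have := Lw2 n; lra.
Qed.

(* The weights gam are completed by the weights om' / thr of a tail window, so that the total weight is
   large enough for the Dvoretzky-Milman theorem with N rows. *)
Lemma head_op_event (kappa c thr : R) (gam : R^nat) : DM_weighted kappa c -> 0 < kappa ->
  0 < sigma k <= thr -> thr = kappa * ell ^+ 2 / N%:R ->
  (forall j, (j < k)%N -> 0 < gam j <= 1) -> \sum_(j < k) gam j <= N%:R ->
  with_prob_ge P (1 - expR (- (c * N%:R))) [set w | forall t : 'cV[R]_N,
    \sum_(j < k) gam j * tsum t w j ^+ 2 <= 3 / 2 * (N%:R + 2 * trt / thr) * ip t t].
Proof.
move=> DM kap0 /andP[sk skt] thrE gam01 gamN.
have thr0 : 0 < thr := lt_le_trans sk skt.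
have NR0 : 0 < N%:R :> R by rewrite ltr0n.
have [m hm] := ell_le_Lw es cov mOm POm sz hz sk.
have {hm} ellL : ell <= Lw m by exact: hm.
have ell0 : 0 <= ell := ell_ge0 es cov mOm POm sz hz k.
pose n := (k + win m)%N.
pose wt : R^nat := fun j => if (j < k)%N then gam j else om' (j - k) / thr.
have wt01 j : (j < n)%N -> 0 < wt j <= 1.
  rewrite /wt; case: (ltnP j k) => [jk _|kj jn]; first exact: gam01.
  have h : (j - k < win m)%N by rewrite ltn_subLR.
  have /andP[h1 h2] := om'_bound es h.
  by rewrite divr_gt0//= ler_pdivrMr// mul1r (le_trans h2).
have wt0 j : (j < n)%N -> 0 < wt j by move=> /wt01/andP[].
have fp j : (j < n)%N -> in_dim p j.
  move=> jn; have [jk|kj] := ltnP j k; first exact: kp.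
  by rewrite -(subnKC kj); apply: (@win_dim p k m); rewrite ltn_subLR.
pose z w : R^nat := fun j => if (j < n)%N then zeta w j else 0.
have mz j : measurable_fun setT (fun w => zeta w j) by have [h _ _ _] := sz; exact: h.
have lz j : (j < n)%N -> has_law P0 (fun w => zeta w j) (normal_law 1).
  by move=> /fp pj; have [_ _ h _] := sz; exact: h.
pose L := fine (\int[P0]_w (wnorm n wt (zeta w))%:E).
have S0 : 0 <= \sum_(j < n) wt j by apply: sumr_ge0 => j _; rewrite ltW// wt0.
have Lub := @expect_wnorm_le _ _ _ P0 n wt zeta mz wt0 lz.
have L0' : (0 <= \int[P0]_w (wnorm n wt (zeta w))%:E)%E.
  by apply: integral_ge0 => w _; rewrite lee_fin wnorm_ge0.
have LE : (\int[P0]_w (wnorm n wt (zeta w))%:E = L%:E)%E.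
  rewrite /L fineK// fin_numElt (lt_le_trans (ltNyr 0) L0')/=.
  exact: le_lt_trans Lub (ltry _).
rewrite LE lee_fin in Lub.
have L0 : 0 <= L by rewrite -lee_fin -LE.
have Llb : ell / Num.sqrt thr <= L.
  apply: (@le_trans _ _ (Lw m / Num.sqrt thr)).
    by apply: ler_wpM2r; [rewrite invr_ge0 sqrtr_ge0|exact: ellL].
  rewrite -lee_fin -LE EFinM muleC -(LwE es sz k m) -ge0_integralZl//; last 2 first.
  - apply/measurable_EFinP; apply: measurable_wnorm; first exact: (mzk sz).
    by move=> j h; have /andP[] := om'_bound es h.
  - by move=> w _; rewrite lee_fin wnorm_ge0.
  apply: ge0_le_integral => //.
  - by move=> w _; rewrite mule_ge0// lee_fin ?invr_ge0 ?sqrtr_ge0 ?wnorm_ge0.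
  - apply: measurable_funeM; apply/measurable_EFinP; apply: measurable_wnorm; first exact: (mzk sz).
    by move=> j h; have /andP[] := om'_bound es h.
  - by apply/measurable_EFinP; exact: measurable_wnorm.
  move=> w _; rewrite -EFinM lee_fin -(@ler_sqr R) ?nnegrE ?mulr_ge0 ?invr_ge0 ?sqrtr_ge0 ?wnorm_ge0//.
  rewrite exprMn exprVn sqr_sqrtr ?(ltW thr0)// !wnorm_sqr//; last first.
    by move=> j h; have /andP[] := om'_bound es h.
  rewrite big_split_ord/= -[leLHS]add0r lerD//.
    by apply: sumr_ge0 => j _; rewrite mulr_ge0 ?sqr_ge0// ltW// wt0// ltn_addr.
  rewrite mulr_sumr; apply: ler_sum => j _; rewrite le_eqVlt; apply/orP; left; apply/eqP.
  by rewrite /wt ltnNge leq_addr/= addKn /zk; ring.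
(* The threshold is made for this: ell^2 / thr = N / kappa, so the added tail weights alone reach
   the dimension required for N rows, all weights being at most 1. *)
have hN : N%:R <= kappa * (L ^+ 2 / 1).
  rewrite divr1; apply: (@le_trans _ _ (kappa * (ell / Num.sqrt thr) ^+ 2)).
    rewrite exprMn exprVn sqr_sqrtr ?(ltW thr0)// thrE.
    have [e0|e0] := eqVneq ell 0.
      by move: thr0; rewrite thrE e0 expr0n mulr0 mul0r ltxx.
    by rewrite le_eqVlt; apply/orP; left; apply/eqP; field; rewrite e0 !gt_eqF.
  by rewrite ler_pM2l// ler_sqr ?nnegrE// divr_ge0// sqrtr_ge0.
have fi i j : (i < n)%N -> (j < n)%N -> i = j -> i = j by [].
have := DM N n wt 1 _ _ P0 _ _ _ P _ N0 wt01 (sub_vec fp fi) (sub_mx fp fi).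
have -> : fine (\int[P0]_w (wnorm n wt (fun j => if (j < n)%N then zeta w j else 0))%:E) = L.
  congr fine; apply: eq_integral => w _; congr EFin; apply: wnorm_eq => j jn.
  by rewrite jn.
move=> /(_ hN); apply: with_prob_ge_sub => // w /= h t.
have /andP[_ h2] := h (fun i => t i 0).
have tt : \sum_i t i 0 ^+ 2 = ip t t by apply: eq_bigr => i _; rewrite expr2.
rewrite tt in h2.
apply: (@le_trans _ _ (3 / 2 * L ^+ 2 * ip t t)).
  apply: le_trans h2; rewrite [leRHS]big_split_ord/= -[leLHS]addr0 lerD//.
    apply: ler_sum => j _; rewrite /wt ltn_ord.
    by rewrite (eq_bigr (fun i : 'I_N => t i 0 * gauss ((i : nat), (j : nat)) w))// => i _;
       rewrite ltn_addr.
  by apply: sumr_ge0 => j _; rewrite mulr_ge0 ?sqr_ge0// ltW// wt0// ltn_add2l.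
rewrite ler_wpM2r ?ip_ge0// ler_wpM2l//.
have L2 : L ^+ 2 <= \sum_(j < n) wt j.
  by rewrite -[leRHS]sqr_sqrtr// ler_sqr ?nnegrE ?sqrtr_ge0.
apply: le_trans L2 _; rewrite big_split_ord/= lerD//.
  by apply: le_trans gamN; apply: ler_sum => j _; rewrite /wt ltn_ord.
apply: (@le_trans _ _ (\sum_(j < win m) 2 * sigma (k + j) / thr)).
  apply: ler_sum => j _; rewrite /wt ltnNge leq_addr/= addKn ler_wpM2r ?invr_ge0 ?(ltW thr0)//.
  exact: om'_le.
rewrite -mulr_suml ler_wpM2r ?invr_ge0 ?(ltW thr0)// -mulr_sumr ler_wpM2l//.
exact: (sum_om_le es cov).
Qed.

(** Either sqrt(thr) |v| <= |Sigma_h^(1/2) v|, and v is in the cone of the restricted isometry since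
    R_N <= sqrt(thr), or sum_j sigma_j v_j^2 <= thr |v|^2. Replacing sigma_j by max(sigma_j, thr)
    costs one more thr |v|^2. *)
Lemma rip_event (kR c thr : R) : RIP_body kR c -> 0 <= thr ->
  R_N P0 g kR N p (spec_op u (low_part k (sqrt_seq sigma)) @` ball2 p 1) <= Num.sqrt thr ->
  with_prob_ge P (1 - expR (- (c * N%:R))) [set w | forall v : R^nat,
    \sum_(j < k) Num.max (sigma j) thr * v j ^+ 2 <=
    2 / N%:R * (\sum_i (\sum_(j < k) xc w i j * v j) ^+ 2) + 2 * thr * \sum_(j < k) v j ^+ 2].
Proof.
move=> RIP thr0 RNt.
have NR0 : 0 < N%:R :> R by rewrite ltr0n.
pose Gam (x : R^nat) : R^nat := fun j => low_part k sigma j * x j.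
pose S := head_root sigma k.
have Gs x j : (k <= j)%N -> Gam x j = 0 by rewrite /Gam /low_part leqNgt => /negbTE ->; rewrite mul0r.
have Ss x j : (k <= j)%N -> S x j = 0 by exact: head_root_supp.
have GRp x : Rp (Fin k) (Gam x) by apply/Rp_FinP; exact: Gs.
have SRp x : Rp (Fin k) (S x) by apply/Rp_FinP; exact: Ss.
have lo0 j : 0 <= low_part k sigma j by rewrite /low_part; case: ifP; rewrite ?s0.
have psdG : covariance_op (Fin k) Gam.
  split; first split.
  - by move=> x _; exact: GRp.
  - by move=> a x y _ _; apply/funext => j; rewrite /Gam /=; ring.
  - move=> x y _ _; rewrite (dot_supp _ (Gs x)) dotC (dot_supp _ (Gs y)).
    by apply: eq_bigr => j _; rewrite /Gam; ring.
  - move=> x _; rewrite dotC (dot_supp _ (Gs x)); apply: sumr_ge0 => j _.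
    by rewrite /Gam -mulrA -expr2 mulr_ge0 ?sqr_ge0.
  apply: (@nneg_cvg_series _ _ (\sum_(j < k) sigma j)) => [j|n].
    rewrite /diag_entry; case: ifP => // _; apply: mulr_ge0; first exact: lo0.
    by rewrite /basis_vec eqxx.
  have -> : diag_entry (Fin k) Gam = fun j => if (j < k)%N then sigma j else 0.
    apply/funext => j; rewrite /diag_entry/=; case: ifP => // jk.
    by rewrite /Gam /low_part jk /basis_vec eqxx mulr1.
  rewrite -[leRHS](sum_trunc sigma (leq_addl n k)).
  rewrite [leRHS]big_split_ord/= lerDl; apply: sumr_ge0 => j _.
  by case: ifP; rewrite ?s0.
have sqrtS : is_sqrt_op (Fin k) Gam S.
  split; first split.
  - by move=> x _; exact: SRp.
  - by move=> a x y _ _; apply/funext => j; rewrite /S /head_root /=; ring.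
  - move=> x y _ _; rewrite (dot_supp _ (Ss x)) dotC (dot_supp _ (Ss y)).
    by apply: eq_bigr => j _; rewrite /S /head_root; ring.
  - move=> x _; rewrite dotC (dot_supp _ (Ss x)); apply: sumr_ge0 => j _.
    rewrite /S /head_root -mulrA -expr2 mulr_ge0 ?sqr_ge0//.
    by rewrite /low_part; case: ifP => // _; rewrite sqrtr_ge0.
  - move=> x _; apply/funext => j; rewrite /S /head_root /Gam /low_part /sqrt_seq.
    by case: ifP => _; rewrite ?mul0r// mulrA -expr2 sqr_sqrtr// s0.
have fi i j : (i < k)%N -> (j < k)%N -> i = j -> i = j by [].
have := RIP N (Fin k) Gam S _ _ P0 _ _ _ P _ N0 psdG sqrtS (zh_std sz kp) (sub_mx kp fi).
rewrite -(R_N_head es mOm POm hz kp); apply: with_prob_ge_sub => // w /= h v.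
pose v' : R^nat := low_part k v.
have pv : Rp (Fin k) v'.
  by apply/Rp_FinP => j kj; rewrite /v' /low_part ltnNge kj.
have v's j : (k <= j)%N -> v' j = 0 by move/Rp_FinP: pv; exact.
have nv : norm2 v' ^+ 2 = \sum_(j < k) v j ^+ 2.
  by rewrite norm2_sqr (dot_supp _ v's); apply: eq_bigr => j _; rewrite /v' /low_part ltn_ord expr2.
have nS : norm2 (S v') ^+ 2 = \sum_(j < k) sigma j * v j ^+ 2.
  rewrite norm2_sqr (dot_supp _ (Ss v')); apply: eq_bigr => j _.
  by rewrite /S /head_root /v' /low_part ltn_ord mulrACA -!expr2 sqr_sqrtr// s0.
set z2 := \sum_i (\sum_(j < k) xc w i j * v j) ^+ 2.
have z20 : 0 <= z2 by apply: sumr_ge0 => i _; exact: sqr_ge0.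
have zE : \sum_(i < N) dot (fun j => if (j < k)%N then gauss ((i : nat), j) w else 0) (S v') ^+ 2 = z2.
  apply: eq_bigr => i _; congr (_ ^+ 2); rewrite dotC (dot_supp _ (Ss v')); apply: eq_bigr => j _.
  by rewrite ltn_ord xcE /S /head_root /v' /low_part ltn_ord /sqrt_seq; ring.
have v20 : 0 <= \sum_(j < k) v j ^+ 2 by apply: sumr_ge0 => j _; exact: sqr_ge0.
have le1 : \sum_(j < k) Num.max (sigma j) thr * v j ^+ 2 <=
    \sum_(j < k) sigma j * v j ^+ 2 + thr * \sum_(j < k) v j ^+ 2.
  rewrite mulr_sumr -big_split; apply: ler_sum => j _ /=.
  rewrite -mulrDl ler_wpM2r ?sqr_ge0// ge_max lerDl thr0 lerDr s0//.
apply: le_trans le1 _.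
have [big|small] := leP (Num.sqrt thr * norm2 v') (norm2 (S v')).
  have RNle : R_N P0 g kR N p (spec_op u (low_part k (sqrt_seq sigma)) @` ball2 p 1) * norm2 v'
      <= norm2 (S v').
    by apply: le_trans big; rewrite ler_wpM2r ?norm2_ge0.
  have /andP[h1 _] := h v' pv RNle.
  rewrite zE nS in h1.
  have -> : 2 / N%:R * z2 = 2 * (N%:R^-1 * z2) by rewrite mulrA.
  have : 0 <= thr * \sum_(j < k) v j ^+ 2 by rewrite mulr_ge0.
  rewrite -mulrA; lra.
have h1 : norm2 (S v') ^+ 2 <= thr * norm2 v' ^+ 2.
  rewrite -[X in X * _]sqr_sqrtr// -exprMn ler_sqr ?nnegrE ?mulr_ge0 ?sqrtr_ge0 ?norm2_ge0//.
  exact: ltW.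
rewrite nS nv in h1.
have h2 : 0 <= 2 / N%:R * z2 by rewrite mulr_ge0// divr_ge0.
by rewrite -mulrA; lra.
Qed.

Definition gn (w : T) : 'cV[R]_N := \col_i gauss (N, (i : nat)) w.
Local Notation Am w := (gram (xt w)).
Local Notation Qm w := (gram (qt w)).

Lemma gauss_hist (J : set (nat * nat)) q : (gauss_dom N p sxi q -> J q) ->
  measurable_fun setT (gauss q : hist gauss J -> R).
Proof.
move=> Jq; have [Dq|nD] := pselect (gauss_dom N p sxi q).
  by apply: hist_measurable; exact: Jq.
by rewrite (gauss_off gm nD); exact: measurable_cst.
Qed.

Section hist_gram.
Variable J : set (nat * nat).
Hypothesis Jt : forall q, gauss_dom N p sxi q -> (q.1 < N)%N -> (k <= q.2)%N -> J q.

Lemma xt_hist i j : measurable_fun setT ((fun w => xt w i j) : hist gauss J -> R).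
Proof.
rewrite /xt; under eq_fun do rewrite high_partE xcE.
case: leqP => kj; last exact: measurable_cst.
apply: measurable_funM; first exact: measurable_cst.
by apply: gauss_hist => Dq; apply: Jt => //=.
Qed.

Lemma Am_hist i i' : measurable_fun setT ((fun w => Am w i i') : hist gauss J -> R).
Proof.
apply: (@measurable_fun_cvg _ (hist gauss J) _ _ (fun n w => \sum_(j < n) xt w i j * xt w i' j)).
  by move=> n; apply: measurable_sum => j; apply: measurable_funM; exact: xt_hist.
by move=> w _; rewrite mxE; exact: dot_cvg (xt_l2 w i) (xt_l2 w i').
Qed.

Lemma Qm_hist i i' : measurable_fun setT ((fun w => Qm w i i') : hist gauss J -> R).
Proof.
apply: (@measurable_fun_cvg _ (hist gauss J) _ _ (fun n w => \sum_(j < n) qt w i j * qt w i' j)).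
  move=> n; apply: measurable_sum => j; apply: measurable_funM;
    by apply: measurable_funM; [exact: measurable_cst|exact: xt_hist].
by move=> w _; rewrite mxE; exact: dot_cvg (qt_l2 w i) (qt_l2 w i').
Qed.
End hist_gram.

Lemma Qm_le w x : 0 <= ip x (Qm w *m x) <= sigma k * ip x (Am w *m x).
Proof.
rewrite !gram_form; [|exact: xt_l2|exact: qt_l2]; rewrite dot_ge0/=.
apply: dot_le => n; apply: (@le_trans _ _ (\sum_(j < n) sigma k * lcomb x (xt w) j ^+ 2)).
  apply: ler_sum => j _; have -> : lcomb x (qt w) j = Num.sqrt (sigma j) * lcomb x (xt w) j.
    by rewrite /lcomb mulr_sumr; apply: eq_bigr => i _; rewrite /qt /xt mulrCA.
  rewrite exprMn sqr_sqrtr ?s0//; have [jk|kj] := ltnP j k.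
    by rewrite lcomb_xtE leqNgt jk expr0n !mulr0.
  by rewrite ler_wpM2r ?sqr_ge0// (sigma_noninc es).
by rewrite -mulr_sumr ler_wpM2l ?s0// sum_sqr_le_dot//; exact: lcomb_l2 (xt_l2 w).
Qed.

(** For each coordinate j the values f i j form a vector F of R^N with |A^-1 F|^2 <= |F|^2 / a^2;
    summing over j gives both sides. *)
Lemma trace_inverse (f : 'I_N -> R^nat) (A : 'M[R]_N) (a b : R) : (forall i, l2 (f i)) -> 0 < a -> 0 < b ->
  A^T = A -> (forall x, a * ip x x <= ip x (A *m x) <= b * ip x x) ->
  \tr (invmx A *m gram f *m invmx A) <= (\sum_i dot (f i) (f i)) / a ^+ 2.
Proof.
move=> lf a0 b0 As Aab.
pose h (l : 'I_N) := lcomb (col l (invmx A)) f.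
have lh l : l2 (h l) by exact: lcomb_l2.
have trE : \tr (invmx A *m gram f *m invmx A) = \sum_l dot (h l) (h l).
  apply: eq_bigr => l _; rewrite -gram_form// -mulmxA mxE; apply: eq_bigr => i _.
  rewrite [col _ _ _ _]mxE; congr (_ * _); first by rewrite -{1}(invmx_sym As) mxE.
  by rewrite [LHS]mxE [RHS]mxE; apply: eq_bigr => j _; congr (_ * _); rewrite [RHS]mxE.
have cl : \sum_l \sum_(j < n) h l j ^+ 2 @[n --> \oo] --> \sum_l dot (h l) (h l).
  apply: cvg_seq_sum => l; have := dot_cvg (lh l) (lh l).
  by under eq_fun do under eq_bigr do rewrite -expr2.
have cr : (\sum_i \sum_(j < n) f i j ^+ 2) / a ^+ 2 @[n --> \oo] --> (\sum_i dot (f i) (f i)) / a ^+ 2.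
  apply: cvgM; last exact: cvg_cst.
  apply: cvg_seq_sum => l; have := dot_cvg (lf l) (lf l).
  by under eq_fun do under eq_bigr do rewrite -expr2.
rewrite trE -(cvg_lim _ cl)// -(cvg_lim _ cr)//; apply: ler_lim.
- by apply/cvg_ex; eexists; exact: cl.
- by apply/cvg_ex; eexists; exact: cr.
apply: nearW => n; rewrite exchange_big/= [X in _ <= X / _]exchange_big/= mulr_suml.
apply: ler_sum => j _; pose F : 'cV[R]_N := \col_i f i j.
have := invmx_norm a0 As Aab F.
have -> : ip F F = \sum_i f i j ^+ 2 by apply: eq_bigr => i _; rewrite mxE expr2.
apply: le_trans; rewrite le_eqVlt; apply/orP; left; apply/eqP; apply: eq_bigr => l _.
rewrite expr2; have -> : h l j = (invmx A *m F) l 0 => //.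
rewrite mxE; apply: eq_bigr => i _; rewrite -{2}(invmx_sym As) !mxE//.
Qed.

Lemma with_prob_ge_all (t : R) (E : set T) : (forall w, E w) -> with_prob_ge P (1 - expR (- t)) E.
Proof.
move=> h; exists setT; split; [exact: measurableT|by move=> w _|].
by rewrite probability_setT lee_fin lerBlDr lerDl expR_ge0.
Qed.

Lemma gn0 w : sxi = 0 -> gn w = 0.
Proof. by move=> sx; apply/matrixP => i j; rewrite !mxE gauss_noise sx invr0 mul0r. Qed.

Lemma lcomb0 (f : 'I_N -> R^nat) : lcomb 0 f = cst 0.
Proof. by apply/funext => j; rewrite /lcomb big1// => i _; rewrite mxE mul0r. Qed.

Lemma noise_event (a b t : R) : 0 < a -> 0 < b -> 0 <= t -> 0 < sigma k ->
  with_prob_ge P (1 - expR (- t)) [set w |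
    (forall x, a * ip x x <= ip x (Am w *m x) <= b * ip x x) ->
    let mu := invmx (Am w) *m gn w in
    dot (lcomb mu (qt w)) (lcomb mu (qt w)) <=
      4 * ((\sum_i dot (qt w i) (qt w i)) / a ^+ 2) + 4 * (sigma k * t / a)].
Proof.
move=> a0 b0 t0 sk; have [sx|sx] := eqVneq sxi 0.
  apply: with_prob_ge_all => w _ /=; rewrite gn0// mulmx0 lcomb0.
  rewrite (@dot_supp _ 0) ?big_ord0// addr_ge0 ?mulr_ge0// ?invr_ge0 ?exprn_ge0 ?(ltW a0)//.
    by apply: sumr_ge0 => i _; exact: dot_ge0.
  exact: ltW.
(* The whole design is the past, and only the noise row is fresh. *)
pose J : set (nat * nat) := [set q | gauss_dom N p sxi q /\ (q.1 < N)%N].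
have Jt q : gauss_dom N p sxi q -> (q.1 < N)%N -> (k <= q.2)%N -> J q by [].
have JD : J `<=` gauss_dom N p sxi by move=> q [].
have zD i : (i < N)%N -> gauss_dom N p sxi (N, i) /\ ~ J (N, i).
  move=> iN; split; last by case=> _ /=; rewrite ltnn.
  by rewrite /gauss_dom/= ltnn eqxx iN.
have zi i j : (i < N)%N -> (j < N)%N -> (N, i) = (N, j) -> i = j by move=> _ _ [].
have := @noise_quadratic _ _ _ P _ gauss (gauss_dom N p sxi) J N (fun i => (N, i)) (gauss_std gm) JD zD zi
  (fun w => Am w) (fun w => Qm w) a (sigma k) a0 sk (Am_hist Jt) (Qm_hist Jt) (fun w => gram_sym _)
  (fun w => gram_sym _) Qm_le t.
apply: with_prob_ge_sub => // w /= h Aab; rewrite -gram_form; last exact: qt_l2.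
apply: le_trans (h _) _; first by move=> x; have /andP[] := Aab x.
rewrite lerD2r ler_wpM2l//; exact: (trace_inverse (qt_l2 w) a0 b0 (gram_sym _) Aab).
Qed.

(* Given the tail of the design and the noise, X_h^T (mu / |mu|) is a Gaussian vector. *)
Lemma head_noise_event (a t : R) (om : R^nat) : 0 < a -> (forall j, 0 <= om j <= 1) ->
  with_prob_ge P (1 - expR (- t)) [set w |
    (forall x, a * ip x x <= ip x (Am w *m x)) ->
    let mu := invmx (Am w) *m gn w in
    \sum_(j < k) om j * tsum mu w j ^+ 2 <= 4 * ip mu mu * (\sum_(j < k) om j + t)].
Proof.
move=> a0 om01.
pose J : set (nat * nat) := [set q | gauss_dom N p sxi q /\ ~ ((q.1 < N)%N /\ (q.2 < k)%N)].
have Jt q : gauss_dom N p sxi q -> (q.1 < N)%N -> (k <= q.2)%N -> J q.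
  by move=> Dq qN kq; split => // -[_]; rewrite ltnNge kq.
have JD : J `<=` gauss_dom N p sxi by move=> q [].
pose mu w := adj_inv (Am w) *m gn w.
have mmu i : measurable_fun setT ((fun w => mu w i 0) : hist gauss J -> R).
  apply: (@measurable_mulmx _ _ (hist gauss J)) => [i1 j1|i1 j1].
    by apply: (@measurable_adj_inv _ _ (hist gauss J)) => i2 j2; exact: Am_hist.
  under eq_fun do rewrite mxE.
  by apply: gauss_hist => Dq; split => //=; rewrite ltnn => -[].
pose nm w := Num.sqrt (ip (mu w) (mu w)).
have mnm : measurable_fun setT (nm : hist gauss J -> R).
  apply: (measurableT_comp (continuous_measurable_fun (@sqrt_continuous R))).
  by apply: measurable_sum => i; apply: measurable_funM; exact: mmu.
(* The direction mu / |mu|, which is 0 when mu = 0 by the convention on the inverse, so that |th| <=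
   1 everywhere. *)
pose th (i : nat) (w : T) : R := if insub i is Some i' then mu w i' 0 / nm w else 0.
have mth i : measurable_fun setT (th i : hist gauss J -> R).
  rewrite /th; case: insub => [i'|]; last exact: measurable_cst.
  apply: measurable_funM; first exact: mmu.
  exact: (measurableT_comp measurable_invr mnm).
have thE (i : 'I_N) w : th i w = mu w i 0 / nm w by rewrite /th valK.
have th1 w : \sum_(i < N) th i w ^+ 2 <= 1.
  rewrite (eq_bigr (fun i : 'I_N => (nm w ^+ 2)^-1 * (mu w i 0 * mu w i 0))) => [|i _].
    rewrite -mulr_sumr sqr_sqrtr ?ip_ge0//; have [->|n0] := eqVneq (ip (mu w) (mu w)) 0.
      by rewrite invr0 mul0r.
    by rewrite mulVf.
  by rewrite thE expr_div_n mulrC expr2.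
have zD i j : (i < N)%N -> (j < k)%N -> gauss_dom N p sxi (i, j) /\ ~ J (i, j).
  by move=> iN jk; split; [rewrite /gauss_dom/= iN; exact: kp|case=> _ []].
have zi i j i' j' : (i < N)%N -> (j < k)%N -> (i' < N)%N -> (j' < k)%N -> (i, j) = (i', j') ->
    i = i' /\ j = j' by move=> _ _ _ _ [].
have := @chaos_features _ _ _ P _ _ _ (gauss_std gm) (fun i j => (i, j)) J N k om th t JD zD zi om01 mth th1.
apply: with_prob_ge_sub => // w /= h Aa.
have Au : Am w \in unitmx by exact: coercive_unit a0 (gram_sym _) Aa.
have muE : invmx (Am w) *m gn w = mu w by rewrite /mu adj_invE.
rewrite muE.
have nm2 : nm w ^+ 2 = ip (mu w) (mu w) by rewrite sqr_sqrtr ?ip_ge0.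
have e j : tsum (mu w) w j = nm w * \sum_(i < N) th i w * gauss ((i : nat), j) w.
  rewrite /tsum mulr_sumr; apply: eq_bigr => i _; rewrite thE.
  have [n0|n0] := eqVneq (nm w) 0; last by rewrite mulrA mulrCA mulfV// mulr1.
  have /ip_eq0 -> : ip (mu w) (mu w) = 0 by rewrite -nm2 n0 expr0n.
  by rewrite mxE !mul0r mulr0.
under eq_bigr do rewrite e exprMn mulrCA nm2; rewrite -mulr_sumr -mulrA mulrCA.
by rewrite ler_wpM2l ?ip_ge0.
Qed.

Definition trt2 : R := dot (high_part k sigma) (high_part k sigma).

Lemma high_sigma_l2 : l2 (high_part k sigma).
Proof.
apply: (@l2_bound _ _ (sigma 0%N * limn (series sigma))) => n.
apply: (@le_trans _ _ (\sum_(j < n) sigma 0%N * sigma j)).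
  apply: ler_sum => j _; rewrite high_partE; case: ifP => _.
    by rewrite expr2 ler_wpM2r ?s0// (sigma_noninc es).
  by rewrite expr0n mulr_ge0 ?s0.
rewrite -mulr_sumr ler_wpM2l ?s0//.
by apply: nneg_sum_le_lim; [exact: s0|exact: (sigma_cvg es cov)].
Qed.

Lemma sum_win_sigma2 m : \sum_(j < win m) sigma (k + j) ^+ 2 <= trt2.
Proof.
apply: le_trans (sum_sqr_le_dot (k + win m) high_sigma_l2).
rewrite [leRHS]big_split_ord/= -[leLHS]add0r lerD//.
  by apply: sumr_ge0 => j _; exact: sqr_ge0.
by apply: ler_sum => j _; rewrite high_partE leq_addr.
Qed.

Lemma sigma_k_le_trt2 : sigma k ^+ 2 <= trt2.
Proof. by have := sqr_le_dot k high_sigma_l2; rewrite high_partE leqnn. Qed.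

Lemma win_design m i j : (i < N)%N -> (j < win m)%N -> gauss_dom N p sxi (i, (k + j)%N).
Proof. by move=> iN /win_dim h; rewrite /gauss_dom/= iN. Qed.

Let win_inj m i j i' j' : (i < N)%N -> (j < win m)%N -> (i' < N)%N -> (j' < win m)%N ->
  (i, (k + j)%N) = (i', (k + j')%N) -> i = i' /\ j = j'.
Proof. by move=> _ _ _ _ [-> /addnI]. Qed.

(** Here [chaos_diag] is used on each window with t = N and c_j = sigma_(k+j)^2. Its deviation 4
    sigma_k^2 N is absorbed because sigma_k^2 <= Tr(Sigma_t^2). *)
Lemma trace_event : 0 < sigma k -> with_prob_ge P (1 - expR (- N%:R))
  [set w | \sum_i dot (qt w i) (qt w i) <= 8 * (N%:R * trt2)].
Proof.
move=> sk.
have Em m : (0 <= m)%N -> with_prob_ge P (1 - expR (- N%:R)) [set w |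
    \sum_(i < N) \sum_(j < win m) sigma (k + j) ^+ 2 * gauss ((i : nat), (k + j)%N) w ^+ 2 <=
    8 * (N%:R * trt2)].
  move=> _; have c01 j : 0 <= sigma (k + j) ^+ 2 <= sigma k ^+ 2.
    by rewrite sqr_ge0/= ler_sqr ?nnegrE ?s0// (sigma_noninc es)// leq_addr.
  have M0 : 0 < sigma k ^+ 2 by rewrite exprn_gt0.
  have := @chaos_diag _ _ _ P _ _ _ (gauss_std gm) (fun i j => (i, (k + j)%N)) N (win m) (fun j => sigma (k + j) ^+ 2) _ N%:R
    (@win_design m) (@win_inj m) M0 c01.
  apply: with_prob_ge_sub => // w /= /le_trans; apply.
  have h1 := sum_win_sigma2 m; have h2 := sigma_k_le_trt2.
  have h3 : N%:R * \sum_(j < win m) sigma (k + j) ^+ 2 <= N%:R * trt2 by rewrite ler_wpM2l.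
  have h4 : sigma k ^+ 2 * N%:R <= N%:R * trt2 by rewrite mulrC ler_wpM2l.
  lra.
apply: with_prob_ge_sub (with_prob_ge_limsup Em) => // w /= h.
have cv : \sum_i \sum_(j < k + win m) qt w i j ^+ 2 @[m --> \oo] --> \sum_i dot (qt w i) (qt w i).
  apply: cvg_seq_sum => i; apply: (@sum_win_cvg R p k (fun j => qt w i j ^+ 2)).
    by move=> j pj; rewrite /qt (eigen_val_out es pj) sqrtr0 mul0r expr0n.
  have := dot_cvg (qt_l2 w i) (qt_l2 w i).
  by under eq_fun do under eq_bigr do rewrite -expr2.
apply: (cvg_io_le cv) => m; have [n mn hn] := h m; exists n => //.
apply: le_trans hn; rewrite le_eqVlt; apply/orP; left; apply/eqP; apply: eq_bigr => i _.
rewrite big_split_ord/= big1 ?add0r => [|j _]; last by rewrite /qt high_partE leqNgt ltn_ord mulr0 expr0n.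
apply: eq_bigr => j _; rewrite /qt high_partE leq_addr xcE mulrA -expr2 sqr_sqrtr ?s0//.
by rewrite exprMn.
Qed.

Definition bias : R^nat := fun j => Num.sqrt (sigma j) * high_part k (ucoord u beta) j.

Lemma bias_l2 : l2 bias.
Proof.
have lb := high_part_l2 k (coord_l2 es (Rp_l2 (model_beta gm))).
apply: (l2_le (M := Num.sqrt (sigma 0%N)) lb) => j.
by rewrite normrM ler_wpM2r// (sqrt_sigma_le es).
Qed.

(** On each window [chaos_rows] applies with t = N: the pairings of the rows with the tail of beta
    have variance at most |Sigma_t^(1/2) beta_t|^2. *)
Lemma bias_event : with_prob_ge P (1 - expR (- N%:R))
  [set w | \sum_i dot (xt w i) (ucoord u beta) ^+ 2 <= 8 * N%:R * dot bias bias].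
Proof.
have lbc := coord_l2 es (Rp_l2 (model_beta gm)).
pose v j := bias (k + j).
have vs m : \sum_(j < win m) v j ^+ 2 <= dot bias bias.
  apply: le_trans (sum_sqr_le_dot (k + win m) bias_l2).
  rewrite [leRHS]big_split_ord/= -[leLHS]add0r lerD//.
  by apply: sumr_ge0 => j _; exact: sqr_ge0.
have Em m : (0 <= m)%N -> with_prob_ge P (1 - expR (- N%:R)) [set w |
    \sum_(i < N) (\sum_(j < win m) v j * gauss ((i : nat), (k + j)%N) w) ^+ 2 <=
    8 * N%:R * dot bias bias].
  move=> _; have := @chaos_rows _ _ _ P _ _ _ (gauss_std gm) (fun i j => (i, (k + j)%N)) N (win m) v _ N%:R (ler0n _ N)
    (@win_design m) (@win_inj m) (vs m).
  apply: with_prob_ge_sub => // w /= /le_trans; apply.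
  by rewrite le_eqVlt; apply/orP; left; apply/eqP; ring.
apply: with_prob_ge_sub (with_prob_ge_limsup Em) => // w /= h.
have cv : \sum_i (\sum_(j < k + win m) xt w i j * ucoord u beta j) ^+ 2 @[m --> \oo] -->
    \sum_i dot (xt w i) (ucoord u beta) ^+ 2.
  apply: cvg_seq_sum => i; apply: (cvg_comp _ (fun x : R => x ^+ 2)); last exact: exprn_continuous.
  apply: (@sum_win_cvg R p k (fun j => xt w i j * ucoord u beta j)).
    by move=> j pj; rewrite (coord_out es)// mulr0.
  exact: dot_cvg (xt_l2 w i) lbc.
apply: (cvg_io_le cv) => m; have [n mn hn] := h m; exists n => //.
apply: le_trans hn; rewrite le_eqVlt; apply/orP; left; apply/eqP; apply: eq_bigr => i _.
rewrite big_split_ord/= big1 ?add0r => [|j _]; last by rewrite /xt high_partE leqNgt ltn_ord mul0r.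
congr (_ ^+ 2); apply: eq_bigr => j _; rewrite /v /bias /xt !high_partE leq_addr xcE.
by rewrite mulrAC.
Qed.

Lemma noise_size_event : with_prob_ge P (1 - expR (- N%:R)) [set w | ip (gn w) (gn w) <= 8 * N%:R].
Proof.
have [sx|sx] := eqVneq sxi 0.
  apply: with_prob_ge_all => w /=; rewrite gn0// /ip big1 ?mulr_ge0// => i _.
  by rewrite mxE mul0r.
have zD i j : (i < N)%N -> (j < 1)%N -> gauss_dom N p sxi (N, i).
  by move=> iN _; rewrite /gauss_dom/= ltnn eqxx iN.
have zi i j i' j' : (i < N)%N -> (j < 1)%N -> (i' < N)%N -> (j' < 1)%N -> (N, i) = (N, i') ->
    i = i' /\ j = j' by move=> _; case: j => // _ _; case: j' => // _ [].
have c01 : forall j : nat, 0 <= cst (1 : R) j <= 1 by move=> j; rewrite ler01 lexx.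
have := @chaos_diag _ _ _ P _ _ _ (gauss_std gm) (fun i _ => (N, i)) N 1 (cst 1) 1 N%:R zD zi ltr01 c01.
apply: with_prob_ge_sub => // w /=; rewrite big_ord1 => h.
apply: le_trans (_ : _ <= 4 * (N%:R * 1) + 4 * 1 * N%:R) _; last by lra.
apply: le_trans h; rewrite le_eqVlt; apply/orP; left; apply/eqP; apply: eq_bigr => i _.
by rewrite big_ord1 mul1r mxE expr2.
Qed.

End events.

Ltac nneg := repeat first [done | exact: sqrtr_ge0 | exact: sqr_ge0 | apply: addr_ge0 |
  apply: mulr_ge0 | rewrite invr_ge0 | apply: exprn_ge0 | by apply: ltW].

Lemma lcombZ {R : realType} (N : nat) (s : R) (t : 'cV[R]_N) (f : 'I_N -> R^nat) :
  lcomb (s *: t) f = s \*o lcomb t f.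
Proof.
by apply/funext => j; rewrite /lcomb /= mulr_sumr; apply: eq_bigr => i _; rewrite mxE mulrA.
Qed.

Lemma sqrtD_le {R : realType} (x y : R) : 0 <= x -> 0 <= y ->
  Num.sqrt (x + y) <= Num.sqrt x + Num.sqrt y.
Proof.
move=> x0 y0; rewrite -(@ler_sqr R) ?nnegrE ?addr_ge0 ?sqrtr_ge0//.
rewrite sqr_sqrtr ?addr_ge0// sqrrD !sqr_sqrtr// lerD2r lerDl.
by rewrite mulrn_wge0// mulr_ge0 ?sqrtr_ge0.
Qed.

Lemma sqrt_leP {R : realType} (x y : R) : 0 <= y -> x <= y ^+ 2 -> Num.sqrt x <= y.
Proof. by move=> y0 /ler_wsqrtr/le_trans; apply; rewrite sqrtr_sqr ger0_norm. Qed.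

(* The three terms of [risk_bound] once the parameters of the events are plugged in. *)
Lemma risk_arith {R : realType} (n e tt sk kap i rho te B s tro t tt2 C1 thr r q a m4 W : R) :
  0 < n -> 0 < e -> 0 < kap <= 1 -> 0 <= i -> e <= tt -> tt <= i * e -> 0 <= sk -> sk * n <= kap * e ->
  0 <= rho -> 0 <= te -> 0 <= B -> 0 <= s -> 0 <= tro -> 0 <= t -> 0 <= tt2 ->
  C1 = 3 / 2 * (1 + 2 * (i / kap)) ->
  thr = kap * e / n -> r = 2 / n * (3 * tt) + 2 * thr ->
  q = rho * (3 / 2 * (n + 2 * tt / thr)) -> a = e / 4 -> m4 = 8 * n * te ^+ 2 ->
  W = B + Num.sqrt (q * m4) / a + Num.sqrt (s ^+ 2 * (4 * (8 * n / a ^+ 2) * (tro + t))) ->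
  r * W + (Num.sqrt (sk * m4 / a) + Num.sqrt (s ^+ 2 * (4 * (8 * (n * tt2) / a ^+ 2) + 4 * (sk * t / a)))
    + W * Num.sqrt (sk * r)) + te <=
  11 * (tt / n) * B + 44 * i * Num.sqrt (8 * C1) * (Num.sqrt rho * te) +
    (300 * i + 4) * (s * Num.sqrt ((tro + t) / n)) +
    (23 * i) * (s * (Num.sqrt (n * tt2) / tt)) + 7 * te.
Proof.
move=> n0 e0 /andP[k0 k1] i0 ett tie sk0 skn rho0 te0 B0 s0 tro0 t0 tt20 C1E thrE rE qE aE m4E WE.
have tt0 : 0 < tt := lt_le_trans e0 ett.
have a0 : 0 < a by rewrite aE divr_gt0.
have tn0 : 0 <= tt / n by nneg.
have C10 : 0 <= C1.
  by rewrite C1E; nneg.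
have thr0 : 0 < thr by rewrite thrE divr_gt0// mulr_gt0.
have ken : kap * e / n <= tt / n.
  rewrite ler_pM2r ?invr_gt0//; apply: le_trans ett; rewrite ler_piMl// ltW//.
have r0 : 0 <= r by rewrite rE; nneg.
have rle : r <= 8 * (tt / n).
  have -> : r = 6 * (tt / n) + 2 * thr by rewrite rE; field; rewrite gt_eqF.
  by rewrite thrE; lra.
(* The inequality sk n <= kap e is the Dvoretzky-Milman hypothesis: sigma_k lies below the
   threshold, itself at most tt / n. *)
have skle : sk <= tt / n.
  by apply: le_trans ken; rewrite ler_pdivlMr.
have sr : Num.sqrt (sk * r) <= 3 * (tt / n).
  apply: sqrt_leP; first by nneg.
  apply: le_trans (_ : _ <= (tt / n) * (8 * (tt / n))) _.
    by apply: ler_pM.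
  by have := sqr_ge0 (tt / n); lra.
have W0 : 0 <= W by rewrite WE; nneg.
(* The factor 11 is 8 for the head error plus 3 for the tail error that it creates. *)
have rW : r * W + W * Num.sqrt (sk * r) <= 11 * (tt / n) * W.
  by rewrite [W * _]mulrC -mulrDl ler_wpM2r//; lra.
have qle : Num.sqrt (q * m4) / a <= (4 * Num.sqrt (8 * C1) * (Num.sqrt rho * te)) * (n / e).
  have -> : 4 * Num.sqrt (8 * C1) * (Num.sqrt rho * te) * (n / e) =
      (Num.sqrt (8 * C1) * (Num.sqrt rho * te) * n) / a by rewrite aE; field; rewrite gt_eqF.
  rewrite ler_pM2r ?invr_gt0//; apply: sqrt_leP; first by nneg.
  rewrite !exprMn !sqr_sqrtr ?mulr_ge0//.
  have : 2 * tt / thr <= 2 * (i / kap) * n.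
    rewrite thrE; have -> : 2 * tt / (kap * e / n) = 2 * (tt / e) / kap * n.
      by field; rewrite !gt_eqF.
    have h : tt / e <= i by rewrite ler_pdivrMr.
    by rewrite ler_pM2r// [leRHS]mulrA ler_pM2r ?invr_gt0// ler_pM2l.
  move=> h; rewrite qE m4E.
  have -> : 8 * C1 * (rho * te ^+ 2) * n ^+ 2 = rho * (3 / 2 * (n + 2 * (i / kap) * n)) * (8 * n * te ^+ 2).
    by rewrite C1E; ring.
  rewrite ler_wpM2r ?mulr_ge0 ?sqr_ge0 ?(ltW n0)//.
  by rewrite ler_wpM2l// ler_wpM2l// lerD2l.
(* As a = e / 4, the constants multiply to 4 * 8 * 16 = 512 <= 23^2. *)
have m2le : Num.sqrt (s ^+ 2 * (4 * (8 * n / a ^+ 2) * (tro + t))) <=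
    23 * (s * Num.sqrt ((tro + t) / n)) * (n / e).
  apply: sqrt_leP; first by nneg.
  rewrite !exprMn sqr_sqrtr ?divr_ge0 ?addr_ge0 ?(ltW n0)//.
  have -> : s ^+ 2 * (4 * (8 * n / a ^+ 2) * (tro + t)) = 512 * (s ^+ 2 * (tro + t) * n / e ^+ 2).
    by rewrite aE; field; rewrite gt_eqF.
  have -> : 23 ^+ 2 * (s ^+ 2 * ((tro + t) / n)) * (n ^+ 2 * e^-1 ^+ 2) =
     529 * (s ^+ 2 * (tro + t) * n / e ^+ 2) by field; rewrite !gt_eqF.
  rewrite ler_wpM2r; [by []| |by rewrite ler_nat].
  by nneg.
have tte : tt / n * (n / e) <= i.
  (* The powers of n cancel, and tt / e <= i is the comparison of Tr(Sigma_t) with ell^2. *)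
  by rewrite mulrA divfK ?gt_eqF// ler_pdivrMr.
have tW : 11 * (tt / n) * W <= 11 * (tt / n) * B + 44 * i * Num.sqrt (8 * C1) * (Num.sqrt rho * te) +
    253 * i * (s * Num.sqrt ((tro + t) / n)).
  set A2 := Num.sqrt (8 * C1) * (Num.sqrt rho * te).
  set A3 := s * Num.sqrt ((tro + t) / n).
  have A20 : 0 <= A2 by nneg.
  have A30 : 0 <= A3 by nneg.
  have -> : 44 * i * Num.sqrt (8 * C1) * (Num.sqrt rho * te) = 44 * (i * A2) by rewrite /A2; ring.
  rewrite WE.
  have h2 : 11 * (tt / n) * (Num.sqrt (q * m4) / a) <= 44 * (i * A2).
    apply: le_trans (_ : 11 * (tt / n) * (4 * A2 * (n / e)) <= _).
      by rewrite [4 * A2](_ : _ = 4 * Num.sqrt (8 * C1) * (Num.sqrt rho * te)); [apply: ler_wpM2l; [nneg|exact: qle]|rewrite /A2; ring].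
    have -> : 11 * (tt / n) * (4 * A2 * (n / e)) = 44 * ((tt / n * (n / e)) * A2) by ring.
    by rewrite ler_wpM2l// ler_wpM2r.
  have h3 : 11 * (tt / n) * Num.sqrt (s ^+ 2 * (4 * (8 * n / a ^+ 2) * (tro + t))) <= 253 * i * A3.
    apply: le_trans (_ : 11 * (tt / n) * (23 * A3 * (n / e)) <= _).
      by apply: ler_wpM2l; [nneg|exact: m2le].
    have -> : 11 * (tt / n) * (23 * A3 * (n / e)) = 253 * ((tt / n * (n / e)) * A3) by ring.
    by rewrite -[253 * i * A3]mulrA ler_wpM2l// ler_wpM2r.
  lra.
have m4le : Num.sqrt (sk * m4 / a) <= 6 * te.
  apply: sqrt_leP; first by nneg.
  have -> : sk * m4 / a = 32 * (te ^+ 2 * (sk * n / e)) by rewrite m4E aE; field; rewrite gt_eqF.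
  have h : sk * n / e <= 1.
    by rewrite ler_pdivrMr// mul1r; apply: le_trans skn _; rewrite ler_piMl// ltW.
  have : te ^+ 2 * (sk * n / e) <= te ^+ 2 * 1 by rewrite ler_wpM2l ?sqr_ge0.
  by rewrite exprMn; have := sqr_ge0 te; lra.
have m3le : Num.sqrt (s ^+ 2 * (4 * (8 * (n * tt2) / a ^+ 2) + 4 * (sk * t / a))) <=
    23 * i * (s * (Num.sqrt (n * tt2) / tt)) + 4 * (s * Num.sqrt ((tro + t) / n)).
  have p1 : 0 <= 4 * (8 * (n * tt2) / a ^+ 2).
    by nneg.
  have p2 : 0 <= 4 * (sk * t / a) by nneg.
  rewrite mulrDr; apply: le_trans (sqrtD_le _ _) _; [by nneg|by nneg|].
  apply: lerD.
    apply: (@le_trans _ _ (23 * (s * (Num.sqrt (n * tt2) / e)))).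
      apply: sqrt_leP; first by nneg.
      rewrite !exprMn sqr_sqrtr ?mulr_ge0 ?(ltW n0)//.
      have -> : s ^+ 2 * (4 * (8 * (n * tt2) / a ^+ 2)) = 512 * (s ^+ 2 * (n * tt2 * e^-1 ^+ 2)).
        by rewrite aE; field; rewrite gt_eqF.
      have -> : 23 ^+ 2 = 529 :> R by ring.
      by rewrite ler_wpM2r ?ler_nat//; nneg.
    have -> : 23 * i * (s * (Num.sqrt (n * tt2) / tt)) = 23 * (s * (Num.sqrt (n * tt2) * (i / tt))) by ring.
    rewrite ler_wpM2l// ler_wpM2l// ler_wpM2l ?sqrtr_ge0//.
    by rewrite ler_pdivlMr// mulrC ler_pdivrMr.
  apply: sqrt_leP; first by nneg.
  rewrite !exprMn sqr_sqrtr ?divr_ge0 ?addr_ge0 ?(ltW n0)//.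
  have -> : s ^+ 2 * (4 * (sk * t / a)) = 16 * (s ^+ 2 * (t * (sk / e))).
    by rewrite aE; field; rewrite gt_eqF.
  have -> : 4 ^+ 2 = 16 :> R by ring.
  rewrite ler_wpM2l// ler_wpM2l ?sqr_ge0//.
  have h : sk / e <= n^-1.
    rewrite ler_pdivrMr// ler_pdivlMl// mulrC.
    by apply: le_trans skn _; rewrite ler_piMl// ltW.
  apply: ler_pM => //; first by nneg.
  by rewrite lerDr.
have : 0 <= i * (s * Num.sqrt ((tro + t) / n)) by nneg.
lra.
Qed.

(** * The risk bound on the intersection of the events *)

Section assembly.
Context {R : realType} (N : nat) (p : xdim) (Sigma : R^nat -> R^nat) (sigma : R^nat)
  (u : nat -> R^nat) (beta : R^nat) (sxi : R) d (T : measurableType d) (P : probability T R)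
  (X : 'I_N -> T -> R^nat) (xi betahat : T -> R^nat).
Hypothesis gm : gaussian_linear_model p Sigma sigma u beta sxi P X xi betahat.
Context d0 (T0 : measurableType d0) (P0 : probability T0 R) (g zeta : T0 -> R^nat) (Om : set T0).
Hypotheses (mOm : measurable Om) (POm : P0 Om = 1%E).
Hypothesis sz : std_gaussian_vec P0 p zeta.
Hypothesis hz : forall w, Om w -> is_limit sigma u g w (fun j => Num.sqrt (sigma j) * zeta w j).
Variable k : nat.
Hypothesis kp : forall j, (j < k)%N -> in_dim p j.
Hypothesis N0 : (0 < N)%N.
Local Notation es := (model_eigen gm).
Local Notation cov := (model_cov gm).
Local Notation ell := (ell p sigma u P0 g k).
Local Notation trt := (trt sigma k).
Local Notation s0 := (sigma_ge0 es).
Local Notation xc := (xc u X).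
Local Notation xt := (xt u X k).
Local Notation qt := (qt sigma u X k).
Local Notation gn := (gn sigma u sxi X xi).
Local Notation tsum := (tsum sigma u sxi X xi).
Local Notation bias := (bias sigma u beta k).
Local Notation trt2 := (trt2 sigma k).
Local Notation uc := (ucoord u).

Lemma ucoord_lcomb (t : 'cV[R]_N) w : uc (lcomb t (fun i => X i w)) = lcomb t (xc w).
Proof.
apply/funext => j; rewrite /ucoord dotC dot_lcomb//; last exact: (l2_u es).
  by apply: eq_bigr => i _; rewrite dotC.
by move=> i; exact: Rp_l2 (X_Rp gm i w).
Qed.

Lemma lcomb_Rp (t : 'cV[R]_N) w : Rp p (lcomb t (fun i => X i w)).
Proof.
apply: RpI; last by apply: lcomb_l2 => i; exact: Rp_l2 (X_Rp gm i w).
move=> j pj; rewrite /lcomb big1// => i _.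
by have [h _] := X_Rp gm i w; rewrite h// mulr0.
Qed.

(** The almost sure facts, transported to the eigenbasis by Parseval. Minimality is kept only
    against interpolants in the span of the rows, the form that [interpolant_span] takes. *)
Lemma estimator_event : with_prob_ge P (1 - 0) [set w |
  [/\ l2 (uc (betahat w)), Rp p (betahat w),
     forall i, dot (xc w i) (uc (betahat w)) = dot (xc w i) (uc beta) + (sxi *: gn w) i 0 &
     forall t, (forall i, dot (xc w i) (lcomb t (xc w)) = dot (xc w i) (uc beta) + (sxi *: gn w) i 0) ->
       norm2 (uc (betahat w)) <= norm2 (lcomb t (xc w))]].
Proof.
have [G [mG PG hG]] := noise_conull gm.
have [Z [mZ PZ hZ]] := model_estimator gm.
exists (G `&` ~` Z); split.
- by apply: measurableI => //; exact: measurableC.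
- move=> w [Gw nZ]; have mi : min_norm_interpolant p (fun i => X i w)
      (response (fun i => X i w) beta (xi w)) (betahat w) by apply: contrapT => h; apply: nZ; exact: hZ.
  have [pb hi hm] := mi; have lb := Rp_l2 pb; have pbe := model_beta gm.
  have ni (i : 'I_N) : xi w i = (sxi *: gn w) i 0 by rewrite hG// !mxE.
  split => [||i|t ht] //.
  + exact: (coord_l2 es lb).
  + by rewrite !(parseval es (X_Rp gm i w))// hi /response -ni.
  + rewrite -(norm2_coord es pb) -ucoord_lcomb -(norm2_coord es (lcomb_Rp t w)).
    apply: hm => [|i]; first exact: lcomb_Rp.
    rewrite -(parseval es (X_Rp gm i w) (lcomb_Rp t w)) ucoord_lcomb ht.
    by rewrite (parseval es (X_Rp gm i w) pbe) -ni.
- rewrite subr0; have h : (P (G `&` ~` Z) = 1 - P (~` G `|` Z))%E.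
    rewrite -[in RHS](setCK Z) -setCI -probability_setC ?setCK//.
    by apply: measurableC; apply: measurableI => //; exact: measurableC.
  rewrite h (_ : P (~` G `|` Z) = 0%E) ?sube0//.
  apply/eqP; rewrite eq_le measure_ge0 andbT; apply: le_trans (measureU2 _ _ _) _ => //.
    exact: measurableC.
  change (P (~` G) + P Z <= 0)%E.
  have -> : P Z = 0%E by exact: PZ.
  by rewrite adde0 probability_setC// PG subee.
Qed.

Variables (kR kD cR cD c1 : R).
Hypotheses (RIP : RIP_body kR cR) (DM : DM_weighted kD cD).
Hypotheses (kD01 : 0 < kD <= 1) (c10 : 0 < c1) (c11 : c1 <= 1) (c1R : c1 <= cR) (c1D : c1 <= cD).
Hypothesis NL : N%:R <= kD * (ell ^+ 2 / sigma k).
Hypothesis RNl : R_N P0 g kR N p (spec_op u (low_part k (sqrt_seq sigma)) @` ball2 p 1)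
    <= ell * Num.sqrt (kD / N%:R).

Let NR0 : 0 < N%:R :> R. Proof. by rewrite ltr0n. Qed.
Let kD0 : 0 < kD. Proof. by case/andP: kD01. Qed.
Let ell0 : 0 <= ell. Proof. exact: (ell_ge0 es cov mOm POm sz hz k). Qed.

(** If sigma_k were 0, its inverse would be 0 by convention and [NL] would read N <= 0. Hence the
    tail is not empty. *)
Lemma sigma_k_gt0 : 0 < sigma k.
Proof.
rewrite lt_neqAle s0 andbT eq_sym; apply/eqP => h.
by move: NL; rewrite h invr0 !mulr0 leNgt NR0.
Qed.

Lemma ell_gt0 : 0 < ell.
Proof.
rewrite lt_neqAle ell0 andbT eq_sym; apply/eqP => h.
by move: NL; rewrite h expr0n mul0r mulr0 leNgt NR0.
Qed.

Definition thr : R := kD * ell ^+ 2 / N%:R.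

Lemma sigma_k_le : sigma k * N%:R <= kD * ell ^+ 2.
Proof. by move: NL; rewrite mulrA ler_pdivlMr ?sigma_k_gt0// mulrC. Qed.

Lemma thr_gt0 : 0 < thr.
Proof. by rewrite divr_gt0// mulr_gt0// exprn_gt0// ell_gt0. Qed.

Lemma ell_sqr_le : ell ^+ 2 <= trt.
Proof.
have t0 := trt_ge0 es cov k; rewrite -[leRHS]sqr_sqrtr// ler_sqr ?nnegrE ?sqrtr_ge0//.
exact: (ell_le es cov mOm POm sz hz k).
Qed.

Lemma ell_sqr_ge : trt <= ((@absmean R) ^+ 2)^-1 * ell ^+ 2.
Proof.
have t0 := trt_ge0 es cov k; have m0 := @absmean_gt0 R.
rewrite ler_pdivlMl ?exprn_gt0// -[in leLHS](sqr_sqrtr t0) -exprMn.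
rewrite ler_sqr ?nnegrE ?mulr_ge0 ?sqrtr_ge0 ?(ltW m0)//.
exact: (ell_ge es cov mOm POm sz hz k).
Qed.

(** The ratio sigma_j / D_j, which is the squared scale of coordinate j in D^(-1/2) X_h^T. The sum
    over j < k is the effective dimension |J_1| + sum_(J_2) sigma_j / thr of the head. *)
Definition weight (j : nat) : R := sigma j / Num.max (sigma j) thr.

Let D0 j : 0 < Num.max (sigma j) thr. Proof. by rewrite lt_max thr_gt0 orbT. Qed.

Lemma weight01 j : 0 <= weight j <= 1.
Proof.
rewrite /weight divr_ge0 ?s0 ?(ltW (D0 j))//= ler_pdivrMr// mul1r.
by rewrite le_max lexx.
Qed.

Lemma lcomb_weight (t : 'cV[R]_N) w (j : nat) :
  (Num.max (sigma j) thr)^-1 * lcomb t (xc w) j ^+ 2 = weight j * tsum t w j ^+ 2.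
Proof. by rewrite (lcomb_xcE gm) exprMn sqr_sqrtr ?s0// /weight mulrA (mulrC _^-1). Qed.

Lemma rate_le (c t : R) (E : set T) : c1 <= c -> t <= N%:R ->
  with_prob_ge P (1 - expR (- (c * N%:R))) E -> with_prob_ge P (1 - expR (- (c1 * t))) E.
Proof.
move=> cc tN; apply: with_prob_ge_sub => //; rewrite lerD2l lerN2 ler_expR lerN2.
apply: le_trans (_ : _ <= c1 * N%:R) _; first by rewrite ler_pM2l.
by rewrite ler_pM2r.
Qed.

(** The weights are factored as rho * gam because [head_op_event] asks for gam <= 1 with sum at most
    N. The factor rho then scales the squared norm of D^(-1/2) X_h^T and ends as sqrt(rho) in front
    of the bias of the tail. *)
Lemma risk_event (rho t : R) (gam : R^nat) : 0 < rho -> 0 <= t <= N%:R ->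
  (forall j, (j < k)%N -> 0 < gam j <= 1) -> \sum_(j < k) gam j <= N%:R ->
  (forall j, (j < k)%N -> weight j = rho * gam j) ->
  let i := ((@absmean R) ^+ 2)^-1 in
  let C := 3 / 2 * (1 + 2 * (i / kD)) in
  with_prob_ge P (1 - 8 * expR (- (c1 * t))) [set w |
    norm2 (spec_op u (sqrt_seq sigma) (betahat w \- beta)) <=
    11 * (trt / N%:R) * Num.sqrt (\sum_(j < k) (Num.max (sigma j) thr)^-1 * uc beta j ^+ 2) +
    44 * i * Num.sqrt (8 * C) * (Num.sqrt rho * norm2 bias) +
    (300 * i + 4) * (sxi * Num.sqrt ((\sum_(j < k) weight j + t) / N%:R)) +
    23 * i * (sxi * (Num.sqrt (N%:R * trt2) / trt)) + 7 * norm2 bias].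
Proof.
move=> rho0 /andP[t0 tN] gam01 gamN wE /=.
set e1 := expR (- (c1 * t)).
have sk := sigma_k_gt0; have th0 := thr_gt0.
have e0 : 0 < ell ^+ 2 by rewrite exprn_gt0// ell_gt0.
have tt0 : 0 < trt := lt_le_trans e0 ell_sqr_le.
have skt : sigma k <= thr by rewrite ler_pdivlMr// sigma_k_le.
have a0 : 0 < ell ^+ 2 / 4 by rewrite divr_gt0.
have bA0 : 0 < 3 * trt by rewrite mulr_gt0.
have E0 := estimator_event.
have E1 := rate_le c1D tN (tail_event gm mOm POm sz hz N0 DM sk NL kD0).
have sk2 : 0 < sigma k <= thr by rewrite sk skt.
have E2 := rate_le c1D tN (head_op_event gm mOm POm sz hz kp N0 DM kD0 sk2 (erefl _) gam01 gamN).
(* The bound ell sqrt(kD / N) in the hypothesis on R_N is sqrt(thr). *)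
have RNt : R_N P0 g kR N p (spec_op u (low_part k (sqrt_seq sigma)) @` ball2 p 1) <= Num.sqrt thr.
  apply: le_trans RNl _; 
  have -> : thr = (ell * Num.sqrt (kD / N%:R)) ^+ 2.
    by rewrite exprMn sqr_sqrtr ?divr_ge0 ?(ltW kD0)// /thr mulrAC mulrC.
  by rewrite sqrtr_sqr ler_norm.
have E3 := rate_le c1R tN (rip_event gm mOm POm sz hz kp N0 RIP (ltW th0) RNt).
have t1 (E : set T) : with_prob_ge P (1 - expR (- t)) E -> with_prob_ge P (1 - e1) E.
  apply: with_prob_ge_sub => //; rewrite lerD2l lerN2 ler_expR lerN2.
  by rewrite -[leRHS]mul1r ler_wpM2r.
have N1 (E : set T) : with_prob_ge P (1 - expR (- N%:R)) E -> with_prob_ge P (1 - e1) E.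
  by move=> h; apply: (rate_le c11 tN); rewrite mul1r.
have E4 := t1 _ (noise_event gm (k := k) a0 bA0 t0 sk).
have E5 := t1 _ (head_noise_event gm kp t a0 weight01).
have E6 := N1 _ (trace_event gm sk).
have E7 := N1 _ (bias_event gm k).
have E8 := N1 _ (noise_size_event gm).
(* Eight events fail with probability at most exp(- c1 t) each; the one on the estimator is almost
   sure. *)
have := with_prob_ge_setI E0 (with_prob_ge_setI E1 (with_prob_ge_setI E2 (with_prob_ge_setI E3
  (with_prob_ge_setI E4 (with_prob_ge_setI E5 (with_prob_ge_setI E6 (with_prob_ge_setI E7 E8))))))).
apply: with_prob_ge_sub; first by rewrite -/e1; lra.
move=> w /= [[lbh pbh hint hmin] [h1 [h2 [h3 [h4 [h5 [h6 [h7 h8]]]]]]]].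
have HA (x : 'cV[R]_N) : ell ^+ 2 / 4 * ip x x <= ip x (gram (xt w) *m x) <= 3 * trt * ip x x.
  by rewrite gram_form; [exact: h1|exact: (xt_l2 gm k)].
set mu := invmx (gram (xt w)) *m gn w in h4 h5.
have muE : invmx (gram (xt w)) *m (sxi *: gn w) = sxi *: mu by rewrite -scalemxAr.
have {}h4 := h4 HA.
have {}h5 : \sum_(j < k) weight j * tsum mu w j ^+ 2 <= 4 * ip mu mu * (\sum_(j < k) weight j + t).
  by apply: h5 => x; have /andP[] := HA x.
have w0 : 0 <= \sum_(j < k) weight j by apply: sumr_ge0 => j _; have /andP[] := weight01 j.
have mu2 : ip mu mu <= 8 * N%:R / (ell ^+ 2 / 4) ^+ 2.
  apply: le_trans (invmx_norm a0 (gram_sym _) HA (gn w)) _.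
  by rewrite ler_wpM2r ?invr_ge0 ?exprn_ge0 ?(ltW a0).
have lb := coord_l2 es (Rp_l2 (model_beta gm)).
have nb2 : norm2 bias ^+ 2 = dot bias bias by exact: norm2_sqr.
have -> : norm2 (spec_op u (sqrt_seq sigma) (betahat w \- beta)) =
    norm2 (fun j => Num.sqrt (sigma j) * (uc (betahat w) j - uc beta j)).
  have pB : Rp p (betahat w \- beta).
    rewrite (_ : _ \- _ = betahat w \+ ((-1) \*o beta)); last first.
      by apply/funext => j; rewrite /= mulN1r.
    by apply: RpD => //; apply: RpZ; exact: (model_beta gm).
  rewrite (norm2_coord es (spec_op_Rp es (sqrt_sigma_le es) pB)).
  rewrite (coord_spec_op es (sqrt_sigma_le es) pB) (coordB es (Rp_l2 pbh) (Rp_l2 (model_beta gm))).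
  by [].
apply: le_trans (@risk_bound _ N k sigma (fun j => Num.max (sigma j) thr) (uc beta) (uc (betahat w)) (xc w)
  (sxi *: gn w) (ell ^+ 2 / 4) (3 * trt) (2 / N%:R) (2 * thr) (rho * (3 / 2 * (N%:R + 2 * trt / thr)))
  (sxi ^+ 2 * (4 * (8 * N%:R / (ell ^+ 2 / 4) ^+ 2) * (\sum_(j < k) weight j + t)))
  (sxi ^+ 2 * (4 * (8 * (N%:R * trt2) / (ell ^+ 2 / 4) ^+ 2) + 4 * (sigma k * t / (ell ^+ 2 / 4))))
  (8 * N%:R * norm2 bias ^+ 2) (sigma k)
  a0 bA0 _ _ _ (ltW sk) s0 _ _ _ (fun i => xc_l2 gm w i) lb lbh hint hmin h1 h3 _ _ _ _) _.
- by rewrite divr_ge0.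
- by rewrite mulr_ge0// ltW.
- have h : 0 <= 2 * trt / thr by rewrite divr_ge0 ?mulr_ge0 ?(ltW tt0)// ltW.
  by apply: mulr_ge0; [exact: ltW|apply: mulr_ge0; [by []|apply: addr_ge0]].
- by move=> j kj; exact: (sigma_noninc es).
- by move=> j _; exact: D0.
- by move=> j _; rewrite le_max lexx.
- move=> x; under eq_bigr do rewrite lcomb_weight.
  apply: le_trans (_ : rho * \sum_(j < k) gam j * tsum x w j ^+ 2 <= _).
    by rewrite mulr_sumr; apply: ler_sum => j _; rewrite wE// mulrA.
  by rewrite -mulrA ler_pM2l//; exact: h2.
- rewrite muE; under eq_bigr do rewrite lcomb_weight.
  have -> : \sum_(j < k) weight j * tsum (sxi *: mu) w j ^+ 2 =
      sxi ^+ 2 * \sum_(j < k) weight j * tsum mu w j ^+ 2.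
    rewrite mulr_sumr; apply: eq_bigr => j _; rewrite [RHS]mulrCA -exprMn; congr (_ * _ ^+ 2).
    by rewrite /tsum mulr_sumr; apply: eq_bigr => i _; rewrite mxE mulrA.
  rewrite ler_wpM2l ?sqr_ge0//; apply: le_trans h5 _.
  by rewrite ler_wpM2r ?addr_ge0// ler_wpM2l.
- rewrite muE lcombZ; have lq := lcomb_l2 mu (qt_l2 gm k w).
  rewrite dotZl//; last exact: l2Z.
  rewrite dotC dotZl// mulrA -expr2 ler_wpM2l ?sqr_ge0//; apply: le_trans h4 _.
  rewrite lerD2r ler_wpM2l// ler_wpM2r ?invr_ge0 ?exprn_ge0 ?(ltW a0)//.
- by rewrite nb2.
apply: (@risk_arith _ N%:R (ell ^+ 2) trt (sigma k) kD ((@absmean R) ^+ 2)^-1 rho (norm2 bias) _ sxi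
  (\sum_(j < k) weight j) t trt2 _ thr _ _ _ _ _ NR0 e0 kD01 _ ell_sqr_le ell_sqr_ge (ltW sk) sigma_k_le (ltW rho0)
  (norm2_ge0 _) (sqrtr_ge0 _) (model_noise_level gm) w0 t0 (dot_ge0 _) (erefl _) (erefl _) (erefl _)
  (erefl _) (erefl _) (erefl _)).
  by rewrite invr_ge0 exprn_ge0// ltW// absmean_gt0.
by [].
Qed.

End assembly.

(** * The theorem *)

Section traces.
Context {R : realType} (p : xdim) (Sigma : R^nat -> R^nat) (sigma : R^nat) (u : nat -> R^nat).
Hypothesis es : eigen_system p Sigma sigma u.
Hypothesis cov : covariance_op p Sigma.
Variable k : nat.
Local Notation uc := (ucoord u).
Local Notation s0 := (sigma_ge0 es).

(** The trace is defined in the canonical basis, the a_j live in the eigenbasis. Each inequality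
    comes from the double sum of a_j u_j(i)^2, where only finite sums are exchanged before a limit
    is taken. *)
Lemma tr_spec_op (a : R^nat) : (forall j, 0 <= a j) -> (forall j, ~~ in_dim p j -> a j = 0) ->
  cvgn (series a) -> tr p (spec_op u a) = limn (series a).
Proof.
move=> a0 aout ca; set L := limn (series a).
have aL n : \sum_(j < n) a j <= L by exact: nneg_sum_le_lim.
pose r i : R^nat := fun j => Num.sqrt (a j) * u j i.
have lr i : l2 (r i).
  apply: (@l2_le _ (fun j => u j i) _ (Num.sqrt L)); first exact: (l2_col es i).
  move=> j; rewrite normrM ler_wpM2r// ger0_norm ?sqrtr_ge0// ler_wsqrtr//.
  by apply: le_trans (aL j.+1); rewrite big_ord_recr/= lerDr sumr_ge0.
have dE i : diag_entry p (spec_op u a) i = dot (r i) (r i).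
  rewrite /diag_entry; case: ifP => pi; last first.
    by rewrite (@dot_supp _ 0) ?big_ord0// => j _; rewrite /r (u_out es) ?pi// mulr0.
  rewrite /spec_op [RHS]/dot; congr (limn (series _)); apply/funext => j.
  by rewrite dot_basis_vec /r mulrACA -expr2 sqr_sqrtr// mulrA.
have d0 i : 0 <= diag_entry p (spec_op u a) i by rewrite dE dot_ge0.
have dL n : \sum_(i < n) diag_entry p (spec_op u a) i <= L.
  under eq_bigr do rewrite dE.
  have cv : \sum_(i < n) \sum_(j < m) r i j ^+ 2 @[m --> \oo] --> \sum_(i < n) dot (r i) (r i).
    apply: cvg_seq_sum => i; have := dot_cvg (lr i) (lr i).
    by under eq_fun do under eq_bigr do rewrite -expr2.
  rewrite -(cvg_lim _ cv)//; apply: limr_le; first by apply/cvg_ex; eexists; exact: cv.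
  apply: nearW => m; apply: le_trans (aL m); rewrite exchange_big/=; apply: ler_sum => j _.
  apply: (@le_trans _ _ (a j * \sum_(i < n) u j i ^+ 2)).
    by rewrite mulr_sumr; apply: ler_sum => i _; rewrite /r exprMn sqr_sqrtr.
  have [pj|pj] := boolP (in_dim p j); last by rewrite aout// mul0r.
  rewrite ler_piMr//; apply: le_trans (sum_sqr_le_dot n (l2_u es j)) _.
  by rewrite (u_norm es).
have cd : cvgn (series (diag_entry p (spec_op u a))) by exact: nneg_cvg_series dL.
apply/eqP; rewrite eq_le; apply/andP; split.
  by have := limn_series_le cd dL.
apply: (limn_series_le ca) => J.
have cv : \sum_(j < J) a j * (\sum_(i < n) u j i * u j i) @[n --> \oo] --> \sum_(j < J) a j.
  apply: (@cvg_ord_sum _ (fun n j => a j * (\sum_(i < n) u j i * u j i))) => j _.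
  have [pj|pj] := boolP (in_dim p j); last first.
    by rewrite aout//; under eq_fun do rewrite mul0r; exact: cvg_cst.
  rewrite -[X in _ --> X]mulr1 -(u_norm es pj); apply: cvgM; first exact: cvg_cst.
  by apply: dot_cvg; exact: (l2_u es).
rewrite -(cvg_lim _ cv)//; apply: limr_le; first by apply/cvg_ex; eexists; exact: cv.
apply: nearW => n; apply: le_trans (nneg_sum_le_lim n d0 cd).
under eq_bigr do rewrite mulr_sumr; rewrite exchange_big/=; apply: ler_sum => i _.
rewrite dE; apply: le_trans (sum_sqr_le_dot J (lr i)); apply: ler_sum => j _.
by rewrite /r exprMn sqr_sqrtr// expr2.
Qed.

Lemma high_sigma_ge0 j : 0 <= high_part k sigma j.
Proof. by rewrite high_partE; case: ifP; rewrite ?s0. Qed.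

Lemma high_sigma_le j : `|high_part k sigma j| <= sigma 0%N.
Proof.
by rewrite ger0_norm ?high_sigma_ge0// high_partE; case: ifP => _; rewrite ?s0// (sigma_noninc es).
Qed.

Lemma high_sigma_cvg : cvgn (series (high_part k sigma)).
Proof.
apply: (@nneg_cvg_series _ _ (limn (series sigma))) => [j|n]; first exact: high_sigma_ge0.
apply: (@le_trans _ _ (\sum_(j < n) sigma j)).
  by apply: ler_sum => j _; rewrite high_partE; case: ifP => //; rewrite s0.
by apply: nneg_sum_le_lim; [exact: s0|exact: (sigma_cvg es cov)].
Qed.

Lemma tr_tail : tr p (spec_op u (high_part k sigma)) = trt sigma k.
Proof.
apply: tr_spec_op => [j|j pj|]; [exact: high_sigma_ge0| |exact: high_sigma_cvg].
by rewrite high_partE (eigen_val_out es pj) if_same.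
Qed.

Lemma lim_low_part (a : R^nat) : series (low_part k a) @ \oo --> \sum_(j < k) a j.
Proof.
apply: cvg_near_cst; near=> n; rewrite /series/= big_mkord; apply: sum_trunc.
by near: n; exact: nbhs_infty_ge.
Unshelve. all: by end_near. Qed.

Lemma tr_head : tr p (spec_op u (low_part k sigma)) = \sum_(j < k) sigma j.
Proof.
rewrite tr_spec_op => [|j|j pj|]; first by apply: cvg_lim => //; exact: lim_low_part.
- by rewrite /low_part; case: ifP; rewrite ?s0.
- by rewrite /low_part (eigen_val_out es pj) if_same.
- by apply/cvg_ex; eexists; exact: lim_low_part.
Qed.

Lemma tr_tail2 : l2 (high_part k sigma) ->
  tr p (spec_op u (high_part k sigma) \o spec_op u (high_part k sigma)) = trt2 sigma k.
Proof.
move=> lh; rewrite -[RHS](@tr_spec_op (fun j => high_part k sigma j * high_part k sigma j)).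
- rewrite /tr; congr (limn (series _)); apply/funext => i; rewrite /diag_entry; case: ifP => // pi.
  have pb := @basis_vec_Rp R p i pi.
  rewrite [LHS](_ : _ = syn u (fun j => high_part k sigma j *
    uc (spec_op u (high_part k sigma) (basis_vec i)) j) i)// (coord_spec_op es high_sigma_le pb).
  by rewrite spec_opE; congr (syn u _ i); apply/funext => j; rewrite mulrA.
- by move=> j; rewrite -expr2 sqr_ge0.
- by move=> j pj; rewrite high_partE (eigen_val_out es pj) if_same mul0r.
- exact: (l2_mul lh lh).
Qed.

Lemma cst1_low_le j : `|low_part k (cst (1 : R)) j| <= 1.
Proof. by rewrite /low_part; case: ifP; rewrite ?normr1 ?normr0. Qed.

Lemma norm2_low_part (a v : R^nat) (M : R) : (forall j, `|low_part k a j| <= M) -> Rp p v ->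
  norm2 (spec_op u (low_part k a) (spec_op u (low_part k (cst 1)) v)) =
  Num.sqrt (\sum_(j < k) (a j * uc v j) ^+ 2).
Proof.
move=> aM pv; have p1 := spec_op_Rp es cst1_low_le pv.
rewrite (norm2_coord es (spec_op_Rp es aM p1)) (coord_spec_op es aM p1).
rewrite (coord_spec_op es cst1_low_le pv) /norm2; congr Num.sqrt.
rewrite (@dot_supp _ k) => [|j kj]; last by rewrite /low_part ltnNge kj mul0r.
by apply: eq_bigr => j _; rewrite /low_part ltn_ord mul1r expr2.
Qed.

Lemma norm2_head (v : R^nat) : Rp p v ->
  norm2 (spec_op u (low_part k (cst 1)) v) = Num.sqrt (\sum_(j < k) uc v j ^+ 2).
Proof.
move=> pv; rewrite (norm2_coord es (spec_op_Rp es cst1_low_le pv)).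
rewrite (coord_spec_op es cst1_low_le pv) /norm2; congr Num.sqrt.
rewrite (@dot_supp _ k) => [|j kj]; last by rewrite /low_part ltnNge kj mul0r.
by apply: eq_bigr => j _; rewrite /low_part ltn_ord mul1r expr2.
Qed.

Lemma norm2_tail (v : R^nat) : Rp p v ->
  norm2 (spec_op u (high_part k (sqrt_seq sigma)) (spec_op u (high_part k (cst 1)) v)) =
  norm2 (bias sigma u v k).
Proof.
move=> pv.
have h1 j : `|high_part k (cst (1 : R)) j| <= 1.
  by rewrite high_partE; case: ifP; rewrite ?normr1 ?normr0.
have h2 j : `|high_part k (sqrt_seq sigma) j| <= Num.sqrt (sigma 0%N).
  rewrite high_partE; case: ifP => _; first exact: (sqrt_sigma_le es).
  by rewrite normr0 sqrtr_ge0.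
have p1 := spec_op_Rp es h1 pv.
rewrite (norm2_coord es (spec_op_Rp es h2 p1)) (coord_spec_op es h2 p1).
rewrite (coord_spec_op es h1 pv); congr norm2; apply/funext => j.
by rewrite /bias !high_partE /sqrt_seq; case: ifP; rewrite ?mul1r// !mul0r mulr0.
Qed.
End traces.

Section final_arithmetic.
Context {R : realType}.
Implicit Types n e tt kap i s M w : R.

(** The effective dimension J + S / thr and the deviation J + n S / tt, divided by n, are both of
    order J / n + S / tt because e and tt are comparable. *)
Lemma noise_arith n e tt kap i s J S : 0 < n -> 0 < e -> 0 < tt -> 0 < kap -> tt <= i * e -> 0 <= i ->
  0 <= s -> 0 <= J -> 0 <= S ->
  s * Num.sqrt ((J + S / (kap * e / n) + (J + n * (S / tt))) / n) <=
  2 * (s * Num.sqrt (J / n)) + (1 + i / kap) * (s * Num.sqrt (S / tt)).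
Proof.
move=> n0 e0 tt0 k0 tie i0 s0 J0 S0.
have -> : 2 * (s * Num.sqrt (J / n)) + (1 + i / kap) * (s * Num.sqrt (S / tt)) =
  s * (2 * Num.sqrt (J / n) + (1 + i / kap) * Num.sqrt (S / tt)) by ring.
rewrite ler_wpM2l//.
have w0 : 0 <= i / kap by nneg.
have h : (J + S / (kap * e / n) + (J + n * (S / tt))) / n <= 2 * (J / n) + (1 + i / kap) * (S / tt).
  have -> : (J + S / (kap * e / n) + (J + n * (S / tt))) / n = 2 * (J / n) + (S / tt + S / kap * e^-1).
    by field; rewrite !gt_eqF.
  rewrite lerD2l mulrDl mul1r lerD2l.
  have -> : i / kap * (S / tt) = S / kap * (i / tt) by ring.
  by rewrite ler_wpM2l//; [nneg|rewrite ler_pdivlMr// mulrC ler_pdivrMr].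
apply: le_trans (ler_wsqrtr h) _; apply: le_trans (sqrtD_le _ _) _; [by nneg|by nneg|].
apply: lerD; apply: sqrt_leP; [by nneg| |by nneg|]; rewrite exprMn sqr_sqrtr; [|by nneg| |by nneg].
  by rewrite ler_wpM2r//; [nneg|lra].
by rewrite ler_wpM2r//; [nneg|nra].
Qed.

(** With w = i / kap, the square of the ratio of both sides is at most w / (3 + w)^2 <= 1. The
    generous factor 3 + w is common to the three kinds of terms. *)
Lemma head_bias_arith n e tt kap i S : 0 < n -> 0 < e -> 0 < tt -> 0 < kap -> tt <= i * e -> 0 <= i ->
  0 <= S -> tt / n * Num.sqrt ((kap * e / n)^-1 * S) <= (3 + i / kap) * (Num.sqrt S * Num.sqrt (tt / n)).
Proof.
move=> n0 e0 tt0 k0 tie i0 S0; have w0 : 0 <= i / kap by nneg.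
have d0 : 0 < kap * e / n by rewrite divr_gt0// mulr_gt0.
rewrite -(@ler_sqr R) ?nnegrE; [|by nneg|by nneg].
rewrite exprMn sqr_sqrtr; last by nneg.
rewrite [leRHS]exprMn [X in _ <= _ * X]exprMn !sqr_sqrtr; [|by nneg|exact: S0].
have -> : (tt / n) ^+ 2 * ((kap * e / n)^-1 * S) = tt / e / kap * (S * (tt / n)).
  by field; rewrite !gt_eqF.
rewrite ler_wpM2r//; first by nneg.
have : tt / e / kap <= i / kap by rewrite ler_pM2r ?invr_gt0// ler_pdivrMr.
nra.
Qed.

Lemma tail_bias_arith n e tt kap i x : 0 < n -> 0 < e -> 0 < tt -> 0 < kap -> tt <= i * e -> 0 <= i ->
  0 <= x -> Num.sqrt (x / (kap * e / n)) <= (3 + i / kap) * Num.sqrt (n * x / tt).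
Proof.
move=> n0 e0 tt0 k0 tie i0 x0; have w0 : 0 <= i / kap by nneg.
apply: sqrt_leP; first by nneg.
rewrite exprMn sqr_sqrtr; last by nneg.
have -> : x / (kap * e / n) = tt / e / kap * (n * x / tt) by field; rewrite !gt_eqF.
rewrite ler_wpM2r//; first by nneg.
have : tt / e / kap <= i / kap by rewrite ler_pM2r ?invr_gt0// ler_pdivrMr.
nra.
Qed.

Lemma combine_arith (w K1 K2 K3 y1 y2 y3 z te M c3 : R) : 0 <= w -> 0 <= K1 -> 0 <= K2 -> 0 <= te -> 0 <= M ->
  y1 <= (3 + w) * M -> y2 <= (3 + w) * M -> y3 <= (3 + w) * M -> c3 = 7 + (3 + w) * (11 + K1 + K2) ->
  11 * y1 + K1 * y2 + K2 * y3 + K3 * z + 7 * te <= c3 * M + K3 * z + c3 * te.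
Proof.
move=> w0 K10 K20 te0 M0 h1 h2 h3 ->.
have g2 : K1 * y2 <= K1 * ((3 + w) * M) by rewrite ler_wpM2l.
have g3 : K2 * y3 <= K2 * ((3 + w) * M) by rewrite ler_wpM2l.
have g4 : 0 <= (3 + w) * (11 + K1 + K2) * te by nneg.
lra.
Qed.

End final_arithmetic.

Lemma sum_thresholded {R : realType} (k : nat) (sigma : R^nat) (thr : R) : 0 < thr -> (forall j, 0 <= sigma j) ->
  let J1 := [set j : 'I_k | thr <= sigma j]%SET in
  \sum_(j < k) sigma j / Num.max (sigma j) thr = #|J1|%:R + (\sum_(j in ~: J1) sigma j) / thr.
Proof.
move=> t0 s0 J1; rewrite (bigID (mem J1))/=; congr (_ + _).
  rewrite -sum1_card natr_sum; apply: eq_bigr => j; rewrite inE => h.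
  by rewrite max_l// divff// gt_eqF// (lt_le_trans t0 h).
rewrite mulr_suml; apply: eq_big => [j|j]; first by rewrite finset.in_setC.
by rewrite finset.in_set -ltNge => /ltW h; rewrite max_r.
Qed.

Theorem theorem8 (R : realType) (kRIP kDM : R) :
  RIP_constant kRIP -> DM_constant kDM ->
  exists c0 c1 c2 c3 : R, [/\ 0 < c0, 0 < c1, 0 < c2 & 0 < c3] /\
  forall (N : nat) (p : xdim) (Sigma : R^nat -> R^nat) (sigma : R^nat)
    (u : nat -> R^nat) (beta : R^nat) (sigma_xi : R)
    (d : measure_display) (T : measurableType d) (P : probability T R)
    (X : 'I_N -> T -> R^nat) (xi betahat : T -> R^nat)
    (d0 : measure_display) (T0 : measurableType d0) (P0 : probability T0 R)
    (g : T0 -> R^nat),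
  (0 < N)%N ->
  gaussian_linear_model p Sigma sigma u beta sigma_xi P X xi betahat ->
  std_gaussian_vec P0 p g ->
  forall k : nat, (0 < k)%N -> in_dim p k.-1 ->
  let Sigma_head := spec_op u (low_part k sigma) in
  let Sigma_tail := spec_op u (high_part k sigma) in
  let sqrt_Sigma := spec_op u (sqrt_seq sigma) in
  let sqrt_Sigma_head := spec_op u (low_part k (sqrt_seq sigma)) in
  let sqrt_Sigma_tail := spec_op u (high_part k (sqrt_seq sigma)) in
  let beta_head := spec_op u (low_part k (cst 1)) beta in
  let beta_tail := spec_op u (high_part k (cst 1)) beta in
  let ell := fine (ell_star P0 g (sqrt_Sigma_tail @` ball2 p 1)) in
  let dstar := ell ^+ 2 / sigma k in
  let thres := kDM * ell ^+ 2 / N%:R in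
  let J1 := [set j : 'I_k | thres <= sigma j]%SET in
  let J2 := (~: J1)%SET in
  let sum_J2 := \sum_(j in J2) sigma j in
  let Sigma_thres_invsqrt :=
    spec_op u (low_part k (fun j => (Num.sqrt (Num.max (sigma j) thres))^-1)) in
  let trh := tr p Sigma_head in
  let trt := tr p Sigma_tail in
  let trt2 := tr p (Sigma_tail \o Sigma_tail) in
  let tail_err := norm2 (sqrt_Sigma_tail beta_tail) in
  N%:R <= kDM * dstar ->
  R_N P0 g kRIP N p (sqrt_Sigma_head @` ball2 p 1)
    <= ell * Num.sqrt (kDM / N%:R) ->
  let claim := fun square : R =>
    with_prob_ge P
      (1 - c0 * expR (- (c1 * (#|J1|%:R + N%:R * (sum_J2 / trt)))))
      [set w | norm2 (sqrt_Sigma (betahat w \- beta))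
        <= square + sigma_xi * (c2 * Num.sqrt (N%:R * trt2) / trt)
           + c3 * tail_err] in
  (sigma 0%N * N%:R < kDM * ell ^+ 2 -> trh <= N%:R * sigma 0%N ->
   claim (c3 * Num.max (sigma_xi * Num.sqrt (trh / trt))
              (Num.max (Num.sqrt (N%:R * sigma 0%N / trt) * tail_err)
                       (norm2 beta_head * Num.sqrt (trt / N%:R)))))
  /\
  (kDM * ell ^+ 2 <= sigma 0%N * N%:R ->
   sum_J2 <= kDM * ell ^+ 2 * (1 - #|J1|%:R / N%:R) ->
   claim (c3 * Num.max (sigma_xi * Num.sqrt (#|J1|%:R / N%:R))
              (Num.max (sigma_xi * Num.sqrt (sum_J2 / trt))
              (Num.max tail_err
                       (norm2 (Sigma_thres_invsqrt beta_head)
                        * (trt / N%:R)))))).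

Proof.
move=> [_ [cR cR0 RIP]] DMc; have [cD cD0 DM] := DM_apply DMc.
have [kD01 _] := DMc; have /andP[kD0 kD1] := kD01 => {DMc}.
have m0 := @absmean_gt0 R.
(* An upper bound on Tr(Sigma_t) / ell^2. *)
pose i : R := ((@absmean R) ^+ 2)^-1.
have i0 : 0 < i by rewrite invr_gt0 exprn_gt0.
pose w := i / kDM; have w0 : 0 <= w by rewrite divr_ge0// ltW.
pose K1 := 44 * i * Num.sqrt (8 * (3 / 2 * (1 + 2 * (i / kDM)))).
pose K2 := 300 * i + 4; pose K3 := 23 * i.
have K10 : 0 <= K1 by rewrite /K1; nneg.
have K20 : 0 <= K2 by apply: addr_ge0; [apply: mulr_ge0; [exact: ler0n|exact: ltW]|exact: ler0n].
pose c3 := 7 + (3 + w) * (11 + K1 + K2).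
have c30 : 0 < c3 by rewrite /c3 ltr_wpDr//; nneg.
(* The rates are 1 for the chaos bounds, cD for Dvoretzky-Milman and cR for the restricted
   isometry. *)
pose c1 := Num.min 1 (Num.min cD cR).
have c10 : 0 < c1 by rewrite !lt_min ltr01 cD0 cR0.
have c11 : c1 <= 1 by rewrite ge_min lexx.
have c1D : c1 <= cD by rewrite !ge_min lexx orbT.
have c1R : c1 <= cR by rewrite !ge_min lexx !orbT.
(* The constant 8 counts the events of [risk_event]. *)
exists 8, c1, K3, c3; split; first by split => //; rewrite mulr_gt0.
move=> N p Sigma sigma u beta sxi d T P X xi betahat d0 T0 P0 g N0 gm sg k k0 pk.
move=> Sh St sS sSh sSt bh bt ell dstar thres J1 J2 sumJ2 Sti trh vt vt2 te NL RNl claim.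
have es := model_eigen gm; have cov := model_cov gm; have s0 := sigma_ge0 es.
have pbeta := model_beta gm; have sx0 := model_noise_level gm.
have kp j : (j < k)%N -> in_dim p j.
  by move=> jk; apply: (in_dim_le _ pk); rewrite -ltnS prednK.
have [Om [zeta [mOm POm sz hz]]] := zeta_ex es cov sg.
have n0 : 0 < N%:R :> R by rewrite ltr0n.
have th0 : 0 < thres := thr_gt0 gm mOm POm sz hz N0 kD01 NL.
have el0 : 0 < ell := ell_gt0 gm mOm POm sz hz N0 NL.
have e0 : 0 < ell ^+ 2 by rewrite exprn_gt0.
have trtE : vt = trt sigma k by exact: (tr_tail es cov k).
have ett : ell ^+ 2 <= vt by rewrite trtE; exact: (ell_sqr_le gm mOm POm sz hz).
have tie : vt <= i * ell ^+ 2 by rewrite trtE; exact: (ell_sqr_ge gm mOm POm sz hz).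
have tt0 : 0 < vt := lt_le_trans e0 ett.
have teE : te = norm2 (bias sigma u beta k) by exact: (norm2_tail es k pbeta).
have te0 : 0 <= te by exact: norm2_ge0.
have trt2E : vt2 = trt2 sigma k by exact: (tr_tail2 es (high_sigma_l2 gm k)).
have trhE : trh = \sum_(j < k) sigma j by exact: (tr_head es k).
have S0 : 0 <= sumJ2 by apply: sumr_ge0 => j _; exact: s0.
pose t := #|J1|%:R + N%:R * (sumJ2 / vt).
have t0 : 0 <= t by rewrite /t; nneg.
have wsum : \sum_(j < k) sigma j / Num.max (sigma j) thres = #|J1|%:R + sumJ2 / thres.
  exact: sum_thresholded.
pose B := Num.sqrt (\sum_(j < k) (Num.max (sigma j) thres)^-1 * ucoord u beta j ^+ 2).
(* Both cases reduce to a choice of rho and gam. The two bounds by (3 + w) M concern the bias of the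
   head and of the tail, the last two bounds by M the noise. *)
have main (rho M : R) (gam : R^nat) : 0 < rho -> t <= N%:R ->
    (forall j, (j < k)%N -> 0 < gam j <= 1) -> \sum_(j < k) gam j <= N%:R ->
    (forall j, (j < k)%N -> sigma j / Num.max (sigma j) thres = rho * gam j) ->
    0 <= M -> vt / N%:R * B <= (3 + w) * M -> Num.sqrt rho * te <= (3 + w) * M ->
    sxi * Num.sqrt (#|J1|%:R / N%:R) <= M -> sxi * Num.sqrt (sumJ2 / vt) <= M ->
    claim (c3 * M).
  move=> rho0 tN gam01 gamN wE M0 y1 y2 z1 z2.
  have t0N : 0 <= t <= N%:R by rewrite t0.
  have := risk_event gm mOm POm sz hz kp N0 RIP DM kD01 c10 c11 c1R c1D NL RNl rho0 t0N gam01 gamN wE.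
  apply: with_prob_ge_sub; first by [].
  move=> x /= /le_trans; apply.
  have y3 : sxi * Num.sqrt ((\sum_(j < k) sigma j / Num.max (sigma j) thres + t) / N%:R) <= (3 + w) * M.
    rewrite wsum; apply: le_trans (noise_arith n0 e0 tt0 kD0 tie (ltW i0) sx0 (ler0n _ _) S0) _.
    have h : (1 + w) * (sxi * Num.sqrt (sumJ2 / vt)) <= (1 + w) * M by rewrite ler_wpM2l//; nneg.
    rewrite -/w; lra.
  have cb := @combine_arith _ w K1 K2 K3 _ _ _ (sxi * (Num.sqrt (N%:R * vt2) / vt)) te M c3
    w0 K10 K20 te0 M0 y1 y2 y3 (erefl _).
  apply: le_trans (le_trans _ cb) _.
    by rewrite trt2E trtE teE [in leRHS]mulrA.
  rewrite le_eqVlt; apply/orP; left; apply/eqP; congr (_ + _ + _).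
  by rewrite -[in RHS]mulrA [in RHS]mulrCA.
have sB (b : R) : 0 < b -> ((Num.sqrt b)^-1) ^+ 2 = b^-1.
  by move=> b0; rewrite exprVn sqr_sqrtr// ltW.
split=> [small trh_le|large sumJ2_le].
  set M := Num.max _ _.
  have s00 : 0 < sigma 0%N by exact: (eigen_val_gt0 es (kp _ k0)).
  have lt0 : sigma 0%N < thres by rewrite ltr_pdivlMr.
  have ltj j : sigma j < thres by apply: le_lt_trans lt0; exact: (sigma_noninc es).
  have maxE j : Num.max (sigma j) thres = thres by rewrite max_r// ltW.
  have J10 : J1 = finset.set0 by apply/finset.setP => j; rewrite !finset.inE leNgt ltj.
  (* All eigenvalues lie below the threshold: J_1 is empty, the sum over J_2 is Tr(Sigma_1:k), and
     the rate is N Tr(Sigma_1:k) / Tr(Sigma_t). *)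
  have JE : #|J1| = 0%N by rewrite J10 cards0.
  have SE : sumJ2 = trh.
    by rewrite trhE /sumJ2 /J2 J10; apply: eq_bigl => j; rewrite finset.in_setC finset.in_set0.
  have trt_le : trh <= vt.
    apply: le_trans trh_le _; rewrite mulrC; apply: le_trans (ltW small) _.
    by apply: le_trans ett; rewrite ler_piMl// ltW.
  have le1 : sxi * Num.sqrt (trh / vt) <= M by rewrite le_max lexx.
  have le2 : Num.sqrt (N%:R * sigma 0%N / vt) * te <= M by rewrite !le_max lexx orbT.
  have le3 : norm2 bh * Num.sqrt (vt / N%:R) <= M by rewrite !le_max lexx !orbT.
  have M0 : 0 <= M by apply: le_trans le1; nneg.
  have w3 : 0 <= 3 + w by nneg.
  (* The gam_j = sigma_j / sigma_1 sum to at most N by the hypothesis Tr(Sigma_1:k) <= N sigma_1,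
     and sqrt(rho) yields the factor sqrt(N sigma_1 / Tr(Sigma_t)) of the bias. *)
  apply: (main (sigma 0%N / thres) M (fun j => sigma j / sigma 0%N)) => //.
  - by rewrite divr_gt0.
  - by rewrite /t JE add0r ler_piMr// ler_pdivrMr// mul1r SE.
  - move=> j jk; have sj := eigen_val_gt0 es (kp _ jk).
    by rewrite divr_gt0//= ler_pdivrMr// mul1r (sigma_noninc es).
  - by rewrite -mulr_suml ler_pdivrMr// -trhE.
  - by move=> j _; rewrite maxE; field; rewrite !gt_eqF.
  - apply: le_trans (_ : (3 + w) * (norm2 bh * Num.sqrt (vt / N%:R)) <= _); last by rewrite ler_wpM2l.
    rewrite /B; under eq_bigr do rewrite maxE; rewrite -mulr_sumr.
    rewrite /bh (norm2_head es k pbeta); apply: (head_bias_arith n0 e0 tt0 kD0 tie (ltW i0)).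
    by apply: sumr_ge0 => j _; exact: sqr_ge0.
  - apply: le_trans (_ : (3 + w) * (Num.sqrt (N%:R * sigma 0%N / vt) * te) <= _); last by rewrite ler_wpM2l.
    by rewrite mulrA ler_wpM2r//; exact: (tail_bias_arith n0 e0 tt0 kD0 tie (ltW i0) (s0 _)).
  - by rewrite JE mul0r sqrtr0 mulr0.
  - by rewrite SE.
set M := Num.max _ _.
have le1 : sxi * Num.sqrt (#|J1|%:R / N%:R) <= M by rewrite le_max lexx.
have le2 : sxi * Num.sqrt (sumJ2 / vt) <= M by rewrite !le_max lexx orbT.
have le3 : te <= M by rewrite !le_max lexx !orbT.
have le4 : norm2 (Sti bh) * (vt / N%:R) <= M by rewrite !le_max lexx !orbT.
have M0 : 0 <= M := le_trans te0 le3.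
have wM (y : R) : y <= M -> y <= (3 + w) * M.
  move=> yM; apply: le_trans yM _; rewrite ler_peMl//.
  have := w0; lra.
have c0 : 0 < kDM * ell ^+ 2 by rewrite mulr_gt0.
(* The hypothesis on the sum over J_2 says |J_1| + sum_(J_2) sigma_j / thres <= N: the weights
   themselves sum to at most N, so rho = 1 is admissible. *)
have hS : N%:R * (sumJ2 / (kDM * ell ^+ 2)) <= N%:R - #|J1|%:R.
  have -> : N%:R - #|J1|%:R = N%:R * (1 - #|J1|%:R / N%:R) :> R.
    by field; rewrite gt_eqF.
  by rewrite ler_wpM2l// ler_pdivrMr// mulrC.
have D0 j : 0 < Num.max (sigma j) thres by rewrite lt_max th0 orbT.
apply: (main 1 M (fun j => sigma j / Num.max (sigma j) thres)) => //.
(* The rate is at most N because kDM ell^2 <= Tr(Sigma_t). *)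
- have : N%:R * (sumJ2 / vt) <= N%:R * (sumJ2 / (kDM * ell ^+ 2)).
    rewrite ler_wpM2l// ler_wpM2l// lef_pV2 ?posrE//.
    by apply: le_trans ett; rewrite ler_piMl// ltW.
  rewrite /t; lra.
- move=> j jk; have sj := eigen_val_gt0 es (kp _ jk).
  by rewrite divr_gt0//= ler_pdivrMr// mul1r le_max lexx.
- rewrite wsum; have -> : sumJ2 / thres = N%:R * (sumJ2 / (kDM * ell ^+ 2)).
    by rewrite /thres; field; rewrite !gt_eqF.
  lra.
- by move=> j _; rewrite mul1r.
- apply: wM; apply: le_trans le4; rewrite mulrC; apply: ler_wpM2r; first by rewrite divr_ge0// ltW.
  have aM j : `|low_part k (fun j => (Num.sqrt (Num.max (sigma j) thres))^-1) j| <= (Num.sqrt thres)^-1.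
    rewrite /low_part; case: ifP => _; last by rewrite normr0 invr_ge0 sqrtr_ge0.
    rewrite ger0_norm ?invr_ge0 ?sqrtr_ge0// lef_pV2 ?posrE ?sqrtr_gt0//.
    by rewrite ler_wsqrtr// le_max lexx orbT.
  rewrite /Sti /bh (norm2_low_part es aM pbeta) le_eqVlt; apply/orP; left; apply/eqP; congr Num.sqrt.
  by apply: eq_bigr => j _; rewrite exprMn sB.
- by rewrite sqrtr1 mul1r; exact: wM.
Qed.
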